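(* Let $G$ be a countable abelian group and $H$ a subgroup. If $H$ is not an infinite bounded group, then $\pi_H(\Omega_G)$ contains a dense $G_\delta$ subset of $\Omega_H$. If $H$ is an infinite bounded group, then $\pi_H(\Omega_G)$ contains a dense $G_\delta$ subset of $\Omega_H$ if and only if there is a subgroup $G^*\le G$ such that $G^*\cap H=\{0\}$ and $G/G^*$ is weakly isomorphic to $H$. Moreover, if $H$ is an infinite bounded group and such a subgroup $G^*$ exists, then the restriction of $\pi_H$ to $\varphi^*(\Omega_{G/G^*})$ is essentially category preserving.
   Context: $(X,\mathcal{F},\mu)$ is a standard atomless Borel probability space; $\Omega$ its group of invertible measure-preserving transformations (mod null sets) with weak topology; for a countable group $K$, $\Omega_K$ is the Polish space of $K$-actions (homomorphisms $K\to\Omega$) with pointwise convergence topology. $\pi_H:\Omega_G\to\Omega_H$ is the restriction map $T\mapsto T|_H$. For $G^*\le G$ with canonical homomorphism $\varphi:G\to G/G^*$, $\varphi^*:\Omega_{G/G^*}\to\Omega_G$ is the embedding $\varphi^*(T)_g=T_{\varphi(g)}$, whose image is a closed subset of $\Omega_G$. A continuous map of Polish spaces is essentially category preserving if images and preimages of second category sets are of second category. A group is bounded if the orders of its elements are bounded; groups are weakly isomorphic if each is isomorphic to a subgroup of the other. *)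

(* Defs.v *)
From HB Require Import structures.
From mathcomp Require Import all_boot all_order all_algebra.
From mathcomp Require Import all_classical all_reals all_analysis.
Set Implicit Arguments. Unset Strict Implicit. Unset Printing Implicit Defensive.
Import Order.TTheory GRing.Theory Num.Theory.
Local Open Scope classical_set_scope.
Local Open Scope ring_scope.

(* (X, F) is a standard Borel space: Borel-isomorphic to a Borel subset of R
   (Kuratowski: equivalent to being Borel-isomorphic to a Borel subset of a
   Polish space). *)
Definition standard_borel (R : realType) (d : measure_display) (X : measurableType d) : Prop :=
  exists f : X -> R, [/\ measurable_fun setT f, injective f &
    forall A : set X, measurable A -> measurable (f @` A)].

Definition atomless (R : realType) (d : measure_display) (X : measurableType d)
  (P : probability X R) : Prop :=
  forall A : set X, measurable A -> (0 < P A)%E ->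
    exists B : set X, [/\ measurable B, B `<=` A, (0 < P B)%E & (P B < P A)%E].

Definition mpt (R : realType) (d : measure_display) (X : measurableType d)
  (P : probability X R) (T : X -> X) : Prop :=
  measurable_fun setT T /\ forall A : set X, measurable A -> P (T @^-1` A) = P A.

Definition ae_eq (R : realType) (d : measure_display) (X : measurableType d)
  (P : probability X R) (f g : X -> X) : Prop :=
  {ae P, forall x, f x = g x}.

(* representatives of elements of Omega: invertible (mod null sets)
   measure-preserving transformations *)
Definition inv_mpt (R : realType) (d : measure_display) (X : measurableType d)
  (P : probability X R) (T : X -> X) : Prop :=
  mpt P T /\ exists S : X -> X, [/\ mpt P S, ae_eq P (S \o T) id & ae_eq P (T \o S) id].

Definition is_subgroup (G : zmodType) (H : set G) : Prop :=
  H 0 /\ forall x y, H x -> H y -> H (x - y).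

Definition bounded_group (G : zmodType) (H : set G) : Prop :=
  exists N : nat, forall h, H h -> exists m : nat, (0 < m <= N)%N /\ h *+ m = 0.

Definition is_quotient_map (G Q : zmodType) (Gs : set G) (phi : G -> Q) : Prop :=
  [/\ forall x y, phi (x + y) = phi x + phi y,
      forall q, exists g, phi g = q
    & forall g, phi g = 0 <-> Gs g].

Definition weakly_isomorphic_sub (Q G : zmodType) (H : set G) : Prop :=
  (exists f : Q -> G, [/\ forall x y, f (x + y) = f x + f y, injective f
                        & forall q, H (f q)]) /\
  (exists f : G -> Q, (forall h1 h2, H h1 -> H h2 -> f (h1 + h2) = f h1 + f h2) /\
                      (forall h1 h2, H h1 -> H h2 -> f h1 = f h2 -> h1 = h2)).

(* Actions of the subgroup H of K (written as functions on K that are the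
   identity off H): homomorphisms H -> Omega, represented modulo null sets. *)
Definition actions_on (R : realType) (d : measure_display) (X : measurableType d)
  (P : probability X R) (K : zmodType) (H : set K) : set (K -> X -> X) :=
  [set T | [/\ forall k, H k -> inv_mpt P (T k),
              ae_eq P (T 0) id,
              forall k1 k2, H k1 -> H k2 -> ae_eq P (T (k1 + k2)) (T k1 \o T k2)
            & forall k, ~ H k -> T k = id]].

Definition Omega (R : realType) (d : measure_display) (X : measurableType d)
  (P : probability X R) (K : zmodType) : set (K -> X -> X) :=
  actions_on P [set: K].

Definition symdiff (T : Type) (A B : set T) : set T := (A `\` B) `|` (B `\` A).

(* Open sets (relative to a subspace Sp) for the topology of pointwise
   convergence of actions, each coordinate carrying the weak topology. *)
Definition wopen_in (R : realType) (d : measure_display) (X : measurableType d)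
  (P : probability X R) (K : Type) (Sp U : set (K -> X -> X)) : Prop :=
  U `<=` Sp /\
  forall T, U T -> exists (n : nat) (k : 'I_n -> K) (A : 'I_n -> set X) (e : R),
    [/\ 0 < e, forall i, measurable (A i) &
      forall S, Sp S ->
        (forall i, (P (symdiff (S (k i) @^-1` A i) (T (k i) @^-1` A i)) < e%:E)%E) ->
        U S].

Definition dense_in (R : realType) (d : measure_display) (X : measurableType d)
  (P : probability X R) (K : Type) (Sp D : set (K -> X -> X)) : Prop :=
  D `<=` Sp /\ forall U, wopen_in P Sp U -> U !=set0 -> (D `&` U) !=set0.

Definition Gdelta_in (R : realType) (d : measure_display) (X : measurableType d)
  (P : probability X R) (K : Type) (Sp D : set (K -> X -> X)) : Prop :=
  exists U : nat -> set (K -> X -> X),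
    (forall n, wopen_in P Sp (U n)) /\ D = \bigcap_n U n.

Definition contains_dense_Gdelta (R : realType) (d : measure_display) (X : measurableType d)
  (P : probability X R) (K : Type) (Sp A : set (K -> X -> X)) : Prop :=
  exists D, [/\ Gdelta_in P Sp D, dense_in P Sp D & D `<=` A].

Definition nowhere_dense_in (R : realType) (d : measure_display) (X : measurableType d)
  (P : probability X R) (K : Type) (Sp N : set (K -> X -> X)) : Prop :=
  forall U, wopen_in P Sp U -> U !=set0 ->
    exists V, [/\ wopen_in P Sp V, V !=set0, V `<=` U & V `&` N = set0].

Definition meager_in (R : realType) (d : measure_display) (X : measurableType d)
  (P : probability X R) (K : Type) (Sp M : set (K -> X -> X)) : Prop :=
  exists N : nat -> set (K -> X -> X),
    (forall n, nowhere_dense_in P Sp (N n)) /\ M `<=` \bigcup_n N n.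

Definition second_category_in (R : realType) (d : measure_display) (X : measurableType d)
  (P : probability X R) (K : Type) (Sp A : set (K -> X -> X)) : Prop :=
  A `<=` Sp /\ ~ meager_in P Sp A.

Definition ess_cat_preserving (R : realType) (d : measure_display) (X : measurableType d)
  (P : probability X R) (K1 K2 : Type)
  (f : (K1 -> X -> X) -> (K2 -> X -> X)) (Sp1 : set (K1 -> X -> X))
  (Sp2 : set (K2 -> X -> X)) : Prop :=
  (forall A, second_category_in P Sp1 A -> second_category_in P Sp2 (f @` A)) /\
  (forall B, second_category_in P Sp2 B -> second_category_in P Sp1 (Sp1 `&` f @^-1` B)).

Definition restr (X : Type) (G : zmodType) (H : set G) (T : G -> X -> X) : G -> X -> X :=
  fun g => if `[< H g >] then T g else id.

Definition pullback (X : Type) (G Q : zmodType) (phi : G -> Q) (T : Q -> X -> X) : G -> X -> X :=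
  fun g => T (phi g).

Arguments Omega {R d X} P K.

(* Main.v *)
(** Sufficiency and the category statement rest on one perturbation principle, [key]: if [g] is
    adjoined to [H], every action of [H + <g>] can be perturbed so that some [h] in [H] acts
    almost like [g].  The perturbations are skew products over finite sets.  When [H] has
    unbounded orders they exist for every [g]; when [H] is bounded, they exist as soon as the
    elements of order [p] and large height in the ambient group already lie in [H], and weak
    isomorphism with [H] forces this, because an injective endomorphism of a finite set is
    onto.  Iterating the principle shows that near every action of the large group there is an
    action whose restriction to [H] has a neighbourhood in which restrictions of nearby actions
    are dense; as the spaces are complete, images of comeagre sets then contain dense
    G-deltas.  For finite [H] a generic action has a fundamental domain, any two such actions
    are conjugate, and one of them extends to the whole group.

    For necessity, a generic action [T] of an infinite bounded [H] has arbitrarily fine towers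
    over finite subgroups of [H], so every transformation commuting with [T] is a weak limit of
    the [T h].  If [T] extends to an action [S] of the whole group and [Gs] is the kernel of [S],
    the quotient is therefore bounded and its elements of large height lie in the image of [H];
    a back-and-forth argument on heights embeds it into [H].

    Throughout, [dm] is the measure of the symmetric difference, and the neighbourhoods are
    given by [wclose n]: the first [n] group elements act on the first [n] sets of a dense
    sequence of measurable sets up to [1 / (n + 1)]. *)
Require Import Defs.
From HB Require Import structures.
From mathcomp Require Import all_boot all_order all_algebra.
From mathcomp Require Import all_classical all_reals all_analysis.
From mathcomp Require Import measurable_realfun zify ring lra.
Set Implicit Arguments. Unset Strict Implicit. Unset Printing Implicit Defensive.
Import Order.TTheory GRing.Theory Num.Theory.
Import Defs.
Local Open Scope classical_set_scope.
Local Open Scope ring_scope.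

(** The obstruction common to both directions is this. If [g] is a limit of elements [h] of [H]
    under some action, then every multiple of [g] is a limit of the corresponding multiples of the
    [h]. Where those multiples form a finite set, the multiple of [g] must act as one of them. For a
    bounded group this constrains exactly the finite layers of elements of order [p] and height at
    least [k]; [key_bounded] shows that nothing else is in the way, and the same condition on layers
    is what makes the embedding possible. Estimates only concern finitely many group elements and
    finitely many sets. Constructions therefore take place over finitely generated subgroups,
    [extension] reproduces an action on prescribed sets only, and limits lead to the whole group. In
    a skew product over a finite set the distances become averages, so an error confined to few
    copies is small no matter how bad it is there. Actions are functions and not classes modulo null
    sets, so realising a given action as a restriction always ends with a correction on null
    sets. *)

Section measure_algebra.
Context (R : realType) (d : measure_display) (X : measurableType d)
  (P : probability X R).
Implicit Types (A B C : set X) (S T U : X -> X).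

(** * Real-valued measure, distance of sets, equality almost everywhere *)

Definition Pr A : R := fine (P A).
Definition dm A B : R := Pr (symdiff A B).

Lemma PrE A : measurable A -> P A = (Pr A)%:E.
Proof. by move=> mA; rewrite /Pr fineK// fin_num_measure. Qed.

Lemma Pr_ge0 A : 0 <= Pr A.
Proof. by rewrite /Pr fine_ge0. Qed.

Lemma Pr_le1 A : measurable A -> Pr A <= 1.
Proof. by move=> mA; rewrite -lee_fin -PrE// probability_le1. Qed.

Lemma PrT : Pr setT = 1.
Proof. by rewrite /Pr probability_setT. Qed.

Lemma Pr0 : Pr set0 = 0.
Proof. by rewrite /Pr measure0. Qed.

Lemma PrU A B : measurable A -> measurable B -> A `&` B = set0 ->
  Pr (A `|` B) = Pr A + Pr B.
Proof.
move=> mA mB AB; apply: EFin_inj; rewrite EFinD -!PrE//; last exact: measurableU.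
by rewrite measureU.
Qed.

Lemma PrC A : measurable A -> Pr (~` A) = 1 - Pr A.
Proof.
move=> mA; have mC : measurable (~` A) by exact: measurableC.
have := PrU mA mC (setICr A); rewrite setUv PrT; lra.
Qed.

Lemma Pr_le A B : measurable A -> measurable B -> A `<=` B -> Pr A <= Pr B.
Proof.
by move=> mA mB AB; rewrite -lee_fin -!PrE// le_measure// inE.
Qed.

Lemma PrU_le A B : measurable A -> measurable B ->
  Pr (A `|` B) <= Pr A + Pr B.
Proof.
move=> mA mB; rewrite -lee_fin EFinD -!PrE//; last exact: measurableU.
exact: measureU2.
Qed.

Lemma ae_Pr0 A : measurable A -> (\forall x \ae P, ~ A x) <-> Pr A = 0.
Proof.
move=> mA; split.
  move=> [N [mN N0 sub]]; apply: EFin_inj; rewrite -PrE//.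
  apply: (subset_measure0 (B := N)) => // x Ax; by apply: sub => /=; apply.
move=> h; apply/(@negligibleS _ _ _ _ A).
  by move=> x /= /contrapT.
by apply/negligibleP => //; have := PrE mA; rewrite h.
Qed.

Lemma Pr_le_ae A B : measurable A -> measurable B ->
  (\forall x \ae P, A x -> B x) -> Pr A <= Pr B.
Proof.
move=> mA mB h.
have mD : measurable (A `\` B) by exact: measurableD.
have D0 : Pr (A `\` B) = 0.
  apply/ae_Pr0 => //; apply: filterS h => x AB [/AB].
  by [].
apply: (@le_trans _ _ (Pr ((A `\` B) `|` B))).
  apply: Pr_le => //; first exact: measurableU.
  by move=> x Ax; have [|] := pselect (B x); [right|left].
by apply: (le_trans (PrU_le mD mB)); rewrite D0 add0r.
Qed.

Lemma Pr_eq_ae A B : measurable A -> measurable B ->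
  (\forall x \ae P, A x <-> B x) -> Pr A = Pr B.
Proof.
move=> mA mB h; apply/eqP; rewrite eq_le; apply/andP; split;
  by apply: Pr_le_ae => //; apply: filterS h => x [].
Qed.

Lemma Pr_leD_ae A B C : measurable A -> measurable B -> measurable C ->
  (\forall x \ae P, A x -> B x \/ C x) -> Pr A <= Pr B + Pr C.
Proof.
move=> mA mB mC h; apply: le_trans (PrU_le mB mC).
by apply: Pr_le_ae => //; apply: measurableU.
Qed.

Lemma measurable_symdiff A B : measurable A -> measurable B ->
  measurable (symdiff A B).
Proof. by move=> mA mB; apply: measurableU; apply: measurableD. Qed.

Lemma symdiff_sym A B : symdiff A B = symdiff B A.
Proof. by rewrite /symdiff setUC. Qed.

Lemma dm_ge0 A B : 0 <= dm A B. Proof. exact: Pr_ge0. Qed.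

Lemma dmC A B : dm A B = dm B A. Proof. by rewrite /dm symdiff_sym. Qed.

Lemma dm_le1 A B : measurable A -> measurable B -> dm A B <= 1.
Proof. by move=> mA mB; apply: Pr_le1; apply: measurable_symdiff. Qed.

Lemma dmxx A : dm A A = 0.
Proof. by rewrite /dm /symdiff setDv setU0 Pr0. Qed.

Lemma dm_tri B A C : measurable A -> measurable B -> measurable C ->
  dm A C <= dm A B + dm B C.
Proof.
move=> mA mB mC; apply: Pr_leD_ae; try exact: measurable_symdiff.
apply: aeW => x; rewrite /symdiff /= => -[[a c]|[c a]];
  have [b|b] := pselect (B x); tauto.
Qed.

Lemma dm0_ae A B : measurable A -> measurable B ->
  dm A B = 0 <-> \forall x \ae P, A x <-> B x.
Proof.
move=> mA mB; have mS := measurable_symdiff mA mB; split.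
  move/(ae_Pr0 mS); apply: filterS => x; rewrite /symdiff /= => h.
  by split=> ?; apply: contrapT => ?; apply: h; [left|right].
by move=> h; apply/(ae_Pr0 mS); apply: filterS h => x [h1 h2] [[/h1]|[/h2]].
Qed.

Lemma Pr_dm A B : measurable A -> measurable B -> Pr A <= Pr B + dm A B.
Proof.
move=> mA mB; apply: Pr_leD_ae => //; first exact: measurable_symdiff.
apply: aeW => x a; rewrite /symdiff /=.
by have [b|b] := pselect (B x); tauto.
Qed.

Lemma dm_setC A B : dm (~` A) (~` B) = dm A B.
Proof.
rewrite /dm; congr Pr; apply/seteqP; split=> x; rewrite /symdiff /=.
  move=> [[a b]|[b a]]; [right|left]; by split=> //; apply: contrapT.
by move=> [[a b]|[b a]]; [right|left]; split=> //; tauto.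
Qed.

Lemma dm_setU A B C D : measurable A -> measurable B -> measurable C ->
  measurable D -> dm (A `|` B) (C `|` D) <= dm A C + dm B D.
Proof.
move=> mA mB mC mD; apply: Pr_leD_ae; try exact: measurable_symdiff.
  by apply: measurable_symdiff; apply: measurableU.
apply: aeW => x; rewrite /symdiff /=.
by have [a|a] := pselect (A x); have [b|b] := pselect (B x);
   have [c|c] := pselect (C x); have [e|e] := pselect (D x); tauto.
Qed.

Lemma dm_setI A B C D : measurable A -> measurable B -> measurable C ->
  measurable D -> dm (A `&` B) (C `&` D) <= dm A C + dm B D.
Proof.
move=> mA mB mC mD; apply: Pr_leD_ae; try exact: measurable_symdiff.
  by apply: measurable_symdiff; apply: measurableI.
apply: aeW => x; rewrite /symdiff /=.
by have [a|a] := pselect (A x); have [b|b] := pselect (B x);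
   have [c|c] := pselect (C x); have [e|e] := pselect (D x); tauto.
Qed.

Lemma mpt_pre T A : mpt P T -> measurable A -> measurable (T @^-1` A).
Proof. by move=> [mT _] mA; rewrite -[_ @^-1` _]setTI; apply: mT. Qed.

Lemma Pr_pre T A : mpt P T -> measurable A -> Pr (T @^-1` A) = Pr A.
Proof. by move=> [_ h] mA; rewrite /Pr h. Qed.

Lemma dm_pre T A B : mpt P T -> measurable A -> measurable B ->
  dm (T @^-1` A) (T @^-1` B) = dm A B.
Proof.
by move=> hT mA mB; rewrite /dm -(Pr_pre hT (measurable_symdiff mA mB)).
Qed.

Lemma mpt_id : mpt P id.
Proof. by split; [exact: measurable_id|]. Qed.

Lemma mpt_comp S T : mpt P S -> mpt P T -> mpt P (S \o T).
Proof.
move=> hS hT; split; first by apply: measurableT_comp; [exact: hS.1|exact: hT.1].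
move=> A mA; rewrite comp_preimage hT.2 ?hS.2//; exact: mpt_pre.
Qed.

Lemma mpt_ae T (Q : X -> Prop) : mpt P T ->
  (\forall x \ae P, Q x) -> \forall x \ae P, Q (T x).
Proof.
move=> hT [N [mN N0 sub]]; exists (T @^-1` N); split; first exact: mpt_pre.
  by rewrite hT.2.
by move=> x /= h; apply: sub.
Qed.

Lemma ae_eq_dm0 S T A : mpt P S -> mpt P T -> ae_eq P S T -> measurable A ->
  dm (S @^-1` A) (T @^-1` A) = 0.
Proof.
move=> hS hT h mA; apply/dm0_ae; try exact: mpt_pre.
by apply: filterS h => x /= ->.
Qed.

Lemma aeq_sym S T : ae_eq P S T -> ae_eq P T S.
Proof. by apply: filterS. Qed.

Lemma aeq_trans S T U : ae_eq P S T -> ae_eq P T U -> ae_eq P S U.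
Proof. by apply: filterS2 => x ->. Qed.

Lemma aeq_refl S : ae_eq P S S.
Proof. exact: aeW. Qed.

Lemma aeq_comp S S' T T' : mpt P T -> ae_eq P S S' -> ae_eq P T T' ->
  ae_eq P (S \o T) (S' \o T').
Proof.
move=> hT hS h; have hST := mpt_ae hT hS.
by apply: filterS2 h hST => x /= <-.
Qed.

(** Finite partitions are always given by a label with values in a finite type; this is the rule
    behind every summation over levels or copies. *)
Lemma Pr_fibers (J : finType) (b : X -> J) A :
  (forall j, measurable (b @^-1` [set j])) -> measurable A ->
  Pr A = \sum_j Pr (A `&` b @^-1` [set j]).
Proof.
move=> mb mA.
have mAb j : measurable (A `&` b @^-1` [set j]) by exact: measurableI.
suff: forall s : seq J, uniq s ->
    Pr (A `&` b @^-1` [set j | j \in s]) = \sum_(j <- s) Pr (A `&` b @^-1` [set j]).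
  move=> /(_ (enum J) (enum_uniq _)); rewrite big_enum/= => <-.
  congr Pr; apply/seteqP; split=> [x Ax|x []//]; split=> //=.
  by rewrite mem_enum.
elim=> [_|j s ih /= /andP[js us]].
  rewrite big_nil (_ : _ `&` _ = set0) ?Pr0//.
  by apply/seteqP; split => x //= [].
rewrite big_cons -ih// -PrU//.
- congr Pr; apply/seteqP; split => x /=.
    move=> [Ax]; rewrite inE => /orP[/eqP ->|]; first by left.
    by right.
  move=> [[Ax ->]|[Ax bx]]; split=> //; rewrite inE ?eqxx// bx orbT//.
- apply: measurableI => //.
  rewrite (_ : _ @^-1` _ = \bigcup_(j in [set` s]) b @^-1` [set j]).
    by apply: fin_bigcup_measurable.
  by apply/seteqP; split=> [x /= h|x [i /= si ->]//]; exists (b x).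
- apply/seteqP; split=> x //= [[_ ->] [_]].
  by rewrite (negbTE js).
Qed.

End measure_algebra.

(** * Approximation by an algebra of sets, and uniqueness of laws *)

Section approximation.
Context (R : realType) (d : measure_display) (X : measurableType d)
  (P : probability X R).
Implicit Types (A B C : set X).
Local Notation Pr := (Pr P).
Local Notation dm := (dm P).

Lemma Pr_cvg_up (F : (set X)^nat) (e : R) : 0 < e ->
  (forall n, measurable (F n)) -> (forall n m, (n <= m)%N -> F n `<=` F m) ->
  exists n, Pr (\bigcup_k F k) < Pr (F n) + e.
Proof.
move=> e0 mF ndF; have mU : measurable (\bigcup_k F k) by exact: bigcup_measurable.
have : P \o F @ \oo --> P (\bigcup_k F k).
  by apply: nondecreasing_cvg_mu => // n m nm; apply/subsetPset; exact: ndF.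
rewrite PrE// (_ : P \o F = EFin \o (Pr \o F)); last first.
  by apply/funext => n /=; rewrite PrE.
move/fine_cvgP => [_ /cvgrPdist_lt /(_ e e0) [N _ /(_ N (leqnn N))]] /=.
by move=> h; exists N; move: h; rewrite ltr_norml => /andP[_]; lra.
Qed.

Lemma Pr_cvg_down (F : (set X)^nat) (e : R) : 0 < e ->
  (forall n, measurable (F n)) -> (forall n m, (n <= m)%N -> F m `<=` F n) ->
  exists n, Pr (F n) < Pr (\bigcap_k F k) + e.
Proof.
move=> e0 mF niF.
have mC n : measurable (~` F n) by exact: measurableC.
have [n] := Pr_cvg_up e0 mC (fun n m nm => subsetC (@niF n m nm)).
rewrite -setC_bigcap !PrC//; last exact: bigcap_measurable.
by move=> h; exists n; move: h; lra.
Qed.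

Definition approximable (AA : set (set X)) B :=
  measurable B /\ forall e, 0 < e -> exists2 A, AA A & dm B A < e.

Section approximable_by_algebra.
Context (AA : set (set X)).
Hypothesis mAA : forall A, AA A -> measurable A.
Hypothesis AAC : forall A, AA A -> AA (~` A).
Hypothesis AAU : forall A B, AA A -> AA B -> AA (A `|` B).
Hypothesis AA0 : AA set0.

Lemma approximable_in A : AA A -> approximable AA A.
Proof. by move=> AAA; split; [exact: mAA|move=> e e0; exists A; rewrite ?dmxx]. Qed.

Lemma approximableC B : approximable AA B -> approximable AA (~` B).
Proof.
move=> [mB h]; split; first exact: measurableC.
by move=> e /h[A AAA hA]; exists (~` A); [exact: AAC|rewrite dm_setC].
Qed.

Lemma approximableU B C : approximable AA B -> approximable AA C ->
  approximable AA (B `|` C).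
Proof.
move=> [mB hB] [mC hC]; split; first exact: measurableU.
move=> e e0; have e2 : 0 < e / 2 by rewrite divr_gt0.
have [A A1 A2] := hB _ e2; have [D D1 D2] := hC _ e2.
exists (A `|` D); first exact: AAU.
apply: le_lt_trans (dm_setU P mB mC (mAA A1) (mAA D1)) _; lra.
Qed.

(** Half of [e] pays for replacing the union by a finite one, half for approximating the finite one
    inside the algebra. *)
Lemma approximable_bigcup (F : (set X)^nat) :
  (forall n, approximable AA (F n)) -> approximable AA (\bigcup_n F n).
Proof.
move=> hF; have mF n : measurable (F n) by case: (hF n).
split; first exact: bigcup_measurable.
pose S n := \bigcup_(i in [set k | (k < n)%N]) F i.
have hS n : approximable AA (S n).
  elim: n => [|n ih].
    rewrite (_ : S 0%N = set0); last by apply/seteqP; split => x // [].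
    exact: approximable_in.
  rewrite (_ : S n.+1 = S n `|` F n); first exact: approximableU.
  apply/seteqP; split=> x.
    move=> [i /=]; rewrite ltnS leq_eqVlt => /orP[/eqP ->|]; first by right.
    by left; exists i.
  move=> [[i /= ni Fi]|Fn]; first by exists i => //=; rewrite ltnS ltnW.
  by exists n => /=.
have US : \bigcup_n F n = \bigcup_n S n.
  apply/seteqP; split=> [x [i _ Fi]|x [n _ [i _ Fi]]]; last by exists i.
  by exists i.+1 => //; exists i => /=.
move=> e e0; have e2 : 0 < e / 2 by rewrite divr_gt0.
have mS n : measurable (S n) by case: (hS n).
have [n hn] : exists n, Pr (\bigcup_k S k) < Pr (S n) + e / 2.
  apply: Pr_cvg_up => // n m nm x [i /= ni Fi]; exists i => //=.
  exact: leq_trans nm.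
have [A AAA hA] := (hS n).2 _ e2; exists A => //.
have mU : measurable (\bigcup_n S n) by exact: bigcup_measurable.
rewrite US; apply: le_lt_trans (dm_tri P mU (mS n) (mAA AAA)) _.
suff : dm (\bigcup_n S n) (S n) < e / 2 by lra.
have sub : S n `<=` \bigcup_n S n by move=> x Sx; exists n.
have mD : measurable (\bigcup_n S n `\` S n) by exact: measurableD.
have <- : Pr (\bigcup_n S n `\` S n) = dm (\bigcup_n S n) (S n).
  rewrite /dm /symdiff; congr Pr; rewrite [X in _ `|` X](_ : _ = set0) ?setU0//.
  by apply/seteqP; split=> x // [/sub].
move: hn; rewrite -[in X in X < _ -> _](setDUK sub) PrU//; first lra.
by apply/seteqP; split=> x // [? []].
Qed.

Lemma approximable_preimage (f : X -> R) :
  (forall r, approximable AA (f @^-1` `]-oo, r[%classic)) ->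
  forall I : set R, measurable I -> approximable AA (f @^-1` I).
Proof.
move=> hf I mI.
suff: <<s (@RGenInftyO.G R) >> `<=` [set I | approximable AA (f @^-1` I)].
  have sG : @measurable _ R = <<s (@RGenInftyO.G R) >>.
    exact: RGenInftyO.measurableE.
  by apply; rewrite -sG.
apply: smallest_sub; last by move=> _ [x ->]; exact: hf.
split=> /=.
- by rewrite preimage_set0; exact: approximable_in.
- by move=> A hA; rewrite setTD; exact: approximableC.
- by move=> F hF; rewrite preimage_bigcup; exact: approximable_bigcup.
Qed.

End approximable_by_algebra.

Lemma countable_setU (T : Type) (AA BB : set T) :
  countable AA -> countable BB -> countable (AA `|` BB).
Proof.
move=> cA cB; rewrite (_ : AA `|` BB = \bigcup_(b in [set: bool]) if b then AA else BB).
  by apply: bigcup_countable => // -[].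
apply/seteqP; split=> [x [Ax|Bx]|x [[] _ ?]]; [by exists true|by exists false|by left|by right].
Qed.

Lemma countable_enum (T : Type) (x0 : T) (AA : set T) : countable AA -> AA x0 ->
  exists E : nat -> T, (forall n, AA (E n)) /\ (forall a, AA a -> exists n, E n = a).
Proof.
move=> /countable_injP[f finj] A0.
have /choice[E hE] : forall n, exists x, AA x /\ forall y, AA y -> f y = n -> x = y.
  move=> n; have [[z [Az <-]]|no] := pselect (exists z, AA z /\ f z = n).
    by exists z; split=> // y Ay fy; apply: finj; rewrite ?inE.
  by exists x0; split=> // y Ay fy; exfalso; apply: no; exists y.
exists E; split=> [n|a AAa]; first by case: (hE n).
by exists (f a); case: (hE (f a)) => _; apply.
Qed.

Section embedding.
Context (f : X -> R) (mf : measurable_fun setT f) (inj : injective f)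
  (fimg : forall A : set X, measurable A -> measurable (f @` A)).

Lemma ray_measurable (r : R) : measurable (f @^-1` `]-oo, r[%classic).
Proof. by rewrite -[_ @^-1` _]setTI; apply: mf. Qed.

Lemma dense_family : exists E : nat -> set X,
  (forall n, measurable (E n)) /\
  forall A, measurable A -> forall e, 0 < e -> exists n, dm A (E n) < e.
Proof.
(* Complement of a union is one operation from which both complements and unions arise, so iterating
   it on the rational rays gives a countable algebra. *)
pose step (S : set (set X)) := S `|`
  [set ~` (A.1 `|` A.2) | A in S `*` S].
pose S0 := set0 |` [set f @^-1` `]-oo, ratr q[%classic | q in [set: rat]].
pose S n := iter n step S0.
have cS n : countable (S n).
  elim: n => [|n ih] /=.
    apply: countable_setU; first exact: countable1.
    by apply: (sub_countable (card_image_le _ _)); exact: countableP.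
  by apply: countable_setU => //; apply: (sub_countable (card_image_le _ _)); exact: countableX.
have mS n A : S n A -> measurable A.
  elim: n A => [|n ih] A /=.
    move=> [->//|[q _ <-]]; exact: ray_measurable.
  move=> [/ih//|[[B C] /= [/ih mB /ih mC] <-]].
  by apply: measurableC; apply: measurableU.
have ndS n m A : (n <= m)%N -> S n A -> S m A.
  move=> /subnK <-; elim: (m - n)%N => // k ih /ih h; rewrite addSn; by left.
pose AA := \bigcup_n S n.
have cAA : countable AA by exact: bigcup_countable.
have mAA A : AA A -> measurable A by move=> [n _ /mS].
have NOR A B : AA A -> AA B -> AA (~` (A `|` B)).
  move=> [n _ An] [m _ Bm]; exists (maxn n m).+1 => //; right.
  exists (A, B) => //; split => /=; [apply: ndS An|apply: ndS Bm];
    by rewrite ?leq_maxl ?leq_maxr.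
have AAC A : AA A -> AA (~` A) by move=> h; rewrite -[X in ~` X]setUid; exact: NOR.
have AAU A B : AA A -> AA B -> AA (A `|` B).
  by move=> a b; rewrite -[_ `|` _]setCK; apply: AAC; exact: NOR.
have AA0 : AA set0 by exists 0%N => //; left.
have [E [AE Esurj]] := countable_enum cAA AA0.
exists E; split; first by move=> n; exact: mAA.
move=> A mA e e0.
have [|_ /(_ _ e0)[B AAB AB]] := @approximable_preimage _ mAA AAC AAU AA0 f _ _ (fimg mA).
  move=> r; pose F n := if unpickle n is Some q then
    (if ratr q < r then f @^-1` `]-oo, ratr q[%classic else set0) else set0.
  rewrite (_ : _ @^-1` _ = \bigcup_n F n).
    apply: approximable_bigcup => // n; apply: approximable_in => //.
    rewrite /F; case: (unpickle n) => // q; case: ifP => // _.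
    by exists 0%N => //; right; exists q.
  apply/seteqP; split=> x /=.
    rewrite in_itv/= => /rat_in_itvoo[q]; rewrite in_itv/= => /andP[q1 q2].
    exists (pickle q); first exact: I.
    by rewrite /F pickleK q2 /= in_itv.
  move=> [n _]; rewrite /F; case: (unpickle n) => // q; case: ifP => //= qr.
  by rewrite !in_itv/= => /lt_trans; apply.
have [n nB] := Esurj _ AAB; exists n; rewrite nB; move: AB.
rewrite (_ : f @^-1` (f @` A) = A)//.
by apply/seteqP; split=> x /= => [[y Ay /inj <-]|Ax]//; exists x.
Qed.

(** The countably many rational rays separate points through [f], so one null set can be discarded
    for all of them together. *)
Lemma aeq_dm0 (S T : X -> X) : measurable_fun setT S -> measurable_fun setT T ->
  (forall A, measurable A -> dm (S @^-1` A) (T @^-1` A) = 0) -> ae_eq P S T.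
Proof.
move=> mS mT h.
have pre (U : X -> X) A : measurable_fun setT U -> measurable A ->
  measurable (U @^-1` A) by move=> mU mA; rewrite -[_ @^-1` _]setTI; apply: mU.
pose F n := if unpickle n is Some q then f @^-1` `]-oo, ratr q[%classic else set0.
have mF n : measurable (F n).
  by rewrite /F; case: (unpickle n) => // q; exact: ray_measurable.
have : \forall x \ae P, forall n, F n (S x) <-> F n (T x).
  by apply: ae_foralln => n; apply/(dm0_ae P) ; rewrite ?h//; exact: pre.
apply: filterS => x hx; apply: inj.
have sep a b : (forall n, F n a <-> F n b) -> ~ f a < f b.
  move=> hab /rat_in_itvoo[q]; rewrite in_itv/= => /andP[q1 q2].
  have := hab (pickle q); rewrite /F pickleK /= !in_itv/= q1.
  by move=> [/(_ isT)/lt_trans/(_ q2)]; rewrite ltxx.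
case: (ltgtP (f (S x)) (f (T x))) => // /sep; case => // n.
by split => /hx.
Qed.

End embedding.

(** The weights allow sets of different measure: with [a = Pr B'] and [b = Pr B] the normalised laws
    of [u] on [B] and of [u'] on [B'] are compared. Rays are stable under intersection, and the
    equality passes to complements and countable disjoint unions. *)
Lemma law_unique (B B' : set X) (u u' : X -> R) (a b : R) :
  measurable B -> measurable B' ->
  measurable_fun setT u -> measurable_fun setT u' ->
  a * Pr B = b * Pr B' ->
  (forall s, a * Pr (B `&` u @^-1` `]-oo, s[%classic) =
             b * Pr (B' `&` u' @^-1` `]-oo, s[%classic)) ->
  forall J : set R, measurable J ->
    a * Pr (B `&` u @^-1` J) = b * Pr (B' `&` u' @^-1` J).
Proof.
move=> mB mB' mu mu' h0 h J mJ.
have pre (v : X -> R) (D : set X) (K : set R) : measurable_fun setT v -> measurable D ->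
    measurable K -> measurable (D `&` v @^-1` K).
  by move=> mv mD mK; apply: measurableI => //; rewrite -[_ @^-1` _]setTI; apply: mv.
have sG : @measurable _ R = <<s (@RGenInftyO.G R) >> by exact: RGenInftyO.measurableE.
pose Q (K : set R) := a * Pr (B `&` u @^-1` K) = b * Pr (B' `&` u' @^-1` K).
apply: (@dynkin_induction _ R (@RGenInftyO.G R) Q) => //; last by rewrite -sG.
- move=> _ _ [x ->] [y ->]; exists (Num.min x y).
  apply/seteqP; split=> z /=; rewrite !in_itv/= lt_min; first by move=> [-> ->].
  by move=> /andP.
- by rewrite /Q !preimage_setT !setIT.
- by move=> _ [x ->]; exact: h.
- move=> S mS QS; rewrite /Q.
  have split (v : X -> R) (D : set X) : measurable_fun setT v -> measurable D ->
      Pr (D `&` v @^-1` (~` S)) = Pr D - Pr (D `&` v @^-1` S).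
    move=> mv mD; rewrite -[in X in X - _](setIT D) -(setvU (v @^-1` S)) setIUr PrU.
    + by rewrite addrK.
    + by rewrite preimage_setC; apply: pre => //; exact: measurableC.
    + exact: pre.
    + by apply/seteqP; split=> x //= [[_ ?] []].
  by rewrite !split// !mulrBr h0 QS.
- move=> F mF tF QF; rewrite /Q.
  pose S n := \bigcup_(i in [set k | (k < n)%N]) F i.
  have mSS n : measurable (S n) by apply: bigcup_measurable => k _; exact: mF.
  have QS n : Q (S n).
    elim: n => [|n ih].
      rewrite /Q (_ : S 0%N = set0); last by apply/seteqP; split => x // [].
      by rewrite !preimage_set0 !setI0 Pr0 !mulr0.
    have SE : S n.+1 = S n `|` F n.
      apply/seteqP; split=> x.
        move=> [i /=]; rewrite ltnS leq_eqVlt => /orP[/eqP ->|]; first by right.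
        by left; exists i.
      move=> [[i /= ni Fi]|Fn]; first by exists i => //=; rewrite ltnS ltnW.
      by exists n => /=.
    have SF : S n `&` F n = set0.
      apply/seteqP; split=> x // [[i /= ni Fi] Fn].
      have := tF i n I I; move=> /(_ (ex_intro _ x (conj Fi Fn))) ine.
      by rewrite ine ltnn in ni.
    have splitU (v : X -> R) (D : set X) : measurable_fun setT v -> measurable D ->
        Pr (D `&` v @^-1` (S n `|` F n)) = Pr (D `&` v @^-1` S n) + Pr (D `&` v @^-1` F n).
      move=> mv mD; rewrite preimage_setU setIUr PrU//; try exact: pre.
      apply/seteqP; split=> x // [[_ Sx] [_ Fx]].
      by have : (S n `&` F n) (v x) by []; rewrite SF.
    by rewrite /Q SE !splitU// !mulrDr QF ih.
  have US : \bigcup_n F n = \bigcup_n S n.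
    apply/seteqP; split=> [x [i _ Fi]|x [n _ [i _ Fi]]]; last by exists i.
    by exists i.+1 => //; exists i => /=.
  have close (v : X -> R) (D : set X) (e : R) : measurable_fun setT v -> measurable D -> 0 < e ->
      exists N, forall n, (N <= n)%N -> `|Pr (D `&` v @^-1` (\bigcup_n F n)) - Pr (D `&` v @^-1` S n)| < e.
    move=> mv mD e0; rewrite US preimage_bigcup setI_bigcupr.
    have nd n m : (n <= m)%N -> D `&` v @^-1` S n `<=` D `&` v @^-1` S m.
      move=> nm x [Dx [i /= ni Fi]]; split=> //; exists i => //=; exact: leq_trans nm.
    have mm n : measurable (D `&` v @^-1` S n) by exact: pre.
    have [N hN] := Pr_cvg_up e0 mm nd.
    exists N => n Nn; have := Pr_le P (mm N) (mm n) (nd _ _ Nn).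
    have mU : measurable (\bigcup_k (D `&` v @^-1` S k)) by exact: bigcup_measurable.
    have : Pr (D `&` v @^-1` S n) <= Pr (\bigcup_k (D `&` v @^-1` S k)).
      by apply: Pr_le => // x ?; exists n.
    by move=> h1 h2; rewrite ger0_norm; lra.
  apply/eqP; rewrite -subr_eq0 -normr_le0; apply/ler_addgt0Pl => e e0; rewrite addr0.
  pose c := `|a| + `|b| + 1.
  have c0 : 0 < c by rewrite /c; have := normr_ge0 a; have := normr_ge0 b; lra.
  have [N1 h1] := close u B (e / c) mu mB (divr_gt0 e0 c0).
  have [N2 h2] := close u' B' (e / c) mu' mB' (divr_gt0 e0 c0).
  have {}h1 := h1 _ (leq_maxl N1 N2); have {}h2 := h2 _ (leq_maxr N1 N2).
  set n := maxn N1 N2 in h1 h2; have := QS n; rewrite /Q => Qn.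
  set x := Pr (B `&` u @^-1` \bigcup_n F n) in h1 *.
  set y := Pr (B' `&` u' @^-1` \bigcup_n F n) in h2 *.
  set x' := Pr (B `&` u @^-1` S n) in h1 Qn; set y' := Pr (B' `&` u' @^-1` S n) in h2 Qn.
  have -> : a * x - b * y = a * (x - x') - b * (y - y').
    by rewrite !mulrBr Qn; lra.
  apply: le_trans (ler_normB _ _) _; rewrite !normrM.
  have -> : e = `|a| * (e / c) + `|b| * (e / c) + e / c.
    have : c * (e / c) = e by rewrite mulrC divfK// gt_eqF.
    by rewrite /c !mulrDl mul1r => ->.
  have := ler_wpM2l (normr_ge0 a) (ltW h1); have := ler_wpM2l (normr_ge0 b) (ltW h2).
  have := divr_gt0 e0 c0; lra.
Qed.

End approximation.

(** * Uniform coordinates on a set of positive measure *)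

Section isomorphisms.
Context (R : realType) (d : measure_display) (X : measurableType d)
  (P : probability X R) (HP : atomless P)
  (f : X -> R) (mf : measurable_fun setT f) (inj : injective f)
  (fimg : forall A : set X, measurable A -> measurable (f @` A)).
Implicit Types (A B C : set X).
Local Notation Pr := (Pr P).
Local Notation dm := (dm P).

Lemma mpre (T : X -> X) A : measurable_fun setT T -> measurable A ->
  measurable (T @^-1` A).
Proof. by move=> mT mA; rewrite -[_ @^-1` _]setTI; apply: mT. Qed.

Lemma mpreR (u : X -> R) (J : set R) : measurable_fun setT u -> measurable J ->
  measurable (u @^-1` J).
Proof. by move=> mT mA; rewrite -[_ @^-1` _]setTI; apply: mT. Qed.

(** A fibre of the injective [f] has at most one point, so it has no subset of strictly smaller
    positive measure. *)
Lemma atomless_fiber0 (r : R) : Pr (f @^-1` [set r]) = 0.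
Proof.
have mA : measurable (f @^-1` [set r]) by apply: mpreR => //; exact: measurable_set1.
apply/eqP; rewrite eq_le Pr_ge0 andbT leNgt; apply/negP => h.
have [|B [mB BA B0 BP]] := HP mA; first by rewrite PrE.
have [x Bx] : B !=set0 by apply/set0P/eqP => Be; move: B0; rewrite Be measure0 ltxx.
suff BE : B = f @^-1` [set r] by rewrite BE ltxx in BP.
apply/seteqP; split=> // y /= fy.
by have := BA _ Bx; rewrite /= -fy => /inj <-.
Qed.

(** Everything off the range goes to one point [x0], so a preimage is an image under [f], enlarged
    by the complement of the range when it contains [x0]. *)
Lemma range_inverse : exists2 g : R -> X, measurable_fun setT g & forall x, g (f x) = x.
Proof.
have [x0 _] : [set: X] !=set0.
  by apply/set0P/eqP => h; have := @probability_setT _ _ _ P; rewrite h measure0 => -[] /eqP; rewrite eq_sym oner_eq0.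
have /choice[g hg] : forall r, exists x, (forall y, f y = r -> x = y) /\ (~ range f r -> x = x0).
  move=> r; have [[y _ <-]|no] := pselect (range f r).
    by exists y; split=> [z /inj|[]]//; exists y.
  by exists x0; split=> // y fy; exfalso; apply: no; exists y.
exists g; last by move=> x; apply: (hg (f x)).1.
move=> _ A mA; rewrite setTI.
have mr : measurable (range f) by apply: fimg.
have [Ax0|Ax0] := pselect (A x0).
  rewrite (_ : g @^-1` A = f @` A `|` ~` range f).
    by apply: measurableU; [exact: fimg|exact: measurableC].
  apply/seteqP; split=> [r /= Ar|r /= [[x Ax <-]|no]].
  - have [[y _ fy]|no] := pselect (range f r); [left|by right].
    by exists y => //; rewrite -((hg r).1 _ fy).
  - by rewrite ((hg (f x)).1 x).
  - by rewrite (hg r).2.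
rewrite (_ : g @^-1` A = f @` A); first exact: fimg.
apply/seteqP; split=> [r /= Ar|r /= [x Ax <-]]; last by rewrite ((hg (f x)).1 x).
have [[y _ fy]|no] := pselect (range f r).
  by exists y => //; rewrite -((hg r).1 _ fy).
by exfalso; apply: Ax0; rewrite -((hg r).2 no).
Qed.

(** The distribution function of the uniform law on the unit interval. *)
Definition clamp (s : R) := Num.max 0 (Num.min s 1).

Section uniform.
Context (B : set X) (mB : measurable B) (b0 : 0 < Pr B).
Let ray r := f @^-1` `]-oo, r[%classic.
Let F r := Pr (B `&` ray r) / Pr B.
Let u x := F (f x).

Let mray r : measurable (B `&` ray r).
Proof. by apply: measurableI => //; apply: mpreR. Qed.

Let rayS r s : r <= s -> B `&` ray r `<=` B `&` ray s.
Proof.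
move=> rs x [Bx]; rewrite /ray /= !in_itv/= => h; split=> //=.
by rewrite ?in_itv/= (lt_le_trans h).
Qed.

Let F_mono r s : r <= s -> F r <= F s.
Proof. by move=> rs; rewrite ler_pM2r ?invr_gt0//; apply: Pr_le => //; exact: rayS. Qed.

Let F_ge0 r : 0 <= F r.
Proof. by rewrite divr_ge0 ?Pr_ge0. Qed.

Let FE r : Pr (B `&` ray r) = F r * Pr B.
Proof. by rewrite divfK// gt_eqF. Qed.

Let F_low s : 0 < s -> exists r, F r <= s.
Proof.
move=> s0; have sb : 0 < s * Pr B by rewrite mulr_gt0.
have [||n] := @Pr_cvg_down _ _ _ P (fun n => B `&` ray (- n%:R)) _ sb.
- by move=> n; exact: mray.
- by move=> n m nm; apply: rayS; rewrite lerN2 ler_nat.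
rewrite (_ : \bigcap_k _ = set0) ?Pr0 ?add0r => [h|].
  by exists (- n%:R); rewrite ler_pdivrMr// ltW.
apply/seteqP; split=> x // h.
have := h (Num.truncn `|f x|).+1 I; rewrite /ray /= in_itv/= => -[_].
have := truncnS_gt `|f x|; have := ler_norm (- f x); rewrite normrN.
by move=> h1 h2 h3; lra.
Qed.

Let F_high s : s < 1 -> exists r, s < F r.
Proof.
move=> s1; have sb : 0 < (1 - s) * Pr B by rewrite mulr_gt0// subr_gt0.
have [||n] := @Pr_cvg_up _ _ _ P (fun n => B `&` ray n%:R) _ sb.
- by move=> n; exact: mray.
- by move=> n m nm; apply: rayS; rewrite ler_nat.
rewrite (_ : \bigcup_k _ = B) => [h|].
  exists n%:R; rewrite ltr_pdivlMr//; lra.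
apply/seteqP; split=> x; first by move=> [k _ []].
move=> Bx; exists (Num.truncn `|f x|).+1 => //; split=> //.
rewrite /ray /= in_itv/=; apply: le_lt_trans (truncnS_gt _); exact: ler_norm.
Qed.

(** Continuity of [F]: from the left, rays increase to a ray; from the right, their intersection
    adds a single fibre of [f], which is null. *)
Let F_ivt s : 0 < s -> s < 1 -> exists r, F r = s.
Proof.
move=> s0 s1; pose S := [set r | F r <= s].
have S0 : S !=set0 by have [r] := F_low s0; exists r.
have [r1 hr1] := F_high s1.
have Sub : has_ubound S.
  by exists r1 => r; rewrite /S/= => h; rewrite leNgt; apply/negP => /ltW/F_mono; lra.
have hS : has_sup S by split.
exists (sup S); apply/eqP; rewrite eq_le; apply/andP; split.
  apply/ler_addgt0Pl => e e0; have eb : 0 < e * Pr B by rewrite mulr_gt0.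
  have [||n] := @Pr_cvg_up _ _ _ P (fun n => B `&` ray (sup S - n.+1%:R^-1)) _ eb.
  - by move=> n; exact: mray.
  - by move=> n m nm; apply: rayS; rewrite lerD2l lerN2 lef_pV2 ?posrE// ler_nat.
  rewrite (_ : \bigcup_k _ = B `&` ray (sup S)); last first.
    apply/seteqP; split=> x.
      move=> [k _]; apply: rayS; rewrite gerBl//.
    move=> [Bx]; rewrite /ray/= in_itv/= => h.
    have /ltr_add_invr[k hk] := h; exists k => //; split=> //.
    by rewrite /ray/= in_itv/= ltrBrDr.
  rewrite !FE -mulrDl ltr_pM2r// => h.
  have [|r rS rn] := @sup_adherent _ S (n.+1%:R^-1) _ hS; first by rewrite invr_gt0.
  rewrite /S/= in rS.
  have := F_mono (ltW rn); lra.
have h n : s * Pr B <= Pr (B `&` ray (sup S + n.+1%:R^-1)).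
  rewrite FE ler_pM2r// leNgt; apply/negP => /ltW h.
  have : sup S + n.+1%:R^-1 <= sup S by apply: ub_le_sup.
  by rewrite gerDl leNgt invr_gt0 ltr0n.
rewrite ler_pdivlMr//; apply/ler_addgt0Pl => e e0.
have [||n] := @Pr_cvg_down _ _ _ P (fun n => B `&` ray (sup S + n.+1%:R^-1)) _ e0.
- by move=> n; exact: mray.
- by move=> n m nm; apply: rayS; rewrite lerD2l lef_pV2 ?posrE// ler_nat.
move=> hn; apply: (le_trans (h n)); apply: (le_trans (ltW hn)); rewrite addrC lerD2l.
have mfib : measurable (f @^-1` [set sup S]) by apply: mpreR => //; exact: measurable_set1.
rewrite -[leRHS]addr0 -(atomless_fiber0 (sup S)); apply: Pr_leD_ae => //.
  by apply: bigcap_measurable => // k _; exact: mray.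
apply: aeW => x /= hx; have Bx : B x by case: (hx 0%N I).
have [lt|ge] := ltP (f x) (sup S); first by left; rewrite /ray /= in_itv.
right; apply/eqP; rewrite eq_le ge andbT leNgt; apply/negP => /ltr_add_invr[k hk].
by have [_] := hx k I; rewrite /ray/= in_itv/= => /lt_trans/(_ hk); rewrite ltxx.
Qed.

Let mF : measurable_fun setT F.
Proof. by apply: nondecreasing_measurable => // r s; exact: F_mono. Qed.

Let mu : measurable_fun setT u.
Proof. exact: measurableT_comp. Qed.

Let law_mid s : 0 < s -> s < 1 -> Pr (B `&` u @^-1` `]-oo, s[%classic) = Pr B * s.
Proof.
move=> s0 s1; have mu' t : measurable (B `&` u @^-1` `]-oo, t[%classic).
  by apply: measurableI => //; apply: mpreR.
apply/eqP; rewrite eq_le; apply/andP; split.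
  have [r hr] := F_ivt s0 s1; rewrite -hr mulrC -FE; apply: Pr_le => // x [Bx].
  rewrite /= in_itv/= => h; split=> //; rewrite /ray /= in_itv/= ltNge.
  by apply/negP => /F_mono; rewrite leNgt h.
apply/ler_addgt0Pl => e e0; pose t := Num.max (s / 2) (s - e / Pr B).
have e1 : 0 < e / Pr B by rewrite divr_gt0.
have t0 : 0 < t by rewrite lt_max divr_gt0.
have ts : t < s by rewrite gt_max; apply/andP; split; lra.
have [r hr] := F_ivt t0 (lt_trans ts s1).
apply: (@le_trans _ _ (e + Pr B * t)).
  have : s - e / Pr B <= t by rewrite le_max lexx orbT.
  rewrite lerBlDr => h.
  have : Pr B * s <= Pr B * (t + e / Pr B) by rewrite ler_pM2l.
  by rewrite mulrDr (mulrC (Pr B) (e / _)) divfK ?gt_eqF//; lra.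
rewrite lerD2l -hr mulrC -FE; apply: Pr_le => // x [Bx].
rewrite /ray /= !in_itv/= => h; split=> //.
by apply: le_lt_trans ts; rewrite -hr; apply: F_mono; exact: ltW.
Qed.

Let law s : Pr (B `&` u @^-1` `]-oo, s[%classic) = Pr B * clamp s.
Proof.
have mu' t : measurable (B `&` u @^-1` `]-oo, t[%classic).
  by apply: measurableI => //; apply: mpreR.
have [s0|s0] := leP s 0.
  rewrite /clamp (_ : Num.max _ _ = 0) ?mulr0; last first.
    by apply/max_idPl; rewrite ge_min s0.
  rewrite (_ : _ `&` _ = set0) ?Pr0//; apply/seteqP; split=> x // [_].
  by rewrite /= in_itv/= => /lt_le_trans/(_ s0); rewrite ltNge F_ge0.
have [s1|s1] := ltP s 1.
  rewrite law_mid// /clamp; congr (_ * _); rewrite (min_idPl (ltW s1)).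
  by rewrite (max_idPr (ltW s0)).
rewrite /clamp (min_idPr s1) (max_idPr ler01) mulr1.
apply/eqP; rewrite eq_le; apply/andP; split; first by apply: Pr_le => //; exact: subIsetl.
apply/ler_addgt0Pl => e e0; pose t := Num.max (1 / 2) (1 - e / Pr B).
have e1 : 0 < e / Pr B by rewrite divr_gt0.
have t0 : 0 < t by rewrite lt_max divr_gt0.
have ts : t < 1 by rewrite gt_max; apply/andP; split; lra.
apply: (@le_trans _ _ (e + Pr B * t)).
  have : Pr B * (1 - e / Pr B) <= Pr B * t by rewrite ler_pM2l// le_max lexx orbT.
  by rewrite mulrBr mulr1 (mulrC (Pr B) (e / _)) divfK ?gt_eqF//; lra.
rewrite lerD2l -law_mid//; apply: Pr_le => // x [Bx].
by rewrite /= !in_itv/= => h; split=> //; rewrite ?in_itv/=; lra.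
Qed.

Let fiber0 s : Pr (B `&` u @^-1` [set s]) = 0.
Proof.
have mu' t : measurable (B `&` u @^-1` `]-oo, t[%classic).
  by apply: measurableI => //; apply: mpreR.
apply/eqP; rewrite eq_le Pr_ge0 andbT; apply/ler_addgt0Pl => e e0; rewrite addr0.
have e1 : 0 < e / Pr B by rewrite divr_gt0.
have m1 : measurable (B `&` u @^-1` [set s]).
  by apply: measurableI => //; apply: mpreR => //; exact: measurable_set1.
have : Pr ((B `&` u @^-1` [set s]) `|` (B `&` u @^-1` `]-oo, s[%classic)) <=
       Pr (B `&` u @^-1` `]-oo, (s + e / Pr B)[%classic).
  apply: Pr_le => //; first exact: measurableU.
  by move=> x /= [[Bx ->]|[Bx]]; rewrite ?in_itv/=; split=> //=; rewrite ?in_itv/=; move: e1; lra.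
rewrite PrU//; last first.
  by apply/seteqP; split=> x // [[_ /= ->] [_ /=]]; rewrite in_itv/= ltxx.
rewrite !law => h.
have : clamp (s + e / Pr B) <= clamp s + e / Pr B.
  rewrite /clamp; move: e1; set c := e / _ => e1.
  case: (leP (s + c) 1) => ?; case: (leP s 1) => ?; rewrite ge_max; apply/andP; split;
   rewrite ?maxEle; case: ifP; lra.
move=> h2; have : Pr B * clamp (s + e / Pr B) <= Pr B * (clamp s + e / Pr B) by rewrite ler_pM2l.
by rewrite mulrDr (mulrC (Pr B) (e / _)) divfK ?gt_eqF//; lra.
Qed.

(** Where [F] is constant on an interval, [u] forgets [f]. Such an interval contains a rational, so
    the affected points lie in countably many level sets of [u], all null; elsewhere the generalised
    inverse of [F] recovers [f]. *)
Let quantile : exists2 q : R -> R, measurable_fun setT q &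
  \forall x \ae P, B x -> q (u x) = f x.
Proof.
pose S s := [set r | F r <= s].
exists (fun s => sup (S s)); last first.
  have : \forall x \ae P, forall n, ~ (if unpickle n is Some a then
      (B `&` u @^-1` [set F (ratr a)]) x else False).
    apply: ae_foralln => n; case: (unpickle n) => [a|]; last by apply: aeW => x.
    apply/ae_Pr0; rewrite ?fiber0//; apply: measurableI => //.
    by apply: mpreR => //; exact: measurable_set1.
  apply: filterS => x hx Bx.
  have hx' a : u x <> F (ratr a).
    by move=> e; apply: (hx (pickle a)); rewrite pickleK; split.
  have ub r : F r <= F (f x) -> r <= f x.
    move=> h; rewrite leNgt; apply/negP => /rat_in_itvoo[a]; rewrite in_itv/= => /andP[a1 a2].
    apply: (hx' a); apply/eqP; rewrite eq_le; apply/andP; split; first exact/F_mono/ltW.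
    by apply: le_trans h; exact/F_mono/ltW.
  apply/eqP; rewrite eq_le; apply/andP; split.
    by apply: ge_sup; [exists (f x); exact: lexx|move=> r; exact: ub].
  by apply: ub_le_sup; [exists (f x) => r; exact: ub|exact: lexx].
pose D := [set s | has_sup (S s)].
have mD : measurable D.
  pose low n := if unpickle n is Some a then `[F (ratr a), +oo[%classic else set0.
  pose high n := if unpickle n is Some a then `]-oo, F (ratr a)[%classic else set0.
  have mlow n : measurable (low n) by rewrite /low; case: (unpickle n).
  have mhigh n : measurable (high n) by rewrite /high; case: (unpickle n).
  rewrite (_ : D = \bigcup_n low n `&` \bigcup_n high n).
    by apply: measurableI; apply: bigcup_measurable.
  apply/seteqP; split=> s.
    move=> [[r /= rs] [r1 hr1]]; split.
      have [|a'] := @rat_in_itvoo _ (r - 1) r; first by lra.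
      rewrite in_itv/= => /andP[_ a2].
      exists (pickle a'); first exact: I.
      by rewrite /low pickleK /= in_itv/= andbT; apply: le_trans rs; exact/F_mono/ltW.
    have [|a'] := @rat_in_itvoo _ r1 (r1 + 1); first by lra.
    rewrite in_itv/= => /andP[a1 _].
    exists (pickle a'); first exact: I.
    rewrite /high pickleK /= in_itv/= ltNge; apply/negP => h.
    by have := hr1 _ h; rewrite leNgt a1.
  move=> [[n _ ln] [m _ hm]]; split.
    move: ln; rewrite /low; case: (unpickle n) => //= a; rewrite in_itv/= andbT => h.
    by exists (ratr a).
  move: hm; rewrite /high; case: (unpickle m) => //= a; rewrite in_itv/= => h.
  by exists (ratr a) => r; rewrite /S/= => hr; rewrite leNgt; apply/negP => /ltW/F_mono; lra.
apply: (measurability _ (RGenOInfty.measurableE R)) => //.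
move=> _ [_ [c ->] <-]; rewrite setTI.
pose low n := if unpickle n is Some a then
  (if c < ratr a then `[F (ratr a), +oo[%classic else set0) else set0.
have mlow n : measurable (low n).
  by rewrite /low; case: (unpickle n) => // a; case: ifP.
(* Off [D] the supremum takes the default value 0, which exceeds [c] exactly when [c] is
   negative. *)
rewrite (_ : _ @^-1` _ = (D `&` \bigcup_n low n) `|` (if c < 0 then ~` D else set0)).
  apply: measurableU; first by apply: measurableI => //; apply: bigcup_measurable.
  by case: ifP => // _; exact: measurableC.
apply/seteqP; split=> s /=; rewrite in_itv/= andbT.
  have [Ds|nDs] := pselect (D s); last by rewrite sup_out// => ->; right.
  move=> h; left; split=> //.
  have [|r /= rS cr] := @sup_adherent _ (S s) (sup (S s) - c) _ Ds; first by rewrite subr_gt0.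
  have [|a] := @rat_in_itvoo _ c r; first by lra.
  rewrite in_itv/= => /andP[a1 a2]; exists (pickle a); first exact: I.
  rewrite /low pickleK a1 /= in_itv/= andbT; apply: le_trans rS; exact/F_mono/ltW.
move=> [[Ds [n _]]|]; last by case: ifP => // c0 nDs; rewrite sup_out.
rewrite /low; case: (unpickle n) => // a; case: ifP => //= ca; rewrite in_itv/= andbT => h.
by apply: lt_le_trans ca _; apply: ub_le_sup => //; case: Ds.
Qed.

(** [u] is the distribution function of [f] on [B] evaluated at [f], hence uniform; [v] is the
    quantile function followed by the inverse of [f]. Together they identify [B] with the unit
    interval modulo null sets. *)
Lemma uniformization : exists (u : X -> R) (v : R -> X),
  [/\ measurable_fun setT u, measurable_fun setT v,
      \forall x \ae P, B x -> v (u x) = x,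
      forall s, Pr (B `&` u @^-1` `]-oo, s[%classic) = Pr B * clamp s
    & forall x, 0 <= u x].
Proof.
have [q mq hq] := quantile; have [g mg hg] := range_inverse.
exists u, (g \o q); split.
- exact: mu.
- exact: measurableT_comp.
- by apply: filterS hq => x h Bx /=; rewrite h.
- exact: law.
- by move=> x; exact: F_ge0.
Qed.

End uniform.
End isomorphisms.

(** * Measure isomorphisms, equal slices, and [X] as a product with a finite set *)

Section copies.
Context (R : realType) (d : measure_display) (X : measurableType d)
  (P : probability X R) (HX : standard_borel R X) (HP : atomless P).
Implicit Types (A B C : set X).
Local Notation Pr := (Pr P).
Local Notation dm := (dm P).

(** Both sets are normalised copies of the unit interval, so they are isomorphic up to a scale
    factor. Writing the scaling with products instead of quotients keeps the case of two null sets,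
    where the identity works. *)
Lemma iso_pair B B' : measurable B -> measurable B' -> (Pr B = 0 <-> Pr B' = 0) ->
  exists w w' : X -> X,
  [/\ measurable_fun setT w /\ measurable_fun setT w',
      \forall x \ae P, B x -> B' (w x) /\ w' (w x) = x,
      \forall x \ae P, B' x -> B (w' x) /\ w (w' x) = x,
      forall A, measurable A -> Pr (B `&` w @^-1` A) * Pr B' = Pr B * Pr (B' `&` A)
    & forall A, measurable A -> Pr (B' `&` w' @^-1` A) * Pr B = Pr B' * Pr (B `&` A)].
Proof.
move=> mB mB' BB'; have [B0|B0] := eqVneq (Pr B) 0.
  have B'0 := (BB'.1 B0); exists id, id; split.
  - by split; exact: measurable_id.
  - by move/(ae_Pr0 P mB) : B0; apply: filterS => x.
  - by move/(ae_Pr0 P mB') : B'0; apply: filterS => x.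
  - by move=> A mA; rewrite B0 B'0 mulr0 mul0r.
  - by move=> A mA; rewrite B0 B'0 mulr0 mul0r.
have {}B0 : 0 < Pr B by rewrite lt_def B0 Pr_ge0.
have B'0 : 0 < Pr B'.
  by rewrite lt_def Pr_ge0 andbT; apply/eqP => /BB'; move: B0 => /[swap] ->; rewrite ltxx.
have [f [mf inj fimg]] := HX.
have [u [v [mu mv vu lawu _]]] := uniformization HP mf inj fimg mB B0.
have [u' [v' [mu' mv' vu' lawu' _]]] := uniformization HP mf inj fimg mB' B'0.
have half (C C' : set X) (a : X -> R) (b : R -> X) (a' : X -> R) (b' : R -> X) :
    measurable C -> measurable C' -> 0 < Pr C -> 0 < Pr C' ->
    measurable_fun setT a -> measurable_fun setT b ->
    measurable_fun setT a' -> measurable_fun setT b' ->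
    (\forall x \ae P, C x -> b (a x) = x) ->
    (\forall x \ae P, C' x -> b' (a' x) = x) ->
    (forall s, Pr (C `&` a @^-1` `]-oo, s[%classic) = Pr C * clamp s) ->
    (forall s, Pr (C' `&` a' @^-1` `]-oo, s[%classic) = Pr C' * clamp s) ->
    (\forall x \ae P, C x -> C' (b' (a x)) /\ b (a' (b' (a x))) = x) /\
    forall A, measurable A -> Pr (C `&` (b' \o a) @^-1` A) * Pr C' = Pr C * Pr (C' `&` A).
  move=> mC mC' C0 C'0 ma mb ma' mb' ba ba' la la'.
  have law : forall J : set R, measurable J ->
      Pr C' * Pr (C `&` a @^-1` J) = Pr C * Pr (C' `&` a' @^-1` J).
    apply: law_unique => //; first by rewrite mulrC.
    by move=> s; rewrite la la' !mulrA (mulrC (Pr C)).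
  have mpb A : measurable A -> measurable (b' @^-1` A).
    by move=> mA; rewrite -[_ @^-1` _]setTI; apply: mb'.
  split; last first.
    move=> A mA; rewrite mulrC comp_preimage law; last exact: mpb.
    congr (_ * _); apply: Pr_eq_ae.
    - apply: measurableI => //; apply: mpreR => //; exact: mpb.
    - exact: measurableI.
    - apply: filterS ba' => x h /=; split=> -[C'x]; have h' := h C'x; by rewrite /= ?h'.
  (* [a'] and [b'] are mutually inverse only almost everywhere on [C']. The parameters where this
     fails form a Borel set, null for the law of [a'] and therefore for the proportional law of
     [a]. *)
  pose good := b' @^-1` C' `&` [set s | a' (b' s) = s].
  have mg : measurable good.
    apply: measurableI; first exact: mpb.
    rewrite (_ : [set s | _] = ((a' \o b') \- id) @^-1` [set 0]).
      rewrite -[X in measurable X]setTI.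
      suff h : measurable_fun setT ((a' \o b') \- id : R -> R) by apply: h => //; exact: measurable_set1.
      by apply: measurable_funB; [exact: measurableT_comp|exact: measurable_id].
    apply/seteqP; split=> s /=; first by move=> ->; rewrite subrr.
    by move=> /eqP; rewrite subr_eq0 => /eqP.
  have mng : measurable (~` good) by exact: measurableC.
  have z' : Pr (C' `&` a' @^-1` (~` good)) = 0.
    apply/ae_Pr0; first by apply: measurableI => //; exact: mpreR.
    by apply: filterS ba' => x h [C'x]; apply; rewrite /good /=; rewrite (h C'x).
  have z : Pr (C `&` a @^-1` (~` good)) = 0.
    have := law _ mng; rewrite z' mulr0 => /eqP; rewrite mulf_eq0.
    by rewrite gt_eqF//= => /eqP.
  move/(ae_Pr0 P) : z => /(_ _)/wrap[]; first by apply: measurableI => //; exact: mpreR.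
  apply: filterS2 ba => x h1 h2 Cx.
  have [g1 /= g2] : good (a x) by apply: contrapT => ng; apply: h2.
  by split=> //; rewrite g2 h1.
have [h1 h2] := half B B' u v u' v' mB mB' B0 B'0 mu mv mu' mv' vu vu' lawu lawu'.
have [h1' h2'] := half B' B u' v' u v mB' mB B'0 B0 mu' mv' mu mv vu' vu lawu' lawu.
exists (v' \o u), (v \o u'); split=> //.
by split; exact: measurableT_comp.
Qed.

(** One uniform coordinate [u] serves all [m] at once, slice [j] being the part where [u] lies in
    the [j]-th interval of length [1 / (m + 1)]. The last clause lets unions of initial slices be
    compared with rays of [u]. *)
Lemma split_slices B : measurable B -> 0 < Pr B ->
  exists (u : X -> R) (v : R -> X) (b : nat -> X -> nat),
  [/\ measurable_fun setT u /\ measurable_fun setT v, \forall x \ae P, B x -> v (u x) = x,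
    forall s, Pr (B `&` u @^-1` `]-oo, s[%classic) = Pr B * clamp s, forall x, 0 <= u x
  & forall m, [/\ forall x, (b m x < m.+1)%N, forall j, measurable (b m @^-1` [set j]),
      forall j, (j < m.+1)%N -> m.+1%:R * Pr (B `&` b m @^-1` [set j]) = Pr B
    & forall x k, (k < m.+1)%N -> (b m x < k)%N = (u x < k%:R / m.+1%:R)]].
Proof.
move=> mB B0; have [f [mf inj fimg]] := HX.
have [u [v [mu mv vu law u0]]] := uniformization HP mf inj fimg mB B0.
(* [minn m] sends the points with [u x = 1] to the last slice. *)
exists u, v, (fun m x => minn m (Num.truncn (m.+1%:R * u x))); split; [by split|by []|by []|by []|move=> m].
set n := m.+1; have n0 : 0 < n%:R :> R by rewrite ltr0n.
set b := fun x => minn m _.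
have hb x k : (k < n)%N -> (b x < k)%N = (u x < k%:R / n%:R).
  move=> kn; have nu0 : 0 <= n%:R * u x by rewrite mulr_ge0// ltW.
  rewrite ltr_pdivlMr// [u x * _]mulrC /b gtn_min ltnNge -ltnS kn/=.
  have /andP[h1 h2] := truncn_itv nu0.
  apply/idP/idP => h.
    by apply: lt_le_trans h2 _; rewrite ler_nat.
  by rewrite -(ltr_nat R); apply: le_lt_trans h1 h.
have fib j : (j < n)%N -> b @^-1` [set j] =
    if (j < m)%N then u @^-1` `]-oo, (j.+1%:R / n%:R)[%classic `\`
      u @^-1` `]-oo, (j%:R / n%:R)[%classic else ~` (u @^-1` `]-oo, (j%:R / n%:R)[%classic).
  move=> jn; case: ifPn => jm; apply/seteqP; split=> x /=; rewrite !in_itv/=.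
  - by move=> bj; rewrite -(hb x j.+1)// -(hb x j)// bj ltnn ltnSn.
  - rewrite -(hb x j.+1)// -(hb x j)// => -[h1 /negP]; rewrite -leqNgt => h2.
    by apply/eqP; rewrite eqn_leq h2 -ltnS h1.
  - by move=> bj; rewrite -(hb x j)// bj ltnn.
  - rewrite -(hb x j)// => /negP; rewrite -leqNgt => h2; apply/eqP; rewrite eqn_leq h2 andbT.
    by apply: (leq_trans (geq_minl _ _)); rewrite leqNgt.
have mray s : measurable (u @^-1` `]-oo, s[%classic) by apply: mpreR.
have bn x : (b x < n)%N by rewrite ltnS geq_minl.
split=> // [j|j jn].
  have [jn|jn] := ltnP j n.
    by rewrite fib//; case: ifP => _; [exact: measurableD|exact: measurableC].
  rewrite (_ : _ @^-1` _ = set0)//; apply/seteqP; split=> x //= bj.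
  by have := bn x; rewrite bj ltnNge jn.
have cl k : (k <= n)%N -> clamp (k%:R / n%:R : R) = k%:R / n%:R.
  move=> kn; rewrite /clamp min_l ?ler_pdivrMr ?mul1r ?ler_nat// max_r// divr_ge0// ltW//.
have law' k : (k <= n)%N -> n%:R * Pr (B `&` u @^-1` `]-oo, (k%:R / n%:R)[%classic) = Pr B * k%:R.
  by move=> kn; rewrite law cl// mulrCA [n%:R * (_ / _)]mulrC divfK ?gt_eqF.
rewrite fib//; case: ifPn => jm.
  have : Pr (B `&` u @^-1` `]-oo, (j.+1%:R / n%:R)[%classic) =
      Pr (B `&` u @^-1` `]-oo, (j%:R / n%:R)[%classic) +
      Pr (B `&` (u @^-1` `]-oo, (j.+1%:R / n%:R)[%classic `\` u @^-1` `]-oo, (j%:R / n%:R)[%classic)).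
    rewrite -PrU; first congr Pr.
    - apply/seteqP; split=> x; last first.
        move=> [[Bx /= ]|[Bx [/=]]]//; rewrite !in_itv/= => h; split=> //=; rewrite ?in_itv//=.
        by apply: (lt_le_trans h); rewrite ler_pM2r ?invr_gt0// ler_nat.
      move=> [Bx ux]; have [h|h] := pselect ((u @^-1` `]-oo, (j%:R / n%:R)[%classic) x).
        by left.
      by right.
    - exact: measurableI.
    - by apply: measurableI => //; exact: measurableD.
    - by apply/seteqP; split=> x // [[_ ?] [_ []]].
  move/(congr1 (fun z => n%:R * z)); rewrite mulrDr !law'//; last by rewrite ltnW.
  by rewrite -natr1 mulrDr mulr1; lra.
have jE : j = m by apply/eqP; rewrite eqn_leq -ltnS jn leqNgt.
have : Pr B = Pr (B `&` u @^-1` `]-oo, (j%:R / n%:R)[%classic) +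
      Pr (B `&` ~` (u @^-1` `]-oo, (j%:R / n%:R)[%classic)).
  rewrite -PrU; first congr Pr.
  - by rewrite -setIUr setUv setIT.
  - exact: measurableI.
  - by apply: measurableI => //; exact: measurableC.
  - by apply/seteqP; split=> x // [[_ ?] [_]].
move/(congr1 (fun z => n%:R * z)); rewrite mulrDr !law'//; last by rewrite ltnW.
by rewrite jE /n -natr1; lra.
Qed.

Lemma split_nat B m : measurable B -> (0 < m)%N ->
  exists b : X -> nat, [/\ forall x, (b x < m)%N,
    forall j, measurable (b @^-1` [set j]) &
    forall j, (j < m)%N -> m%:R * Pr (B `&` b @^-1` [set j]) = Pr B].
Proof.
case: m => // m mB _; have [B0|B0] := eqVneq (Pr B) 0.
  exists (fun=> 0%N); split=> // j.
    by rewrite preimage_cst; case: ifP.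
  move=> _; rewrite B0 (_ : Pr _ = 0) ?mulr0//; apply/eqP.
  rewrite eq_le Pr_ge0 andbT -[leRHS]B0 Pr_le//.
  by apply: measurableI => //; rewrite preimage_cst; case: ifP.
have {}B0 : 0 < Pr B by rewrite lt_def B0 Pr_ge0.
have [u [v [b [_ _ _ _ /(_ m)[h1 h2 h3 _]]]]] := split_slices mB B0.
by exists (b m).
Qed.

Lemma split_fin (J : finType) (j0 : J) B : measurable B ->
  exists b : X -> J, (forall j, measurable (b @^-1` [set j])) /\
    forall j, #|J|%:R * Pr (B `&` b @^-1` [set j]) = Pr B.
Proof.
move=> mB; have J0 : (0 < #|J|)%N by apply/card_gt0P; exists j0.
have [b [bl mb hb]] := split_nat mB J0.
have E j : (fun x => nth j0 (enum J) (b x)) @^-1` [set j] = b @^-1` [set index j (enum J)].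
  apply/seteqP; split=> x /= => [<-|->]; last by rewrite nth_index ?mem_enum.
  by rewrite index_uniq ?enum_uniq// -cardE.
exists (fun x => nth j0 (enum J) (b x)); split=> j; rewrite E//.
by apply: hb; rewrite cardE index_mem mem_enum.
Qed.

Lemma measurable_glue (I : finType) (l : X -> I) (F : I -> X -> X) :
  (forall i, measurable (l @^-1` [set i])) -> (forall i, measurable_fun setT (F i)) ->
  measurable_fun setT (fun x => F (l x) x).
Proof.
move=> ml mF _ A mA; rewrite setTI.
rewrite (_ : _ @^-1` _ = \bigcup_(i in [set: I]) (l @^-1` [set i] `&` F i @^-1` A)).
  apply: fin_bigcup_measurable => // i _; apply: measurableI => //.
  by rewrite -[_ @^-1` _]setTI; apply: mF.
by apply/seteqP; split=> [x /= h|x [i _ [/= -> ]]]//; exists (l x).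
Qed.

(** An identification of [X] with the product of [X] and [J]: [a] and [b] are the two coordinates,
    [g j] is the embedding onto copy [j], and the last clause says that [P] becomes the product of
    [P] with the uniform law. *)
Definition is_copies (J : finType) (g : J -> X -> X) (a : X -> X) (b : X -> J) :=
  [/\ (forall j, measurable_fun setT (g j)) /\ measurable_fun setT a,
      forall j, measurable (b @^-1` [set j]),
      \forall x \ae P, forall j, a (g j x) = x /\ b (g j x) = j,
      \forall x \ae P, g (b x) (a x) = x
    & forall j A, measurable A -> #|J|%:R * Pr (b @^-1` [set j] `&` a @^-1` A) = Pr A].

(** As [b] is uniform and independent of [l], each piece of [l] is isomorphic up to scale to its
    part in copy [j]; gluing these isomorphisms gives coordinates that respect [l]. *)
Lemma copies_of_labels (I J : finType) (l : X -> I) (b : X -> J) :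
  (forall i, measurable (l @^-1` [set i])) -> (forall j, measurable (b @^-1` [set j])) ->
  (forall i j, #|J|%:R * Pr (l @^-1` [set i] `&` b @^-1` [set j]) = Pr (l @^-1` [set i])) ->
  exists g a, is_copies g a b /\ \forall x \ae P, l (a x) = l x.
Proof.
move=> ml mb hlb.
have J0 (j : J) : (#|J|%:R != 0 :> R) by rewrite pnatr_eq0 -lt0n; apply/card_gt0P; exists j.
have mlb i j : measurable (l @^-1` [set i] `&` b @^-1` [set j]) by exact: measurableI.
have /choice[W hW] : forall ij : I * J, exists ww : (X -> X) * (X -> X),
  let B := l @^-1` [set ij.1] in let B' := B `&` b @^-1` [set ij.2] in
  [/\ measurable_fun setT ww.1 /\ measurable_fun setT ww.2,
      \forall x \ae P, B x -> B' (ww.1 x) /\ ww.2 (ww.1 x) = x,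
      \forall x \ae P, B' x -> B (ww.2 x) /\ ww.1 (ww.2 x) = x
    & forall A, measurable A -> Pr (B' `&` ww.2 @^-1` A) * Pr B = Pr B' * Pr (B `&` A)].
  move=> [i j] /=.
  have [|w [w' [h1 h2 h3 _ h4]]] := iso_pair (ml i) (mlb i j); last by exists (w, w').
  rewrite -(hlb i j); split=> [/eqP|->]; last by rewrite mulr0.
  by rewrite mulf_eq0 (negbTE (J0 j)) => /eqP.
have {}hW i j := hW (i, j).
pose g j x := (W (l x, j)).1 x; pose a x := (W (l x, b x)).2 x.
have mg j : measurable_fun setT (g j).
  by apply: (measurable_glue (F := fun i => (W (i, j)).1)) => // i; have [[]] := hW i j.
have ma : measurable_fun setT a.
  apply: (measurable_glue (l := fun x => (l x, b x)) (F := fun ij => (W ij).2)).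
    move=> [i j]; rewrite (_ : _ @^-1` _ = l @^-1` [set i] `&` b @^-1` [set j])//.
    by apply/seteqP; split=> x /= => [[-> ->]|[-> ->]].
  by move=> [i j]; have [[]] := hW i j.
have gx : \forall x \ae P, forall j, (l (g j x) = l x /\ b (g j x) = j) /\
    (W (l x, j)).2 (g j x) = x.
  have : \forall x \ae P, forall ij : I * J, l x = ij.1 ->
     (l ((W ij).1 x) = ij.1 /\ b ((W ij).1 x) = ij.2) /\ (W ij).2 ((W ij).1 x) = x.
    by apply: filter_forall => -[i j]; have [_ h _ _] := hW i j.
  by apply: filterS => x h j; have := h (l x, j) erefl.
have ax : \forall x \ae P, l (a x) = l x /\ g (b x) (a x) = x.
  have : \forall x \ae P, forall ij : I * J, l x = ij.1 /\ b x = ij.2 ->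
     l ((W ij).2 x) = ij.1 /\ (W ij).1 ((W ij).2 x) = x.
    by apply: filter_forall => -[i j]; have [_ _ h _] := hW i j.
  apply: filterS => x /(_ (l x, b x)) /= /(_ (conj erefl erefl)) [h1 h2].
  by split=> //; rewrite /g h1.
exists g, a; split; last by apply: filterS ax => x [].
split=> //.
- apply: filterS gx => x h j; have [[h1 h2] h3] := h j.
  by split=> //; rewrite /a h1 h2.
- by apply: filterS ax => x [].
move=> j A mA; have mpA : measurable (a @^-1` A) by rewrite -[_ @^-1` _]setTI; apply: ma.
rewrite (Pr_fibers P ml mA) (Pr_fibers P ml (measurableI _ _ (mb j) mpA)) mulr_sumr.
apply: eq_bigr => i _; have [_ _ _ h] := hW i j; have {h} := h A mA.
set B := _ @^-1` [set (i, j).1] => h.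
have -> : b @^-1` [set j] `&` a @^-1` A `&` l @^-1` [set i] =
    B `&` b @^-1` [set (i, j).2] `&` (W (i, j)).2 @^-1` A.
  apply/seteqP; split=> x; rewrite /B /a /=; first by move=> [[-> ?] <-].
  by move=> [[-> ->] ?].
have [B0|B0] := eqVneq (Pr B) 0.
  have z C : measurable C -> C `<=` B -> Pr C = 0.
    move=> mC CB; apply/eqP; rewrite eq_le Pr_ge0 andbT -[leRHS]B0; apply: Pr_le => //; exact: ml.
  have mW : measurable ((W (i, j)).2 @^-1` A).
    by rewrite -[_ @^-1` _]setTI; have [[_ m2] _ _ _] := hW i j; apply: m2.
  rewrite (z (B `&` _ `&` _)); last by move=> x [[]].
    have -> : Pr (A `&` l @^-1` [set i]) = 0 by apply: z; [exact: measurableI|move=> x []].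
    by rewrite mulr0.
  by apply: measurableI => //; exact: mlb.
apply: (mulIf B0); rewrite -mulrA h mulrA [(i, j).2]/= hlb /= setIC mulrC//.
Qed.

(** The label of a point records which sets of [Bs] contain it. Splitting every atom evenly among
    the copies makes each set of [Bs] a product set. *)
Lemma copies_family (J : finType) (j0 : J) (Bs : seq (set X)) :
  (forall B, B \in Bs -> measurable B) ->
  exists g a b, @is_copies J g a b /\
    forall B, B \in Bs -> \forall x \ae P, B (a x) <-> B x.
Proof.
move=> mBs; pose Lab := {ffun 'I_(size Bs) -> bool}.
have mnth i : measurable (nth set0 Bs i).
  have [h|h] := ltnP i (size Bs); first by apply: mBs; rewrite mem_nth.
  by rewrite nth_default.
pose l x : Lab := [ffun i => `[< nth set0 Bs (val i) x >]].
have ml i : measurable (l @^-1` [set i]).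
  rewrite (_ : _ @^-1` _ = \bigcap_(k in [set: 'I_(size Bs)])
      if i k then nth set0 Bs k else ~` nth set0 Bs k).
    apply: fin_bigcap_measurable => // k _; case: ifP => _; last apply: measurableC; exact: mnth.
  apply/seteqP; split=> x /=.
    by move=> <- k _; rewrite ffunE; case: ifPn => /asboolP.
  move=> h; apply/ffunP => k; rewrite ffunE; have := h k I.
  by case: (i k) => ?; apply/asboolP.
have /choice[bb hbb] : forall i, exists b : X -> J, (forall j, measurable (b @^-1` [set j])) /\
    forall j, #|J|%:R * Pr (l @^-1` [set i] `&` b @^-1` [set j]) = Pr (l @^-1` [set i]).
  by move=> i; exact: split_fin.
pose b x := bb (l x) x.
have mb j : measurable (b @^-1` [set j]).
  rewrite (_ : _ @^-1` _ = \bigcup_(i in [set: Lab]) (l @^-1` [set i] `&` bb i @^-1` [set j])).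
    apply: fin_bigcup_measurable; first exact: finite_finset.
    by move=> i _; apply: measurableI => //; exact: (hbb i).1.
  by apply/seteqP; split=> [x /= h|x [i _ [/= <- ]]]//; exists (l x).
have [|g [a [ha la]]] := @copies_of_labels Lab J l b ml mb.
  move=> i j; rewrite -[in RHS]((hbb i).2 j); congr (_ * Pr _).
  by apply/seteqP; split=> x /= [<-].
exists g, a, b; split=> // B BBs; apply: filterS la => x.
have iB : (index B Bs < size Bs)%N by rewrite index_mem.
move/ffunP/(_ (Ordinal iB)); rewrite !ffunE /= nth_index// => h.
by apply: asbool_eq_equiv.
Qed.

End copies.

(** * Skew products *)
Section skew_products.
Context (R : realType) (d : measure_display) (X : measurableType d)
  (P : probability X R) (HX : standard_borel R X) (HP : atomless P).
Context (G : zmodType).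
Implicit Types (A B C : set X) (K L H : set G) (S T : G -> X -> X).
Local Notation Pr := (Pr P).
Local Notation dm := (dm P).

Lemma subgroup0 K : is_subgroup K -> K 0. Proof. by case. Qed.

Lemma subgroupB K a b : is_subgroup K -> K a -> K b -> K (a - b).
Proof. by move=> [_]; apply. Qed.

Lemma subgroupN K a : is_subgroup K -> K a -> K (- a).
Proof. by move=> sK Ka; rewrite -sub0r; apply: subgroupB => //; exact: subgroup0. Qed.

Lemma subgroupD K a b : is_subgroup K -> K a -> K b -> K (a + b).
Proof.
by move=> sK Ka Kb; rewrite -[b]opprK; apply: subgroupB => //; exact: subgroupN.
Qed.

Lemma act_mpt K T k : actions_on P K T -> K k -> mpt P (T k).
Proof. by move=> [h _ _ _] /h[]. Qed.

Lemma act0 K T : actions_on P K T -> ae_eq P (T 0) id.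
Proof. by case. Qed.

Lemma actD K T k l : actions_on P K T -> K k -> K l ->
  ae_eq P (T (k + l)) (T k \o T l).
Proof. by move=> [_ _ h _]; exact: h. Qed.

Lemma act_off K T k : actions_on P K T -> ~ K k -> T k = id.
Proof. by move=> [_ _ _ h]; exact: h. Qed.

Lemma restrE H T g : H g -> restr H T g = T g.
Proof. by rewrite /restr => /asboolP ->. Qed.

Lemma restrN H T g : ~ H g -> restr H T g = id.
Proof. by rewrite /restr => /asboolPn/negbTE ->. Qed.

(** Invertibility is a consequence of the group law, [T (- k)] being the inverse of [T k]. This is
    also why limits of actions are again actions. *)
Lemma actions_onI K T : is_subgroup K -> (forall k, K k -> mpt P (T k)) ->
  ae_eq P (T 0) id ->
  (forall k l, K k -> K l -> ae_eq P (T (k + l)) (T k \o T l)) ->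
  actions_on P K (restr K T).
Proof.
move=> sK mT T0 TD; split.
- move=> k Kk; rewrite restrE//; have Kn := subgroupN sK Kk.
  split; first exact: mT.
  exists (T (- k)); split; first exact: mT.
    by apply: aeq_trans T0; rewrite -(addNr k); apply: aeq_sym; exact: TD.
  by apply: aeq_trans T0; rewrite -(subrr k); apply: aeq_sym; exact: TD.
- by rewrite restrE//; exact: subgroup0.
- by move=> k l Kk Kl; rewrite !restrE//; [exact: TD|exact: subgroupD].
- by move=> k nK; rewrite restrN.
Qed.

Lemma restr_actions L K T : is_subgroup L -> L `<=` K -> actions_on P K T ->
  actions_on P L (restr L T).
Proof.
move=> sL LK aT; apply: actions_onI => //.
- by move=> k /LK; exact: act_mpt.
- exact: act0 aT.
- by move=> k l /LK Kk /LK Kl; exact: actD aT _ _.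
Qed.

(* [g j], [al], [b] identify [X] with [X * J] so that each [B] in [Bs] is a product set
   [B * J]; on the copy [t] the element [a] acts by [T (c a t)] and moves the copy to [tau a t]. *)
Lemma skew_of_copies K L T (J : finType) (j0 : J) (tau : G -> J -> J) (c : G -> J -> G)
    (g : J -> X -> X) (al : X -> X) (b : X -> J) (Bs : seq (set X)) :
  is_subgroup K -> is_subgroup L -> actions_on P L T ->
  (forall a b t, K a -> K b -> tau (a + b) t = tau a (tau b t)) ->
  (forall t, tau 0 t = t) ->
  (forall a t, K a -> L (c a t)) ->
  (forall a b t, K a -> K b -> c (a + b) t = c a (tau b t) + c b t) ->
  is_copies P g al b ->
  (forall B, B \in Bs -> measurable B) ->
  (forall B, B \in Bs -> \forall x \ae P, B (al x) <-> B x) ->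
  exists S : G -> X -> X,
  [/\ actions_on P K S,
      forall a B C, K a -> B \in Bs -> C \in Bs ->
        #|J|%:R * dm (S a @^-1` B) C = \sum_t dm (T (c a t) @^-1` B) C
    & forall a, K a -> \forall x \ae P, b (S a x) = tau a (b x)].
Proof.
move=> sK sL aT tauD tau0 cL cD [[mg mal] mb gx ax hP] mBs hBs.
have J0 : #|J|%:R != 0 :> R by rewrite pnatr_eq0 -lt0n; apply/card_gt0P; exists j0.
have mpal : mpt P al.
  split=> // A mA; have mpA : measurable (al @^-1` A) by exact: mpre.
  rewrite !PrE//; congr EFin; apply: (mulfI J0).
  rewrite (Pr_fibers P mb mpA) mulr_sumr (eq_bigr (fun=> Pr A)).
    by rewrite sumr_const mulr_natl.
  by move=> j _; rewrite setIC hP.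
pose S k x := g (tau k (b x)) (T (c k (b x)) (al x)).
have mTc k j : K k -> mpt P (T (c k j)) by move=> Kk; apply: (act_mpt aT); exact: cL.
have mS k : K k -> measurable_fun setT (S k).
  move=> Kk; apply: (measurable_glue (F := fun j x => g (tau k j) (T (c k j) (al x)))) => // j.
  apply: (measurableT_comp (mg _)); apply: measurableT_comp mal.
  exact: (mTc k j Kk).1.
have Sx k : K k -> \forall x \ae P, al (S k x) = T (c k (b x)) (al x) /\ b (S k x) = tau k (b x).
  move=> Kk.
  have : \forall x \ae P, forall j, forall i, al (g i (T (c k j) (al x))) = T (c k j) (al x) /\
       b (g i (T (c k j) (al x))) = i.
    apply: filter_forall => j.
    by have := mpt_ae (mpt_comp (mTc k j Kk) mpal) gx.
  by apply: filterS => x /(_ (b x) (tau k (b x))).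
have taub k : K k -> injective (tau k).
  move=> Kk i j /(congr1 (tau (- k))); rewrite -!tauD ?addNr ?tau0//; exact: subgroupN.
(* A measure is an average over the copies; since [tau k] permutes the copies, measure preservation
   of [S k] reduces to that of each [T (c k j)]. *)
have PS A : measurable A -> #|J|%:R * Pr A = \sum_j Pr (g j @^-1` A).
  move=> mA; rewrite (Pr_fibers P mb mA) mulr_sumr; apply: eq_bigr => j _.
  have mgA : measurable (g j @^-1` A) by exact: mpre.
  rewrite -(hP j _ mgA); congr (_ * _); apply: Pr_eq_ae.
  - exact: measurableI.
  - by apply: measurableI => //; exact: mpre.
  - by apply: filterS ax => x h /=; split=> [[? <-]|[<-]]; rewrite h.
have mptS k : K k -> mpt P (S k).
  move=> Kk; split; first exact: mS.
  move=> A mA; have mSA : measurable (S k @^-1` A) by apply: mpre => //; exact: mS.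
  rewrite !PrE//; congr EFin; apply: (mulfI J0); rewrite (PS A mA) (reindex_inj (taub k Kk)).
  rewrite (Pr_fibers P mb mSA) mulr_sumr; apply: eq_bigr => j _.
  have mgA : measurable (g (tau k j) @^-1` A) by exact: mpre.
  rewrite -(Pr_pre (mTc k j Kk) mgA) -(hP j _ (mpt_pre (mTc k j Kk) mgA)).
  congr (_ * Pr _); apply/seteqP; split=> x /=; first by move=> [h <-].
  by move=> [<- h].
have aS : actions_on P K (restr K S).
  apply: actions_onI => //.
    have c0 t : c 0 t = 0.
      have := cD 0 0 t (subgroup0 sK) (subgroup0 sK); rewrite addr0 tau0.
      by move/eqP; rewrite -subr_eq0 opprD addrA subrr sub0r oppr_eq0 => /eqP.
    have := mpt_ae mpal (act0 aT); apply: filterS2 ax => x h1 h2.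
    by rewrite /S c0 tau0 /= h2.
  move=> k l Kk Kl.
  have : \forall x \ae P, forall t, T (c k (tau l t) + c l t) (al x) =
       T (c k (tau l t)) (T (c l t) (al x)).
    apply: filter_forall => t; apply: (mpt_ae mpal (actD aT (cL _ (tau l t) Kk) (cL _ t Kl))).
  apply: filterS2 (Sx l Kl) => x [h1 h2] h3.
  by rewrite /S /= -/(S l x) h1 h2 -h3 -cD// tauD.
exists (restr K S); split=> //.
- move=> a B C Ka BB CB; rewrite restrE//.
  have mB := mBs _ BB; have mC := mBs _ CB.
  have mSB : measurable (S a @^-1` B) by apply: mpre => //; exact: mS.
  have mD := measurable_symdiff mSB mC.
  rewrite {1}/dm (Pr_fibers P mb mD) mulr_sumr; apply: eq_bigr => j _.
  have mTB : measurable (T (c a j) @^-1` B) by apply: mpt_pre => //; exact: mTc.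
  have mE := measurable_symdiff mTB mC.
  rewrite /dm -(hP j _ mE); congr (_ * _); apply: Pr_eq_ae.
  - exact: measurableI.
  - by apply: measurableI => //; exact: mpre.
  - have := mpt_ae (mptS a Ka) (hBs _ BB); have := hBs _ CB.
    apply: filterS3 (Sx a Ka) => x [h1 h2] hC hB.
    rewrite /symdiff /preimage /=; rewrite h1 in hB.
    by split=> -[]; [move=> h <-|move=> <- h]; tauto.
- by move=> a Ka; rewrite restrE//; apply: filterS (Sx a Ka) => x [].
Qed.

(** On the prescribed sets, distances of [S] are averages of distances of [T] along the cocycle [c];
    the density estimates rest on this formula. The copy number [b] remains as a finite factor of
    [S], independent of the prescribed sets. *)
Lemma skew_product K L T (J : finType) (j0 : J) (tau : G -> J -> J) (c : G -> J -> G)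
    (Bs : seq (set X)) :
  is_subgroup K -> is_subgroup L -> actions_on P L T ->
  (forall a b t, K a -> K b -> tau (a + b) t = tau a (tau b t)) ->
  (forall t, tau 0 t = t) ->
  (forall a t, K a -> L (c a t)) ->
  (forall a b t, K a -> K b -> c (a + b) t = c a (tau b t) + c b t) ->
  (forall B, B \in Bs -> measurable B) ->
  exists (S : G -> X -> X) (b : X -> J),
  [/\ actions_on P K S,
      forall a B C, K a -> B \in Bs -> C \in Bs ->
        #|J|%:R * dm (S a @^-1` B) C = \sum_t dm (T (c a t) @^-1` B) C,
      forall t, measurable (b @^-1` [set t]),
      forall t B, B \in Bs -> #|J|%:R * Pr (b @^-1` [set t] `&` B) = Pr B
    & forall a, K a -> \forall x \ae P, b (S a x) = tau a (b x)].
Proof.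
move=> sK sL aT tauD tau0 cL cD mBs.
have [g [al [b [hc hBs]]]] := copies_family HX HP j0 mBs.
have [S [aS h1 h2]] := skew_of_copies j0 sK sL aT tauD tau0 cL cD hc mBs hBs.
have [[mg mal] mb gx ax hP] := hc.
exists S, b; split=> //.
move=> t B BB; have mB := mBs _ BB; rewrite -(hP t B mB); congr (_ * _).
apply: Pr_eq_ae; try exact: measurableI.
  by apply: measurableI => //; exact: mpre.
by apply: filterS (hBs _ BB) => x h /=; tauto.
Qed.

End skew_products.

(** * Completeness of the measure algebra and of the space of transformations *)

Section completeness.
Context (R : realType) (d : measure_display) (X : measurableType d)
  (P : probability X R) (HX : standard_borel R X).
Implicit Types (A B C : set X).
Local Notation Pr := (Pr P).
Local Notation dm := (dm P).

Definition dm_lim (As : (set X)^nat) (L : set X) :=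
  forall e : R, 0 < e -> exists N, forall i, (N <= i)%N -> dm (As i) L < e.

(** A subsequence with consecutive distances at most [2^-m] converges to its lower limit: a point on
    which the two differ lies in one of the later consecutive differences, whose measures sum to at
    most [2 * 2^-m]. *)
Lemma dm_cauchy_lim (As : (set X)^nat) : (forall i, measurable (As i)) ->
  (forall e : R, 0 < e -> exists N, forall i j, (N <= i)%N -> (N <= j)%N -> dm (As i) (As j) < e) ->
  exists2 L, measurable L & dm_lim As L.
Proof.
move=> mA cau.
have /choice[N hN] : forall m, exists N, forall i j, (N <= i)%N -> (N <= j)%N ->
    dm (As i) (As j) < (2^-1 : R) ^+ m.
  by move=> m; apply: cau; rewrite exprn_gt0.
pose phi m := (\max_(k < m.+1) N k)%N.
have phiN m k : (k <= m)%N -> (N k <= phi m)%N.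
  by move=> km; apply: (leq_bigmax (Ordinal (_ : (k < m.+1)%N))).
pose B m := As (phi m).
have mB m : measurable (B m) by exact: mA.
have BB m : dm (B m) (B m.+1) <= (2^-1 : R) ^+ m.
  by apply/ltW/hN; apply: phiN.
pose L := \bigcup_M \bigcap_(m in [set m | (M <= m)%N]) B m.
have mL : measurable L.
  by apply: bigcup_measurable => M _; apply: bigcap_measurable => //; exists M => /=.
exists L => //.
have sub M : symdiff (B M) L `<=` \bigcup_k symdiff (B (M + k)%N) (B (M + k).+1).
  move=> x hx; apply: contrapT => nx.
  have same k : B (M + k)%N x <-> B M x.
    elim: k => [|k ih]; first by rewrite addn0.
    rewrite -ih addnS; split=> h; apply: contrapT => h'; apply: nx; exists k => //.
      by right.
    by left.
  have samem m : (M <= m)%N -> B m x <-> B M x.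
    by move=> /subnKC <-; exact: same.
  case: hx => [[BM nL]|[[K _ hK] nBM]].
    by apply: nL; exists M => // m /= Mm; apply/samem.
  apply: nBM; apply/(samem (maxn M K)); first exact: leq_maxl.
  by apply: hK; exact: leq_maxr.
have dBL M : dm (B M) L <= 2 * (2^-1 : R) ^+ M.
  pose U n := \bigcup_(k in [set k | (k < n)%N]) symdiff (B (M + k)%N) (B (M + k).+1).
  have mS k : measurable (symdiff (B (M + k)%N) (B (M + k).+1)) by exact: measurable_symdiff.
  have mU n : measurable (U n) by apply: bigcup_measurable.
  have PU n : Pr (U n) <= 2 * (2^-1) ^+ M - 2 * (2^-1) ^+ (M + n).
    elim: n => [|n ih].
      rewrite (_ : U 0%N = set0) ?Pr0 ?addn0 ?subrr//.
      by apply/seteqP; split => x // [].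
    have US : U n.+1 `<=` U n `|` symdiff (B (M + n)%N) (B (M + n).+1).
      move=> x [k /=]; rewrite ltnS leq_eqVlt => /orP[/eqP ->|]; first by right.
      by left; exists k.
    have h1 := Pr_le P (mU n.+1) (measurableU _ _ (mU n) (mS n)) US.
    have h2 := PrU_le P (mU n) (mS n).
    have h3 : Pr (symdiff (B (M + n)%N) (B (M + n).+1)) <= (2^-1) ^+ (M + n) := BB (M + n)%N.
    by rewrite addnS exprS; lra.
  apply/ler_addgt0Pl => e e0.
  have [|n hn] := Pr_cvg_up P e0 mU.
    by move=> n m nm x [k /= kn ?]; exists k => //=; exact: leq_trans nm.
  have UE : \bigcup_n U n = \bigcup_k symdiff (B (M + k)%N) (B (M + k).+1).
    apply/seteqP; split=> [x [n' _ [i _ Fi]]|x [i _ Fi]]; first by exists i.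
    by exists i.+1 => //; exists i => /=.
  rewrite UE in hn.
  have h1 : dm (B M) L <= Pr (\bigcup_k symdiff (B (M + k)%N) (B (M + k).+1)).
    by apply: Pr_le => //; [exact: measurable_symdiff|exact: bigcup_measurable].
  have := PU n; have : 0 <= (2^-1 : R) ^+ (M + n) by rewrite exprn_ge0.
  by move: hn h1; lra.
move=> e e0.
have [m hm] : exists m, 3 * (2^-1 : R) ^+ m < e.
  have e3 : 0 < e / 3 by rewrite divr_gt0.
  pose m := (Num.truncn (e / 3)^-1).+1; exists m.
  have h : (e / 3)^-1 < 2%:R ^+ m :> R.
    apply: (lt_trans (truncnS_gt _)); rewrite -natrX ltr_nat; exact: ltn_expl.
  suff : (2^-1 : R) ^+ m < e / 3 by lra.
  by rewrite exprVn -[ltRHS]invrK ltf_pV2 ?posrE ?invr_gt0 ?exprn_gt0.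
exists (phi m) => i im; apply: le_lt_trans (dm_tri P (mA i) (mB m) mL) _.
have h1 : dm (As i) (B m) < 2^-1 ^+ m.
  by apply: hN; [apply: leq_trans im|]; apply: phiN.
by have := dBL m; lra.
Qed.

Lemma dm_lim_Pr (As : (set X)^nat) L (p : R) : (forall i, measurable (As i)) -> measurable L ->
  dm_lim As L -> (forall i, Pr (As i) = p) -> Pr L = p.
Proof.
move=> mA mL h hp; apply/eqP; rewrite eq_le; apply/andP; split; apply/ler_addgt0Pl => e e0;
  have [N /(_ N (leqnn N)) hN] := h _ e0; rewrite -?(hp N).
  by rewrite addrC; apply: le_trans (Pr_dm P mL (mA N)) _; rewrite lerD2l dmC ltW.
by rewrite addrC; apply: le_trans (Pr_dm P (mA N) mL) _; rewrite lerD2l ltW.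
Qed.

Lemma dm_limC (As : (set X)^nat) L : dm_lim As L -> dm_lim (fun i => ~` As i) (~` L).
Proof. by move=> h e /h[N hN]; exists N => i /hN; rewrite dm_setC. Qed.

Lemma dm_limU (As Bs : (set X)^nat) L M : (forall i, measurable (As i)) ->
  (forall i, measurable (Bs i)) -> measurable L -> measurable M ->
  dm_lim As L -> dm_lim Bs M -> dm_lim (fun i => As i `|` Bs i) (L `|` M).
Proof.
move=> mA mB mL mM hA hB e e0; have e2 : 0 < e / 2 by rewrite divr_gt0.
have [N hN] := hA _ e2; have [N' hN'] := hB _ e2; exists (maxn N N') => i.
rewrite geq_max => /andP[/hN h1 /hN' h2].
by apply: le_lt_trans (dm_setU P (mA i) (mB i) mL mM) _; lra.
Qed.

Lemma dm_lim0 : dm_lim (fun=> set0) set0.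
Proof. by move=> e e0; exists 0%N => i _; rewrite dmxx. Qed.

(** The limits [L q] of the preimages of rational rays determine a real function [r], the infimum of
    the [q] with [x] in [L q]. It has the law of [f], so almost all its values are in the range of
    [f], and the inverse of [f] turns it into a map of [X]. *)
Lemma mpt_limit (T : nat -> X -> X) : (forall i, mpt P (T i)) ->
  (forall A, measurable A -> forall e : R, 0 < e -> exists N, forall i j,
     (N <= i)%N -> (N <= j)%N -> dm (T i @^-1` A) (T j @^-1` A) < e) ->
  exists2 S, mpt P S & forall A, measurable A -> dm_lim (fun i => T i @^-1` A) (S @^-1` A).
Proof.
move=> mT cau; have [f [mf inj fimg]] := HX.
pose F (q : rat) := f @^-1` `]-oo, ratr q[%classic.
have mF q : measurable (F q) by apply: mpreR.
have mTF i A : measurable A -> measurable (T i @^-1` A) by exact: mpt_pre.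
have /choice[L hL] : forall q, exists L, measurable L /\ dm_lim (fun i => T i @^-1` F q) L.
  move=> q; have [||L] := @dm_cauchy_lim (fun i => T i @^-1` F q); last by exists L.
    by move=> i; exact: mTF.
  exact: cau.
have mL q : measurable (L q) by case: (hL q).
have lL q : dm_lim (fun i => T i @^-1` F q) (L q) by case: (hL q).
have PL q : Pr (L q) = Pr (F q).
  by apply: (dm_lim_Pr _ (mL q) (lL q)) => i; [exact: mTF|exact: Pr_pre].
(* Enumerating the rationals turns a union over a set of rationals into an increasing union of
   finite unions. *)
pose sel (D : set rat) (W : rat -> set X) n : set X :=
  if unpickle n is Some q then (if `[< D q >] then W q else set0) else set0.
have msel D W n : (forall q, measurable (W q)) -> measurable (sel D W n).
  by move=> mW; rewrite /sel; case: (unpickle n) => // q; case: ifP.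
have selE D W : \bigcup_n sel D W n = \bigcup_(q in D) W q.
  apply/seteqP; split=> x.
    move=> [n _]; rewrite /sel; case: (unpickle n) => // q; case: ifP => // /asboolP.
    by exists q.
  move=> [q Dq Wq]; exists (pickle q); first exact: I.
  by rewrite /sel pickleK asboolT.
(* Finite unions commute with [dm_lim], so their measures are correct; continuity from below carries
   this to infinite unions. *)
have PU D : Pr (\bigcup_(q in D) L q) = Pr (\bigcup_(q in D) F q).
  pose U W n := \bigcup_(k in [set k | (k < n)%N]) sel D W k.
  have US W n : U W n.+1 = U W n `|` sel D W n.
    apply/seteqP; split=> x.
      move=> [i /=]; rewrite ltnS leq_eqVlt => /orP[/eqP ->|]; first by right.
      by left; exists i.
    move=> [[i /= ni Fi]|Fn]; first by exists i => //=; rewrite ltnS ltnW.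
    by exists n => /=.
  have U0 W : U W 0%N = set0 by apply/seteqP; split => x // [].
  have mU W n : (forall q, measurable (W q)) -> measurable (U W n).
    by move=> mW; apply: bigcup_measurable => k _; exact: msel.
  have UU W : \bigcup_n U W n = \bigcup_(q in D) W q.
    rewrite -selE; apply/seteqP; split=> [x [n' _ [i _ Fi]]|x [i _ Fi]]; first by exists i.
    by exists i.+1 => //; exists i => /=.
  have lU n : dm_lim (fun i => T i @^-1` U F n) (U L n).
    elim: n => [|n ih].
      have -> : (fun i => T i @^-1` U F 0%N) = fun=> set0 by apply/funext => i; rewrite U0 preimage_set0.
      by rewrite U0; exact: dm_lim0.
    have -> : (fun i => T i @^-1` U F n.+1) = fun i => T i @^-1` U F n `|` T i @^-1` sel D F n.
      by apply/funext => i; rewrite US preimage_setU.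
    rewrite US.
    apply: dm_limU => //; try by move=> i; apply: mTF; (exact: mU || exact: msel).
    - exact: mU.
    - exact: msel.
    - rewrite /sel; case: (unpickle n) => [q|]; last exact: dm_lim0.
      by case: ifP => // _; exact: dm_lim0.
  have PUn n : Pr (U L n) = Pr (U F n).
    apply: (dm_lim_Pr _ _ (lU n)) => [i||i]; [by apply: mTF; exact: mU|exact: mU|].
    by apply: Pr_pre => //; exact: mU.
  have nd W n m : (n <= m)%N -> U W n `<=` U W m.
    by move=> nm x [k /= kn ?]; exists k => //=; exact: leq_trans nm.
  have le W W' : (forall q, measurable (W q)) -> (forall q, measurable (W' q)) ->
      (forall n, Pr (U W n) = Pr (U W' n)) ->
      Pr (\bigcup_(q in D) W q) <= Pr (\bigcup_(q in D) W' q).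
    move=> mW mW' h; rewrite -!UU; apply/ler_addgt0Pl => e e0.
    have [n hn] := Pr_cvg_up P e0 (fun n => mU W n mW) (nd W).
    apply: (le_trans (ltW hn)); rewrite addrC lerD2l h.
    apply: Pr_le; [exact: mU|apply: bigcup_measurable => k _; exact: mU|].
    by move=> x ?; exists n.
  by apply/eqP; rewrite eq_le !le.
have mUL (D : set rat) (W : rat -> set X) : (forall q, measurable (W q)) -> measurable (\bigcup_(q in D) W q).
  by move=> mW; rewrite -(selE D W); apply: bigcup_measurable => n _; exact: msel.
pose r0 x := ereal_inf [set (ratr q : R)%:E | q in [set q | L q x]].
have r0lt x (s : R) : (r0 x < s%:E)%E <-> (\bigcup_(q in [set q | ratr q < s]) L q) x.
  split.
    by move=> /ereal_inf_lt[_ [q Lq <-]]; rewrite lte_fin => qs; exists q.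
  move=> [q /= qs Lq]; apply: (@le_lt_trans _ _ (ratr q)%:E); last by rewrite lte_fin.
  by apply: ereal_inf_lbound; exists q.
have mr0 : measurable_fun setT r0.
  apply: (measurability _ (ErealGenCInfty.measurableE R)) => //.
  move=> _ [_ [s ->] <-]; rewrite setTI.
  rewrite (_ : _ @^-1` _ = ~` (\bigcup_(q in [set q | ratr q < s]) L q)).
    by apply: measurableC; exact: mUL.
  apply/seteqP; split=> x /=; rewrite in_itv/= andbT.
    by move=> h /r0lt; rewrite ltNge h.
  by move=> h; rewrite leNgt; apply/negP => /r0lt.
pose r := fine \o r0.
have mr : measurable_fun setT r by apply: measurableT_comp.
have fin1 : \forall x \ae P, (\bigcup_(q in setT) L q) x.
  have : Pr (~` (\bigcup_(q in setT) L q)) = 0.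
    rewrite PrC ?PU; last exact: mUL.
    rewrite (_ : \bigcup_(q in _) _ = setT) ?PrT ?subrr//; apply/seteqP; split=> // x _.
    have [|q] := @rat_in_itvoo _ (f x) (f x + 1); first by lra.
    by rewrite in_itv/= => /andP[h _]; exists q => //; rewrite /F /= in_itv.
  move/(ae_Pr0 P) => /(_ _)/wrap[]; first by apply: measurableC; exact: mUL.
  by apply: filterS => x /contrapT.
have fin2 : \forall x \ae P, exists q, ~ L q x.
  have mI : measurable (\bigcap_q L q).
    rewrite -[X in measurable X]setCK setC_bigcap; apply: measurableC.
    by apply: mUL => q; exact: measurableC.
  have : Pr (\bigcap_q L q) = 0.
    apply/eqP; rewrite eq_le Pr_ge0 andbT; apply/ler_addgt0Pl => e e0; rewrite addr0.
    have [||n] := @Pr_cvg_down _ _ _ P (fun n => F (- n%:R)) _ e0.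
    - by move=> n; exact: mF.
    - move=> n m nm x; rewrite /F /= !in_itv/= => /lt_le_trans; apply.
      by rewrite ler_rat lerN2 ler_nat.
    rewrite (_ : \bigcap_k _ = set0) ?Pr0 ?add0r => [h|].
      apply: le_trans (ltW h); rewrite -PL; apply: Pr_le => // x; exact.
    apply/seteqP; split=> x // h.
    have := h (Num.truncn `|f x|).+1 I; rewrite /F /= in_itv/= rmorphN/= ratr_nat.
    have := truncnS_gt `|f x|; have := ler_norm (- f x); rewrite normrN.
    by move=> h1 h2 h3; lra.
  move/(ae_Pr0 P mI); apply: filterS => x h; apply: contrapT => h'; apply: h => q _.
  by apply: contrapT => ?; apply: h'; exists q.
have Lmono q q' : q <= q' -> \forall x \ae P, L q x -> L q' x.
  move=> qq'; have mD : measurable (L q `\` L q') by exact: measurableD.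
  suff : Pr (L q `\` L q') = 0.
    by move/(ae_Pr0 P mD); apply: filterS => x h Lq; apply: contrapT => ?; exact: h.
  apply/eqP; rewrite eq_le Pr_ge0 andbT; apply/ler_addgt0Pl => e e0; rewrite addr0.
  have e2 : 0 < e / 2 by rewrite divr_gt0.
  have [N hN] := lL q _ e2; have [N' hN'] := lL q' _ e2.
  have {}hN := hN _ (leq_maxl N N'); have {}hN' := hN' _ (leq_maxr N N').
  set i := maxn N N' in hN hN'.
  have : Pr (L q `\` L q') <= dm (T i @^-1` F q) (L q) + dm (T i @^-1` F q') (L q').
    apply: Pr_leD_ae => //; try by apply: measurable_symdiff => //; exact: mTF.
    apply: aeW => x [Lq nLq'].
    have [Tq|Tq] := pselect ((T i @^-1` F q) x); last by left; right.
    right; left; split=> //; move: Tq; rewrite /F /= !in_itv/= => /lt_le_trans; apply.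
    by rewrite ler_rat.
  by lra.
have r0fin : \forall x \ae P, r0 x = (r x)%:E.
  have : \forall x \ae P, forall n, if (unpickle n : option (rat * rat)) is Some (q, q') then
      (q <= q' -> L q x -> L q' x) else True.
    apply: ae_foralln => n; case: (unpickle n) => [[q q']|]; last by apply: aeW => x.
    have [qq'|/negP qq'] := boolP (q <= q'); last by apply: aeW => x.
    by apply: filterS (Lmono _ _ qq') => x.
  apply: filterS3 fin1 fin2 => x [q1 _ Lq1] [q2 nL2] mono.
  have mono' q q' : q <= q' -> L q x -> L q' x.
    by have := mono (pickle (q, q')); rewrite pickleK.
  rewrite /r /= fineK// fin_numElt; apply/andP; split.
    apply: (@lt_le_trans _ _ (ratr q2)%:E); first by rewrite ltNyr.
    apply: le_ereal_inf_tmp => _ [q Lq <-]; rewrite lee_fin ler_rat leNgt; apply/negP => /ltW.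
    by move=> /mono'/(_ Lq).
  by apply: (@le_lt_trans _ _ (ratr q1)%:E); [apply: ereal_inf_lbound; exists q1|rewrite ltry].
have law s : Pr (r @^-1` `]-oo, s[%classic) = Pr (f @^-1` `]-oo, s[%classic).
  have mrs : measurable (r @^-1` `]-oo, s[%classic) by apply: mpreR.
  rewrite (@Pr_eq_ae _ _ _ P _ (\bigcup_(q in [set q | ratr q < s]) L q))//.
  - rewrite PU; congr Pr; apply/seteqP; split=> x.
      by move=> [q /= qs]; rewrite /F /= !in_itv/= => /lt_trans; apply.
    rewrite /= in_itv/= => /rat_in_itvoo[q]; rewrite in_itv/= => /andP[q1 q2].
    by exists q => //; rewrite /F /= in_itv.
  - exact: mUL.
  - apply: filterS r0fin => x hx; rewrite /= in_itv/=.
    by rewrite -lte_fin -hx; exact: r0lt.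
have lawJ : forall J : set R, measurable J -> Pr (r @^-1` J) = Pr (f @^-1` J).
  have := @law_unique _ _ _ P setT setT r f 1 1 measurableT measurableT mr mf erefl.
  move=> /(_ _)/wrap[]; first by move=> s; rewrite !setTI law.
  by move=> h J /h; rewrite !setTI !mul1r.
have [g mg gf] := range_inverse P inj fimg.
have rf : \forall x \ae P, f (g (r x)) = r x.
  have mrg : measurable (range f) by apply: fimg.
  have : Pr (r @^-1` (~` range f)) = 0.
    rewrite lawJ; last exact: measurableC.
    rewrite (_ : _ @^-1` _ = set0) ?Pr0//; apply/seteqP; split=> x //=.
    by apply; exists x.
  move/(ae_Pr0 P) => /(_ _)/wrap[]; first by apply: mpreR => //; exact: measurableC.
  by apply: filterS => x /contrapT[y _ fy]; rewrite -fy gf.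
have mS : measurable_fun setT (g \o r) by exact: measurableT_comp.
have mptS : mpt P (g \o r).
  split=> // A mA; have mgA : measurable (f @` A) by exact: fimg.
  rewrite !PrE//; last exact: mpre.
  congr EFin; transitivity (Pr (r @^-1` (f @` A))).
    apply: Pr_eq_ae; [exact: mpre|exact: mpreR|].
    apply: filterS rf => x hx /=; split; first by exists (g (r x)).
    by move=> [y Ay fy]; rewrite -fy gf.
  rewrite lawJ//; congr Pr; apply/seteqP; split=> x /=; last by exists x.
  by move=> [y Ay /inj <-].
exists (g \o r) => //.
(* The sets on which convergence holds form an algebra containing the rational rays, hence
   approximate every measurable set; distances are preserved by all the maps, so this is enough. *)
pose AA := [set A | measurable A /\ dm_lim (fun i => T i @^-1` A) ((g \o r) @^-1` A)].
have mAA A : AA A -> measurable A by case.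
have AAC A : AA A -> AA (~` A).
  by move=> [mA h]; split; [exact: measurableC|exact: dm_limC].
have AAU A B : AA A -> AA B -> AA (A `|` B).
  move=> [mA hA] [mB hB]; split; first exact: measurableU.
  by apply: dm_limU => //; try (move=> i; exact: mTF); exact: mpre.
have AA0 : AA set0 by split=> //; exact: dm_lim0.
have AAray q : AA (F q).
  split=> //.
  have mSF : measurable ((g \o r) @^-1` F q) by exact: mpre.
  suff z : dm (L q) ((g \o r) @^-1` F q) = 0.
    move=> e /(lL q)[N hN]; exists N => i /hN.
    by apply: le_lt_trans; apply: le_trans (dm_tri P (mTF i _ (mF q)) (mL q) mSF) _; rewrite z addr0.
  have sub : \forall x \ae P, ((g \o r) @^-1` F q) x -> L q x.
    have : \forall x \ae P, forall n, if (unpickle n : option rat) is Some q' then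
      (q' <= q -> L q' x -> L q x) else True.
      apply: ae_foralln => n; case: (unpickle n) => [q'|]; last by apply: aeW => x.
      have [qq'|/negP qq'] := boolP (q' <= q); last by apply: aeW => x.
      by apply: filterS (Lmono _ _ qq') => x.
    apply: filterS3 rf r0fin => x h1 h2 h3; rewrite /F /= in_itv/= h1 => h4.
    have /r0lt[q' /= qq' Lq'] : (r0 x < (ratr q)%:E)%E by rewrite h2 lte_fin.
    by have := h3 (pickle q'); rewrite pickleK; apply=> //; rewrite -(ler_rat R) ltW.
  rewrite /dm.
  have mD1 : measurable (L q `\` ((g \o r) @^-1` F q)) by exact: measurableD.
  rewrite (@Pr_eq_ae _ _ _ P _ (L q `\` ((g \o r) @^-1` F q)))//; last 2 first.
  - exact: measurable_symdiff.
  - by apply: filterS sub => x h; rewrite /symdiff; split=> [[//|[/h Lq nL]]|?]; [|left].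
  have := PL q; rewrite -(Pr_pre mptS (mF q)).
  have -> : Pr (L q) = Pr ((g \o r) @^-1` F q) + Pr (L q `\` ((g \o r) @^-1` F q)).
    rewrite -PrU//; last by apply/seteqP; split=> x // [? []].
    apply: Pr_eq_ae => //; first exact: measurableU.
    apply: filterS sub => x h; split; last by move=> [/h|[]].
    by move=> Lq; have [?|?] := pselect (((g \o r) @^-1` F q) x); [left|right].
  lra.
have appr A : measurable A -> approximable P AA A.
  move=> mA; have [|mA' hA'] := @approximable_preimage _ _ _ P AA mAA AAC AAU AA0 f _ _ (fimg _ mA).
    move=> s; rewrite (_ : _ @^-1` _ = \bigcup_n sel [set q | ratr q < s] F n).
      apply: approximable_bigcup => // n; apply: approximable_in => //.
      by rewrite /sel; case: (unpickle n) => // q; case: ifP.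
    rewrite selE; apply/seteqP; split=> x; last first.
      by move=> [q /= qs]; rewrite /F /= !in_itv/= => /lt_trans; apply.
    rewrite /= in_itv/= => /rat_in_itvoo[q]; rewrite in_itv/= => /andP[q1 q2].
    by exists q => //; rewrite /F /= in_itv.
  suff <- : f @^-1` (f @` A) = A by [].
  by apply/seteqP; split=> x /= => [[y Ay /inj <-]|Ax]//; exists x.
move=> A mA e e0; have e4 : 0 < e / 3 by rewrite divr_gt0.
have [B [mB hB] AB] := (appr A mA).2 _ e4; have [N hN] := hB _ e4.
exists N => i /hN h.
have h1 := dm_pre (mT i) mA mB; have h2 := dm_pre mptS mA mB.
apply: le_lt_trans (dm_tri P (mTF i _ mA) (mTF i _ mB) (mpt_pre mptS mA)) _.
have := dm_tri P (mTF i _ mB) (mpt_pre mptS mB) (mpt_pre mptS mA).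
rewrite h1 (dmC P ((g \o r) @^-1` B) ((g \o r) @^-1` A)) h2; lra.
Qed.

End completeness.

(** * Adjoining finitely many elements to a subgroup *)

Section adjunction.
Context (G : zmodType).
Implicit Types (H K L : set G) (g h a b : G).

Lemma subgroupMz K a (i : int) : is_subgroup K -> K a -> K (a *~ i).
Proof.
move=> sK Ka; have hn (n : nat) : K (a *+ n).
  elim: n => [|n ih]; first by rewrite mulr0n; exact: subgroup0.
  by rewrite mulrS; exact: subgroupD.
by case: i => n; [rewrite -pmulrn|rewrite NegzE mulrNz; apply: subgroupN => //; rewrite -pmulrn].
Qed.

Definition adjoin H g : set G := [set a | exists k (i : int), H k /\ a = k + g *~ i].

Lemma adjoin_subgroup H g : is_subgroup H -> is_subgroup (adjoin H g).
Proof.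
move=> sH; split; first by exists 0, 0; rewrite mulr0z addr0; split=> //; exact: subgroup0.
move=> _ _ [k [i [Hk ->]]] [l [j [Hl ->]]]; exists (k - l), (i - j).
by split; [exact: subgroupB|rewrite mulrzBr opprD addrACA].
Qed.

Lemma sub_adjoin H g : H `<=` adjoin H g.
Proof. by move=> k Hk; exists k, 0; rewrite mulr0z addr0. Qed.

Lemma adjoin_gen H g : is_subgroup H -> adjoin H g g.
Proof. by move=> sH; exists 0, 1; rewrite add0r; split=> //; exact: subgroup0. Qed.

Lemma adjoin_min H K g : is_subgroup K -> H `<=` K -> K g -> adjoin H g `<=` K.
Proof.
move=> sK HK Kg _ [k [i [/HK Kk ->]]]; apply: subgroupD => //; exact: subgroupMz.
Qed.

Fixpoint adjoins H (l : seq G) : set G :=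
  if l is g :: l' then adjoin (adjoins H l') g else H.

Lemma adjoins_subgroup H l : is_subgroup H -> is_subgroup (adjoins H l).
Proof. by move=> sH; elim: l => //= g l ih; exact: adjoin_subgroup. Qed.

Lemma sub_adjoins H l : H `<=` adjoins H l.
Proof. by elim: l => [|g l ih] //= a /ih; exact: sub_adjoin. Qed.

Lemma adjoins_gen H l g : is_subgroup H -> g \in l -> adjoins H l g.
Proof.
move=> sH; elim: l => //= h l ih; rewrite inE => /orP[/eqP ->|/ih].
  by apply: adjoin_gen; exact: adjoins_subgroup.
exact: sub_adjoin.
Qed.

Lemma adjoins_min H K l : is_subgroup K -> H `<=` K -> (forall g, g \in l -> K g) ->
  adjoins H l `<=` K.
Proof.
move=> sK HK; elim: l => //= g l ih lK; apply: adjoin_min => //.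
  by apply: ih => h hl; apply: lK; rewrite inE hl orbT.
by apply: lK; rewrite inE eqxx.
Qed.

(** The order of [g] modulo [H], with the value 0 for infinite order: divisibility by 0 then says
    that the multiple is 0. *)
Lemma order_mod H g : is_subgroup H ->
  exists n : nat, forall i : int, H (g *~ i) <-> (n%:Z %| i)%Z.
Proof.
move=> sH; have [h|h] := pselect (exists n : nat, (0 < n)%N /\ H (g *+ n)); last first.
  exists 0%N => i; split; last by rewrite dvd0z => /eqP ->; rewrite mulr0z; exact: subgroup0.
  rewrite dvd0z => Hi; apply/eqP; apply: contrapT => i0; apply: h.
  exists `|i|%N; split; first by rewrite absz_gt0; apply/eqP.
  case: (intP i) Hi i0 => [|n|n] //.
  rewrite mulrNz => /(subgroupN sH); rewrite opprK abszN absz_nat -pmulrn//.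
have {}h : exists n, [&& (0 < n)%N & `[< H (g *+ n) >]].
  by case: h => n [n0 Hn]; exists n; rewrite n0; apply/asboolP.
case: (ex_minnP h) => n /andP[n0 /asboolP Hn] nmin; exists n => i.
have Hnz j : H (g *~ (j * n%:Z)).
  by rewrite mulrC mulrzA; apply: subgroupMz => //; rewrite -pmulrn.
split=> [Hi|/dvdzP[j ->]]; last exact: Hnz.
have nz : n%:Z != 0 by rewrite eqz_nat -lt0n.
have Hr : H (g *~ (i %% n%:Z)%Z).
  have -> : (i %% n%:Z)%Z = i - (i %/ n%:Z)%Z * n%:Z by rewrite {2}(divz_eq i n%:Z) addrC addKr.
  by rewrite mulrzBr; apply: subgroupB.
have r0 := modz_ge0 i nz.
have [//|r1] := eqVneq (i %% n%:Z)%Z 0; first by move=> h0; apply/dvdz_mod0P.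
have rE : (i %% n%:Z)%Z = `|(i %% n%:Z)%Z|%N%:Z by rewrite gez0_abs.
have := nmin `|(i %% n%:Z)%Z|%N; rewrite absz_gt0 r1 /=.
move=> /(_ _)/wrap[]; first by apply/asboolP; rewrite pmulrn -rE.
by rewrite leqNgt -ltz_nat -rE ltz_pmod// ltz_nat.
Qed.

End adjunction.

Section pullback_actions.
Context (R : realType) (d : measure_display) (X : measurableType d) (P : probability X R).

Lemma pull_action (G G' : zmodType) (K : set G') (L : set G) (T : G -> X -> X) (r : G' -> G) :
  is_subgroup K -> actions_on P L T ->
  (forall a, K a -> L (r a)) -> (forall a b, K a -> K b -> r (a + b) = r a + r b) ->
  actions_on P K (restr K (T \o r)).
Proof.
move=> sK aT rL rD; apply: actions_onI => //.
- by move=> k Kk; apply: (act_mpt aT); exact: rL.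
- suff -> : (T \o r) 0 = T 0 by exact: act0 aT.
  rewrite /=; congr T; have := rD _ _ (subgroup0 sK) (subgroup0 sK).
  by rewrite addr0 => /eqP; rewrite -subr_eq0 opprD addrA subrr sub0r oppr_eq0 => /eqP.
- by move=> k l Kk Kl; rewrite /= rD//; apply: (actD aT); exact: rL.
Qed.

End pullback_actions.

(** * Letting a new generator act, and limits of actions *)

Section extension.
Context (R : realType) (d : measure_display) (X : measurableType d)
  (P : probability X R) (HX : standard_borel R X) (HP : atomless P).
Context (G : zmodType).
Implicit Types (A B C : set X) (K L H : set G) (S T : G -> X -> X).
Local Notation Pr := (Pr P).
Local Notation dm := (dm P).

(** The action induced from [L] to [K]: [s] is a transversal of the finite quotient, [tau] the
    permutation of the cosets, and [a + s t - s (tau a t)] the usual cocycle with values in [L]. *)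
Lemma tskew K L T (J : finType) (j0 : J) (s : J -> G) (Bs : seq (set X)) :
  is_subgroup K -> is_subgroup L -> L `<=` K -> actions_on P L T ->
  (forall t, K (s t)) -> (forall a, K a -> exists t, L (a - s t)) ->
  (forall t t', L (s t - s t') -> t = t') ->
  (forall B, B \in Bs -> measurable B) ->
  exists (S : G -> X -> X) (tau : G -> J -> J) (b : X -> J),
  [/\ actions_on P K S /\ (forall a t, K a -> L (a + s t - s (tau a t))),
      forall a B C, K a -> B \in Bs -> C \in Bs ->
        #|J|%:R * dm (S a @^-1` B) C =
        \sum_t dm (T (a + s t - s (tau a t)) @^-1` B) C,
      forall t, measurable (b @^-1` [set t]),
      forall t B, B \in Bs -> #|J|%:R * Pr (b @^-1` [set t] `&` B) = Pr B
    & forall a, K a -> \forall x \ae P, b (S a x) = tau a (b x)].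
Proof.
move=> sK sL LK aT Ks cover uniq mBs.
have /choice[tau' htau] : forall at_ : G * J, exists t', K at_.1 -> L (at_.1 + s at_.2 - s t').
  move=> [a t] /=; have [Ka|nKa] := pselect (K a); last by exists t.
  by have [t' ht] := cover _ (subgroupD sK Ka (Ks t)); exists t'.
pose tau a t := tau' (a, t).
have tauL a t : K a -> L (a + s t - s (tau a t)) by move=> Ka; exact: (htau (a, t)).
have tau_uniq a t t' : K a -> L (a + s t - s t') -> tau a t = t'.
  move=> Ka h; apply: uniq; have := subgroupB sL h (tauL a t Ka).
  by rewrite opprB addrC addrA addrNK.
pose c a t := a + s t - s (tau a t).
have cD a b t : c a (tau b t) + c b t = a + b + s t - s (tau a (tau b t)).
  rewrite /c addrC !addrA; congr (_ - _).
  by rewrite -[LHS]addrA [a + s _]addrC addrA addrNK addrC addrA.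
have tauD a b t : K a -> K b -> tau (a + b) t = tau a (tau b t).
  move=> Ka Kb; apply: tau_uniq; first exact: subgroupD.
  by rewrite -cD; apply: subgroupD => //; exact: tauL.
have tau0 t : tau 0 t = t.
  by apply: tau_uniq; [exact: subgroup0|rewrite add0r subrr; exact: subgroup0].
have [|S [b [h1 h2 h3 h4 h5]]] :=
  @skew_product _ _ _ _ HX HP _ K L T J j0 tau c Bs sK sL aT tauD tau0 tauL _ mBs.
  by move=> a b' t Ka Kb; rewrite cD /c tauD.
by exists S, tau, b.
Qed.

(** Here [g] is made to act approximately as [h]. In the case of finite order the coset
    representatives are multiples of [g - h], so the cocycle at [a] takes values [a + (h - g) *~ m],
    and distances of [S a] are averages over these translates. The bound [M] depends on [L], [g] and
    [Fs] only and is fixed before [T] and [h] are known. *)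
Lemma ext_step L g (Fs : seq G) : is_subgroup L -> exists M : nat,
  forall T h (Bs : seq (set X)), actions_on P L T -> L h ->
  (forall B, B \in Bs -> measurable B) ->
  exists S, [/\ actions_on P (adjoin L g) S,
    forall a B C, L a -> B \in Bs -> C \in Bs -> dm (S a @^-1` B) C = dm (T a @^-1` B) C
  & forall a B C (e : R), a \in Fs -> adjoin L g a -> B \in Bs -> C \in Bs ->
      (forall m : int, `|m| <= M%:Z -> L (a + (h - g) *~ m) ->
         dm (T (a + (h - g) *~ m) @^-1` B) C <= e) ->
      dm (S a @^-1` B) C <= e].
Proof.
move=> sL; have [n hn] := order_mod g sL; set K := adjoin L g.
have sK : is_subgroup K by exact: adjoin_subgroup.
have LK : L `<=` K by exact: sub_adjoin.
case: n hn => [|n] hn.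
  (* When [g] has infinite order modulo [L], sending [g] to [h] defines a retraction [r] of [K] onto
     [L], and [T] can simply be pulled back. *)
  have inj0 (i : int) : L (g *~ i) -> i = 0 by move=> /hn; rewrite dvd0z => /eqP.
  have /choice[ix hix] : forall a, exists i : int, K a -> L (a - g *~ i).
    move=> a; have [[k [i [Lk ->]]]|nKa] := pselect (K a); last by exists 0.
    by exists i => _; rewrite addrK.
  have ixu a i : K a -> L (a - g *~ i) -> ix a = i.
    move=> Ka h; apply/eqP; rewrite eq_sym -subr_eq0; apply/eqP/inj0.
    have := subgroupB sL (hix _ Ka) h.
    by rewrite opprB addrC addrA addrNK mulrzBr.
  exists (\max_(a <- Fs) `|ix a|)%N => T h Bs aT Lh mBs.
  pose r a := a + (h - g) *~ ix a.
  have rL a : K a -> L (r a).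
    move=> Ka; rewrite /r mulrzBl addrCA; apply: subgroupD => //; first exact: subgroupMz.
    exact: hix.
  have rD a b : K a -> K b -> r (a + b) = r a + r b.
    move=> Ka Kb; have -> : r (a + b) = a + b + (h - g) *~ (ix a + ix b).
      rewrite /r (ixu (a + b) (ix a + ix b))//; first exact: subgroupD.
      by rewrite mulrzDr opprD addrACA; apply: subgroupD => //; exact: hix.
    by rewrite /r mulrzDr addrACA.
  exists (restr K (T \o r)); split; first exact: pull_action sK aT rL rD.
    move=> a B C La _ _; have Ka := LK _ La; rewrite restrE//= /r (ixu _ 0) ?mulr0z ?addr0//.
    by rewrite subr0.
  move=> a B C e aF Ka _ _; rewrite restrE//=; apply; last exact: rL.
  by rewrite -abszE lez_nat; apply: leq_bigmax_seq.
(* The multiples that occur are differences of two indices below [n + 1]. *)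
exists n.+1 => T h Bs aT Lh mBs.
pose s (t : 'I_n.+1) := (g - h) *~ (t : nat)%:Z.
have Kg : K g by exact: adjoin_gen.
have Ks t : K (s t) by apply: subgroupMz => //; apply: subgroupB => //; exact: LK.
have nz : n.+1%:Z != 0 by [].
have Lhm i : L (h *~ i) by exact: subgroupMz.
have cover a : K a -> exists t, L (a - s t).
  move=> [k [i [Lk ->]]].
  have rl : (`|(i %% n.+1%:Z)%Z| < n.+1)%N.
    by rewrite -ltz_nat gez0_abs ?modz_ge0// ltz_pmod.
  exists (Ordinal rl); rewrite /s /= gez0_abs ?modz_ge0//.
  set j := (i %% n.+1%:Z)%Z.
  have -> : k + g *~ i - (g - h) *~ j = (k + h *~ j) + g *~ (i - j).
    by rewrite mulrzBl opprB mulrzBr addrACA.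
  apply: subgroupD => //; first exact: subgroupD.
  apply/hn; rewrite /j {1}(divz_eq i n.+1%:Z) addrK; exact: dvdz_mull.
have uniq t t' : L (s t - s t') -> t = t'.
  rewrite /s -mulrzBr mulrzBl => /(subgroupD sL)/(_ (Lhm (t%:Z - t'%:Z))).
  rewrite addrNK => /hn hd; apply/val_inj/eqP => /=.
  rewrite -eqz_nat -subr_eq0.
  have : `|t%:Z - t'%:Z| < n.+1%:Z.
    have := ltn_ord t; have := ltn_ord t'; rewrite -!ltz_nat => h1 h2.
    have p1 : 0 <= t%:Z by []. have p2 : 0 <= t'%:Z by [].
    by rewrite ltr_norml; apply/andP; split; lia.
  case/dvdzP: hd => q ->; rewrite normrM (ger0_norm (_ : 0 <= n.+1%:Z))// => hq.
  have : `|q| < 1 by rewrite -(ltr_pM2r (_ : 0 < n.+1%:Z))// mul1r.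
  by rewrite -[1]add0r ltzD1 normr_le0 => /eqP ->; rewrite mul0r.
have [S [tau [b [[aS tL] hS _ _ _]]]] := tskew ord0 sK sL LK aT Ks cover uniq mBs.
have n0 : 0 < n.+1%:R :> R by rewrite ltr0n.
exists S; split=> //.
  move=> a B C La BB CB; have := hS a B C (LK _ La) BB CB; rewrite card_ord.
  have tauid t : tau a t = t.
    apply/esym/uniq; have := tL a t (LK _ La); rewrite -addrA => /(subgroupD sL (subgroupN sL La)).
    by rewrite addKr.
  under eq_bigr do rewrite tauid addrK.
  rewrite sumr_const card_ord -[RHS]mulr_natl; apply: mulfI; exact: lt0r_neq0.
move=> a B C e aF Ka BB CB he; rewrite -(ler_pM2l n0).
have := hS a B C Ka BB CB; rewrite card_ord => ->.
rewrite (_ : n.+1%:R * e = \sum_(t < n.+1) e); last by rewrite sumr_const card_ord mulr_natl.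
apply: ler_sum => t _.
have E : a + s t - s (tau a t) = a + (h - g) *~ ((tau a t : nat)%:Z - (t : nat)%:Z).
  by rewrite /s -addrA -mulrzBr -(opprB g h) mulNrz -mulrNz opprB.
rewrite E; apply: he; last by rewrite -E; exact: tL.
have := ltn_ord t; have := ltn_ord (tau a t); rewrite -!ltz_nat => h1 h2.
have p1 : 0 <= t%:Z by []. have p2 : 0 <= (tau a t)%:Z by [].
by rewrite ler_norml; apply/andP; split; lia.
Qed.

(** The limit is taken separately for each element once it belongs to the acting subgroups; the
    group law passes to the limit and brings invertibility with it. *)
Lemma act_limit K (Ls : nat -> set G) (S : nat -> G -> X -> X) : is_subgroup K ->
  (forall i, actions_on P (Ls i) (S i)) ->
  (forall a, K a -> exists N, forall i, (N <= i)%N -> Ls i a) ->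
  (forall a A, K a -> measurable A -> forall e : R, 0 < e -> exists N, forall i j,
     (N <= i)%N -> (N <= j)%N -> dm (S i a @^-1` A) (S j a @^-1` A) < e) ->
  exists2 T, actions_on P K T &
    forall a A, K a -> measurable A -> dm_lim P (fun i => S i a @^-1` A) (T a @^-1` A).
Proof.
move=> sK aS hL cau.
have /choice[T hT] : forall a, exists t, K a -> mpt P t /\
    forall A, measurable A -> dm_lim P (fun i => S i a @^-1` A) (t @^-1` A).
  move=> a; have [Ka|nKa] := pselect (K a); last by exists id.
  have [N hN] := hL a Ka.
  have [||t mt ht] := @mpt_limit _ _ _ P HX (fun i => S (i + N)%N a).
  - by move=> i; apply: (act_mpt (aS _)); apply: hN; rewrite leq_addl.
  - move=> A mA e e0; have [M hM] := cau a A Ka mA e e0; exists M => i j iM jM.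
    by apply: hM; apply: (leq_trans _ (leq_addr _ _)).
  - exists t => _; split=> // A mA e e0; have [M hM] := ht A mA e e0.
    exists (M + N)%N => i iMN; have iN : (N <= i)%N by lia.
    by have := hM (i - N)%N; rewrite subnK//; apply; lia.
have mT a : K a -> mpt P (T a) by move=> /hT[].
have lT a A : K a -> measurable A -> dm_lim P (fun i => S i a @^-1` A) (T a @^-1` A).
  by move=> /hT[_]; apply.
have [f [mf inj fimg]] := HX.
have zero (x : R) : 0 <= x -> (forall e, 0 < e -> x <= e) -> x = 0.
  move=> x0 h; apply/eqP; rewrite eq_le x0 andbT; apply/ler_addgt0Pl => e e0.
  by rewrite addr0; exact: h.
exists (restr K T); last by move=> a A Ka mA; rewrite restrE//; exact: lT.
apply: actions_onI => //.
  have K0 := subgroup0 sK.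
  apply: (aeq_dm0 mf inj); [exact: (mT _ K0).1|exact: measurable_id|] => A mA.
  have mTA := mpt_pre (mT _ K0) mA.
  apply: zero => [|e e0]; first exact: dm_ge0.
  have [N hN] := lT 0 A K0 mA e e0; have [M hM] := hL 0 K0.
  have h1 := hN _ (leq_maxl N M); have L0 := hM _ (leq_maxr N M).
  have mS := act_mpt (aS (maxn N M)) L0; have mSA := mpt_pre mS mA.
  apply: le_trans (dm_tri P mTA mSA mA) _.
  by rewrite (ae_eq_dm0 mS (mpt_id P) (act0 (aS _)) mA) addr0 dmC ltW.
move=> a b Ka Kb; have Kab := subgroupD sK Ka Kb.
have mTab := mpt_comp (mT a Ka) (mT b Kb).
apply: (aeq_dm0 mf inj); [exact: (mT _ Kab).1|exact: mTab.1|] => A mA.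
apply: zero => [|e e0]; first exact: dm_ge0.
have e3 : 0 < e / 3 by rewrite divr_gt0.
have mTaA := mpt_pre (mT a Ka) mA.
have [N1 h1] := lT _ A Kab mA _ e3; have [N2 h2] := lT _ A Ka mA _ e3.
have [N3 h3] := lT _ _ Kb mTaA _ e3.
have [M1 l1] := hL _ Kab; have [M2 l2] := hL _ Ka; have [M3 l3] := hL _ Kb.
pose i := (N1 + N2 + N3 + M1 + M2 + M3)%N.
have {}h1 : dm (S i (a + b) @^-1` A) (T (a + b) @^-1` A) < e / 3 by apply: h1; rewrite /i; lia.
have {}h2 : dm (S i a @^-1` A) (T a @^-1` A) < e / 3 by apply: h2; rewrite /i; lia.
have {}h3 : dm (S i b @^-1` (T a @^-1` A)) (T b @^-1` (T a @^-1` A)) < e / 3.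
  by apply: h3; rewrite /i; lia.
have {}l1 : Ls i (a + b) by apply: l1; rewrite /i; lia.
have {}l2 : Ls i a by apply: l2; rewrite /i; lia.
have {}l3 : Ls i b by apply: l3; rewrite /i; lia.
have m1 := act_mpt (aS i) l1; have m2 := act_mpt (aS i) l2; have m3 := act_mpt (aS i) l3.
have z := ae_eq_dm0 m1 (mpt_comp m2 m3) (actD (aS i) l2 l3) mA.
have y1 := mpt_pre m1 mA; have y2 := mpt_pre m2 mA.
have y3 := mpt_pre m3 mTaA.
have y4 := mpt_pre (mpt_comp m2 m3) mA.
have y5 := mpt_pre mTab mA; have y6 := mpt_pre (mT _ Kab) mA.
have t1 := dm_tri P y6 y1 y5; have t2 := dm_tri P y1 y4 y5; have t3 := dm_tri P y4 y3 y5.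
have z2 : dm ((S i a \o S i b) @^-1` A) (S i b @^-1` (T a @^-1` A)) =
   dm (S i a @^-1` A) (T a @^-1` A) := dm_pre m3 y2 mTaA.
rewrite (dmC P (T (a + b) @^-1` A) (S i (a + b) @^-1` A)) in t1.
have h3' : dm (S i b @^-1` (T a @^-1` A)) ((T a \o T b) @^-1` A) < e / 3 by exact: h3.
lra.
Qed.

End extension.

(** * Homomorphisms defined on a subgroup *)

Section homs.
Context (G A : zmodType).
Implicit Types (H K L : set G) (g h a b : G).

Lemma hom_on0 K (psi : G -> A) : is_subgroup K ->
  (forall a b, K a -> K b -> psi (a + b) = psi a + psi b) -> psi 0 = 0.
Proof.
move=> sK h; have := h 0 0 (subgroup0 sK) (subgroup0 sK).
by rewrite addr0 => /eqP; rewrite -subr_eq0 opprD addrA subrr sub0r oppr_eq0 => /eqP.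
Qed.

Lemma hom_onN K (psi : G -> A) a : is_subgroup K ->
  (forall a b, K a -> K b -> psi (a + b) = psi a + psi b) -> K a -> psi (- a) = - psi a.
Proof.
move=> sK h Ka; apply/eqP; rewrite -subr_eq0 opprK -h//; last exact: subgroupN.
by rewrite addNr (hom_on0 sK h).
Qed.

Lemma hom_onMz K (psi : G -> A) a (i : int) : is_subgroup K ->
  (forall a b, K a -> K b -> psi (a + b) = psi a + psi b) -> K a -> psi (a *~ i) = psi a *~ i.
Proof.
move=> sK h Ka; have hn (n : nat) : psi (a *~ n) = psi a *~ n.
  elim: n => [|n ih]; first by rewrite !mulr0z (hom_on0 sK h).
  by rewrite -addn1 PoszD !mulrzDr h ?ih ?mulr1z//; exact: subgroupMz.
case: i => n; first exact: hn.
by rewrite NegzE !mulrNz (hom_onN sK h) ?hn//; exact: subgroupMz.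
Qed.

Lemma hom_adjoin L (psi : G -> A) g (y : A) : is_subgroup L ->
  (forall a b, L a -> L b -> psi (a + b) = psi a + psi b) ->
  (forall i : int, L (g *~ i) -> psi (g *~ i) = y *~ i) ->
  exists phi : G -> A, (forall k (i : int), L k -> phi (k + g *~ i) = psi k + y *~ i) /\
    forall a b, adjoin L g a -> adjoin L g b -> phi (a + b) = phi a + phi b.
Proof.
move=> sL hpsi hy.
have /choice[ki hki] : forall a, exists ki : G * int, adjoin L g a -> L ki.1 /\ a = ki.1 + g *~ ki.2.
  move=> a; have [[k [i [Lk ->]]]|no] := pselect (adjoin L g a); last by exists (0, 0).
  by exists (k, i).
pose phi a := psi (ki a).1 + y *~ (ki a).2.
have phiE k (i : int) : L k -> phi (k + g *~ i) = psi k + y *~ i.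
  move=> Lk; have ka : adjoin L g (k + g *~ i) by exists k, i.
  have := hki _ ka; rewrite /phi; move: (ki _) => [k' i'] /= [Lk' E].
  have E2 : g *~ (i - i') = k' - k.
    by apply/eqP; rewrite mulrzBr subr_eq addrAC -E addrAC subrr add0r.
  have := hy (i - i'); rewrite E2 => /(_ (subgroupB sL Lk' Lk)).
  rewrite hpsi//; last exact: subgroupN.
  rewrite (hom_onN sL hpsi)// mulrzBr => h.
  have -> : psi k' = y *~ i - y *~ i' + psi k by rewrite -h addrNK.
  by rewrite addrAC addrNK addrC.
exists phi; split=> // _ _ [k [i [Lk ->]]] [l [j [Ll ->]]].
rewrite addrACA -mulrzDr !phiE//; last exact: subgroupD.
by rewrite hpsi// mulrzDr addrACA.
Qed.

End homs.

(** * The perturbation principle: actions in which [h] imitates [g] *)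

Section keys.
Context (R : realType) (d : measure_display) (X : measurableType d)
  (P : probability X R) (HX : standard_borel R X) (HP : atomless P).
Context (G : zmodType) (enumG : nat -> G) (enumG_surj : forall g, exists i, enumG i = g).
Implicit Types (A B C : set X) (K L H : set G) (S T : G -> X -> X).
Local Notation Pr := (Pr P).
Local Notation dm := (dm P).

Lemma act_mpt_all K T k : actions_on P K T -> mpt P (T k).
Proof.
move=> aT; have [/(act_mpt aT)//|nK] := pselect (K k).
by rewrite (act_off aT nK); exact: mpt_id.
Qed.

Lemma act_pre K T k A : actions_on P K T -> measurable A -> measurable (T k @^-1` A).
Proof. by move=> aT; apply: mpt_pre; exact: act_mpt_all aT. Qed.

Lemma le0_eps (x : R) : 0 <= x -> (forall e, 0 < e -> x <= e) -> x = 0.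
Proof.
move=> x0 h; apply/eqP; rewrite eq_le x0 andbT; apply/ler_addgt0Pl => e e0.
by rewrite addr0; exact: h.
Qed.

(** Not an extension in the strict sense, as agreement is only required on the listed elements and
    sets. Elements of [K] are adjoined one at a time, and each stage is exact on more elements and
    on more sets of the dense sequence, which makes the stages converge. *)
Lemma extension K L T (Fs : seq G) (Bs : seq (set X)) :
  is_subgroup K -> is_subgroup L -> L `<=` K -> actions_on P L T ->
  (forall B, B \in Bs -> measurable B) ->
  exists2 S, actions_on P K S & forall a B, a \in Fs -> L a -> B \in Bs ->
    dm (S a @^-1` B) (T a @^-1` B) = 0.
Proof.
move=> sK sL LK aT mBs.
have [f [mf inj fimg]] := HX.
have [E [mE dE]] := dense_family P mf inj fimg.
pose g i := if `[< K (enumG i) >] then enumG i else 0.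
have Kg i : K (g i) by rewrite /g; case: asboolP => // _; exact: subgroup0.
pose Ls := fix F n := if n is n'.+1 then adjoin (F n') (g n') else L.
have sLs i : is_subgroup (Ls i) by elim: i => //= i ih; exact: adjoin_subgroup.
have LsS i j : (i <= j)%N -> Ls i `<=` Ls j.
  by move=> /subnK <-; elim: (j - i)%N => // k ih a /ih; exact: sub_adjoin.
pose Fl i := Fs ++ [seq enumG k | k <- iota 0 i].
pose Bl i := Bs ++ [seq E k | k <- iota 0 i].
have mBl i B : B \in Bl i -> measurable B.
  by rewrite mem_cat => /orP[/mBs//|/mapP[k _ ->]].
have /choice[step hstep] : forall iS : nat * (G -> X -> X), exists S',
    actions_on P (Ls iS.1) iS.2 -> actions_on P (Ls iS.1.+1) S' /\
    forall a B, a \in Fl iS.1 -> Ls iS.1 a -> B \in Bl iS.1 ->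
      dm (S' a @^-1` B) (iS.2 a @^-1` B) = 0.
  move=> [i S]; have [aS|] := pselect (actions_on P (Ls i) S); last by exists S.
  have [M hM] := ext_step HX HP (g i) [::] (sLs i).
  (* Once the preimages under [S a] are themselves among the controlled sets, preservation of
     distances by [ext_step] reads as distance 0 between the new and the old preimage. *)
  pose Bs' := Bl i ++ [seq S a @^-1` B | a <- Fl i, B <- Bl i].
  have [||S' [aS' h1 _]] := hM S 0 Bs' aS.
  - exact: subgroup0.
  - move=> B; rewrite mem_cat => /orP[/mBl//|/allpairsP[[a B'] /= [_ /mBl mB' ->]]].
    exact: act_pre aS mB'.
  exists S' => _; split=> // a B aF La BB; rewrite h1//.
  - by rewrite dmxx.
  - by rewrite mem_cat BB.
  - by rewrite mem_cat; apply/orP; right; apply/allpairsP; exists (a, B).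
pose Ss := fix F n := if n is n'.+1 then step (n', F n') else T.
have aSs i : actions_on P (Ls i) (Ss i).
  by elim: i => //= i ih; exact: (hstep (i, Ss i) ih).1.
have hSs i a B : a \in Fl i -> Ls i a -> B \in Bl i ->
    dm (Ss i.+1 a @^-1` B) (Ss i a @^-1` B) = 0.
  by move=> aF La BB; exact: (hstep (i, Ss i) (aSs i)).2.
have const N a B : (forall i, (N <= i)%N -> a \in Fl i /\ B \in Bl i) -> Ls N a ->
    forall i, (N <= i)%N -> dm (Ss i a @^-1` B) (Ss N a @^-1` B) = 0.
  move=> h La; have mB : measurable B by have [_ /mBl] := h N (leqnn N).
  move=> i /subnK <-; elim: (i - N)%N => [|k ih]; first by rewrite dmxx.
  apply/eqP; rewrite eq_le dm_ge0 andbT.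
  apply: le_trans (dm_tri P _ (act_pre a (aSs (k + N)%N) mB) _) _; try exact: act_pre (aSs _) mB.
  rewrite ih addr0 addSn hSs//; first by case: (h (k + N)%N (leq_addl _ _)).
    by apply: LsS La; exact: leq_addl.
  by case: (h (k + N)%N (leq_addl _ _)).
have inFl i k : (k < i)%N -> enumG k \in Fl i.
  by move=> ki; rewrite mem_cat; apply/orP; right; apply: map_f; rewrite mem_iota.
have inBl i k : (k < i)%N -> E k \in Bl i.
  by move=> ki; rewrite mem_cat; apply/orP; right; apply: map_f; rewrite mem_iota.
have [||S aS hS] := act_limit HX sK aSs.
- move=> a Ka; have [k ka] := enumG_surj a; exists k.+1 => i ki.
  apply: (LsS k.+1) => //=; have <- : g k = a by rewrite /g ka asboolT.
  exact: adjoin_gen.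
- move=> a A Ka mA e e0; have [k ka] := enumG_surj a.
  have e2 : 0 < e / 2 by rewrite divr_gt0.
  have [l hl] := dE A mA _ e2; pose N := maxn k.+1 l.+1.
  have La : Ls N a.
    apply: (LsS k.+1); first exact: leq_maxl.
    by have <- : g k = a; [rewrite /g ka asboolT|exact: adjoin_gen].
  have cN := @const N a (E l) _ La.
  have {}cN i : (N <= i)%N -> dm (Ss i a @^-1` E l) (Ss N a @^-1` E l) = 0.
    apply: cN => j; rewrite geq_max => /andP[h1 h2].
    by rewrite -ka inFl// inBl.
  have near i : (N <= i)%N -> dm (Ss i a @^-1` A) (Ss N a @^-1` E l) < e / 2.
    move=> Ni; apply: le_lt_trans (dm_tri P _ (act_pre a (aSs i) (mE l)) _) _;
      try exact: act_pre (aSs _) _.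
    by rewrite (cN i Ni) addr0 dm_pre//; exact: act_mpt_all (aSs i).
  exists N => i j Ni Nj.
  apply: le_lt_trans (dm_tri P _ (act_pre a (aSs N) (mE l)) _) _; try exact: act_pre (aSs _) _.
  by rewrite (dmC P (Ss N a @^-1` _)); have := near i Ni; have := near j Nj; lra.
exists S => // a B aF La BB; have mB := mBs _ BB.
apply: le0_eps => [|e e0]; first exact: dm_ge0.
have [N hN] := hS a B (LK _ La) mB e e0.
have h1 := hN N (leqnn N).
have h2 : dm (Ss N a @^-1` B) (T a @^-1` B) = 0.
  apply: (const 0%N) => // i _; split; rewrite mem_cat; apply/orP; by left.
apply: le_trans (dm_tri P _ (act_pre a (aSs N) mB) _) _.
- exact: act_pre aS mB.
- exact: act_pre aT mB.
- by rewrite h2 addr0 dmC ltW.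
Qed.

(* The hypothesis on [(h - g) *~ m] for all [|m| <= M] is what makes the later averaging over
   [M] translates by [h - g] possible. *)
Definition key H g := forall (Fs : seq G) (Bs : seq (set X)) (M : nat) (e : R) T,
  0 < e -> (forall B, B \in Bs -> measurable B) -> actions_on P (adjoin H g) T ->
  exists S h, [/\ H h, actions_on P (adjoin H g) S,
    forall a B C, a \in Fs -> adjoin H g a -> B \in Bs -> C \in Bs ->
      dm (S a @^-1` B) C <= dm (T a @^-1` B) C + e
  & forall (m : int) B, `|m| <= M%:Z -> B \in Bs -> dm (S ((h - g) *~ m) @^-1` B) B <= e].

Lemma subgroup_triv : is_subgroup [set (0 : G)].
Proof. by split=> // x y -> ->; rewrite subrr. Qed.

(* It suffices to build the perturbed action on a subgroup [L] of [adjoin H g] containing the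
   group elements that are being controlled. *)
Lemma key_local H g : is_subgroup H ->
  (forall (l : seq G) (Bs : seq (set X)) (M : nat) (e : R) T,
    0 < e -> (forall B, B \in Bs -> measurable B) ->
    (forall x, x \in l -> adjoin H g x) -> g \in l ->
    actions_on P (adjoins [set 0] l) T ->
    exists L S h, [/\ [/\ is_subgroup L, L `<=` adjoin H g, adjoins [set 0] l `<=` L & L h],
      H h, actions_on P L S,
      forall a B C, a \in l -> B \in Bs -> C \in Bs ->
        dm (S a @^-1` B) C <= dm (T a @^-1` B) C + e
    & forall (m : int) B, `|m| <= M%:Z -> B \in Bs -> dm (S ((h - g) *~ m) @^-1` B) B <= e]) ->
  key H g.
Proof.
move=> sH loc Fs Bs M e T e0 mBs aT; set K := adjoin H g.
have sK : is_subgroup K by exact: adjoin_subgroup.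
pose l := g :: [seq (if `[< K a >] then a else 0) | a <- Fs].
have lK x : x \in l -> K x.
  rewrite inE => /orP[/eqP ->|/mapP[a _ ->]]; first exact: adjoin_gen.
  by case: asboolP => // _; exact: subgroup0.
have gl : g \in l by rewrite inE eqxx.
have sG1 : is_subgroup (adjoins [set 0] l) by apply: adjoins_subgroup; exact: subgroup_triv.
have G1K : adjoins [set 0] l `<=` K.
  by apply: adjoins_min => // x ->; exact: subgroup0.
have [L [S [h [[sL LK G1L Lh] Hh aS h1 h2]]]] :=
  loc l Bs M e _ e0 mBs lK gl (restr_actions sG1 G1K aT).
have Lg : L g by apply: G1L; apply: adjoins_gen => //; exact: subgroup_triv.
pose ms := [seq (h - g) *~ (i%:Z - M%:Z) | i <- iota 0 (2 * M).+1].
have [S' aS' hS'] := extension (l ++ ms) sK sL LK aS mBs.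
exists S', h; split=> //.
  move=> a B C aF Ka BB CB.
  have al : a \in l by rewrite inE; apply/orP; right; apply/mapP; exists a => //; rewrite asboolT.
  have La : adjoins [set 0] l a by apply: adjoins_gen => //; exact: subgroup_triv.
  have := h1 a B C al BB CB; rewrite restrE//; apply: le_trans.
  apply: le_trans (dm_tri P _ (act_pre a aS (mBs _ BB)) (mBs _ CB)) _.
    exact: act_pre aS' (mBs _ BB).
  by rewrite hS' ?add0r// ?mem_cat ?al//; exact: G1L.
move=> m B mM BB; apply: le_trans (h2 m B mM BB).
have mms : (h - g) *~ m \in ms.
  apply/mapP; exists (absz (m + M%:Z)); first by rewrite mem_iota; lia.
  by congr (_ *~ _); move: mM; lia.
apply: le_trans (dm_tri P _ (act_pre ((h - g) *~ m) aS (mBs _ BB)) (mBs _ BB)) _.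
  exact: act_pre aS' (mBs _ BB).
rewrite hS' ?add0r// ?mem_cat ?mms ?orbT//.
by apply: subgroupMz => //; exact: subgroupB.
Qed.

(** The condition is precisely that some homomorphism from the group generated by [l] and [h] to the
    one generated by [l] fixes the latter and sends [h] to [g]. Pulling the action back along it
    makes [h] act exactly like [g]. *)
Lemma key_of_hom H g : is_subgroup H ->
  (forall l : seq G, (forall x, x \in l -> adjoin H g x) -> exists2 h, H h &
     forall i : int, adjoins [set 0] l (h *~ i) -> h *~ i = g *~ i) ->
  key H g.
Proof.
move=> sH hh; apply: key_local => // l Bs M e T e0 mBs lK gl aT.
have [h Hh hi] := hh l lK; set L := adjoins [set 0] l.
have sL : is_subgroup L by apply: adjoins_subgroup; exact: subgroup_triv.
have Lg : L g by apply: adjoins_gen => //; exact: subgroup_triv.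
have sK := adjoin_subgroup g sH; have sLh := adjoin_subgroup h sL.
have [//|r [rE rD]] := @hom_adjoin G G L id h g sL _ hi.
have rL a : adjoin L h a -> L (r a).
  by move=> [k [i [Lk ->]]]; rewrite rE//; apply: subgroupD => //; exact: subgroupMz.
have r_id a : L a -> r a = a by move=> La; have := rE a 0 La; rewrite !mulr0z !addr0.
exists (adjoin L h), (restr (adjoin L h) (T \o r)), h; split=> //.
- split=> //; last exact: adjoin_gen.
    apply: adjoin_min => //; last exact: sub_adjoin.
    by apply: adjoins_min => // x ->; exact: subgroup0.
  exact: sub_adjoin.
- exact: pull_action sLh aT rL rD.
- move=> a B C al BB CB; have La : L a by apply: adjoins_gen => //; exact: subgroup_triv.
  by rewrite restrE/= ?r_id ?lerDl ?ltW//; exact: sub_adjoin.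
- move=> m B mM BB.
  have Lhg : adjoin L h (h - g).
    by apply: subgroupB => //; [exact: adjoin_gen|exact: sub_adjoin].
  have r0 : r (h - g) = 0.
    have := rE (- g) 1 (subgroupN sL Lg); rewrite !mulr1z addNr addrC; exact.
  rewrite restrE/=; last exact: subgroupMz.
  rewrite (hom_onMz _ sLh rD)// r0 mul0rz.
  rewrite (ae_eq_dm0 (act_mpt_all 0 aT) (mpt_id P) (act0 aT)) ?ltW//; exact: mBs.
Qed.

Lemma sum_lt_ord (N k : nat) : (\sum_(t < N) (t < k)%N <= k)%N.
Proof.
suff -> : (\sum_(t < N) (t < k)%N = minn N k)%N by exact: geq_minr.
elim: N => [|N ih]; first by rewrite big_ord0 min0n.
by rewrite big_ord_recr/= ih; lia.
Qed.

(** A translation by [x] leaves the interval of length [N] at no more than [|x|] points, and there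
    the trivial bound 1 is used. *)
Lemma sum_shift_bound (N : nat) (F : 'I_N -> R) (x : int) (c : R) : 0 <= c ->
  (forall t, F t <= 1) -> (forall t : 'I_N, 0 <= (t : nat)%:Z + x < N%:Z -> F t <= c) ->
  \sum_t F t <= N%:R * c + `|x|%N%:R.
Proof.
move=> c0 F1 Fc.
pose bad (t : 'I_N) := ~~ (0 <= (t : nat)%:Z + x < N%:Z).
apply: (@le_trans _ _ (\sum_(t < N) (c + (bad t)%:R))).
  apply: ler_sum => t _; rewrite /bad; case: (boolP (0 <= _ < _)) => [/Fc|_] /=; first lra.
  by have := F1 t; lra.
rewrite big_split/= sumr_const card_ord mulr_natl lerD2l -natr_sum ler_nat.
have [x0|x0] := leP 0 x.
  rewrite (reindex_inj rev_ord_inj)/=; apply: leq_trans (sum_lt_ord N `|x|).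
  apply: leq_sum => t _; rewrite /bad /=; have := ltn_ord t.
  case: ltnP => h; case: (boolP (0 <= _ < _)) => //=; lia.
apply: leq_trans (sum_lt_ord N `|x|); apply: leq_sum => t _; rewrite /bad.
have := ltn_ord t; case: ltnP => h; case: (boolP (0 <= _ < _)) => //=; lia.
Qed.

Lemma archi_mul (M : nat) (e : R) : 0 < e -> exists n : nat, M%:R < n%:R * e.
Proof.
move=> e0; exists (Num.truncn (M%:R / e)).+1.
by rewrite -ltr_pdivrMr//; exact: truncnS_gt.
Qed.

(** With multiples of [h - g] as coset representatives, [h - g] moves each copy to the next one with
    trivial cocycle, except at the wrap-around. Thus [(h - g) *~ m] fails to be harmless on at most
    [|m|] copies, a small fraction when the order of [h] modulo the group of [l] is large. *)
Lemma key_of_large_orders H g : is_subgroup H ->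
  (forall l : seq G, (forall x, x \in l -> adjoin H g x) -> forall M : nat, exists2 h, H h &
     forall m, (0 < m <= M)%N -> ~ adjoins [set 0] l (h *+ m)) ->
  key H g.
Proof.
move=> sH hh; apply: key_local => // l Bs M e T e0 mBs lK gl aT.
have [n1 hn1] := archi_mul M e0.
have [h Hh hM] := hh l lK (maxn n1 M); set L := adjoins [set 0] l in hM *.
have sL : is_subgroup L by apply: adjoins_subgroup; exact: subgroup_triv.
have Lg : L g by apply: adjoins_gen => //; exact: subgroup_triv.
have sK := adjoin_subgroup g sH; have sLh := adjoin_subgroup h sL.
have LhK : adjoin L h `<=` adjoin H g.
  apply: adjoin_min => //; last exact: sub_adjoin.
  by apply: adjoins_min => // x ->; exact: subgroup0.
have LLh : L `<=` adjoin L h by exact: sub_adjoin.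
have Lhh : adjoin L h h by exact: adjoin_gen.
have [n hn] := order_mod h sL.
case: n hn => [|n] hn.
  have [//||r [rE rD]] := @hom_adjoin G G L id h g sL.
    by move=> i /hn; rewrite dvd0z => /eqP ->; rewrite !mulr0z.
  have rL a : adjoin L h a -> L (r a).
    by move=> [k [i [Lk ->]]]; rewrite rE//; apply: subgroupD => //; exact: subgroupMz.
  have r_id a : L a -> r a = a by move=> La; have := rE a 0 La; rewrite !mulr0z !addr0.
  exists (adjoin L h), (restr (adjoin L h) (T \o r)), h; split=> //.
  - exact: pull_action sLh aT rL rD.
  - move=> a B C al BB CB; have La : L a by apply: adjoins_gen => //; exact: subgroup_triv.
    by rewrite restrE/= ?r_id ?lerDl ?ltW//; exact: sub_adjoin.
  - move=> m B mM BB.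
    have Lhg : adjoin L h (h - g) by apply: subgroupB => //; exact: LLh.
    have r0 : r (h - g) = 0.
      have := rE (- g) 1 (subgroupN sL Lg); rewrite !mulr1z addNr addrC; exact.
    rewrite restrE/=; last exact: subgroupMz.
    rewrite (hom_onMz _ sLh rD)// r0 mul0rz.
    rewrite (ae_eq_dm0 (act_mpt_all 0 aT) (mpt_id P) (act0 aT)) ?ltW//; exact: mBs.
have nM : (maxn n1 M < n.+1)%N.
  rewrite ltnNge; apply/negP => h1; apply: (hM n.+1); first by rewrite ltn0Sn.
  by rewrite pmulrn; apply/hn.
pose s (t : 'I_n.+1) := (h - g) *~ (t : nat)%:Z.
have Lhg : adjoin L h (h - g) by apply: subgroupB => //; exact: LLh.
have Ks t : adjoin L h (s t) by exact: subgroupMz.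
have nz : n.+1%:Z != 0 by [].
have Lgm i : L (g *~ i) by exact: subgroupMz.
have cover a : adjoin L h a -> exists t, L (a - s t).
  move=> [k [i [Lk ->]]].
  have rl : (`|(i %% n.+1%:Z)%Z| < n.+1)%N.
    by rewrite -ltz_nat gez0_abs ?modz_ge0// ltz_pmod.
  exists (Ordinal rl); rewrite /s /= gez0_abs ?modz_ge0//.
  set j := (i %% n.+1%:Z)%Z.
  have -> : k + h *~ i - (h - g) *~ j = (k + g *~ j) + h *~ (i - j).
    by rewrite mulrzBl opprB mulrzBr addrACA.
  apply: subgroupD => //; first exact: subgroupD.
  apply/hn; rewrite /j {1}(divz_eq i n.+1%:Z) addrK; exact: dvdz_mull.
have uniq t t' : L (s t - s t') -> t = t'.
  rewrite /s -mulrzBr mulrzBl => /(subgroupD sL)/(_ (Lgm (t%:Z - t'%:Z))).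
  rewrite addrNK => /hn hd; apply/val_inj/eqP => /=.
  rewrite -eqz_nat -subr_eq0.
  have : `|t%:Z - t'%:Z| < n.+1%:Z.
    have := ltn_ord t; have := ltn_ord t'; rewrite -!ltz_nat => h1 h2.
    have p1 : 0 <= t%:Z by []. have p2 : 0 <= t'%:Z by [].
    by rewrite ltr_norml; apply/andP; split; lia.
  case/dvdzP: hd => q ->; rewrite normrM (ger0_norm (_ : 0 <= n.+1%:Z))// => hq.
  have : `|q| < 1 by rewrite -(ltr_pM2r (_ : 0 < n.+1%:Z))// mul1r.
  by rewrite -[1]add0r ltzD1 normr_le0 => /eqP ->; rewrite mul0r.
have [S [tau [b [[aS tL] hS _ _ _]]]] := tskew HX HP ord0 sLh sL LLh aT Ks cover uniq mBs.
have n0 : 0 < n.+1%:R :> R by rewrite ltr0n.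
exists (adjoin L h), S, h; split=> //.
  move=> a B C al BB CB; have La : L a by apply: adjoins_gen => //; exact: subgroup_triv.
  have := hS a B C (LLh _ La) BB CB; rewrite card_ord.
  have tauid t : tau a t = t.
    apply/esym/uniq; have := tL a t (LLh _ La); rewrite -addrA => /(subgroupD sL (subgroupN sL La)).
    by rewrite addKr.
  under eq_bigr do rewrite tauid addrK.
  rewrite sumr_const card_ord -[X in _ = X]mulr_natl => /(mulfI (lt0r_neq0 n0)) ->.
  by rewrite lerDl ltW.
move=> m B mM BB; have Lm : adjoin L h ((h - g) *~ m) by exact: subgroupMz.
have := hS _ B B Lm BB BB; rewrite card_ord => E.
have mB := mBs _ BB.
have : \sum_t dm (T ((h - g) *~ m + s t - s (tau ((h - g) *~ m) t)) @^-1` B) B <=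
    n.+1%:R * 0 + `|m|%N%:R.
  apply: sum_shift_bound => // t; first by apply: dm_le1 => //; exact: act_pre aT mB.
  move=> tm; have rl : (absz ((t : nat)%:Z + m)%R < n.+1)%N by lia.
  have tE : tau ((h - g) *~ m) t = Ordinal rl.
    apply/esym/uniq; have := tL ((h - g) *~ m) t Lm.
    have -> : s (Ordinal rl) = (h - g) *~ m + s t; last by [].
    by rewrite /s -mulrzDr [m + _]addrC /= gez0_abs//; case/andP: tm.
  have -> : (h - g) *~ m + s t - s (tau ((h - g) *~ m) t) = 0.
    by rewrite tE /s -mulrzDr [m + _]addrC /= gez0_abs ?subrr//; case/andP: tm.
  by rewrite (ae_eq_dm0 (act_mpt_all 0 aT) (mpt_id P) (act0 aT)).
rewrite -E mulr0 add0r => h1; rewrite -(ler_pM2l n0); apply: (le_trans h1).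
have : (`|m|%N%:R : R) <= M%:R by rewrite ler_nat; lia.
have : (n1%:R : R) * e <= n.+1%:R * e.
  by rewrite ler_pM2r// ler_nat; apply: leq_trans (leq_maxl _ M) _; exact: ltnW.
lra.
Qed.

End keys.

(** * Torsion, characters and heights in finitely generated groups *)

Section torsion.
Context (G : zmodType).
Implicit Types (H K L : set G) (g h a b : G).

Lemma adjoin_finite H g (n : nat) : is_subgroup H -> finite_set H -> (0 < n)%N -> g *+ n = 0 ->
  finite_set (adjoin H g).
Proof.
move=> sH fH n0 gn.
apply: (@sub_finite_set _ _ [set a.1 + g *+ a.2 | a in H `*` `I_n]); last first.
  by apply: finite_image; apply: finite_setX.
move=> _ [k [i [Hk ->]]].
have nz : n%:Z != 0 by rewrite eqz_nat -lt0n.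
have rE : (i %% n%:Z)%Z = (absz (i %% n%:Z)%Z)%:Z by rewrite gez0_abs// modz_ge0.
exists (k, absz (i %% n%:Z)%Z); first by split=> //=; rewrite -ltz_nat -rE ltz_pmod// ltz_nat.
have -> : g *~ i = g *~ (i %% n%:Z)%Z.
  rewrite {1}(divz_eq i n%:Z) mulrzDr [(i %/ n%:Z)%Z * _]mulrC mulrzA -pmulrn gn mul0rz.
  by rewrite add0r.
by rewrite /= pmulrn -rE.
Qed.

Lemma adjoins_finite l : (forall g, g \in l -> exists2 n : nat, (0 < n)%N & g *+ n = 0) ->
  finite_set (adjoins [set (0 : G)] l).
Proof.
elim: l => [|g l ih] hl /=; first exact: finite_set1.
have [|n n0 gn] := hl g; first by rewrite inE eqxx.
apply: adjoin_finite n0 gn; first by apply: adjoins_subgroup; exact: subgroup_triv.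
by apply: ih => h hh; apply: hl; rewrite inE hh orbT.
Qed.

(** If a generator has infinite order modulo the preceding ones, torsion elements have no component
    along it; if it has finite order, multiplying by that order returns to the preceding group. *)
Lemma adjoins_torsion_bound l : exists2 N : nat, (0 < N)%N &
  forall a m, adjoins [set (0 : G)] l a -> (0 < m)%N -> a *+ m = 0 -> a *+ N = 0.
Proof.
elim: l => [|g l [N N0 hN]] /=; first by exists 1%N => // a m -> _ _; rewrite mul0rn.
have sL : is_subgroup (adjoins [set (0 : G)] l) by apply: adjoins_subgroup; exact: subgroup_triv.
set L := adjoins _ l in hN sL *.
have [n hn] := order_mod g sL; case: n hn => [|n] hn.
  exists N => // _ m [k [i [Lk ->]]] m0 am.
  have : L (g *~ (i * m%:Z)).
    rewrite mulrzA -pmulrn; have := am; rewrite mulrnDl => /eqP; rewrite addrC addr_eq0 => /eqP ->.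
    by apply: subgroupN => //; rewrite pmulrn; exact: subgroupMz.
  move=> /hn; rewrite dvd0z mulf_eq0 eqz_nat => /orP[/eqP i0|/eqP m1]; last by rewrite m1 in m0.
  by move: am; rewrite i0 mulr0z addr0; exact: hN.
exists (n.+1 * N)%N; first by rewrite muln_gt0.
move=> _ m [k [i [Lk ->]]] m0 am.
have Lna : L ((k + g *~ i) *+ n.+1).
  rewrite mulrnDl; apply: subgroupD => //; first by rewrite pmulrn; exact: subgroupMz.
  by rewrite pmulrn -mulrzA; apply/hn; exact: dvdz_mull.
rewrite mulrnA; apply: (hN _ m) => //.
by rewrite mulrnAC am mul0rn.
Qed.

Lemma chi_exists (h0 : G) (l : seq G) : (forall m, (0 < m)%N -> h0 *+ m <> 0) ->
  exists chi : G -> int, (forall a b, adjoins [set 0] (l ++ [:: h0]) a ->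
     adjoins [set 0] (l ++ [:: h0]) b -> chi (a + b) = chi a + chi b) /\ chi h0 != 0.
Proof.
move=> inf; elim: l => [|g l [chi [chiD chi0]]] /=.
  have [||chi [chiE chiD]] := @hom_adjoin G int [set 0] (fun=> 0) h0 1 (subgroup_triv G).
  - by move=> a b; rewrite addr0.
  - move=> i /= hi; suff -> : i = 0 by rewrite mulr0z.
    apply/eqP; apply: contrapT => i0; apply: (inf (absz i)); first by rewrite absz_gt0; apply/negP.
    case: i hi {i0} => n; first by rewrite -pmulrn.
    by rewrite NegzE mulrNz -pmulrn => /eqP; rewrite oppr_eq0 => /eqP.
  exists chi; split=> //.
  by have := chiE 0 1 erefl; rewrite mulr1z !add0r => ->.
set L := adjoins _ _ in chiD *.
have sL : is_subgroup L by apply: adjoins_subgroup; exact: subgroup_triv.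
have Lh : L h0 by apply: adjoins_gen; [exact: subgroup_triv|rewrite mem_cat inE eqxx orbT].
have [n hn] := order_mod g sL; case: n hn => [|n] hn.
  have [|chi' [chiE' chiD']] := @hom_adjoin G int L chi g 0 sL chiD.
    move=> i /hn; rewrite dvd0z => /eqP ->; rewrite !mulr0z; exact: hom_on0 sL chiD.
  exists chi'; split=> //.
  by have := chiE' h0 0 Lh; rewrite !mulr0z !addr0 => ->.
have Lgn : L (g *~ n.+1%:Z) by apply/hn; exact: dvdzz.
(* The value at [g] would require a division by [n + 1] in the integers; multiplying the character
   by [n + 1] beforehand makes it available. *)
have [||chi' [chiE' chiD']] := @hom_adjoin G int L (fun a => chi a *+ n.+1) g (chi (g *~ n.+1%:Z)) sL.
- by move=> a b La Lb; rewrite chiD// mulrnDl.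
- move=> i /hn/dvdzP[q ->]; rewrite [q * _]mulrC mulrzA (hom_onMz _ sL chiD)//.
  by rewrite pmulrn -mulrzA [q * _]mulrC.
- exists chi'; split=> //.
  by have := chiE' h0 0 Lh; rewrite !mulr0z !addr0 => ->; rewrite mulrn_eq0.
Qed.

(* The elements of order [p] and height at least [k] of a [p]-group [K]. *)
Definition socle_layer (p k : nat) K : set G :=
  [set x | x *+ p = 0 /\ exists2 y, K y & x = y *+ (p ^ k)].

Lemma order_mod_pfactor H (p k : nat) h : prime p -> is_subgroup H ->
  H (h *+ (p ^ k.+1)) -> ~ H (h *+ (p ^ k)) ->
  forall i : int, H (h *~ i) -> ((p ^ k.+1)%N%:Z %| i)%Z.
Proof.
move=> pp sH H1 H2 i /[dup] Hi; have [n hn] := order_mod h sH; move/hn => ni.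
have : (n%:Z %| (p ^ k.+1)%N%:Z)%Z by apply/hn; rewrite -pmulrn.
rewrite dvdzE !absz_nat => /(dvdn_pfactor n k.+1 pp)[j jk nE].
have [jk'|jk'] := leqP j k.
  by exfalso; apply: H2; rewrite pmulrn; apply/hn; rewrite dvdzE !absz_nat nE dvdn_exp2l.
by have -> : k.+1 = j; [lia|rewrite -nE].
Qed.

End torsion.

(** * The perturbation principle for unbounded groups and for primary elements *)

Section keys.
Context (R : realType) (d : measure_display) (X : measurableType d)
  (P : probability X R) (HX : standard_borel R X) (HP : atomless P).
Context (G : zmodType) (enumG : nat -> G) (enumG_surj : forall g, exists i, enumG i = g).
Implicit Types (A B C : set X) (K L H : set G) (S T : G -> X -> X).
Local Notation Pr := (Pr P).
Local Notation dm := (dm P).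

(** For instance when [H] is cyclic, no element of large order modulo the listed group need exist.
    Instead a character [chi] drives a rotation of the integers modulo [chi h]. Listed elements have
    small [chi] and rarely wrap around, whereas [h] makes one full turn, and the cocycle is designed
    to replace each full turn of [h] by [g]. *)
Lemma key_of_infinite_order H g h0 : is_subgroup H -> H h0 ->
  (forall m, (0 < m)%N -> h0 *+ m <> 0) -> key P H g.
Proof.
move=> sH Hh0 inf; apply: (key_local HX HP enumG_surj) => // l Bs M e T e0 mBs lK gl aT.
pose l' := l ++ [:: h0].
set L := adjoins [set 0] l in aT; pose L' := adjoins [set 0] l'.
have sL : is_subgroup L by apply: adjoins_subgroup; exact: subgroup_triv.
have sL' : is_subgroup L' by apply: adjoins_subgroup; exact: subgroup_triv.
have lL' a : a \in l' -> L' a by apply: adjoins_gen; exact: subgroup_triv.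
have LL' : L `<=` L'.
  apply: adjoins_min => // [x ->|a al]; first exact: subgroup0.
  by apply: lL'; rewrite mem_cat al.
have [T' aT' hT'] := extension HX HP enumG_surj l sL' sL LL' aT mBs.
have sK := adjoin_subgroup g sH.
have L'K : L' `<=` adjoin H g.
  apply: adjoins_min => // [x ->|a]; first exact: subgroup0.
  by rewrite mem_cat inE => /orP[/lK//|/eqP ->]; exact: sub_adjoin.
have [chi [chiD chi0]] := chi_exists l inf.
have L'g : L' g by apply: lL'; rewrite mem_cat gl.
have L'h0 : L' h0 by apply: lL'; rewrite mem_cat inE eqxx orbT.
(* Bounds the wrap-arounds of both kinds: [|chi a|] for a listed element and [|m * chi g|] for a
   multiple of [h - g]. *)
pose Mx := (\max_(a <- l) absz (chi a) + M * absz (chi g))%N.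
have [n1 hn1] := archi_mul Mx e0.
(* The sign makes [chi h] positive, and the factor [n1.+1] makes [Mx] smaller than [e] times it. *)
pose h := h0 *~ (sgz (chi h0) * n1.+1%:Z).
have Hh : H h by exact: subgroupMz.
have L'h : L' h by exact: subgroupMz.
have chih : chi h = (absz (chi h0) * n1.+1)%N%:Z.
  rewrite /h (hom_onMz _ sL' chiD)// PoszM abszE -[chi h0 *~ _]/(chi h0 *~ _) mulrzA.
  by rewrite -mulrzz !mulrzz [chi h0 * _]mulrC -normrEsg.
have N0 : (0 < absz (chi h0) * n1.+1)%N by rewrite muln_gt0 absz_gt0 chi0.
have n1N : (n1 < absz (chi h0) * n1.+1)%N by rewrite leq_pmull// absz_gt0.
move: chih N0 n1N; move: (absz (chi h0) * n1.+1)%N => [//|N] chih _ n1N.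
have Nz : N.+1%:Z != 0 by [].
have rl (i : int) : (absz (i %% N.+1%:Z)%Z < N.+1)%N.
  by rewrite -ltz_nat gez0_abs ?modz_ge0// ltz_pmod.
pose tau a (t : 'I_N.+1) : 'I_N.+1 := Ordinal (rl ((t : nat)%:Z + chi a)).
pose c a (t : 'I_N.+1) := a - (h - g) *~ (((t : nat)%:Z + chi a) %/ N.+1%:Z)%Z.
have tauE a t : (tau a t : nat)%:Z = (((t : nat)%:Z + chi a) %% N.+1%:Z)%Z.
  by rewrite /tau /= gez0_abs// modz_ge0.
have tauD a b t : L' a -> L' b -> tau (a + b) t = tau a (tau b t).
  move=> La Lb; apply/val_inj/eqP; rewrite -eqz_nat; apply/eqP.
  by rewrite /= !gez0_abs ?modz_ge0// chiD// modzDml -addrA [chi b + _]addrC.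
have tau0 t : tau 0 t = t.
  apply/val_inj/eqP; rewrite -eqz_nat tauE (hom_on0 sL' chiD) addr0 modz_small//.
  by rewrite ltz_nat ltn_ord.
have cL a t : L' a -> L' (c a t).
  by move=> La; apply: subgroupB => //; apply: subgroupMz => //; exact: subgroupB.
have cD a b t : L' a -> L' b -> c (a + b) t = c a (tau b t) + c b t.
  move=> La Lb; rewrite /c addrACA -opprD -mulrzDr; congr (_ - _ *~ _).
  rewrite tauE chiD//; set x := (t : nat)%:Z + chi b.
  have -> : (t : nat)%:Z + (chi a + chi b) =
      (x %/ N.+1%:Z)%Z * N.+1%:Z + ((x %% N.+1%:Z)%Z + chi a).
    by rewrite [RHS]addrA -divz_eq /x -addrA [chi b + _]addrC.
  by rewrite divzMDl// addrC.
have [S [b [aS hS _ _ _]]] :=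
  @skew_product _ _ _ P HX HP _ L' L' T' 'I_N.+1 ord0 tau c Bs sL' sL' aT' tauD tau0 cL cD mBs.
have n0 : 0 < N.+1%:R :> R by rewrite ltr0n.
have bound x : (absz x <= Mx)%N -> (absz x)%:R <= N.+1%:R * e :> R.
  move=> xM; apply: (@le_trans _ _ (Mx%:R)); first by rewrite ler_nat.
  by apply: le_trans (ltW hn1) _; rewrite ler_pM2r// ler_nat ltnW.
have divz0 (t : 'I_N.+1) (x : int) : 0 <= (t : nat)%:Z + x < N.+1%:Z ->
  (((t : nat)%:Z + x) %/ N.+1%:Z)%Z = 0 by move=> ?; exact: divz_small.
have T1 B C a : B \in Bs -> C \in Bs -> dm (T' a @^-1` B) C <= 1.
  by move=> BB CB; apply: dm_le1; [apply: act_pre aT' _; exact: mBs|exact: mBs].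
exists L', S, h; split=> //.
- move=> a B C al BB CB; have La : L' a by apply: lL'; rewrite mem_cat al.
  have La' : L a by apply: adjoins_gen al; exact: subgroup_triv.
  have E := hS a B C La BB CB; rewrite card_ord in E.
  have : \sum_t dm (T' (c a t) @^-1` B) C <= N.+1%:R * dm (T a @^-1` B) C + (absz (chi a))%:R.
    apply: sum_shift_bound => [|t|t tx]; [exact: dm_ge0|exact: T1|].
    rewrite /c divz0// mulr0z subr0.
    apply: le_trans (dm_tri P _ (act_pre a aT (mBs _ BB)) (mBs _ CB)) _.
      exact: act_pre aT' (mBs _ BB).
    by rewrite hT'// add0r.
  rewrite -E => h1; rewrite -(ler_pM2l n0) mulrDr; apply: (le_trans h1); rewrite lerD2l bound//.
  by apply: leq_trans (leq_addr _ _); apply: leq_bigmax_seq.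
- move=> m B mM BB; have Lm : L' ((h - g) *~ m) by apply: subgroupMz => //; exact: subgroupB.
  have E := hS _ B B Lm BB BB; rewrite card_ord in E.
  have : \sum_t dm (T' (c ((h - g) *~ m) t) @^-1` B) B <= N.+1%:R * 0 + (absz (- (m * chi g)))%:R.
    apply: sum_shift_bound => // t; [exact: T1|move=> tx].
    have -> : c ((h - g) *~ m) t = 0.
      rewrite /c (hom_onMz _ sL' chiD); last exact: subgroupB.
      rewrite chiD//; last exact: subgroupN.
      rewrite (hom_onN sL' chiD)// chih mulrzz mulrBl.
      rewrite addrCA [N.+1%:Z * m]mulrC divzMDl// [chi g * m]mulrC divz0// addr0 subrr//.
    by rewrite (ae_eq_dm0 (act_mpt_all 0 aT') (mpt_id P) (act0 aT'))//; exact: mBs.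
  rewrite -E mulr0 add0r => h1; rewrite -(ler_pM2l n0); apply: (le_trans h1).
  apply: bound; rewrite abszN abszM; apply: leq_trans (leq_addl _ _).
  by rewrite leq_mul2r; apply/orP; right; lia.
Qed.

(** If [H] is torsion and every element had a multiple of bounded index in one finitely generated
    group, the bounded torsion of that group would bound [H]; so elements of large order modulo it
    exist. *)
Lemma key_unbounded H g : is_subgroup H -> ~ bounded_group H -> key P H g.
Proof.
move=> sH nb.
have [[h0 [Hh0 inf]]|tors] := pselect (exists h0, H h0 /\ forall m, (0 < m)%N -> h0 *+ m <> 0).
  exact: key_of_infinite_order inf.
apply: (key_of_large_orders HX HP enumG_surj) => // l lK M.
apply: contrapT => no; apply: nb.
have [N N0 hN] := adjoins_torsion_bound l.
exists (M * N)%N => h Hh.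
have [m [m0 hm]] : exists m, (0 < m)%N /\ h *+ m = 0.
  apply: contrapT => nm; apply: tors; exists h; split=> // m m0 hm; apply: nm; by exists m.
have [k [k0 Lk]] : exists m, (0 < m <= M)%N /\ adjoins [set 0] l (h *+ m).
  by apply: contrapT => nk; apply: no; exists h => // k k0 Lk; apply: nk; exists k.
exists (k * N)%N; split.
  by case/andP: k0 => k0 kM; rewrite muln_gt0 k0 N0 leq_mul2r kM orbT.
by rewrite mulrnA; apply: (hN _ m) => //; rewrite mulrnAC hm mul0rn.
Qed.

Lemma key_shift H g h' : is_subgroup H -> H h' -> key P H (g - h') -> key P H g.
Proof.
move=> sH Hh' kg; have KE : adjoin H (g - h') = adjoin H g.
  apply/seteqP; split; apply: adjoin_min; try exact: adjoin_subgroup; try exact: sub_adjoin.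
    apply: subgroupB; [exact: adjoin_subgroup|exact: adjoin_gen|exact: sub_adjoin].
  rewrite -[X in adjoin _ _ X](subrK h' g).
  by apply: subgroupD; [exact: adjoin_subgroup|exact: adjoin_gen|exact: sub_adjoin].
move=> Fs Bs M e T e0 mBs aT; rewrite -KE in aT *.
have [S [h [Hh aS h1 h2]]] := kg Fs Bs M e T e0 mBs aT.
exists S, (h + h'); split=> //; first exact: subgroupD.
by move=> m B mM BB; have := h2 m B mM BB; rewrite opprB addrA.
Qed.

(** Induction on the exponent of [g]. If the layer of [H] is finite, [g *+ (p ^ k)] comes from some
    [h'] in [H], and [g - h'] has smaller exponent. If it is infinite, it leaves the finite group
    generated by [l], so some [h] has order [p ^ k.+1] modulo that group; multiples of [h] inside it
    are then 0, and so are those of [g]. *)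
Lemma key_bounded H K p k g : is_subgroup H -> is_subgroup K -> H `<=` K -> prime p ->
  (forall x, K x -> exists2 n : nat, (0 < n)%N & x *+ n = 0) ->
  (forall k, finite_set (socle_layer p k H) -> socle_layer p k K `<=` socle_layer p k H) ->
  K g -> g *+ (p ^ k) = 0 -> key P H g.
Proof.
move=> sH sK HK pp tors hA; elim: k g => [|k ih] g Kg gk.
  rewrite expn0 mulr1n in gk; apply: (key_of_hom HX HP enumG_surj) => // l _.
  by exists g => //; rewrite gk; exact: subgroup0.
have [fin|inf] := pselect (finite_set (socle_layer p k H)).
  have : socle_layer p k K (g *+ (p ^ k)).
    by split; [rewrite -mulrnA -expnSr|exists g].
  move=> /(hA _ fin)[_ [h' Hh' E]]; apply: (key_shift sH Hh').
  by apply: ih; [apply: subgroupB => //; exact: HK|rewrite mulrnBl E subrr].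
apply: (key_of_hom HX HP enumG_surj) => // l lK.
have finL : finite_set (adjoins [set 0] l).
  apply: adjoins_finite => x /lK xK; apply: tors.
  by apply: (adjoin_min sK HK Kg).
have [x [[xp [h Hh xE]] nLx]] : exists x, socle_layer p k H x /\ ~ adjoins [set 0] l x.
  apply: contrapT => no; apply: inf; apply: sub_finite_set finL => x Ax.
  by apply: contrapT => nL; apply: no; exists x.
exists h => // i Li.
have hp : h *+ (p ^ k.+1) = 0 by rewrite expnSr mulrnA -xE.
have sL : is_subgroup (adjoins [set 0] l) by apply: adjoins_subgroup; exact: subgroup_triv.
have := order_mod_pfactor pp sL _ _ Li.
move=> /(_ k) /(_ _)/wrap[]; first by rewrite hp; exact: subgroup0.
move=> /(_ _)/wrap[]; first by rewrite -xE.
move=> /dvdzP[q ->]; rewrite mulrC !mulrzA -!pmulrn hp gk !mul0rz//.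
Qed.

End keys.

(** * The weak topology and Baire category *)
Section weak_topology.
Context (R : realType) (d : measure_display) (X : measurableType d)
  (P : probability X R).
Context (E : nat -> set X) (mE : forall n, measurable (E n))
  (dE : forall A, measurable A -> forall e : R, 0 < e -> exists n, dm P A (E n) < e).
Context (G : zmodType) (en : nat -> G).
Implicit Types (A B C : set X) (K L H : set G) (S T W : G -> X -> X)
  (Sp U V : set (G -> X -> X)).
Local Notation dm := (dm P).

Definition wclose (n : nat) S T := forall i j, (i < n)%N -> (j < n)%N ->
  dm (S (en i) @^-1` E j) (T (en i) @^-1` E j) < n.+1%:R^-1.

Definition mpts S := forall k, mpt P (S k).

Lemma inv_nat_gt0 (n : nat) : 0 < n.+1%:R^-1 :> R.
Proof. by rewrite invr_gt0. Qed.

(** The reason for the ubiquitous index [n.*2.+1]: it halves the radius, as each triangle inequality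
    requires. *)
Lemma inv_nat_half (n : nat) : (n.*2.+1).+1%:R^-1 = n.+1%:R^-1 / 2 :> R.
Proof.
by rewrite -invfM; congr (_^-1); rewrite -natrM; congr _%:R; lia.
Qed.

Lemma inv_nat_le (m n : nat) : (m <= n)%N -> n.+1%:R^-1 <= m.+1%:R^-1 :> R.
Proof. by move=> mn; rewrite lef_pV2 ?posrE// ler_nat. Qed.

Lemma inv_nat_lt (e : R) : 0 < e -> exists n : nat, n.+1%:R^-1 < e.
Proof.
move=> e0; exists (Num.truncn e^-1); rewrite -[ltRHS]invrK ltf_pV2 ?posrE ?invr_gt0//.
exact: truncnS_gt.
Qed.

Lemma close_refl n S : wclose n S S.
Proof. by move=> i j _ _; rewrite dmxx inv_nat_gt0. Qed.

Lemma close_sym n S T : wclose n S T -> wclose n T S.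
Proof. by move=> h i j ni nj; rewrite dmC; exact: h. Qed.

Lemma close_le m n S T : (m <= n)%N -> wclose n S T -> wclose m S T.
Proof.
move=> mn h i j im jm; apply: lt_le_trans (inv_nat_le mn).
by apply: h; exact: leq_trans mn.
Qed.

Lemma close_tri n S T W : mpts S -> mpts T -> mpts W ->
  wclose n.*2.+1 S T -> wclose n.*2.+1 T W -> wclose n S W.
Proof.
move=> mS mT mW h1 h2 i j ni nj.
have i2 : (i < n.*2.+1)%N by lia.
have j2 : (j < n.*2.+1)%N by lia.
have := h1 i j i2 j2; have := h2 i j i2 j2; rewrite !inv_nat_half => a1 a2.
have := @dm_tri _ _ _ P (T (en i) @^-1` E j) (S (en i) @^-1` E j) (W (en i) @^-1` E j)
  (mpt_pre (mS _) (mE _)) (mpt_pre (mT _) (mE _)) (mpt_pre (mW _) (mE _)).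
by move: a1 a2; set v := n.+1%:R^-1; lra.
Qed.

Lemma aeq_close n S T : mpts S -> mpts T -> (forall k, ae_eq P (S k) (T k)) -> wclose n S T.
Proof. by move=> mS mT h i j _ _; rewrite (ae_eq_dm0 (mS _) (mT _) (h _))// inv_nat_gt0. Qed.

Lemma act_mpts K T : actions_on P K T -> mpts T.
Proof. by move=> aT k; exact: act_mpt_all aT. Qed.

(** The interior relative to [Sp], the balls of [wclose] being a base of neighbourhoods. *)
Definition near_in Sp V : set (G -> X -> X) :=
  [set T | Sp T /\ exists n, forall S, Sp S -> wclose n S T -> V S].

Lemma near_in_sub Sp V : near_in Sp V `<=` V.
Proof. by move=> T [ST [n h]]; apply: h => //; exact: close_refl. Qed.

Lemma close_wopen Sp U : (forall S, Sp S -> mpts S) -> U `<=` Sp ->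
  (forall T, U T -> exists n, forall S, Sp S -> wclose n S T -> U S) -> wopen_in P Sp U.
Proof.
move=> mSp USp h; split=> // T UT; have [n hn] := h T UT.
exists (n * n)%N, (fun i => en (i %/ n)), (fun i => E (i %% n)%N), (n.+1%:R^-1).
split=> // S SS hS; apply: hn => // i j ni nj.
have ij : (i * n + j < n * n)%N by nia.
have n0 : (0 < n)%N by lia.
have := hS (Ordinal ij) => /=; rewrite divnMDl// divn_small// addn0 modnMDl modn_small//.
rewrite PrE ?lte_fin//; apply: measurable_symdiff; apply: mpt_pre => //; [exact: mSp|].
by apply: mSp; exact: USp.
Qed.

Lemma wopen_close Sp U : (forall S, Sp S -> mpts S) -> (forall g, exists i, en i = g) ->
  wopen_in P Sp U -> forall T, U T -> exists n, forall S, Sp S -> wclose n S T -> U S.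
Proof.
move=> mSp surj [USp h] T UT; have [m [k [A [e [e0 mA hU]]]]] := h T UT.
have e3 : 0 < e / 3 by rewrite divr_gt0.
have /choice[a ha] := fun i => surj (k i).
have /choice[b hb] := fun i => dE (mA i) e3.
have [n1 hn1] := inv_nat_lt e3.
pose n := (n1 + \max_i a i + \max_i b i).+1.
exists n => S SS hST; apply: hU => // i.
have mS := mSp _ SS; have mT := mSp _ (USp _ UT).
have ai : (a i < n)%N by rewrite /n; have := leq_bigmax (F := a) i; lia.
have bi : (b i < n)%N by rewrite /n; have := leq_bigmax (F := b) i; lia.
have := hST _ _ ai bi; rewrite ha => h1.
have h2 : n.+1%:R^-1 < e / 3 by apply: le_lt_trans hn1; apply: inv_nat_le; rewrite /n; lia.
have mSA := mpt_pre (mS (k i)) (mA i); have mTA := mpt_pre (mT (k i)) (mA i).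
have mSE := mpt_pre (mS (k i)) (mE (b i)); have mTE := mpt_pre (mT (k i)) (mE (b i)).
rewrite PrE ?lte_fin; last exact: measurable_symdiff.
have t1 := dm_tri P mSA mSE mTA; have t2 := dm_tri P mSE mTE mTA.
have := hb i; rewrite -(dm_pre (mS (k i)) (mA i) (mE (b i))) => h3.
have := hb i; rewrite -(dm_pre (mT (k i)) (mA i) (mE (b i))) dmC => h4.
have h5 := lt_trans h1 h2; rewrite -/(dm _ _).
by clear h1 h2 hn1; lra.
Qed.

Lemma near_in_wopen Sp V : (forall S, Sp S -> mpts S) -> wopen_in P Sp (near_in Sp V).
Proof.
move=> mSp; apply: close_wopen => // [T []//|T [ST [n hn]]].
exists n.*2.+1 => S SS hST; split=> //; exists n.*2.+1 => W SW hWS; apply: hn => //.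
by apply: close_tri hWS hST; exact: mSp.
Qed.

Lemma ball_near Sp n T : Sp T -> near_in Sp (fun S => wclose n S T) T.
Proof. by move=> ST; split=> //; exists n. Qed.

Definition complete_in Sp := forall Ss : nat -> G -> X -> X, (forall k, Sp (Ss k)) ->
  (forall n, exists N, forall i j, (N <= i)%N -> (N <= j)%N -> wclose n (Ss i) (Ss j)) ->
  exists2 S, Sp S & forall n, exists N, forall i, (N <= i)%N -> wclose n (Ss i) S.

(** Radii are at least halved at every step, so all later terms stay in the ball around the present
    one. Passing to the limit costs one more halving, hence the comparison of [S] at radius [r k]
    with [Ss k.+1]. *)
Lemma fusion Sp (Ss : nat -> G -> X -> X) (r : nat -> nat) :
  (forall S, Sp S -> mpts S) -> complete_in Sp -> (forall k, Sp (Ss k)) ->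
  (forall k, (k <= r k)%N) -> (forall k, ((r k).*2.+1 <= r k.+1)%N) ->
  (forall k, wclose (r k).*2.+1 (Ss k.+1) (Ss k)) ->
  exists2 S, Sp S & forall k, wclose (r k) S (Ss k.+1).
Proof.
move=> mSp cSp SSs rk r2 hS.
have mS k : mpts (Ss k) by exact: mSp.
have chain k j : wclose (r k) (Ss (j + k)%N) (Ss k).
  elim: j k => [|j ih] k; first exact: close_refl.
  apply: (close_tri (mS _) (mS k.+1) (mS k)); last exact: hS.
  by apply: close_le (r2 k) _; rewrite addSnnS; exact: ih.
have [|S SS hlim] := cSp Ss SSs.
  move=> n; exists n.*2.+1 => i j ni nj.
  apply: (close_tri (mS _) (mS n.*2.+1) (mS _)).
    by apply: close_le (rk _) _; rewrite -(subnK ni); exact: chain.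
  by apply: close_sym; apply: close_le (rk _) _; rewrite -(subnK nj); exact: chain.
exists S => // k; have [N hN] := hlim (r k).*2.+1.
apply: (close_tri (mSp _ SS) (mS (N + k.+1)%N) (mS _)).
  by apply: close_sym; apply: hN; exact: leq_addr.
by apply: close_le (r2 k) _; exact: chain.
Qed.

Lemma baire Sp (O : nat -> set (G -> X -> X)) : (forall S, Sp S -> mpts S) ->
  (forall g, exists i, en i = g) -> complete_in Sp ->
  (forall n, wopen_in P Sp (O n)) -> (forall n, dense_in P Sp (O n)) ->
  dense_in P Sp (\bigcap_n O n).
Proof.
move=> mSp surj cSp oO dO.
have OSp n : O n `<=` Sp by case: (oO n).
split=> [S h|U oU [S0 US0]]; first exact: (OSp 0%N S (h 0%N I)).
have USp : U `<=` Sp by case: oU.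
have [n0 hn0] := wopen_close mSp surj oU US0.
have step kSr : exists Sr : (G -> X -> X) * nat, Sp kSr.2.1 ->
    let: (k, (W0, r)) := kSr in
    [/\ Sp Sr.1, wclose r.*2.+1 Sr.1 W0, (r.*2.+1 <= Sr.2)%N, (k.+1 <= Sr.2)%N &
        exists2 n1, (n1.*2.+1 <= Sr.2)%N & forall W, Sp W -> wclose n1 W Sr.1 -> O k W].
  move: kSr => [k [S r]] /=; have [SS|] := pselect (Sp S); last by exists (S, r).
  have [T [OT /near_in_sub TS]] := (dO k).2 _ (near_in_wopen (fun T => wclose r.*2.+1 T S) mSp)
     (ex_intro _ S (ball_near r.*2.+1 SS)).
  have [n1 hn1] := wopen_close mSp surj (oO k) OT.
  exists (T, (n1.*2.+1 + r.*2.+1 + k.+1)%N) => _ /=; split.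
  - exact: OSp OT.
  - exact: TS.
  - by lia.
  - by lia.
  - by exists n1 => //; lia.
have /choice[next hnext] := step.
pose sr := fix F k : (G -> X -> X) * nat := if k is k'.+1 then next (k', F k') else (S0, n0.*2.+1).
have Ssr k : Sp (sr k).1.
  elim: k => [|k ih] /=; first exact: USp.
  have := hnext (k, sr k) ih; rewrite /=; case: (sr k) => S r [h _ _ _ _]; exact: h.
have H k := hnext (k, sr k) (Ssr k).
pose Ss k := (sr k).1; pose r k := (sr k).2.
have {}H k : [/\ wclose (r k).*2.+1 (Ss k.+1) (Ss k), ((r k).*2.+1 <= r k.+1)%N, (k.+1 <= r k.+1)%N &
    exists2 n1, (n1.*2.+1 <= r k.+1)%N & forall W, Sp W -> wclose n1 W (Ss k.+1) -> O k W].
  have := H k; rewrite /Ss /r /=; case: (sr k) => S q /= [_ h1 h2 h3 h4].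
  by split.
have [||||S SS hS] := @fusion Sp Ss r mSp cSp.
- exact: Ssr.
- by case=> // k; have [] := H k.
- by move=> k; have [] := H k.
- by move=> k; have [] := H k.
have S1 k : wclose (r k).*2.+1 (Ss k.+1) (Ss k) by have [] := H k.
exists S; split.
  move=> k _; have [_ h2 _ [n1 n1r hn1]] := H k; apply: hn1 => //.
  have [h3 h4 _ _] := H k.+1.
  apply: (close_tri (mSp _ SS) (mSp _ (Ssr k.+2)) (mSp _ (Ssr k.+1))).
    exact: close_le n1r (hS k.+1).
  apply: close_le h3; lia.
apply: hn0 => //; apply: (close_tri (mSp _ SS) (mSp _ (Ssr 1%N)) (mSp _ (USp _ US0))).
  exact: hS 0%N.
apply: close_le (S1 0%N); rewrite /r /=; lia.
Qed.

(* For the image of a comeagre set under restriction to be comeagre it is enough that near every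
   [S'] there be a ball of actions of [H] in which restrictions of actions close to [S'] are
   dense. *)
Definition locally_dense (Sp : set (G -> X -> X)) H := forall S' n, Sp S' ->
  exists T0 m, actions_on P H T0 /\ forall T, actions_on P H T -> wclose m T T0 ->
    forall r, exists S, [/\ Sp S, wclose n S S' & wclose r (restr H S) T].

Definition dense_restr (Sp : set (G -> X -> X)) H := forall T, actions_on P H T ->
  forall r, exists2 S, Sp S & wclose r (restr H S) T.

Lemma restr_mpts H S : mpts S -> mpts (restr H S).
Proof. by move=> mS k; rewrite /restr; case: asboolP => // _; exact: mpt_id. Qed.

Lemma restr_close H n S T : wclose n S T -> wclose n (restr H S) (restr H T).
Proof.
move=> h i j ni nj; rewrite /restr; case: asboolP => _; first exact: h.
by rewrite dmxx inv_nat_gt0.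
Qed.

(** The scheme of the open mapping theorem. At every stage a generic [y] admits a smaller cell
    inside the next [O k] such that restrictions from the cell are still dense near [y]; the nested
    cells yield a Cauchy sequence whose limit lies in all [O k] and restricts to [y]. Cells are
    coded by finite sequences of naturals, so only countably many open dense sets are involved. *)
Lemma residual_image Sp H (O : nat -> set (G -> X -> X)) :
  (forall S, Sp S -> mpts S) -> (forall g, exists i, en i = g) ->
  complete_in Sp -> complete_in (actions_on P H) ->
  (forall S, Sp S -> actions_on P H (restr H S)) ->
  (forall S y, Sp S -> actions_on P H y -> (forall h, H h -> ae_eq P (S h) (y h)) ->
     exists S', [/\ Sp S', restr H S' = y & forall g, ae_eq P (S' g) (S g)]) ->
  locally_dense Sp H -> dense_restr Sp H ->
  (forall A B : X -> X, mpt P A -> mpt P B ->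
     (forall j, dm (A @^-1` E j) (B @^-1` E j) = 0) -> ae_eq P A B) ->
  (forall n, wopen_in P Sp (O n)) -> (forall n, dense_in P Sp (O n)) ->
  exists U : nat -> set (G -> X -> X), [/\ forall n, wopen_in P (actions_on P H) (U n),
    forall n, dense_in P (actions_on P H) (U n) &
    forall y, (\bigcap_n U n) y -> exists S, [/\ Sp S, (\bigcap_n O n) S & restr H S = y]].
Proof.
move=> mSp surj cSp cH rSp fix_ LD DN sep oO dO.
set Y := actions_on P H.
have mY y : Y y -> mpts y by exact: act_mpts.
have OSp n : O n `<=` Sp by case: (oO n).
pose idx (n : nat) (s : seq nat) i j := nth 0%N s (i * n + j)%N.
(* The strict version serves to find elements in a cell, the closed version [cell'] survives the
   passage to the limit. *)
pose cell (c : nat * seq nat) : set (G -> X -> X) := [set W | forall i j, (i < c.1)%N -> (j < c.1)%N ->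
   dm (W (en i) @^-1` E j) (E (idx c.1 c.2 i j)) < c.1.+1%:R^-1].
pose cell' (c : nat * seq nat) : set (G -> X -> X) := [set W | forall i j, (i < c.1)%N -> (j < c.1)%N ->
   dm (W (en i) @^-1` E j) (E (idx c.1 c.2 i j)) <= c.1.+1%:R^-1].
have code S n : Sp S -> exists s, forall W, Sp W -> wclose n.*2.+1 W S -> cell (n, s) W.
  move=> SS; have e2 : 0 < n.*2.+1.+1%:R^-1 :> R by exact: inv_nat_gt0.
  have /choice[t ht] : forall ij : nat * nat, exists k, dm (S (en ij.1) @^-1` E ij.2) (E k) < n.*2.+1.+1%:R^-1.
    by move=> ij; apply: dE => //; apply: mpt_pre => //; exact: mSp.
  exists [seq t (k %/ n, k %% n)%N | k <- iota 0 (n * n)] => W SW hW i j /= ni nj.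
  have ij : (i * n + j < n * n)%N by nia.
  have n0 : (0 < n)%N by lia.
  have -> : idx n [seq t (k %/ n, k %% n)%N | k <- iota 0 (n * n)] i j = t (i, j).
    rewrite /idx (nth_map 0%N) ?size_iota// nth_iota// add0n.
    by rewrite divnMDl// divn_small// addn0 modnMDl modn_small.
  have i2 : (i < n.*2.+1)%N by lia.
  have j2 : (j < n.*2.+1)%N by lia.
  have h1 := ht (i, j); have h2 := hW i j i2 j2; rewrite !inv_nat_half /= in h1 h2.
  have := @dm_tri _ _ _ P (S (en i) @^-1` E j) (W (en i) @^-1` E j) (E (t (i, j)))
    (mpt_pre (mSp _ SW _) (mE _)) (mpt_pre (mSp _ SS _) (mE _)) (mE _).
  by move: h1 h2; set v := n.+1%:R^-1; lra.
have cell_close n s S W : Sp S -> Sp W -> cell (n.*2.+1, s) S -> cell' (n.*2.+1, s) W -> wclose n W S.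
  move=> SS SW h1 h2 i j ni nj.
  have i2 : (i < n.*2.+1)%N by lia.
  have j2 : (j < n.*2.+1)%N by lia.
  have {}h1 := h1 i j i2 j2; have {}h2 := h2 i j i2 j2; rewrite !inv_nat_half /= in h1 h2.
  rewrite dmC in h1.
  have := @dm_tri _ _ _ P (E (idx n.*2.+1 s i j)) (W (en i) @^-1` E j) (S (en i) @^-1` E j)
    (mpt_pre (mSp _ SW _) (mE _)) (mE _) (mpt_pre (mSp _ SS _) (mE _)).
  by move: h1 h2; set v := n.+1%:R^-1; lra.
pose cells (s : seq (nat * seq nat)) := near_in Sp [set W | forall c, c \in s -> cell c W].
pose Wd (s : seq (nat * seq nat)) := near_in Y
  [set y | forall r, exists2 S, cells s S & wclose r (restr H S) y].
(* The size condition makes nested cells shrink. The inclusion in [O k] is asked of the closed cell,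
   since the limit is only known to lie there. *)
pose adm k (c : nat * seq nat) := (k.*2.+1 <= c.1)%N /\ forall W, Sp W -> cell' c W -> O k W.
(* Either restrictions from the cells of [s] are not dense around [y], or a further cell can be
   chosen without losing density. Local density shows that this alternative holds on a dense set. *)
pose Xs s := (\bigcup_(c in adm (size s)) Wd (rcons s c)) `|` near_in Y (~` Wd s).
have oXs s : wopen_in P Y (Xs s).
  apply: close_wopen => //.
    by move=> y [[c _ []]|[]].
  move=> y [[c ac Wy]|Ey].
    have [n hn] := wopen_close mY surj (near_in_wopen _ mY) Wy.
    by exists n => y' Yy' h; left; exists c => //; exact: hn.
  have [n hn] := wopen_close mY surj (near_in_wopen _ mY) Ey.
  by exists n => y' Yy' h; right; exact: hn.
have dXs s : dense_in P Y (Xs s).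
  split=> [|V oV [v Vv]]; first by case: (oXs s).
  have VY : V `<=` Y by case: oV.
  have [[y0 [Vy0 Wy0]]|no] := pselect (exists y0, V y0 /\ Wd s y0); last first.
    exists v; split=> //; right; split; first exact: VY.
    have [n hn] := wopen_close mY surj oV Vv.
    by exists n => y Yy yv Wy; apply: no; exists y; split=> //; exact: hn.
  have [m1 hm1] := wopen_close mY surj oV Vy0.
  have [S Ss Sy0] := near_in_sub Wy0 m1.
  have Ssp : Sp S by case: Ss.
  have oZ : wopen_in P Sp [set W | cells s W /\ V (restr H W)].
    apply: close_wopen => // [W [[]//]|W [cW VW]].
    have [n1 h1] := wopen_close mSp surj (near_in_wopen _ mSp) cW.
    have [n2 h2] := wopen_close mY surj oV VW.
    exists (maxn n1 n2) => W' SW' WW'; split.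
      by apply: h1 => //; apply: close_le WW'; exact: leq_maxl.
    apply: h2; first exact: rSp.
    by apply: restr_close; apply: close_le WW'; exact: leq_maxr.
  have [|S' [OS' [cS' VS']]] := (dO (size s)).2 _ oZ.
    by exists S; split=> //; apply: hm1 => //; exact: rSp.
  have SS' : Sp S' by exact: OSp OS'.
  have [n1 h1] := wopen_close mSp surj (oO (size s)) OS'.
  have [n2 h2] := wopen_close mSp surj oZ (conj cS' VS').
  pose q := (maxn n1 (size s)).*2.+1.
  have [t ht] := code S' q SS'.
  have ac : adm (size s) (q, t).
    split; first by rewrite /= /q; lia.
    move=> W SW cW; apply: h1 => //; apply: close_le (leq_maxl n1 (size s)) _.
    apply: cell_close cW => //; apply: ht => //; exact: close_refl.
  pose q' := (maxn q.*2.+1 n2).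
  have [T0 [m [YT0 hT0]]] := LD S' q'.*2.+1 SS'.
  have cellS W : Sp W -> wclose q'.*2.+1 W S' -> cells (rcons s (q, t)) W /\ V (restr H W).
    move=> SW WS'; split; last by apply: (h2 _ SW _).2; apply: close_le WS'; rewrite /q'; lia.
    split=> //; exists q'.*2.+1 => W' SW' W'W.
    have W'S' : wclose q' W' S' by apply: (close_tri (mSp _ SW') (mSp _ SW) (mSp _ SS')).
    move=> c; rewrite mem_rcons inE => /orP[/eqP ->|cs].
      by apply: ht => //; apply: close_le W'S'; exact: leq_maxl.
    have [/near_in_sub cW' _] := h2 _ SW' (close_le (leq_maxr _ _) W'S').
    exact: cW'.
  have [S1 [SS1 S1S' S1T0]] := hT0 T0 YT0 (@close_refl m T0) m.*2.+1.
  have [_ VS1] := cellS _ SS1 S1S'.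
  exists (restr H S1); split=> //; left; exists (q, t) => //.
  split; first exact: rSp.
  exists m.*2.+1 => y Yy yS1 r.
  have yT0 : wclose m y T0 by apply: (close_tri (mY _ Yy) (restr_mpts H (mSp _ SS1)) (mY _ YT0)).
  have [S2 [SS2 S2S' S2y]] := hT0 y Yy yT0 r.
  by exists S2 => //; exact: (cellS _ SS2 S2S').1.
pose Un n := if unpickle n is Some s then Xs s else Y.
have oY : wopen_in P Y Y by apply: close_wopen => // T _; exists 0%N.
have dY : dense_in P Y Y by split=> // V [VY _] [v Vv]; exists v; split=> //; exact: VY.
exists Un; split=> [n|n|y Uy]; try (by rewrite /Un; case: (unpickle n)).
have Xy s : Xs s y by have := Uy (pickle s) I; rewrite /Un pickleK.
have Yy : Y y by case: (Xy [::]) => [[c _ []]|[]].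
have W0 : Wd [::] y.
  split=> //; exists 0%N => y' Yy' _ r; have [S SS Sy] := DN y' Yy' r.
  by exists S => //; split=> //; exists 0%N.
have /choice[next hnext] : forall s, exists c, Wd s y -> adm (size s) c /\ Wd (rcons s c) y.
  move=> s; have [Wy|] := pselect (Wd s y); last by exists (0%N, [::]).
  case: (Xy s) => [[c ac Wc]|/near_in_sub]; first by exists c.
  by move=> /(_ Wy).
pose sg := fix F k := if k is k'.+1 then rcons (F k') (next (F k')) else [::].
have Wsg k : Wd (sg k) y by elim: k => //= k ih; exact: (hnext _ ih).2.
have ssg k : size (sg k) = k by elim: k => //= k ih; rewrite size_rcons ih.
pose c k := next (sg k).
have ac k : adm k (c k) by have := (hnext _ (Wsg k)).1; rewrite ssg.
have csg k j : (k < j)%N -> c k \in sg j.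
  elim: j => // j ih; rewrite ltnS leq_eqVlt /= mem_rcons inE => /orP[/eqP ->|/ih ->].
    by rewrite eqxx.
  by rewrite orbT.
have /choice[Ss hSs] : forall k, exists S, cells (sg k) S /\ wclose k (restr H S) y.
  by move=> k; have [S h1 h2] := near_in_sub (Wsg k) k; exists S.
have SSs k : Sp (Ss k) by have [[]] := hSs k.
have cSs k j : (k < j)%N -> cell (c k) (Ss j).
  by move=> /csg; have [/near_in_sub h _] := hSs j; exact: h.
have cE k : c k = ((c k).1, (c k).2) by case: (c k).
have c_le k : cell (c k) `<=` cell' (c k) by move=> W h i j ni nj; apply: ltW; exact: h.
have cells_close k S W : Sp S -> Sp W -> cell (c k) S -> cell' (c k) W ->
    forall i j, (i < k.*2.+1)%N -> (j < k.*2.+1)%N ->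
    dm (W (en i) @^-1` E j) (S (en i) @^-1` E j) < k.+1%:R^-1.
  move=> SS SW h1 h2 i j ni nj; have [h3 _] := ac k.
  have {}h1 := h1 i j (leq_trans ni h3) (leq_trans nj h3).
  have {}h2 := h2 i j (leq_trans ni h3) (leq_trans nj h3).
  have h4 : (c k).1.+1%:R^-1 <= k.+1%:R^-1 / 2 :> R.
    by rewrite -inv_nat_half; exact: inv_nat_le.
  have := @dm_tri _ _ _ P (E (idx (c k).1 (c k).2 i j)) (W (en i) @^-1` E j) (S (en i) @^-1` E j)
    (mpt_pre (mSp _ SW _) (mE _)) (mE _) (mpt_pre (mSp _ SS _) (mE _)).
  rewrite dmC in h1.
  by move: h1 h2 h4; set v := k.+1%:R^-1; set w := (c k).1.+1%:R^-1; lra.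
have [|S SS hS] := cSp Ss SSs.
  move=> n; exists n.+1 => i j ni nj a b na nb.
  by apply: (cells_close n) => //; [exact: cSs|apply: c_le; exact: cSs|lia|lia].
have cS k : cell' (c k) S.
  move=> i j ni nj; apply/ler_addgt0Pl => e e0.
  have [n1 hn1] := inv_nat_lt e0.
  have [N hN] := hS (maxn n1 (maxn i j).+1).
  pose M := maxn N k.+1.
  have h1 := hN M (leq_maxl _ _) i j; have {}h1 : dm (Ss M (en i) @^-1` E j) (S (en i) @^-1` E j) < e.
    apply: lt_le_trans (h1 _ _) _; [lia|lia|].
    by apply: le_trans (ltW hn1); apply: inv_nat_le; exact: leq_maxl.
  have h2 := cSs k M (leq_maxr _ _) i j ni nj.
  have := @dm_tri _ _ _ P (Ss M (en i) @^-1` E j) (S (en i) @^-1` E j) (E (idx (c k).1 (c k).2 i j))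
    (mpt_pre (mSp _ SS _) (mE _)) (mpt_pre (mSp _ (SSs M) _) (mE _)) (mE _).
  rewrite dmC in h1.
  by move: h1 h2; set v := (c k).1.+1%:R^-1; lra.
have OS : (\bigcap_n O n) S by move=> k _; apply: (ac k).2.
have Sy h : H h -> ae_eq P (S h) (y h).
  move=> Hh; apply: sep; [exact: mSp|exact: mY|] => j.
  have [i ih] := surj h; apply: le0_eps => [|e e0]; first exact: dm_ge0.
  have e2 : 0 < e / 2 by rewrite divr_gt0.
  have [n1 hn1] := inv_nat_lt e2.
  have [N hN] := hS (maxn n1 (maxn i j).+1).
  pose M := maxn N (maxn n1 (maxn i j).+1).
  have h1 := hN M (leq_maxl _ _) i j; have {}h1 : dm (Ss M (en i) @^-1` E j) (S (en i) @^-1` E j) < e / 2.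
    apply: lt_le_trans (h1 _ _) _; [lia|lia|].
    by apply: le_trans (ltW hn1); apply: inv_nat_le; exact: leq_maxl.
  have h2 := (hSs M).2 i j; have {}h2 : dm (Ss M (en i) @^-1` E j) (y (en i) @^-1` E j) < e / 2.
    have {}h2 : dm (restr H (Ss M) (en i) @^-1` E j) (y (en i) @^-1` E j) < M.+1%:R^-1.
      by apply: h2; rewrite /M; lia.
    have rE : restr H (Ss M) (en i) = Ss M (en i) by rewrite restrE// ih.
    rewrite rE in h2; apply: lt_le_trans h2 _.
    by apply: le_trans (ltW hn1); apply: inv_nat_le; rewrite /M; lia.
  have := @dm_tri _ _ _ P (Ss M (en i) @^-1` E j) (S (en i) @^-1` E j) (y (en i) @^-1` E j)
    (mpt_pre (mSp _ SS _) (mE _)) (mpt_pre (mSp _ (SSs M) _) (mE _)) (mpt_pre (mY _ Yy _) (mE _)).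
  by rewrite dmC ih in h1 h2 *; lra.
(* So far [S] agrees with [y] on [H] only almost everywhere; the correction on null sets is
   invisible to the open sets [O k]. *)
have [S' [SS' yS' S'S]] := fix_ S y SS Yy Sy.
exists S'; split=> // k _; have [n hn] := wopen_close mSp surj (oO k) (OS k I).
by apply: hn => //; apply: aeq_close => //; exact: mSp.
Qed.

End weak_topology.

(** * From the perturbation principle to local density of restrictions *)

Section local_density.
Context (R : realType) (d : measure_display) (X : measurableType d)
  (P : probability X R) (HX : standard_borel R X) (HP : atomless P).
Context (E : nat -> set X) (mE : forall n, measurable (E n))
  (dE : forall A, measurable A -> forall e : R, 0 < e -> exists n, dm P A (E n) < e).
Context (G : zmodType) (en : nat -> G) (surj : forall g, exists i, en i = g).
Implicit Types (A B C : set X) (K L H : set G) (S T W : G -> X -> X).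
Local Notation dm := (dm P).
Local Notation wclose := (wclose P E en).

Lemma eventually_all (n : nat) (Q : nat -> nat -> Prop) :
  (forall i, (i < n)%N -> exists N, forall k, (N <= k)%N -> Q i k) ->
  exists N, forall k, (N <= k)%N -> forall i, (i < n)%N -> Q i k.
Proof.
elim: n => [|n ih] h; first by exists 0%N.
have [|N hN] := ih; first by move=> i ni; apply: h; lia.
have [M hM] := h n (ltnSn n); exists (maxn N M) => k; rewrite geq_max => /andP[Nk Mk] i.
by rewrite ltnS leq_eqVlt => /orP[/eqP ->|]; [exact: hM|exact: hN].
Qed.

Lemma complete_actions K : is_subgroup K -> complete_in P E en (actions_on P K).
Proof.
move=> sK Ss aS cau.
have [||T aT hT] := @act_limit _ _ _ P HX G K (fun=> K) Ss sK aS.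
- by move=> a Ka; exists 0%N.
- move=> a A Ka mA e e0; have [i ia] := surj a.
  have e3 : 0 < e / 3 by rewrite divr_gt0.
  have [j hj] := dE mA e3; have [n1 hn1] := inv_nat_lt e3.
  pose n := (n1 + i + j).+1; have [N hN] := cau n; exists N => k l Nk Nl.
  have i_n : (i < n)%N by rewrite /n; lia.
  have j_n : (j < n)%N by rewrite /n; lia.
  have h1 := hN k l Nk Nl i j i_n j_n; rewrite ia in h1.
  have h2 : n.+1%:R^-1 < e / 3 by apply: le_lt_trans hn1; apply: inv_nat_le; rewrite /n; lia.
  have h3 := lt_trans h1 h2.
  have mk := act_mpt_all a (aS k); have ml := act_mpt_all a (aS l).
  have t1 := dm_tri P (mpt_pre mk mA) (mpt_pre mk (mE j)) (mpt_pre ml mA).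
  have t2 := dm_tri P (mpt_pre mk (mE j)) (mpt_pre ml (mE j)) (mpt_pre ml mA).
  have h4 := hj; rewrite -(dm_pre mk mA (mE j)) in h4.
  have h5 := hj; rewrite -(dm_pre ml mA (mE j)) dmC in h5.
  by clear h1 h2 hn1; lra.
exists T => // n.
have [N hN] : exists N, forall k, (N <= k)%N -> forall i, (i < n)%N -> forall j, (j < n)%N ->
    dm (Ss k (en i) @^-1` E j) (T (en i) @^-1` E j) < n.+1%:R^-1.
  apply: eventually_all => i ni; apply: eventually_all => j nj.
  have [Ki|nKi] := pselect (K (en i)); first exact: hT (inv_nat_gt0 _ _).
  by exists 0%N => k _; rewrite (act_off (aS k) nKi) (act_off aT nKi) dmxx inv_nat_gt0.
by exists N => k Nk i j ni nj; exact: hN.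
Qed.

Lemma extend_close K L T n : is_subgroup K -> is_subgroup L -> L `<=` K -> actions_on P L T ->
  exists2 S, actions_on P K S & forall i j, (i < n)%N -> (j < n)%N -> L (en i) ->
    dm (S (en i) @^-1` E j) (T (en i) @^-1` E j) = 0.
Proof.
move=> sK sL LK aT.
have [|S aS hS] := @extension _ _ _ P HX HP G en surj K L T [seq en i | i <- iota 0 n]
  [seq E j | j <- iota 0 n] sK sL LK aT; first by move=> B /mapP[j _ ->].
exists S => // i j ni nj Li; apply: hS => //; apply: map_f; by rewrite mem_iota.
Qed.

Lemma dense_restr_actions K H : is_subgroup K -> is_subgroup H -> H `<=` K ->
  dense_restr P E en (actions_on P K) H.
Proof.
move=> sK sH HK T aT r; have [S aS hS] := extend_close r sK sH HK aT.
exists S => // i j ri rj; have [Hi|nHi] := pselect (H (en i)).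
  by rewrite restrE// hS// inv_nat_gt0.
by rewrite restrN// (act_off aT nHi) dmxx inv_nat_gt0.
Qed.

(** [S'] is perturbed to [S], under which some [h] acts almost like [g]. Any [T] near the
    restriction of [S] is carried to the larger group by letting [g] imitate [h]. The result is
    governed by the [T (a + (h - g) *~ m)], which are close to [S a] because [S ((h - g) *~ m)] is
    almost the identity. *)
Lemma key_locally_dense H g : is_subgroup H -> key P H g ->
  locally_dense P E en (actions_on P (adjoin H g)) H.
Proof.
move=> sH kg S' n aS'; set K := adjoin H g in aS'.
have sK : is_subgroup K by exact: adjoin_subgroup.
pose Fs := [seq en i | i <- iota 0 n]; pose Es := [seq E j | j <- iota 0 n].
have mEs B : B \in Es -> measurable B by move=> /mapP[j _ ->].
pose Bs := Es ++ [seq S' a @^-1` B | a <- Fs, B <- Es].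
have mBs B : B \in Bs -> measurable B.
  rewrite mem_cat => /orP[/mEs//|/allpairsP[[a C] /= [_ /mEs mC ->]]].
  exact: act_pre aS' mC.
have [M hM] := ext_step HX HP g Fs sH.
(* Three errors of size [e] add up: [T] against [S], [S] against [S'], and the deviation of
   [S ((h - g) *~ mu)] from the identity. *)
pose e : R := n.+1%:R^-1 / 4.
have e0 : 0 < e by rewrite divr_gt0 ?inv_nat_gt0.
have [S [h [Hh aS h1 h2]]] := kg Fs Bs M e S' e0 mBs aS'.
have /choice[ix hix] := surj.
pose cs := [seq a + (h - g) *~ (i%:Z - M%:Z) | a <- Fs, i <- iota 0 (2 * M).+1].
have [n1 hn1] := inv_nat_lt e0.
pose m := (n1 + n + \max_(c <- cs) ix c).+1.
exists (restr H S), m; split; first exact: restr_actions (@sub_adjoin _ H g) aS.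
move=> T aT TS r.
pose r' := maxn r n.
pose Er := [seq E j | j <- iota 0 r']; pose Fr := [seq en i | i <- iota 0 r'].
pose Bs' := (Er ++ Bs) ++ [seq T a @^-1` B | a <- Fr, B <- Er].
have mEr B : B \in Er -> measurable B by move=> /mapP[j _ ->].
have mBs' B : B \in Bs' -> measurable B.
  rewrite !mem_cat => /orP[/orP[/mEr//|]|]; first by rewrite -mem_cat; exact: mBs.
  by move=> /allpairsP[[a C] /= [_ /mEr mC ->]]; exact: act_pre aT mC.
have [S2 [aS2 hS2 hS2']] := hM T h Bs' aT Hh mBs'.
have inEr j : (j < r')%N -> E j \in Er by move=> jr; apply: map_f; rewrite mem_iota.
have inFr i : (i < r')%N -> en i \in Fr by move=> ir; apply: map_f; rewrite mem_iota.
exists S2; split=> //; last first.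
  move=> i j ir jr; have [Hi|nHi] := pselect (H (en i)); last first.
    by rewrite restrN// (act_off aT nHi) dmxx inv_nat_gt0.
  have ir' : (i < r')%N by rewrite /r'; lia.
  have jr' : (j < r')%N by rewrite /r'; lia.
  rewrite restrE// hS2//.
  - by rewrite dmxx inv_nat_gt0.
  - by rewrite !mem_cat inEr.
  - by rewrite !mem_cat; apply/orP; right; apply/allpairsP; exists (en i, E j); rewrite inFr ?inEr.
move=> i j ni nj; have [Ki|nKi] := pselect (K (en i)); last first.
  by rewrite (act_off aS2 nKi) (act_off aS' nKi) dmxx inv_nat_gt0.
have iF : en i \in Fs by apply: map_f; rewrite mem_iota.
have jE : E j \in Es by apply: map_f; rewrite mem_iota.
set C := S' (en i) @^-1` E j.
have CB : C \in Bs.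
  by rewrite mem_cat; apply/orP; right; apply/allpairsP; exists (en i, E j).
have jB : E j \in Bs by rewrite mem_cat jE.
have mC := mBs _ CB.
apply: (@le_lt_trans _ _ (e + e + e)); last first.
  by move: (inv_nat_gt0 R n); rewrite /e; set v := n.+1%:R^-1; lra.
apply: hS2' => //.
- by rewrite !mem_cat inEr//; rewrite /r'; lia.
- by rewrite mem_cat; apply/orP; left; rewrite mem_cat CB orbT.
move=> mu muM; set c := en i + _ => Hc.
have ccs : c \in cs.
  apply/allpairsP; exists (en i, absz (mu + M%:Z)); split; [exact: iF|by rewrite [(_, _).2]/= mem_iota; lia|].
  rewrite /c [(_, _).1]/= [(_, _).2]/=; congr (_ + _ *~ _); move: muM; lia.
have mEj := mE j.
have sT : dm (T c @^-1` E j) (S c @^-1` E j) < e.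
  have ixm : (ix c < m)%N.
    have : (ix c <= \max_(c <- cs) ix c)%N by apply: leq_bigmax_seq.
    by rewrite /m; lia.
  have jm : (j < m)%N by rewrite /m; lia.
  have := TS (ix c) j ixm jm; rewrite hix restrE// => h3; apply: lt_trans h3 _; apply: le_lt_trans hn1; apply: inv_nat_le; rewrite /m; lia.
have Kmu : K ((h - g) *~ mu).
  apply: subgroupMz => //; apply: subgroupB => //; [exact: sub_adjoin|exact: adjoin_gen].
have ma := act_mpt aS Ki; have mm := act_mpt aS Kmu.
have mc := act_mpt_all c aS; have mTc := act_mpt_all c aT.
have z := ae_eq_dm0 mc (mpt_comp ma mm) (actD aS Ki Kmu) mEj.
have mSE := mpt_pre ma mEj.
have z1 : dm ((S (en i) \o S ((h - g) *~ mu)) @^-1` E j) (S ((h - g) *~ mu) @^-1` C) =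
    dm (S (en i) @^-1` E j) C := dm_pre mm mSE mC.
have z2 := h1 _ _ _ iF Ki jB CB; rewrite dmxx add0r in z2.
have z3 := h2 _ _ muM CB.
have mcE := mpt_pre mc mEj; have mmC := mpt_pre mm mC.
have mcomp := mpt_pre (mpt_comp ma mm) mEj.
have t1 := dm_tri P (mpt_pre mTc mEj) mcE mC.
have t2 := dm_tri P mcE mcomp mC.
have t3 := dm_tri P mcomp mmC mC.
lra.
Qed.

Lemma locally_dense_refl H : locally_dense P E en (actions_on P H) H.
Proof.
move=> S' n aS'; exists S', n; split=> // T aT TS r; exists T; split=> //.
move=> i j _ _; have [Hi|nHi] := pselect (H (en i)).
  by rewrite restrE// dmxx inv_nat_gt0.
by rewrite restrN// (act_off aT nHi) dmxx inv_nat_gt0.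
Qed.

Lemma locally_dense_trans K L H : is_subgroup H -> is_subgroup L -> H `<=` L -> L `<=` K ->
  locally_dense P E en (actions_on P K) L -> locally_dense P E en (actions_on P L) H ->
  locally_dense P E en (actions_on P K) H.
Proof.
move=> sH sL HL LK d1 d2 S' n aS'.
have [T1 [m1 [aT1 h1]]] := d1 S' n aS'.
have [T0 [m0 [aT0 h0]]] := d2 T1 m1 aT1.
exists T0, m0; split=> // T aT TT0 r.
have [S1 [aS1 S1T1 S1T]] := h0 T aT TT0 r.*2.+1.
have [S [aS SS' SS1]] := h1 S1 aS1 S1T1 r.*2.+1.
exists S; split=> //.
have rE : restr H (restr L S) = restr H S.
  apply/funext => g; rewrite /restr; case: asboolP => // Hg.
  by case: asboolP => // /(_ (HL _ Hg)).
apply: (close_tri mE (T := restr H S1)) S1T.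
- by apply: restr_mpts; exact: act_mpts aS.
- by apply: restr_mpts; exact: act_mpts aS1.
- exact: act_mpts aT.
- by rewrite -rE; exact: restr_close.
Qed.

Lemma locally_dense_adjoins H l : is_subgroup H ->
  (forall g H', g \in l -> is_subgroup H' -> H `<=` H' -> H' `<=` adjoins H l -> key P H' g) ->
  locally_dense P E en (actions_on P (adjoins H l)) H.
Proof.
move=> sH; elim: l => [|g l ih] hk /=; first exact: locally_dense_refl.
have sL := adjoins_subgroup l sH.
apply: (@locally_dense_trans _ (adjoins H l)) => //.
- exact: sub_adjoins.
- exact: sub_adjoin.
- apply: key_locally_dense => //; apply: hk => //; first by rewrite inE eqxx.
    exact: sub_adjoins.
  exact: sub_adjoin.
- apply: ih => g' H' gl sH' HH' H'L; apply: hk => //; first by rewrite inE gl orbT.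
  by move=> x /H'L; exact: sub_adjoin.
Qed.

(** A ball sees finitely many elements, so it is enough to adjoin those; [extend_close] then carries
    the action to [K] without changing what the ball sees. *)
Lemma locally_dense_union K H : is_subgroup K -> is_subgroup H -> H `<=` K ->
  (forall n, exists l, [/\ adjoins H l `<=` K, forall i, (i < n)%N -> K (en i) -> adjoins H l (en i)
     & locally_dense P E en (actions_on P (adjoins H l)) H]) ->
  locally_dense P E en (actions_on P K) H.
Proof.
move=> sK sH HK hl S' n aS'; have [l [lK nl ld]] := hl n.
set L := adjoins H l in lK nl ld.
have sL : is_subgroup L by exact: adjoins_subgroup.
have aS'L : actions_on P L (restr L S') by exact: restr_actions aS'.
have [T0 [m [aT0 h0]]] := ld _ n aS'L.
exists T0, m; split=> // T aT TT0 r.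
have [S1 [aS1 S1S' S1T]] := h0 T aT TT0 r.
have [S aS hS] := extend_close (maxn n r) sK sL lK aS1.
exists S; split=> //.
  move=> i j ni nj; have [Ki|nKi] := pselect (K (en i)); last first.
    by rewrite (act_off aS nKi) (act_off aS' nKi) dmxx inv_nat_gt0.
  have Li := nl i ni Ki; have := S1S' i j ni nj; rewrite restrE//.
  apply: le_lt_trans; apply: le_trans (dm_tri P _ (act_pre (en i) aS1 (mE j)) _) _.
  - exact: act_pre aS _.
  - exact: act_pre aS' _.
  - by rewrite hS ?add0r//; lia.
move=> i j ir jr; have [Hi|nHi] := pselect (H (en i)); last first.
  by rewrite restrN// (act_off aT nHi) dmxx inv_nat_gt0.
have Li : L (en i) by exact: sub_adjoins.
have := S1T i j ir jr; rewrite !restrE//.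
apply: le_lt_trans; apply: le_trans (dm_tri P _ (act_pre (en i) aS1 (mE j)) _) _.
- exact: act_pre aS _.
- exact: act_pre aT _.
- by rewrite hS ?add0r//; lia.
Qed.

Lemma locally_dense_keys K H : is_subgroup K -> is_subgroup H -> H `<=` K ->
  (forall g H', is_subgroup H' -> H `<=` H' -> H' `<=` K -> K g -> key P H' g) ->
  locally_dense P E en (actions_on P K) H.
Proof.
move=> sK sH HK hk; apply: locally_dense_union => // n.
pose l := [seq (if `[< K (en i) >] then en i else 0) | i <- iota 0 n].
have lK : adjoins H l `<=` K.
  apply: adjoins_min => // g /mapP[i _ ->]; case: asboolP => // _; exact: subgroup0.
exists l; split=> //.
  move=> i ni Ki; apply: adjoins_gen => //; apply/mapP; exists i; first by rewrite mem_iota.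
  by rewrite asboolT.
apply: locally_dense_adjoins => // g H' gl sH' HH' H'l; apply: hk => //.
  by move=> x /H'l /lK.
by apply: lK; exact: adjoins_gen.
Qed.

End local_density.

(** * Category properties of the restriction map *)

Section category.
Context (R : realType) (d : measure_display) (X : measurableType d)
  (P : probability X R) (HX : standard_borel R X) (HP : atomless P).
Context (E : nat -> set X) (mE : forall n, measurable (E n))
  (dE : forall A, measurable A -> forall e : R, 0 < e -> exists n, dm P A (E n) < e).
Local Notation dm := (dm P).

Lemma separation (a b : X -> X) : mpt P a -> mpt P b ->
  (forall j, dm (a @^-1` E j) (b @^-1` E j) = 0) -> ae_eq P a b.
Proof.
move=> ma mb h; have [f [mf inj fimg]] := HX.
apply: (aeq_dm0 mf inj ma.1 mb.1) => A mA; apply: le0_eps => [|e e0]; first exact: dm_ge0.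
have e2 : 0 < e / 2 by rewrite divr_gt0.
have [j hj] := dE mA e2.
have t1 := dm_tri P (mpt_pre ma mA) (mpt_pre ma (mE j)) (mpt_pre mb mA).
have t2 := dm_tri P (mpt_pre ma (mE j)) (mpt_pre mb (mE j)) (mpt_pre mb mA).
have h4 := hj; rewrite -(dm_pre ma mA (mE j)) in h4.
have h5 := hj; rewrite -(dm_pre mb mA (mE j)) dmC in h5.
have := h j; lra.
Qed.

Lemma aeq_actions (G : zmodType) (K : set G) (S S' : G -> X -> X) : is_subgroup K ->
  actions_on P K S -> mpts P S' -> (forall g, ae_eq P (S' g) (S g)) ->
  (forall g, ~ K g -> S' g = id) -> actions_on P K S'.
Proof.
move=> sK aS mS' hS off.
have -> : S' = restr K S'.
  by apply/funext => g; rewrite /restr; case: asboolP => // /off.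
apply: actions_onI => //.
- exact: aeq_trans (hS 0) (act0 aS).
- move=> k l Kk Kl; apply: (aeq_trans (hS _)); apply: (aeq_trans (actD aS Kk Kl)).
  by apply: aeq_comp; [exact: act_mpt aS Kl|apply: aeq_sym; exact: hS|apply: aeq_sym; exact: hS].
Qed.

Section ambient.
Context (G : zmodType) (en : nat -> G) (surj : forall g, exists i, en i = g).
Implicit Types (K L H : set G) (S T W : G -> X -> X) (Sp U V : set (G -> X -> X)).

(** What the category arguments require of a space of ambient actions. It applies both to
    [Omega P G] and to the actions pulled back from a quotient; the third clause is the correction
    on null sets. *)
Definition admissible Sp H := [/\ Sp `<=` Omega P G,
  complete_in P E en Sp,
  forall S y, Sp S -> actions_on P H y -> (forall h, H h -> ae_eq P (S h) (y h)) ->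
     exists S', [/\ Sp S', restr H S' = y & forall g, ae_eq P (S' g) (S g)],
  locally_dense P E en Sp H & dense_restr P E en Sp H].

Lemma subgroupT : is_subgroup [set: G]. Proof. by []. Qed.

Lemma admissible_residual Sp H (O : nat -> set (G -> X -> X)) : is_subgroup H ->
  admissible Sp H ->
  (forall n, wopen_in P Sp (O n)) -> (forall n, dense_in P Sp (O n)) ->
  exists U : nat -> set (G -> X -> X), [/\ forall n, wopen_in P (actions_on P H) (U n),
    forall n, dense_in P (actions_on P H) (U n) &
    forall y, (\bigcap_n U n) y -> exists S, [/\ Sp S, (\bigcap_n O n) S & restr H S = y]].
Proof.
move=> sH [SpO cSp fx ld dr] oO dO.
apply: (@residual_image _ _ _ P E mE dE G en Sp H O) => //.
- by move=> S /SpO; exact: act_mpts.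
- exact: complete_actions.
- by move=> S /SpO; exact: restr_actions.
- exact: separation.
Qed.

Lemma admissible_contains Sp H : is_subgroup H -> admissible Sp H ->
  contains_dense_Gdelta P (actions_on P H) (restr H @` Omega P G).
Proof.
move=> sH adm; have [SpO _ _ _ _] := adm.
have mSp S : Sp S -> mpts P S by move=> /SpO; exact: act_mpts.
have oSp : wopen_in P Sp Sp by apply: (@close_wopen _ _ _ P E mE _ en) => // T _; exists 0%N.
have dSp : dense_in P Sp Sp.
  by split=> // V [VY _] [v Vv]; exists v; split=> //; exact: VY.
have [|//|U [oU dU hU]] := @admissible_residual Sp H (fun=> Sp) sH adm.
  by [].
exists (\bigcap_n U n); split.
- by exists U.
- apply: (@baire _ _ _ P E mE dE G en) => //; first by move=> S; exact: act_mpts.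
  exact: complete_actions.
- by move=> y /hU[S [SS _ <-]]; exists S => //; exact: SpO.
Qed.

(** Restrictions of an open set of actions are dense in some ball, so nowhere dense sets pull back
    to nowhere dense sets. Conversely the image of a comeagre set is comeagre by
    [admissible_residual], so a set with meagre preimage is meagre. *)
Lemma admissible_ess_cat Sp H : is_subgroup H -> admissible Sp H ->
  ess_cat_preserving P (restr H) Sp (actions_on P H).
Proof.
move=> sH adm; have [SpO cSp fx ld dr] := adm; set Y := actions_on P H.
have mSp S : Sp S -> mpts P S by move=> /SpO; exact: act_mpts.
have mY y : Y y -> mpts P y by exact: act_mpts.
have rSp S : Sp S -> Y (restr H S) by move=> /SpO; exact: restr_actions.
split.
  move=> A [ASp nA]; split; first by move=> _ [S /ASp SS <-]; exact: rSp.
  move=> [N [hN AN]]; apply: nA.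
  exists (fun n => Sp `&` restr H @^-1` N n); split; last first.
    move=> S AS; have [n _ Nn] := AN _ (imageP (restr H) AS).
    by exists n => //; split => //; exact: ASp.
  move=> n U oU [S' US']; have USp : U `<=` Sp by case: oU.
  have [n0 hn0] := wopen_close mE dE mSp surj oU US'.
  have [T0 [m [aT0 hT0]]] := ld S' n0 (USp _ US').
  have [V [oV [T VT] VB VN]] := hN n _ (near_in_wopen mE en (fun T => wclose P E en m T T0) mY)
    (ex_intro _ T0 (ball_near P E en m aT0)).
  have YT : Y T by have [VY _] := oV; exact: VY.
  have [r hr] := wopen_close mE dE mY surj oV VT.
  have [S [SS SS' ST]] := hT0 T YT (near_in_sub (VB _ VT)) r.
  exists (U `&` restr H @^-1` V); split.
  - apply: (@close_wopen _ _ _ P E mE _ en) => //; first by move=> W [/USp].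
    move=> W [UW VW].
    have [n1 h1] := wopen_close mE dE mSp surj oU UW.
    have [n2 h2] := wopen_close mE dE mY surj oV VW.
    exists (maxn n1 n2) => W' SW' WW'; split.
      by apply: h1 => //; apply: close_le WW'; exact: leq_maxl.
    apply: h2; first exact: rSp.
    by apply: restr_close; apply: close_le WW'; exact: leq_maxr.
  - by exists S; split; [exact: hn0|apply: hr => //; exact: rSp].
  - by move=> W [].
  - apply/seteqP; split=> W // [[_ VW] [_ NW]].
    have : (V `&` N n) (restr H W) by split.
    by rewrite VN.
move=> B [BY nB]; split; first exact: subIsetl.
move=> [N [hN BN]]; apply: nB.
pose O n := near_in P E en Sp (~` N n).
have oO n : wopen_in P Sp (O n) by exact: near_in_wopen.
have dO n : dense_in P Sp (O n).
  split=> [|U oU U0]; first by move=> S [].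
  have [V [oV [S VS] VU VN]] := hN n U oU U0.
  have VSp : V `<=` Sp by case: oV.
  exists S; split; last exact: VU.
  split; first exact: VSp.
  have [r hr] := wopen_close mE dE mSp surj oV VS.
  exists r => W SW WS NW; have : (V `&` N n) W by split=> //; exact: hr.
  by rewrite VN.
have [U [oU dU hU]] := admissible_residual sH adm oO dO.
exists (fun n => Y `\` U n); split; last first.
  move=> y By; apply: contrapT => ny.
  have [S [SS OS Sy]] : exists S, [/\ Sp S, (\bigcap_n O n) S & restr H S = y].
    apply: hU => n _; apply: contrapT => nU; apply: ny; exists n => //.
    by split=> //; exact: BY.
  have [n _ NS] : (\bigcup_n N n) S by apply: BN; split=> //=; rewrite Sy.
  by have := near_in_sub (OS n I); apply.
move=> n V oV V0; exists (V `&` U n); have VY : V `<=` Y by case: oV.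
split.
- apply: (@close_wopen _ _ _ P E mE _ en) => //; first by move=> W [/VY].
  move=> W [VW UW].
  have [n1 h1] := wopen_close mE dE mY surj oV VW.
  have [n2 h2] := wopen_close mE dE mY surj (oU n) UW.
  exists (maxn n1 n2) => W' SW' WW'; split.
    by apply: h1 => //; apply: close_le WW'; exact: leq_maxl.
  by apply: h2 => //; apply: close_le WW'; exact: leq_maxr.
- by have [y [Uy Vy]] := (dU n).2 V oV V0; exists y.
- by move=> y [].
- by apply/seteqP; split=> y // [[_ Uy] [_]].
Qed.

(** Exchanging the representatives on [H] for those of [y] changes nothing modulo null sets, so the
    group law persists. *)
Lemma aeq_fix K H S y : is_subgroup K -> H `<=` K -> actions_on P K S -> actions_on P H y ->
  (forall h, H h -> ae_eq P (S h) (y h)) ->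
  exists S', [/\ actions_on P K S', restr H S' = y & forall g, ae_eq P (S' g) (S g)].
Proof.
move=> sK HK aS ay hSy.
pose S' g := if `[< H g >] then y g else S g.
have S'S g : ae_eq P (S' g) (S g).
  rewrite /S'; case: asboolP => Hg; [by apply: aeq_sym; exact: hSy|exact: aeq_refl].
exists S'; split=> //.
- apply: (aeq_actions sK aS _ S'S).
    move=> k; rewrite /S'; case: asboolP => _; [exact: act_mpt_all ay|exact: act_mpt_all aS].
  move=> g nK; rewrite /S'; case: asboolP => [/HK//|_]; exact: act_off aS nK.
- apply/funext => g; rewrite /restr /S'; case: asboolP => // nH.
  by rewrite (act_off ay nH).
Qed.

Lemma admissible_Omega H : is_subgroup H ->
  (forall g H', is_subgroup H' -> H `<=` H' -> key P H' g) ->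
  admissible (Omega P G) H.
Proof.
move=> sH hk; split=> //.
- exact: complete_actions.
- by move=> S y aS ay; exact: aeq_fix.
- by apply: locally_dense_keys => // g H' sH' HH' _ _; exact: hk.
- exact: dense_restr_actions.
Qed.

End ambient.

(** * Actions pulled back from a quotient *)

Section quotient.
Context (G Q : zmodType) (en : nat -> G) (surj : forall g, exists i, en i = g).
Context (phi : G -> Q) (phiD : forall x y, phi (x + y) = phi x + phi y)
  (phi_surj : forall q, exists g, phi g = q) (H : set G) (sH : is_subgroup H)
  (phi_inj : forall x, H x -> phi x = 0 -> x = 0).
Local Notation enQ := (phi \o en).
Local Notation Sp := (pullback (X:=X) phi @` Omega P Q).

Lemma phi0 : phi 0 = 0.
Proof. by apply: (hom_on0 (subgroupT G)). Qed.

Lemma phiN x : phi (- x) = - phi x.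
Proof. by apply: (hom_onN (subgroupT G)). Qed.

Lemma phi_injH x y : H x -> H y -> phi x = phi y -> x = y.
Proof.
move=> Hx Hy xy; apply/eqP; rewrite -subr_eq0; apply/eqP/phi_inj; first exact: subgroupB.
by rewrite phiD phiN xy subrr.
Qed.

Lemma enQ_surj : forall q, exists i, enQ i = q.
Proof.
by move=> q; have [g <-] := phi_surj q; have [i <-] := surj g; exists i.
Qed.

Lemma image_subgroup : is_subgroup (phi @` H).
Proof.
split; first by exists 0; [exact: subgroup0|exact: phi0].
move=> _ _ [x Hx <-] [y Hy <-]; exists (x - y); first exact: subgroupB.
by rewrite phiD phiN.
Qed.

Lemma pullback_Omega S : Omega P Q S -> Omega P G (pullback phi S).
Proof.
move=> aS; have := @pull_action _ _ _ P Q G [set: G] [set: Q] S phi (subgroupT G) aS.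
move=> /(_ (fun _ _ => I) (fun x y _ _ => phiD x y)).
suff -> : restr [set: G] (S \o phi) = pullback phi S by [].
by apply/funext => g; rewrite restrE.
Qed.

(** [phi] is injective on [H], so actions of [H] correspond to actions of its image through [hat],
    and each clause is transported from [Omega P Q]. *)
Lemma admissible_pullback :
  locally_dense P E enQ (Omega P Q) (phi @` H) -> admissible en Sp H.
Proof.
set H' := phi @` H => ldQ.
have sH' : is_subgroup H' by exact: image_subgroup.
have sT := subgroupT Q.
have drQ : dense_restr P E enQ (Omega P Q) H'.
  exact: (dense_restr_actions HX HP mE enQ_surj).
have cQ : complete_in P E enQ (Omega P Q) by exact: complete_actions enQ_surj _ sT.
have /choice[psi hpsi] : forall q, exists h, H' q -> H h /\ phi h = q.
  move=> q; have [[h Hh <-]|no] := pselect (H' q); first by exists h.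
  by exists 0.
have psiH q : H' q -> H (psi q) by move=> /hpsi[].
have psiK h : H h -> psi (phi h) = h.
  by move=> Hh; have [|h1 h2] := hpsi (phi h); [exists h|exact: phi_injH].
have psiD q q' : H' q -> H' q' -> psi (q + q') = psi q + psi q'.
  move=> hq hq'; have hqq := subgroupD sH' hq hq'.
  have [h1 h2] := hpsi _ hq; have [h3 h4] := hpsi _ hq'; have [h5 h6] := hpsi _ hqq.
  by apply: phi_injH => //; [exact: subgroupD|rewrite phiD h2 h4 h6].
pose hat (T : G -> X -> X) := restr H' (T \o psi).
have hatA T : actions_on P H T -> actions_on P H' (hat T).
  by move=> aT; exact: pull_action sH' aT psiH psiD.
have restr_pull T : actions_on P H' T -> actions_on P H (restr H (pullback phi T)).
  move=> aT; apply: (@pull_action _ _ _ P Q G H H' T phi sH aT).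
    by move=> h Hh; exists h.
  by move=> x y _ _; exact: phiD.
have push S T r : wclose P E enQ r (restr H' S) (hat T) -> actions_on P H T ->
    wclose P E en r (restr H (pullback phi S)) T.
  move=> h aT i j ri rj; have [Hi|nHi] := pselect (H (en i)); last first.
    by rewrite restrN// (act_off aT nHi) dmxx inv_nat_gt0.
  have H'i : H' (phi (en i)) by exists (en i).
  by have := h i j ri rj; rewrite /= /hat !restrE//= psiK.
split.
- by move=> _ [S /pullback_Omega ? <-].
- move=> Ss hSs cau.
  have /choice[Qs hQs] : forall k, exists S, Omega P Q S /\ pullback phi S = Ss k.
    by move=> k; have [S h1 h2] := hSs k; exists S.
  have [||S aS hS] := cQ Qs.
  + by move=> k; case: (hQs k).
  + move=> n; have [N hN] := cau n; exists N => i j Ni Nj.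
    by have := hN i j Ni Nj; rewrite -(hQs i).2 -(hQs j).2.
  + exists (pullback phi S); first by exists S.
    by move=> n; have [N hN] := hS n; exists N => i /hN; rewrite -(hQs i).2.
- move=> _ y [S aS <-] ay hSy.
  have [||S' [aS' S'y S'S]] := @aeq_fix Q [set: Q] H' S (hat y) sT _ aS (hatA _ ay).
  + by [].
  + move=> _ [h Hh <-]; rewrite /hat restrE; last by exists h.
    by rewrite /= psiK//; exact: hSy.
  + exists (pullback phi S'); split; first by exists S'.
      apply/funext => g; rewrite /restr; case: asboolP => Hg; last by rewrite (act_off ay Hg).
      have := congr1 (fun f => f (phi g)) S'y; rewrite /hat /= !restrE//=; last by exists g.
        by rewrite psiK.
      by exists g.
    by move=> g; exact: S'S.
- move=> _ n [S' aS' <-]; have [T0 [m [aT0 hT0]]] := ldQ S' n aS'.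
  have /choice[ix hix] := surj.
  (* The enumerations differ: a ball of actions of the image involves the elements [psi (enQ i)],
     whose indices under [en] must be below the new bound. *)
  pose m' := (m + \max_(i < m) ix (psi (enQ i))).+1.
  exists (restr H (pullback phi T0)), m'; split; first exact: restr_pull.
  move=> T aT TT0 r.
  have [|S [aS SS' ST]] := hT0 (hat T) (hatA _ aT) _ r.
    move=> i j mi mj; have [Hi|nHi] := pselect (H' (enQ i)); last first.
      by rewrite /hat restrN// (act_off aT0 nHi) dmxx inv_nat_gt0.
    have i' : (ix (psi (enQ i)) < m')%N.
      by have := leq_bigmax (F := fun i : 'I_m => ix (psi (enQ i))) (Ordinal mi); rewrite /m' /=; lia.
    have j' : (j < m')%N by rewrite /m'; lia.
    have := TT0 _ j i' j'; rewrite hix restrE; last exact: psiH.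
    rewrite /pullback (hpsi _ Hi).2 /hat restrE// => h.
    by apply: lt_le_trans h _; apply: inv_nat_le; rewrite /m'; lia.
  exists (pullback phi S); split; first by exists S.
    exact: SS'.
  exact: push.
- move=> T aT r; have [S aS hS] := drQ (hat T) (hatA _ aT) r.
  by exists (pullback phi S); [exists S|exact: push].
Qed.

End quotient.
End category.

(** * Finite subgroups *)
Section equivariant_maps.
Context (R : realType) (d : measure_display) (X : measurableType d)
  (P : probability X R) (HX : standard_borel R X) (HP : atomless P).
Context (G : zmodType).
Implicit Types (A B C D : set X) (K L H : set G) (S T W : G -> X -> X).
Local Notation Pr := (Pr P).
Local Notation dm := (dm P).

Lemma finite_enum H a : finite_set H -> H a ->
  exists (n : nat) (kap : 'I_n.+1 -> G), [/\ forall t, H (kap t), injective kap &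
    forall h, H h -> exists t, kap t = h].
Proof.
move=> /finite_seqP[s sE] Ha; pose u := undup s.
have memu h : H h <-> h \in u by rewrite mem_undup sE.
have u0 : (0 < size u)%N.
  by have /memu := Ha; case: u {memu}.
exists (size u).-1, (fun t => nth 0 u t); split.
- by move=> t; apply/memu; rewrite mem_nth//; have := ltn_ord t; have := prednK u0; lia.
- move=> i j /eqP; rewrite nth_uniq ?undup_uniq//; last 2 first.
  + by have := ltn_ord i; have := prednK u0; lia.
  + by have := ltn_ord j; have := prednK u0; lia.
  by move=> /eqP/val_inj.
- move=> h /memu hu; have hi : (index h u < (size u).-1.+1)%N by rewrite prednK// index_mem.
  by exists (Ordinal hi); rewrite /= nth_index.
Qed.

Lemma measurable_bool_label (J : finType) (A : J -> set X) (v : {ffun J -> bool}) :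
  (forall t, measurable (A t)) -> measurable [set x | [ffun t => `[< A t x >]] = v].
Proof.
move=> mA; rewrite (_ : [set x | _] =
    \bigcap_(k in [set: J]) if v k then A k else ~` A k).
  by apply: fin_bigcap_measurable => // k _; case: ifP => _; last apply: measurableC.
apply/seteqP; split=> x /=.
  by move=> <- k _; rewrite ffunE; case: ifPn => /asboolP.
move=> h; apply/ffunP => k; rewrite ffunE; have := h k I.
by case: (v k) => ?; apply/asboolP.
Qed.

Lemma Pr_sum_disjoint (J : eqType) (s : seq J) (A : J -> set X) : uniq s ->
  (forall i, measurable (A i)) ->
  (forall i j, i \in s -> j \in s -> i != j -> \forall x \ae P, ~ (A i x /\ A j x)) ->
  measurable [set x | exists2 i, i \in s & A i x] /\
  Pr [set x | exists2 i, i \in s & A i x] = \sum_(i <- s) Pr (A i).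
Proof.
move=> us mA; elim: s us => [_ _|j s ih /= /andP[js us] dis].
  rewrite big_nil (_ : [set x | _] = set0) ?Pr0//.
  by apply/seteqP; split=> x // [].
have [|mU PU] := ih us.
  by move=> i k si sk; apply: dis; rewrite inE ?si ?sk orbT.
have E : [set x | exists2 i, i \in j :: s & A i x] =
    A j `|` [set x | exists2 i, i \in s & A i x].
  apply/seteqP; split=> x.
    by move=> [i]; rewrite inE => /orP[/eqP ->|si Ai]; [left|right; exists i].
  by move=> [Aj|[i si Ai]]; [exists j|exists i] => //; rewrite inE ?eqxx// si orbT.
split; first by rewrite E; exact: measurableU.
rewrite E big_cons -PU; set U := [set x | _] in mU *.
have mD : measurable (U `\` A j) by exact: measurableD.
have -> : A j `|` U = A j `|` (U `\` A j) by rewrite setDE setUIr setUv setIT.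
rewrite PrU//; last by apply/seteqP; split=> x // [? []].
congr (_ + _); apply: Pr_eq_ae => //.
have : \forall x \ae P, forall n, if (n < size s)%N then ~ (A j x /\ A (nth j s n) x) else True.
  apply: ae_foralln => n; case: ltnP => ns; last by apply: aeW.
  apply: dis; rewrite ?inE ?eqxx ?mem_nth ?orbT//.
  by apply: contraNneq js => ->; exact: mem_nth.
apply: filterS => x h; split; first by case.
move=> [i si Ai]; split; first by exists i.
by move=> Aj; have := h (index i s); rewrite index_mem si nth_index//; apply.
Qed.

(** A factor map onto [H] acting on itself by translation; equivalently, the fibre over 0 is a
    fundamental domain. *)
Definition equivariant H T (b : X -> G) := [/\ forall x, H (b x),
  forall g, measurable (b @^-1` [set g]) & forall a, H a -> \forall x \ae P, b (T a x) = b x + a].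

Section finite_group.
Context (H : set G) (sH : is_subgroup H) (n : nat) (kap : 'I_n.+1 -> G)
  (kapH : forall t, H (kap t)) (kap_inj : injective kap)
  (kap_surj : forall h, H h -> exists t, kap t = h).

Lemma ae_forallH (Q : G -> X -> Prop) : (forall h, H h -> \forall x \ae P, Q h x) ->
  \forall x \ae P, forall h, H h -> Q h x.
Proof.
move=> h; have : \forall x \ae P, forall t, Q (kap t) x by apply: filter_forall => t; exact: h.
by apply: filterS => x hx _ /kap_surj[t <-].
Qed.

Lemma sum_equivariant T b A : actions_on P H T -> equivariant H T b -> measurable A ->
  Pr A = \sum_(t < n.+1) Pr (b @^-1` [set 0] `&` T (kap t) @^-1` A).
Proof.
move=> aT [bH mb hb] mA.
have /choice[l hl] : forall x, exists t, kap t = b x by move=> x; exact: kap_surj.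
have lE t : l @^-1` [set t] = b @^-1` [set kap t].
  by apply/seteqP; split=> x /= => [<-|]; rewrite -hl// => /kap_inj.
have ml t : measurable (l @^-1` [set t]) by rewrite lE.
rewrite (Pr_fibers P ml mA); apply: eq_bigr => t _; rewrite lE.
have mT := act_mpt aT (kapH t).
have mAb : measurable (A `&` b @^-1` [set kap t]) by exact: measurableI.
rewrite -(Pr_pre mT mAb); apply: Pr_eq_ae.
- exact: mpt_pre mT mAb.
- by apply: measurableI => //; exact: mpt_pre mT mA.
- apply: filterS (hb _ (kapH t)) => x; rewrite /preimage/= => ->.
  by split=> [[? /eqP]|[-> ?]]; [rewrite -subr_eq0 addrK => /eqP|rewrite add0r].
Qed.

(** An isomorphism [w] of the two fundamental domains has a unique equivariant extension: move the
    point into the domain, apply [w], and move back by the same group element. *)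
Lemma equivariant_conj S T b b' : actions_on P H S -> actions_on P H T ->
  equivariant H S b -> equivariant H T b' ->
  exists f f' : X -> X, [/\ mpt P f, mpt P f', ae_eq P (f' \o f) id, ae_eq P (f \o f') id &
    forall a, H a -> ae_eq P (f \o S a) (T a \o f)].
Proof.
have sum1 U c : actions_on P H U -> equivariant H U c -> n.+1%:R * Pr (c @^-1` [set 0]) = 1.
  move=> aU ec; rewrite -[RHS](PrT P) (sum_equivariant aU ec measurableT).
  under eq_bigr do rewrite preimage_setT setIT.
  by rewrite sumr_const card_ord mulr_natl.
(* One direction of the construction; the inverse is the same construction with the roles of the two
   actions exchanged. *)
have half U V c c' w w' : actions_on P H U -> actions_on P H V -> equivariant H U c ->
    equivariant H V c' -> measurable_fun setT w -> measurable_fun setT w' ->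
    (\forall x \ae P, c x = 0 -> c' (w x) = 0 /\ w' (w x) = x) ->
    (forall A, measurable A -> Pr (c @^-1` [set 0] `&` w @^-1` A) * Pr (c' @^-1` [set 0]) =
       Pr (c @^-1` [set 0]) * Pr (c' @^-1` [set 0] `&` A)) ->
    let f x := V (c x) (w (U (- c x) x)) in let f' x := U (c' x) (w' (V (- c' x) x)) in
    [/\ mpt P f, ae_eq P (f' \o f) id & forall a, H a -> ae_eq P (f \o U a) (V a \o f)].
  move=> aU aV eU eV mw mw' hw lw f f'.
  have [cH mc hc] := eU; have [c'H mc' hc'] := eV.
  have D0 : Pr (c @^-1` [set 0]) != 0.
    by apply/eqP => h0; have := sum1 U c aU eU; rewrite h0 mulr0 => /eqP; rewrite eq_sym oner_eq0.
  have DD : Pr (c @^-1` [set 0]) = Pr (c' @^-1` [set 0]).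
    have n0 : n.+1%:R != 0 :> R by rewrite pnatr_eq0.
    by apply: (mulfI n0); rewrite (sum1 U)// (sum1 V).
  have lw' A : measurable A -> Pr (c @^-1` [set 0] `&` w @^-1` A) = Pr (c' @^-1` [set 0] `&` A).
    by move=> mA; apply: (mulIf D0); rewrite {1}DD lw// mulrC.
  have mUk k : mpt P (U k) by exact: act_mpt_all aU.
  have mVk k : mpt P (V k) by exact: act_mpt_all aV.
  have /choice[l hl] : forall x, exists t, kap t = c x by move=> x; exact: kap_surj.
  have lE t : l @^-1` [set t] = c @^-1` [set kap t].
    by apply/seteqP; split=> x /= => [<-|]; rewrite -hl// => /kap_inj.
  have ml t : measurable (l @^-1` [set t]) by rewrite lE.
  have fE x : f x = V (kap (l x)) (w (U (- kap (l x)) x)) by rewrite /f hl.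
  have mf : measurable_fun setT f.
    rewrite (_ : f = fun x => V (kap (l x)) (w (U (- kap (l x)) x))); last by apply/funext.
    apply: (measurable_glue (F := fun t x => V (kap t) (w (U (- kap t) x)))) => // t.
    apply: measurableT_comp; first exact: (mVk _).1.
    by apply: measurableT_comp => //; exact: (mUk _).1.
  have Uc : \forall x \ae P, forall a, H a -> c (U a x) = c x + a.
    by apply: ae_forallH => a Ha; exact: hc.
  have UU : \forall x \ae P, forall a, H a -> forall k, H k -> U (a + k) x = U a (U k x).
    by apply: ae_forallH => a Ha; apply: ae_forallH => k Hk; exact: actD aU Ha Hk.
  have VV : \forall x \ae P, forall a, H a -> forall k, H k -> V (a + k) x = V a (V k x).
    by apply: ae_forallH => a Ha; apply: ae_forallH => k Hk; exact: actD aV Ha Hk.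
  have Hn k : H k -> H (- k) by exact: subgroupN.
  have mfm : mpt P f.
    split=> // A mA; have mfA : measurable (f @^-1` A) by exact: mpre.
    rewrite !PrE//; congr EFin; rewrite (sum_equivariant aV eV mA).
    rewrite (sum_equivariant aU eU mfA); apply: eq_bigr => t _.
    have mVA := mpt_pre (mVk (kap t)) mA.
    rewrite -lw'//; apply: Pr_eq_ae.
    - by apply: measurableI => //; exact: mpt_pre.
    - by apply: measurableI => //; exact: mpre.
    - apply: filterS3 Uc UU (act0 aU) => x h1 h2 h3; rewrite /preimage /=.
      have -> : c x = 0 /\ A (f (U (kap t) x)) <-> c x = 0 /\ A (V (kap t) (w x)); last by [].
      split=> -[cx Ax]; split=> //; move: Ax; rewrite /f h1// cx add0r -h2 ?addNr ?h3//; exact: Hn.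
  (* A property of almost every point of the fibre over [0] transports to the points
     [U (- c x) x]. *)
  have Dae (Q : X -> Prop) : (\forall x \ae P, c x = 0 -> Q x) ->
      \forall x \ae P, Q (U (- c x) x).
    move=> hQ.
    have : \forall x \ae P, forall k, H k -> c (U k x) = 0 -> Q (U k x).
      by apply: ae_forallH => k Hk; exact: mpt_ae (mUk k) hQ.
    apply: filterS2 Uc => x h1 h2; apply: h2; first exact: Hn.
    by rewrite h1 ?subrr//; exact: Hn.
  have V' : \forall x \ae P, c x = 0 -> (forall a, H a -> c' (V a (w x)) = a) /\
      (forall a, H a -> forall k, H k -> V (a + k) (w x) = V a (V k (w x))) /\ V 0 (w x) = w x.
    have wnull (Q : X -> Prop) : (\forall x \ae P, Q x) -> \forall x \ae P, c x = 0 -> Q (w x).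
      move=> [N [mN N0 sub]].
      have : Pr (c @^-1` [set 0] `&` w @^-1` N) = 0.
        rewrite lw'//; apply/eqP; rewrite eq_le Pr_ge0 andbT.
        have <- : Pr N = 0 by rewrite /Pr N0.
        by apply: Pr_le => //; exact: measurableI.
      move/(ae_Pr0 P) => /(_ _)/wrap[]; first by apply: measurableI => //; exact: mpre.
      by apply: filterS => x h cx; apply: contrapT => nQ; apply: h; split=> //; apply: sub.
    have h1 : \forall x \ae P, forall a, H a -> c' (V a x) = c' x + a.
      by apply: ae_forallH => a Ha; exact: hc'.
    have := wnull _ (filterI h1 (filterI VV (act0 aV))).
    move=> /(_ _ _); apply: filterS2 hw => x h2 h3 cx; have [h4 _] := h2 cx; have [h5 [h6 h7]] := h3 cx.
    by split=> // a Ha; rewrite h5// h4 add0r.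

  split=> //.
    have h0 : \forall x \ae P, c x = 0 -> w' (w x) = x by apply: filterS hw => x h /h[].
    have {}h0 := Dae _ h0; have {}hV := Dae _ V'.
    apply: filterS3 (filterI h0 hV) (filterI Uc UU) (act0 aU) => x [h1 h2] [h3 h4] h5.
    have c0 := cH x; have Hnc := Hn _ c0.
    rewrite /f' /f /=; have [h6 [h7 h8]] := h2.
    by rewrite h6// -h7// addNr h8 h1 -h4// subrr h5.
  move=> a Ha; apply: filterS2 (Dae _ V') (filterI Uc UU) => x [_ [h2 _]] [h3 h4] /=.
  have Hc := cH x.
  rewrite /f h3// -h4//; last by apply: Hn; exact: subgroupD.
  by rewrite opprD addrNK [c x + a]addrC h2.
move=> aS aT eS eT; have [bH mb hb] := eS; have [bH' mb' hb'] := eT.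
have D0 U c : actions_on P H U -> equivariant H U c -> Pr (c @^-1` [set 0]) != 0.
  by move=> aU eU; apply/eqP => h0; have := sum1 U c aU eU; rewrite h0 mulr0 => /eqP;
    rewrite eq_sym oner_eq0.
have [|w [w' [[mw mw'] hw hw' lw lw']]] := iso_pair HX HP (mb 0) (mb' 0).
  split=> h0; [have := D0 S b aS (And3 bH mb hb)|have := D0 T b' aT (And3 bH' mb' hb')].
    by rewrite h0 eqxx.
  by rewrite h0 eqxx.
have [m1 i1 c1] := half S T b b' w w' aS aT eS eT mw mw' hw lw.
have [m2 i2 c2] := half T S b' b w' w aT aS eT eS mw' mw hw' lw'.
by exists (fun x => T (b x) (w (S (- b x) x))), (fun x => S (b' x) (w' (T (- b' x) x))).
Qed.

(** In the skew product of the trivial action with the translations of [H], the copy number is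
    equivariant. Carrying this action to [G] while controlling the fibres of the copy number keeps
    it so. *)
Lemma equivariant_exists (enumG : nat -> G) : (forall g, exists i, enumG i = g) ->
  exists S b, Omega P G S /\ equivariant H (restr H S) b.
Proof.
move=> surj.
have /choice[ix hix] : forall h, exists t, H h -> kap t = h.
  by move=> h; have [/kap_surj[t ht]|] := pselect (H h); [exists t|exists ord0].
have s0 : is_subgroup [set (0 : G)] by exact: subgroup_triv.
have aI : actions_on P [set 0] (restr [set (0 : G)] (fun=> id)).
  by apply: actions_onI => //; try (move=> *; exact: aeq_refl); move=> *; exact: mpt_id.
pose tau a t := ix (kap t + a).
have Ht t a : H a -> H (kap t + a) by move=> Ha; exact: subgroupD.
have tauD a a' t : H a -> H a' -> tau (a + a') t = tau a (tau a' t).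
  move=> Ha Ha'; apply: kap_inj; rewrite /tau.
  rewrite (hix (_ + (a + a')))%R; last by apply: Ht; exact: subgroupD.
  by rewrite hix ?hix -?addrA ?[a' + a]addrC//; try exact: Ht; apply: Ht; exact: subgroupD.
have tau0 t : tau 0 t = t by apply: kap_inj; rewrite /tau hix addr0.
have c0 (a a' : G) (t : 'I_n.+1) : H a -> H a' -> 0 = 0 + 0 :> G by rewrite addr0.
have [//|//|S0 [b [aS0 _ mb _ hb]]] := @skew_product _ _ _ P HX HP G H [set 0] _ _
  (ord0 : 'I_n.+1) tau (fun _ _ => 0) [::] sH s0 aI tauD tau0 _ c0.
have mbs B : B \in [seq b @^-1` [set t] | t : 'I_n.+1] -> measurable B.
  by move=> /mapP[t _ ->]; exact: mb.
have sT : is_subgroup [set: G] by [].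
have [S aS hS] := extension HX HP surj [seq kap t | t : 'I_n.+1] sT sH (@subsetT _ _) aS0 mbs.
exists S, (kap \o b); split=> //; split=> [x|g|a Ha]; first exact: kapH.
- have [[t <-]|no] := pselect (exists t, kap t = g).
    rewrite (_ : _ @^-1` _ = b @^-1` [set t])//.
    by apply/seteqP; split=> x /= => [/kap_inj|->].
  rewrite (_ : _ @^-1` _ = set0)//; apply/seteqP; split=> x //= h.
  by apply: no; exists (b x).
- have : \forall x \ae P, forall t, (b (S a x) = t) <-> (b (S0 a x) = t).
    apply: filter_forall => t; have mB := mb t.
    have := hS a (b @^-1` [set t]) _ Ha _; move=> /(_ _ _)/wrap[||].
    + by have [u <-] := kap_surj Ha; apply: map_f; rewrite mem_enum.
    + by apply: map_f; rewrite mem_enum.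
    + move/dm0_ae; apply; [exact: act_pre aS mB|exact: act_pre aS0 mB].
  apply: filterS2 (hb a Ha) => x h1 /(_ (b (S0 a x)))[_ /(_ erefl) h2].
  by rewrite restrE//= h2 h1 /tau hix//; exact: Ht.
Qed.

(** [T] is conjugate to the restriction of one model action of [G]; conjugating the whole model
    extends [T] up to null sets. *)
Lemma equivariant_image (enumG : nat -> G) T b : (forall g, exists i, enumG i = g) ->
  actions_on P H T -> equivariant H T b -> (restr H @` Omega P G) T.
Proof.
move=> surj aT eT; have [S [c [aS eS]]] := equivariant_exists surj.
have aSH : actions_on P H (restr H S) by exact: restr_actions aS.
have [f [f' [mf mf' f'f ff' fS]]] := equivariant_conj aSH aT eS eT.
have mS g : mpt P (S g) by exact: act_mpt_all aS.
pose U g := f \o (S g \o f').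
have aU : actions_on P setT (restr setT U).
  apply: actions_onI => //.
  - by move=> g _; apply: mpt_comp => //; exact: mpt_comp.
  - have := mpt_ae mf' (act0 aS); apply: filterS2 ff' => x h1 h2.
    by rewrite /U /= h2.
  - move=> k l _ _.
    have h1 := mpt_ae mf' (actD aS (I : [set: G] k) (I : [set: G] l)).
    have h2 := mpt_ae mf' (mpt_ae (mS l) f'f).
    by apply: filterS2 h1 h2 => x h1 /= h2; rewrite /U /= h1 /= h2.
have sT : is_subgroup [set: G] by [].
have [|U' [aU' rU' _]] := aeq_fix sT (@subsetT _ H) aU aT.
  move=> h Hh; rewrite restrE//; have := mpt_ae mf' (fS h Hh).
  have := mpt_ae (act_mpt aT Hh) ff'.
  have h3 := act_mpt aT Hh; move=> _; rewrite restrE// => h1.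
  apply: filterS2 h1 ff' => x /= h1 h2; rewrite /U /= h1 h2.
  by [].
by exists U'.
Qed.
End finite_group.
End equivariant_maps.

Section neighbourhoods.
Context (R : realType) (d : measure_display) (X : measurableType d)
  (P : probability X R).
Context (E : nat -> set X) (mE : forall n, measurable (E n))
  (dE : forall A, measurable A -> forall e : R, 0 < e -> exists n, dm P A (E n) < e).
Context (G : zmodType) (en : nat -> G) (en_surj : forall g, exists i, en i = g).
Implicit Types (A B C : set X) (K L H : set G) (S T W : G -> X -> X)
  (Sp U V : set (G -> X -> X)).
Local Notation dm := (dm P).
Local Notation wclose := (wclose P E en).

Lemma close_control (l : seq G) (Bs : seq (set X)) (e : R) : 0 < e ->
  (forall B, B \in Bs -> measurable B) ->
  exists n, forall S T, mpts P S -> mpts P T -> wclose n S T ->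
    forall a B, a \in l -> B \in Bs -> dm (S a @^-1` B) (T a @^-1` B) < e.
Proof.
move=> e0 mBs; have e3 : 0 < e / 3%:R by rewrite divr_gt0.
have one a B : measurable B -> exists n, forall S T, mpts P S -> mpts P T -> wclose n S T ->
    dm (S a @^-1` B) (T a @^-1` B) < e.
  move=> mB; have [i ia] := en_surj a; have [j hj] := dE mB e3.
  have [m hm] := inv_nat_lt e3; exists (maxn m (maxn i.+1 j.+1)) => S T mS mT hST.
  have i1 : (i < maxn m (maxn i.+1 j.+1))%N by rewrite !leq_max leqnn !orbT.
  have j1 : (j < maxn m (maxn i.+1 j.+1))%N by rewrite !leq_max leqnn !orbT.
  have := hST i j i1 j1; rewrite ia.
  have := inv_nat_le R (leq_maxl m (maxn i.+1 j.+1)).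
  set v := _.+1%:R^-1; set u := _.+1%:R^-1 in hm *.
  have hS := dm_pre (mS a) mB (mE j); have hT := dm_pre (mT a) mB (mE j).
  have p1 := mpt_pre (mS a) mB; have p2 := mpt_pre (mS a) (mE j).
  have p3 := mpt_pre (mT a) mB; have p4 := mpt_pre (mT a) (mE j).
  have t1 := dm_tri P p1 p2 p3; have t2 := dm_tri P p2 p4 p3.
  rewrite [dm (T a @^-1` E j) _]dmC hT in t2; rewrite hS in t1; lra.
have pairs (s : seq (G * set X)) : (forall x, x \in s -> measurable x.2) ->
    exists n, forall S T, mpts P S -> mpts P T -> wclose n S T ->
      forall x, x \in s -> dm (S x.1 @^-1` x.2) (T x.1 @^-1` x.2) < e.
  elim: s => [|x s ih] ms; first by exists 0%N.
  have [|n hn] := ih; first by move=> y ys; apply: ms; rewrite inE ys orbT.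
  have [m hm] := one x.1 x.2 (ms _ (mem_head _ _)).
  exists (maxn m n) => S T mS mT hST y; rewrite inE => /orP[/eqP ->|ys].
    by apply: hm => //; apply: close_le hST; exact: leq_maxl.
  by apply: hn => //; apply: close_le hST; exact: leq_maxr.
have [|n hn] := pairs [seq (a, B) | a <- l, B <- Bs].
  by move=> _ /allpairsP[[a B] [_ /mBs mB ->]].
exists n => S T mS mT hST a B al BB; apply: (hn S T mS mT hST (a, B)).
by apply/allpairsP; exists (a, B).
Qed.

Lemma dense_near Sp V : (forall S, Sp S -> mpts P S) ->
  (forall T n, Sp T -> exists2 S, wclose n S T & near_in P E en Sp V S) ->
  dense_in P Sp (near_in P E en Sp V).
Proof.
move=> mSp h; split=> [T []//|U oU [T UT]].
have [n hn] := wopen_close mE dE mSp en_surj oU UT.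
have [S hS VS] := h T n (oU.1 _ UT); exists S; split=> //; apply: hn => //.
by case: VS.
Qed.
End neighbourhoods.

Section finite_subgroups.
Context (R : realType) (d : measure_display) (X : measurableType d)
  (P : probability X R) (HX : standard_borel R X) (HP : atomless P).
Context (G : zmodType).
Implicit Types (A B C : set X) (K L H : set G) (S T : G -> X -> X).
Local Notation Pr := (Pr P).
Local Notation dm := (dm P).

Lemma preimage_label (I : finType) (J : Type) (l : X -> I) (f : I -> J) :
  (forall i, measurable (l @^-1` [set i])) ->
  forall A : set J, measurable ((f \o l) @^-1` A).
Proof.
move=> ml A; rewrite (_ : _ @^-1` _ = \bigcup_(i in [set i | A (f i)]) (l @^-1` [set i])).
  by apply: fin_bigcup_measurable.
by apply/seteqP; split=> [x Ax|x [i Ai /= li]]; [exists (l x)|rewrite /preimage/= li].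
Qed.

Context (H : set G) (sH : is_subgroup H) (n : nat) (kap : 'I_n.+1 -> G)
  (kapH : forall t, H (kap t)) (kap_inj : injective kap)
  (kap_surj : forall h, H h -> exists t, kap t = h).

(** A fundamental domain up to [e], [n.+1] being the order of [H]; the strict inequalities keep it
    valid for nearby actions. *)
Definition almost_domain (e : R) T := exists B, [/\ measurable B,
  forall k, H k -> k != 0 -> Pr (B `&` T k @^-1` B) < e & n.+1%:R^-1 - e < Pr B].

Lemma Pr_setU_bound (J : finType) (A : J -> set X) : (forall t, measurable (A t)) ->
  measurable [set x | exists t, A t x] /\ Pr [set x | exists t, A t x] <= \sum_t Pr (A t).
Proof.
move=> mA.
have gen (s : seq J) : measurable [set x | exists2 t, t \in s & A t x] /\
    Pr [set x | exists2 t, t \in s & A t x] <= \sum_(t <- s) Pr (A t).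
  elim: s => [|j s [mU hU]].
    rewrite big_nil (_ : [set x | _] = set0) ?Pr0//.
    by apply/seteqP; split=> x // [].
  have -> : [set x | exists2 i, i \in j :: s & A i x] =
      A j `|` [set x | exists2 i, i \in s & A i x].
    apply/seteqP; split=> x.
      by move=> [i]; rewrite inE => /orP[/eqP ->|si Ai]; [left|right; exists i].
    by move=> [Aj|[i si Ai]]; [exists j|exists i] => //; rewrite inE ?eqxx// si orbT.
  split; first exact: measurableU.
  by rewrite big_cons; apply: le_trans (PrU_le _ _ _) _ => //; rewrite lerD2l.
have := gen (enum J); rewrite big_enum.
have -> // : [set x | exists2 t, t \in enum J & A t x] = [set x | exists t, A t x].
by apply/seteqP; split=> x [t]; [exists t|exists t => //; rewrite mem_enum].
Qed.

(* If [C m] meets none of its nontrivial translates and the saturations of the [C m] exhaust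
   the space, the points of [C m] outside the saturations of the earlier [C i] form a
   fundamental domain [D]; [b x] is the element of [H] carrying [D] to [x]. *)
Lemma equivariant_of_domains T (C : nat -> set X) : actions_on P H T ->
  (forall m, measurable (C m)) ->
  (forall m k, H k -> k != 0 -> \forall x \ae P, ~ (C m x /\ C m (T k x))) ->
  (\forall x \ae P, exists m t, C m (T (kap t) x)) ->
  exists b, equivariant P H T b.
Proof.
move=> aT mC dis cov.
pose D := [set x | exists m, C m x /\ forall i, (i < m)%N -> forall t, ~ C i (T (kap t) x)].
have mT k : mpt P (T k) by exact: act_mpt_all aT.
have mD : measurable D.
  rewrite (_ : D = \bigcup_m (C m `&`
      \bigcap_(i in `I_m) \bigcap_(t in [set: 'I_n.+1]) ~` (T (kap t) @^-1` C i))).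
    apply: bigcup_measurable => m _; apply: measurableI => //.
    apply: fin_bigcap_measurable => // i _; apply: fin_bigcap_measurable => // t _.
    by apply: measurableC; exact: mpt_pre.
  apply/seteqP; split=> x.
    by move=> [m [Cx h]]; exists m => //; split=> // i im t _; exact: h.
  by move=> [m _ [Cx h]]; exists m; split=> // i im t; exact: h i im t I.
pose v x := [ffun t => `[< D (T (- kap t) x) >]].
have mv w : measurable (v @^-1` [set w]).
  by apply: (measurable_bool_label (A := fun t => T (- kap t) @^-1` D)) => t; exact: mpt_pre.
pose b x := kap (odflt ord0 [pick t | v x t]).
have bP x t : D (T (- kap t) x) -> (forall u, D (T (- kap u) x) -> u = t) -> b x = kap t.
  move=> Dt h; rewrite /b; case: pickP => [u|no] /=.
    by rewrite ffunE => /asboolP/h ->.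
  by have := no t; rewrite ffunE asboolT.
have HN t : H (- kap t) by exact: subgroupN.
have TT : \forall x \ae P, forall a, H a -> forall k, H k -> T (a + k) x = T a (T k x).
  by apply: (ae_forallH kapH kap_surj) => a Ha; apply: (ae_forallH kapH kap_surj) => k Hk; exact: actD aT Ha Hk.
have covT : \forall x \ae P, forall a, H a -> exists m t, C m (T (kap t) (T a x)).
  by apply: (ae_forallH kapH kap_surj) => a Ha; exact: mpt_ae (mT a) cov.
have disT : \forall x \ae P, forall a, H a -> forall k, H k -> k != 0 ->
    forall m, ~ (C m (T a x) /\ C m (T k (T a x))).
  apply: (ae_forallH kapH kap_surj) => a Ha; apply: (ae_forallH kapH kap_surj) => k Hk.
  have [->|k0] := eqVneq k 0; first by apply: aeW.
  have := ae_foralln (fun m => mpt_ae (mT a) (dis m k Hk k0)).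
  by apply: filterS => x h _ m; exact: h.
have uniq : \forall x \ae P, exists2 t, D (T (- kap t) x) & forall u, D (T (- kap u) x) -> u = t.
  apply: filterS2 (filterI TT disT) (filterI covT (act0 aT)) => x [TTx disx] [covx T0].
  have Tsub s1 s2 : exists2 s, kap s = kap s1 - kap s2 &
      T (kap s) (T (- kap s1) x) = T (- kap s2) x.
    have [s sE] : exists s, kap s = kap s1 - kap s2 by apply: kap_surj; exact: subgroupB.
    by exists s => //; rewrite -TTx// sE addrAC subrr add0r.
  have mono s1 s2 m m' : C m' (T (- kap s2) x) ->
      (forall i, (i < m)%N -> forall t, ~ C i (T (kap t) (T (- kap s1) x))) -> (m <= m')%N.
    move=> C2 h; rewrite leqNgt; apply/negP => /h.
    by have [s _ sT] := Tsub s1 s2; move=> /(_ s); rewrite sT.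
  have DD t u : D (T (- kap t) x) -> D (T (- kap u) x) -> u = t.
    move=> [m [C1 h1]] [m' [C2 h2]].
    have mm : m = m' by apply/eqP; rewrite eqn_leq (mono t u m m')// (mono u t m' m).
    apply: kap_inj; apply/eqP; rewrite -subr_eq0; apply/eqP; apply: contrapT => /eqP k0.
    have [s sE sT] := Tsub u t; apply: (disx _ (HN u) (kap s)) => //; first by rewrite sE.
    by split; [exact: C2|rewrite sT -mm].
  have [m [t Ct]] := covx 0 (subgroup0 sH).
  have exm : exists m, `[< exists t, C m (T (kap t) x) >].
    by exists m; apply/asboolP; exists t; rewrite -[x in T _ x]T0.
  case: (ex_minnP exm) => m0 /asboolP[t0 Ct0] min.
  have [u uE] : exists u, kap u = - kap t0 by exact: kap_surj.
  exists u => [|w Dw]; last apply: DD => //.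
    exists m0; split; first by rewrite uE opprK.
    move=> i im s Cs; have : (m0 <= i)%N.
      apply: min; apply/asboolP; have [w wE] : exists w, kap w = kap s - kap u.
        by apply: kap_surj; exact: subgroupB.
      by exists w; rewrite wE TTx.
    by rewrite leqNgt im.
  exists m0; split; first by rewrite uE opprK.
  move=> i im s Cs; have : (m0 <= i)%N.
    apply: min; apply/asboolP; have [w' wE] : exists w, kap w = kap s - kap u.
      by apply: kap_surj; exact: subgroupB.
    by exists w'; rewrite wE TTx.
  by rewrite leqNgt im.
exists b; split=> [x|g|a Ha]; first exact: kapH.
- exact: (preimage_label (fun w : {ffun 'I_n.+1 -> bool} => kap (odflt ord0 [pick t | w t])) mv [set g]).
- have uniqT := mpt_ae (mT a) uniq.
  apply: filterS3 uniq uniqT TT => x [t Dt ht] [u Du hu] TTx.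
  rewrite (bP x t)// (bP _ u)//.
  have [s sE] : exists s, kap s = kap u - a by apply: kap_surj; exact: subgroupB.
  have -> : t = s; last by rewrite sE subrK.
  by apply/esym/ht; move: Du; rewrite sE opprB -TTx// addrC.
Qed.

(** Removing the overlaps from [B m] costs at most [(n + 1) / (m + 1)] and leaves a set disjoint
    from its translates. The measure of its saturation tends to 1, so the saturations jointly
    exhaust the space. *)
Lemma equivariant_of_almost_domains T : actions_on P H T ->
  (forall m : nat, almost_domain m.+1%:R^-1 T) -> exists b, equivariant P H T b.
Proof.
move=> aT /choice[B hB]; have mB m : measurable (B m) by case: (hB m).
have mT k : mpt P (T k) by exact: act_mpt_all aT.
pose A m t := if kap t == 0 then set0 else B m `&` T (kap t) @^-1` B m.
have mA m t : measurable (A m t).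
  by rewrite /A; case: ifP => // _; apply: measurableI => //; exact: mpt_pre.
pose U m := [set x | exists t, A m t x]; pose C m := B m `\` U m.
have mU m : measurable (U m) by exact: (Pr_setU_bound (mA m)).1.
have mC m : measurable (C m) by exact: measurableD.
have PrC_ge m : n.+1%:R^-1 - m.+1%:R^-1 - n.+1%:R * m.+1%:R^-1 <= Pr (C m).
  have [_ h1 h2] := hB m.
  have hU : Pr (U m) <= n.+1%:R * m.+1%:R^-1.
    apply: le_trans (Pr_setU_bound (mA m)).2 _.
    have -> : n.+1%:R * m.+1%:R^-1 = \sum_(t < n.+1) m.+1%:R^-1 :> R.
      by rewrite sumr_const card_ord mulr_natl.
    apply: ler_sum => t _; rewrite /A; case: eqVneq => [_|k0].
      by rewrite Pr0 invr_ge0.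
    by apply/ltW/h1.
  have : Pr (B m) <= Pr (C m) + Pr (U m).
    apply: le_trans (PrU_le P (mC m) (mU m)); apply: Pr_le => //; first exact: measurableU.
    by move=> x Bx; have [Ux|nUx] := pselect (U m x); [right|left].
  by move: h2 hU; set v := _.+1%:R^-1; set w := _.+1%:R^-1; set z := _ * _; lra.
have dis m k : H k -> k != 0 -> forall x, ~ (C m x /\ C m (T k x)).
  move=> Hk k0 x [[Bx nU] [BTx _]]; apply: nU.
  by have [t tk] := kap_surj Hk; exists t; rewrite /A tk (negbTE k0).
apply: (@equivariant_of_domains T C) => // [m k Hk k0|]; first exact/aeW/dis.
have mS m t : measurable (T (kap t) @^-1` C m) by exact: mpt_pre.
pose S m := [set x | exists t, C m (T (kap t) x)].
have [mSm PS] : (forall m, measurable (S m)) /\ forall m, Pr (S m) = n.+1%:R * Pr (C m).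
  suff h m : measurable (S m) /\ Pr (S m) = n.+1%:R * Pr (C m) by split=> m; have [] := h m.
  have := @Pr_sum_disjoint _ _ _ P _ (enum 'I_n.+1) (fun t => T (kap t) @^-1` C m)
    (enum_uniq _) (mS m); move=> /(_ _)/wrap[].
    move=> t u _ _ tu; have Htu : H (kap u - kap t) by exact: subgroupB.
    have ku : kap u - kap t != 0 by rewrite subr_eq0 eq_sym (inj_eq kap_inj).
    apply: filterS (actD aT Htu (kapH t)) => x; rewrite subrK /= => h [Ct].
    by rewrite /preimage/= h => Cu; exact: (dis m _ Htu ku (T (kap t) x) (conj Ct Cu)).
  rewrite (_ : [set x | _] = S m); last first.
    by apply/seteqP; split=> x [t]; [exists t|exists t => //; rewrite mem_enum].
  move=> [m1 ->]; split=> //; under eq_bigr do rewrite (Pr_pre (act_mpt_all _ aT))//.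
  by rewrite big_enum sumr_const card_ord mulr_natl.
have mUS : measurable (\bigcup_m S m) by exact: bigcup_measurable.
have : Pr (~` \bigcup_m S m) = 0.
  apply: le0_eps => [|e e0]; first exact: Pr_ge0.
  have e' : 0 < e / (n.+1%:R + n.+1%:R * n.+1%:R) by rewrite divr_gt0// addr_gt0// mulr_gt0.
  have [m hm] := inv_nat_lt e'.
  have : Pr (S m) <= Pr (\bigcup_m S m) by apply: Pr_le => // x Sx; exists m.
  rewrite PrC// PS; move: (PrC_ge m) hm; set v := m.+1%:R^-1; set w : R := n.+1%:R^-1.
  have : n.+1%:R * w = 1 by rewrite /w mulfV.
  have : 0 < n.+1%:R :> R by [].
  set c := Pr (C m); set q := Pr (\bigcup_m S m); set N : R := n.+1%:R.
  move=> N0 Nw h1; rewrite ltr_pdivlMr ?addr_gt0 ?mulr_gt0// => h2 h3.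
  have : N * (w - v - N * v) <= N * c by rewrite ler_pM2l.
  by rewrite !mulrBr Nw; nra.
move/(ae_Pr0 P) => /(_ (measurableC mUS)); apply: filterS => x h.
by apply: contrapT => no; apply: h => -[m _ [t Ct]]; apply: no; exists m, t.
Qed.

Context (E : nat -> set X) (mE : forall n, measurable (E n))
  (dE : forall A, measurable A -> forall e : R, 0 < e -> exists n, dm A (E n) < e).
Context (en : nat -> G) (en_surj : forall g, exists i, en i = g).

(** The diagonal action on the product of [X] and [H]: the cocycle is [a] itself, so nothing changes
    on the listed sets, while the second coordinate is translated freely. *)
Lemma free_skew T n0 : actions_on P H T -> exists S (b : X -> 'I_n.+1),
  [/\ actions_on P H S, forall t, measurable (b @^-1` [set t]),
    forall t, n.+1%:R * Pr (b @^-1` [set t]) = 1,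
    forall a, H a -> \forall x \ae P, kap (b (S a x)) = kap (b x) + a
  & wclose P E en n0 S T].
Proof.
move=> aT.
have /choice[ix hix] : forall h, exists t, H h -> kap t = h.
  by move=> h; have [/kap_surj[t ht]|] := pselect (H h); [exists t|exists ord0].
pose tau a t := ix (kap t + a).
have Ht t a : H a -> H (kap t + a) by move=> Ha; exact: subgroupD.
have tauD a a' t : H a -> H a' -> tau (a + a') t = tau a (tau a' t).
  move=> Ha Ha'; apply: kap_inj; rewrite /tau.
  rewrite (hix (_ + (a + a')))%R; last by apply: Ht; exact: subgroupD.
  by rewrite hix ?hix -?addrA ?[a' + a]addrC//; try exact: Ht; apply: Ht; exact: subgroupD.
have tau0 t : tau 0 t = t by apply: kap_inj; rewrite /tau hix addr0.
pose Es := [seq E j | j <- iota 0 n0].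
pose Bs := setT :: Es ++ [seq T (en i) @^-1` B | i <- iota 0 n0, B <- Es].
have mEs B : B \in Es -> measurable B by move=> /mapP[j _ ->].
have mBs B : B \in Bs -> measurable B.
  rewrite inE mem_cat => /or3P[/eqP ->//|/mEs//|/allpairsP[[i B'] /= [_ /mEs mB' ->]]].
  exact: act_pre aT mB'.
have [//|//|S [b [aS hS mb hb Sb]]] := @skew_product _ _ _ P HX HP G H H T _
  (ord0 : 'I_n.+1) tau (fun a _ => a) Bs sH sH aT tauD tau0 _ _ mBs.
have N0 : n.+1%:R != 0 :> R by [].
exists S, b; split=> // [t|a Ha|i j ni nj].
- by have := hb t setT (mem_head _ _); rewrite setIT PrT card_ord.
- by apply: filterS (Sb a Ha) => x ->; rewrite /tau hix//; exact: Ht.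
have [Hi|nH] := pselect (H (en i)); last first.
  by rewrite (act_off aS nH) (act_off aT nH) dmxx invr_gt0.
have Ej : E j \in Es by apply/mapP; exists j => //; rewrite mem_iota.
have := hS (en i) (E j) (T (en i) @^-1` E j) Hi; rewrite !inE !mem_cat Ej orbT => /(_ isT).
rewrite (_ : _ \in [seq _ | i <- _, B <- Es]); last first.
  by apply/allpairsP; exists (i, E j); rewrite mem_iota.
rewrite !orbT => /(_ isT); rewrite dmxx big1// => /eqP.
by rewrite mulf_eq0 card_ord (negbTE N0) => /eqP ->; rewrite invr_gt0.
Qed.

Lemma free_dense T n0 (e : R) : actions_on P H T -> 0 < e ->
  exists2 S, wclose P E en n0 S T & near_in P E en (actions_on P H) (almost_domain e) S.
Proof.
move=> aT e0; have [S [b [aS mb hb Sb cS]]] := free_skew n0 aT.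
exists S => //; split=> //; pose B := b @^-1` [set ord0]; have mB : measurable B by exact: mb.
have Bs1 C : C \in [:: B] -> measurable C by rewrite inE => /eqP ->.
have [m hm] := close_control mE dE en_surj [seq kap t | t : 'I_n.+1] e0 Bs1.
exists m => W aW hW; exists B; split=> // [k Hk k0|].
  have kt : k \in [seq kap t | t : 'I_n.+1].
    by have [t <-] := kap_surj Hk; apply: map_f; rewrite mem_enum.
  have := hm W S (act_mpts aW) (act_mpts aS) hW k B kt (mem_head _ _).
  apply: le_lt_trans; have mW := act_pre k aW mB; have mS := act_pre k aS mB.
  have mBS : measurable (B `&` S k @^-1` B) by exact: measurableI.
  have mBW : measurable (B `&` W k @^-1` B) by exact: measurableI.
  have z : Pr (B `&` S k @^-1` B) = 0.
    apply/(ae_Pr0 P mBS); apply: filterS (Sb k Hk) => x h [bx].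
    move=> /(congr1 kap); rewrite h bx.
    by move/eqP; rewrite addrC -subr_eq0 addrK (negbTE k0).
  apply: le_trans (Pr_dm P mBW mBS) _; rewrite z add0r.
  by apply: le_trans (dm_setI P mB mW mB mS) _; rewrite dmxx add0r.
have N0 : n.+1%:R != 0 :> R by [].
have -> : Pr B = n.+1%:R^-1 by apply: (mulfI N0); rewrite hb mulfV.
by move: e0; set v := _^-1; lra.
Qed.

End finite_subgroups.

Section finite_contains.
Context (R : realType) (d : measure_display) (X : measurableType d)
  (P : probability X R) (HX : standard_borel R X) (HP : atomless P).
Context (G : zmodType).

Lemma finite_contains (H : set G) (en : nat -> G) : (forall g, exists i, en i = g) ->
  is_subgroup H -> finite_set H ->
  contains_dense_Gdelta P (actions_on P H) (restr H @` Omega P G).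
Proof.
move=> surj sH fH; have [n [kap [kH ki ks]]] := finite_enum fH (subgroup0 sH).
have [f [mf inj fimg]] := HX; have [E [mE dE]] := dense_family P mf inj fimg.
pose O m := near_in P E en (actions_on P H) (almost_domain P H n m.+1%:R^-1).
have mY y : actions_on P H y -> mpts P y by exact: act_mpts.
have oO m : wopen_in P (actions_on P H) (O m) by exact: near_in_wopen.
have dO m : dense_in P (actions_on P H) (O m).
  apply: dense_near => // T n0 aT.
  by apply: (free_dense HX HP sH kH ki ks mE dE surj n0 aT); rewrite invr_gt0.
exists (\bigcap_m O m); split; first by exists O.
  by apply: (baire mE dE) => //; exact: complete_actions.
move=> T OT; have aT : actions_on P H T by case: (OT 0%N I).
have [|b eb] := equivariant_of_almost_domains sH kH ki ks aT.
  by move=> m; exact: near_in_sub (OT m I).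
exact: (equivariant_image HX HP sH kH ki ks surj aT eb).
Qed.
End finite_contains.

(** * Towers and the closure of a generic action *)
Section slices.
Context (R : realType) (d : measure_display) (X : measurableType d)
  (P : probability X R) (HX : standard_borel R X) (HP : atomless P).
Implicit Types (A B C D : set X).
Local Notation Pr := (Pr P).
Local Notation dm := (dm P).

Lemma preimage_bounded_label (l : X -> nat) m : (forall x, (l x < m)%N) ->
  (forall i, measurable (l @^-1` [set i])) -> forall A : set nat, measurable (l @^-1` A).
Proof.
move=> lm ml A; rewrite (_ : l @^-1` A = \bigcup_(i in A) (l @^-1` [set i])).
  by apply: bigcup_measurable.
by apply/seteqP; split=> [x Ax|x [i Ai /= li]]; [exists (l x)|rewrite /preimage/= li].
Qed.

(** The number of slices will be dictated by the size of a finite group, so every large [m] must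
    work. Sets that are almost unions of slices for all large [m] form an algebra containing the
    rays of the uniform coordinate. *)
Lemma fine_split D (Cs : seq (set X)) (e : R) : measurable D -> 0 < Pr D ->
  (forall C, C \in Cs -> measurable C) -> 0 < e ->
  exists M, forall m, (M <= m)%N -> exists l : X -> nat, [/\ forall x, (l x < m.+1)%N,
    forall j, measurable (l @^-1` [set j]),
    forall j, (j < m.+1)%N -> m.+1%:R * Pr (D `&` l @^-1` [set j]) = Pr D
  & forall C, C \in Cs -> exists A : set nat, dm (D `&` C) (D `&` l @^-1` A) < e].
Proof.
move=> mD D0 mCs e0.
have [u [v [b [[mu mv] vu law u0 hb]]]] := split_slices HX HP mD D0.
have mb m (A : set nat) : measurable (b m @^-1` A).
  by have [h1 h2 _ _] := hb m; exact: preimage_bounded_label h1 h2 A.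
pose AA := [set C | measurable C /\ forall e : R, 0 < e -> exists M, forall m, (M <= m)%N ->
  exists A : set nat, dm (D `&` C) (D `&` b m @^-1` A) < e].
have mAA A : AA A -> measurable A by case.
have mDC C : measurable C -> measurable (D `&` C) by exact: measurableI.
have mDb m (A : set nat) : measurable (D `&` b m @^-1` A) by exact: measurableI.
have AAC A : AA A -> AA (~` A).
  move=> [mA hA]; split=> [|e' e'0]; first exact: measurableC.
  have [M hM] := hA e' e'0; exists M => m /hM[S hS]; exists (~` S).
  suff -> : dm (D `&` ~` A) (D `&` b m @^-1` (~` S)) = dm (D `&` A) (D `&` b m @^-1` S) by [].
  congr Pr; apply/seteqP; split=> x; rewrite /symdiff /preimage /=.
    by have [?|?] := pselect (A x); have [?|?] := pselect (S (b m x)); tauto.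
  by have [?|?] := pselect (A x); have [?|?] := pselect (S (b m x)); tauto.
have AAU A B : AA A -> AA B -> AA (A `|` B).
  move=> [mA hA] [mB hB]; split=> [|e' e'0]; first exact: measurableU.
  have e2 : 0 < e' / 2 by rewrite divr_gt0.
  have [M1 hM1] := hA _ e2; have [M2 hM2] := hB _ e2; exists (maxn M1 M2) => m.
  rewrite geq_max => /andP[/hM1[S1 h1] /hM2[S2 h2]]; exists (S1 `|` S2).
  rewrite preimage_setU !setIUr.
  apply: le_lt_trans (dm_setU P (mDC _ mA) (mDC _ mB) (mDb m S1) (mDb m S2)) _; lra.
have AA0 : AA set0.
  by split=> // e' e'0; exists 0%N => m _; exists set0; rewrite preimage_set0 setI0 dmxx.
have AAray r : approximable P AA (u @^-1` `]-oo, r[%classic).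
  have mray s : measurable (u @^-1` `]-oo, s[%classic) by apply: mpreR.
  apply: approximable_in => //; split=> // e' e'0.
  have [r0|r0] := leP r 0.
    exists 0%N => m _; exists set0; rewrite preimage_set0.
    rewrite (_ : u @^-1` _ = set0) ?dmxx//; apply/seteqP; split=> x //=.
    by rewrite in_itv/= => h; have := u0 x; lra.
  have [r1|r1] := leP 1 r.
    exists 0%N => m _; exists setT; rewrite preimage_setT setIT.
    have h : Pr (D `&` u @^-1` `]-oo, r[%classic) = Pr D.
      by rewrite law /clamp (min_idPr r1) (max_idPr ler01) mulr1.
    have := @PrU _ _ _ P (D `&` u @^-1` `]-oo, r[%classic) (D `&` ~` (u @^-1` `]-oo, r[%classic)).
    rewrite -setIUr setUv setIT h => /(_ (mDC _ (mray r)) (mDC _ (measurableC (mray r)))).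
    move=> /(_ _)/wrap[]; first by apply/seteqP; split=> x // [[_ ?] [_ ]].
    move=> h2; rewrite (_ : dm _ _ = Pr (D `&` ~` (u @^-1` `]-oo, r[%classic))); first lra.
    by congr Pr; apply/seteqP; split=> x; rewrite /symdiff /preimage /=; tauto.
  have [M hM] := inv_nat_lt e'0; exists M => m Mm.
  have [_ _ _ hbk] := hb m.
  have mr0 : 0 <= m.+1%:R * r by rewrite mulr_ge0// ltW.
  have /andP[h1 h2] := truncn_itv mr0; set k := Num.truncn _ in h1 h2.
  have km : (k < m.+1)%N.
    rewrite -(ltr_nat R); apply: le_lt_trans h1 _.
    by rewrite gtr_pMr.
  exists [set j | (j < k)%N].
  have -> : b m @^-1` [set j | (j < k)%N] = u @^-1` `]-oo, (k%:R / m.+1%:R)[%classic.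
    by apply/seteqP; split=> x; rewrite /preimage /= in_itv/= hbk.
  set s := k%:R / m.+1%:R.
  have m0 : 0 < m.+1%:R :> R by [].
  have sr : s <= r by rewrite ler_pdivrMr// mulrC.
  have s0 : 0 <= s by rewrite divr_ge0.
  have rs : r < s + m.+1%:R^-1.
    by rewrite /s -{2}[m.+1%:R^-1]mul1r -mulrDl ltr_pdivlMr// mulrC natr1.
  have cl t : 0 <= t -> t <= r -> clamp t = t.
    by move=> t0 tr; rewrite /clamp min_l ?max_r//; lra.
  have := @PrU _ _ _ P (D `&` u @^-1` `]-oo, s[%classic)
     (D `&` (u @^-1` `]-oo, r[%classic `\` u @^-1` `]-oo, s[%classic)).
  rewrite -setIUr setDUK; last first.
    by move=> x; rewrite /preimage/= !in_itv/= => h; exact: lt_le_trans h sr.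
  move=> /(_ (mDC _ (mray s)) (mDC _ (measurableD (mray r) (mray s)))) /(_ _)/wrap[].
    by apply/seteqP; split=> x // [[_ ?] [_ []]].
  rewrite !law !cl ?lexx//; last exact: ltW.
  move=> h3.
  have -> : dm (D `&` u @^-1` `]-oo, r[%classic) (D `&` u @^-1` `]-oo, s[%classic) =
      Pr (D `&` (u @^-1` `]-oo, r[%classic `\` u @^-1` `]-oo, s[%classic)).
    congr Pr; apply/seteqP; split=> x; rewrite /symdiff /preimage /= !in_itv/=; last tauto.
    move=> [|[[? h]]]; first tauto.
    by move=> []; split=> //; exact: lt_le_trans h sr.
  have := Pr_le1 P mD; have := inv_nat_le R Mm; move: hM rs.
  set w := m.+1%:R^-1; set z := M.+1%:R^-1 => hM rs wz D1; nra.
have one C : exists M, C \in Cs -> forall m, (M <= m)%N ->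
    exists A : set nat, dm (D `&` C) (D `&` b m @^-1` A) < e.
  have [/mCs mC|] := boolP (C \in Cs); last by exists 0%N.
  have e2 : 0 < e / 2 by rewrite divr_gt0.
  have mvC : measurable (v @^-1` C) by rewrite -[_ @^-1` _]setTI; apply: mv.
  have [mC' /(_ _ e2)[A [mA hA] CA]] := approximable_preimage mAA AAC AAU AA0 AAray mvC.
  have [M hM] := hA _ e2; exists M => _ m /hM[S hS]; exists S.
  have z : dm (D `&` C) (D `&` u @^-1` (v @^-1` C)) = 0.
    apply/(dm0_ae P (mDC _ mC) (mDC _ mC')); apply: filterS vu => x h.
    by rewrite /preimage /=; split=> -[Dx]; rewrite h.
  apply: le_lt_trans (dm_tri P (mDC _ mC) (mDC _ mC') (mDb m S)) _; rewrite z add0r.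
  apply: le_lt_trans (dm_tri P (mDC _ mC') (mDC _ mA) (mDb m S)) _.
  by have := dm_setI P mD mC' mD mA; rewrite dmxx; lra.
have /choice[M hM] := one.
exists (\max_(C <- Cs) M C) => m Mm; have [h1 h2 h3 _] := hb m.
exists (b m); split=> // C CC; apply: hM => //; apply: leq_trans Mm.
exact: leq_bigmax_seq.
Qed.
End slices.

Section finite_transversals.
Context (G : zmodType).
Implicit Types (H K L : set G).

(** In an infinite torsion abelian group finitely generated subgroups are finite, and adding
    generators makes them as large as desired. *)
Lemma finite_hull H (l : seq G) N : is_subgroup H -> ~ finite_set H ->
  (forall h, H h -> exists2 n, (0 < n)%N & h *+ n = 0) -> (forall x, x \in l -> H x) ->
  exists K, [/\ is_subgroup K, finite_set K, K `<=` H, forall x, x \in l -> K x &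
    exists u : seq G, [/\ uniq u, (N < size u)%N & forall x, x \in u -> K x]].
Proof.
move=> sH iH tH lH.
have [u [uu us uH]] : exists u : seq G, [/\ uniq u, size u = N.+1 & forall x, x \in u -> H x].
  elim: N.+1 => [|n [u [uu us uH]]]; first by exists [::].
  have [g Hg gu] : exists2 g, H g & g \notin u.
    apply: contrapT => no; apply: iH; apply: (sub_finite_set (B := [set` u])) => // g Hg /=.
    by apply: contrapT => /negP gu; apply: no; exists g.
  exists (g :: u); split; rewrite /= ?gu ?us// => x; rewrite inE => /orP[/eqP ->//|].
  exact: uH.
pose w := l ++ u; have wH x : x \in w -> H x by rewrite mem_cat => /orP[/lH|/uH].
exists (adjoins [set 0] w); have s0 := @subgroup_triv G.
have sw : is_subgroup (adjoins [set 0] w) by exact: adjoins_subgroup.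
split=> //.
- by apply: adjoins_finite => // x /wH/tH.
- by apply: adjoins_min => // x ->; exact: subgroup0.
- by move=> x xl; apply: adjoins_gen; rewrite ?mem_cat ?xl.
- exists u; split=> //; rewrite ?us// => x xu; apply: adjoins_gen => //.
  by rewrite mem_cat xu orbT.
Qed.

Lemma finite_transversal K L : is_subgroup L -> L `<=` K -> is_subgroup K -> finite_set K ->
  exists m (s : 'I_m.+1 -> G), [/\ forall u, K (s u),
    forall g, K g -> exists u, L (g - s u) & forall u v, L (s u - s v) -> u = v].
Proof.
(* [xget] selects from the coset as a set, so congruent elements receive the same representative. *)
move=> sL LK sK fK; pose rho g := xget 0 [set x | K x /\ L (x - g)].
have rhoP g : K g -> K (rho g) /\ L (rho g - g).
  move=> Kg; apply: (@xgetI _ 0 [set x | K x /\ L (x - g)] g).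
  by split; rewrite ?subrr//; exact: subgroup0.
have rhoE g g' : L (g - g') -> rho g = rho g'.
  move=> Lgg; rewrite /rho; congr xget; apply/seteqP; split=> x /= [Kx Lx]; split=> //.
    by have := subgroupD sL Lx Lgg; rewrite addrA subrK.
  by have := subgroupB sL Lx Lgg; rewrite opprB addrA subrK.
have [||m [s [sT si ss]]] := @finite_enum G [set g | K g /\ rho g = g] (rho 0).
- by apply: sub_finite_set fK => g [].
- have [K0 L0] := rhoP 0 (subgroup0 sK); split=> //.
  by apply: rhoE; exact: L0.
exists m, s; split=> [u|g Kg|u v Luv]; first by case: (sT u).
  have [Kr Lr] := rhoP g Kg; have [|u uE] := ss (rho g).
    by split=> //; exact: rhoE.
  by exists u; rewrite uE -opprB; exact: subgroupN.
by apply: si; have [_ <-] := sT u; have [_ <-] := sT v; exact: rhoE.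
Qed.
End finite_transversals.

Section towers.
Context (R : realType) (d : measure_display) (X : measurableType d)
  (P : probability X R) (HX : standard_borel R X) (HP : atomless P).
Context (G : zmodType) (H : set G) (sH : is_subgroup H).
Context (E : nat -> set X) (mE : forall n, measurable (E n))
  (dE : forall A, measurable A -> forall e : R, 0 < e -> exists n, dm P A (E n) < e).
Context (en : nat -> G) (en_surj : forall g, exists i, en i = g).
Implicit Types (A B C D : set X) (S T : G -> X -> X).
Local Notation Pr := (Pr P).
Local Notation dm := (dm P).
Local Notation wclose := (wclose P E en).

(** A Rokhlin tower with levels indexed by the finite subgroup [range kap]. The square of the number
    of levels leaves room for summing errors over pairs of levels in [centralizer_tower]. *)
Definition tower (e : R) m T := exists (J : finType) (kap : J -> G) (l : X -> J),
 [/\ [/\ injective kap, forall t, H (kap t), is_subgroup (range kap) &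
       forall i, (i < m)%N -> H (en i) -> range kap (en i)],
   forall t, measurable (l @^-1` [set t]),
   forall t, #|J|%:R * Pr (l @^-1` [set t]) = 1,
   forall t, #|J|%:R ^+ 2 * Pr [set x | kap (l (T (kap t) x)) <> kap (l x) + kap t] < e
 & forall j, (j < m)%N -> exists A : set J, dm (E j) (l @^-1` A) < e].

Lemma measurable_two_labels (J J' : finType) (l : X -> J) (l' : X -> J') (Q : J -> J' -> Prop) :
  (forall t, measurable (l @^-1` [set t])) -> (forall t, measurable (l' @^-1` [set t])) ->
  measurable [set x | Q (l x) (l' x)].
Proof.
move=> ml ml'; pose l2 x := (l x, l' x).
have ml2 t : measurable (l2 @^-1` [set t]).
  rewrite (_ : _ @^-1` _ = l @^-1` [set t.1] `&` l' @^-1` [set t.2]); first exact: measurableI.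
  by apply/seteqP; split=> x; rewrite /preimage/= /l2; [move=> <-|case: t => a b /= [-> ->]].
exact: (preimage_label (J := J * J') id ml2 [set ab | Q ab.1 ab.2]).
Qed.

(** An equidistributed label identifies [X] with a product with [J], and translating the second
    coordinate alone is the action. *)
Lemma action_of_label (J : finType) (kap : J -> G) (l : X -> J) : injective kap ->
  is_subgroup (range kap) -> (forall t, measurable (l @^-1` [set t])) ->
  (forall t, #|J|%:R * Pr (l @^-1` [set t]) = 1) ->
  exists2 T, actions_on P (range kap) T &
    forall a, range kap a -> \forall x \ae P, kap (l (T a x)) = kap (l x) + a.
Proof.
move=> ik sK ml Pl; have [j0 _ kj0] := subgroup0 sK.
have /choice[ix hix] : forall h, exists t, range kap h -> kap t = h.
  by move=> h; have [[t _ ht]|] := pselect (range kap h); [exists t|exists j0].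
pose tau a t := ix (kap t + a).
have Ht t a : range kap a -> range kap (kap t + a).
  by move=> Ha; apply: subgroupD => //; exists t.
have tauD a a' t : range kap a -> range kap a' -> tau (a + a') t = tau a (tau a' t).
  move=> Ha Ha'; apply: ik; rewrite /tau.
  rewrite (hix (_ + (a + a')))%R; last by apply: Ht; exact: subgroupD.
  by rewrite hix ?hix -?addrA ?[a' + a]addrC//; try exact: Ht; apply: Ht; exact: subgroupD.
have tau0 t : tau 0 t = t.
  by apply: ik; rewrite /tau hix addr0//; exists t.
have s0 : is_subgroup [set (0 : G)] by exact: subgroup_triv.
have aI : actions_on P [set 0] (restr [set (0 : G)] (fun=> id)).
  by apply: actions_onI => //; try (move=> *; exact: aeq_refl); move=> *; exact: mpt_id.
have mu : forall i : unit, measurable ((fun _ : X => tt) @^-1` [set i]).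
  by move=> [] ; rewrite (_ : _ @^-1` _ = setT)//; apply/seteqP; split=> x.
have [i j|g [al [hc _]]] := copies_of_labels HX HP mu ml _.
  rewrite (_ : _ @^-1` [set i] = setT) ?setTI ?Pl ?PrT//.
  by apply/seteqP; split=> x // _; case: i.
have c0 (a a' : G) (t : J) : range kap a -> range kap a' -> 0 = 0 + 0 :> G by rewrite addr0.
have [//|//|//|S [aS _ h]] := @skew_of_copies _ _ _ P G (range kap) [set 0] _ J j0 tau
  (fun _ _ => 0) g al l [::] sK s0 aI tauD tau0 _ c0 hc.
exists S => // a Ka; apply: filterS (h a Ka) => x ->.
by rewrite /tau hix//; exact: Ht.
Qed.

(* A sufficiently fine tower over a large finite [K] contains, as a coarsening, a free tower
   over the subgroup [H1] of the controlled elements; the slices of its base are chosen to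
   approximate all the translates of the given sets. *)
Lemma label_refinement (H1 : set G) T (n1 : nat) (kap1 : 'I_n1.+1 -> G) (l1 : X -> 'I_n1.+1)
    (Es : seq (set X)) (e : R) :
  0 < e -> is_subgroup H1 -> injective kap1 -> range kap1 = H1 -> actions_on P H1 T ->
  (forall t, measurable (l1 @^-1` [set t])) ->
  (forall t, n1.+1%:R * Pr (l1 @^-1` [set t]) = 1) ->
  (forall a, H1 a -> \forall x \ae P, kap1 (l1 (T a x)) = kap1 (l1 x) + a) ->
  (forall B, B \in Es -> measurable B) ->
  exists M, forall m (s : 'I_m.+1 -> G), (M <= m)%N ->
    exists l : X -> 'I_n1.+1 * 'I_m.+1, let kap t := kap1 t.1 + s t.2 in
    [/\ forall t, measurable (l @^-1` [set t]),
      forall t, (n1.+1 * m.+1)%:R * Pr (l @^-1` [set t]) = 1,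
      forall a, H1 a -> \forall x \ae P, kap (l (T a x)) = kap (l x) + a
    & forall B, B \in Es -> exists A : set ('I_n1.+1 * 'I_m.+1), dm B (l @^-1` A) < e].
Proof.
move=> e0 sH1 ik rk aT ml1 Pl1 hl1 mEs.
have kH t : H1 (kap1 t) by rewrite -rk; exists t.
have kN t : H1 (- kap1 t) by exact: subgroupN.
have [t0 _ kt0] : range kap1 0 by rewrite rk; exact: subgroup0.
pose D := l1 @^-1` [set t0]; have mD : measurable D by exact: ml1.
have n0 : 0 < n1.+1%:R :> R by [].
have D0 : 0 < Pr D by rewrite -(pmulr_rgt0 _ n0) Pl1.
pose Cs := [seq T (kap1 t) @^-1` B | t <- enum 'I_n1.+1, B <- Es].
have mT a : mpt P (T a) by exact: act_mpt_all aT.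
have mCs C : C \in Cs -> measurable C.
  by move=> /allpairsP[[t B] /= [_ /mEs mB ->]]; exact: mpt_pre.
have e1 : 0 < e / n1.+1%:R by rewrite divr_gt0.
have [M hM] := fine_split HX HP mD D0 mCs e1.
exists M => m s Mm; have [l [lm ml hl apx]] := hM m Mm.
pose ll x : 'I_n1.+1 * 'I_m.+1 := (l1 x, inord (l (T (- kap1 (l1 x)) x))).
have fib t u : ll @^-1` [set (t, u)] =
    l1 @^-1` [set t] `&` T (- kap1 t) @^-1` (l @^-1` [set (u : nat)]).
  apply/seteqP; split=> x; rewrite /preimage/= /ll.
    by move=> [<- <-]; rewrite inordK.
  by move=> [-> ->]; rewrite inord_val.
have mll t : measurable (ll @^-1` [set t]).
  by case: t => t u; rewrite fib; apply: measurableI => //; exact: mpt_pre.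
have l1D : \forall x \ae P, forall t, l1 x = t <-> D (T (- kap1 t) x).
  have : \forall x \ae P, forall t, kap1 (l1 (T (- kap1 t) x)) = kap1 (l1 x) - kap1 t.
    by apply: filter_forall => t; exact: hl1.
  apply: filterS => x h t; rewrite /D /preimage/=; split=> [xt|Dx].
    by apply: ik; rewrite h xt subrr kt0.
  by apply: ik; apply/eqP; rewrite -subr_eq0 -h Dx kt0.
have TT : \forall x \ae P, forall a, H1 a -> forall k, H1 k -> T (a + k) x = T a (T k x).
  have ks h : H1 h -> exists t, kap1 t = h by rewrite -rk => -[t _ <-]; exists t.
  by apply: (ae_forallH kH ks) => a Ha; apply: (ae_forallH kH ks) => k Hk; exact: actD aT Ha Hk.
exists ll; split=> //.
- move=> [t u]; rewrite fib.
  have mDu : measurable (D `&` l @^-1` [set (u : nat)]) by exact: measurableI.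
  have -> : Pr (l1 @^-1` [set t] `&` T (- kap1 t) @^-1` (l @^-1` [set (u : nat)])) =
      Pr (D `&` l @^-1` [set (u : nat)]).
    rewrite -(Pr_pre (mT (- kap1 t)) mDu); apply: Pr_eq_ae.
    + by apply: measurableI => //; exact: mpt_pre.
    + exact: mpt_pre.
    + by apply: filterS l1D => x /(_ t) h; rewrite /preimage /= -h.
  by rewrite natrM -mulrA hl ?Pl1.
- move=> a Ha; apply: filterS2 (hl1 a Ha) TT => x h1 h2; rewrite /ll /= addrAC; congr (_ + _) => //.
  have Hk := kN (l1 x); have Hka : H1 (- kap1 (l1 x) - a) by exact: subgroupB.
  by rewrite h1; congr (s (inord (l _))); rewrite opprD -h2// subrK.
- move=> B BE; have mB := mEs _ BE.
  have /choice[A hA] : forall t, exists A : set nat, dm (D `&` T (kap1 t) @^-1` B) (D `&` l @^-1` A) < e / n1.+1%:R.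
    by move=> t; apply: apx; apply/allpairsP; exists (t, B); rewrite mem_enum.
  exists [set tu : 'I_n1.+1 * 'I_m.+1 | A tu.1 tu.2].
  have mA : measurable (ll @^-1` [set tu : 'I_n1.+1 * 'I_m.+1 | A tu.1 tu.2]) by exact: (preimage_label id mll).
  have mS := measurable_symdiff mB mA.
  have mlA t : measurable (l @^-1` A t) by exact: preimage_bounded_label lm ml (A t).
  rewrite /dm (Pr_fibers P ml1 mS).
  apply: (@lt_le_trans _ _ (\sum_(t < n1.+1) e / n1.+1%:R)); last first.
    by rewrite sumr_const card_ord -[leLHS]mulr_natr divfK// gt_eqF.
  apply: ltr_sum; first by apply/hasP; exists ord0; rewrite ?mem_index_enum.
  move=> t _; apply: le_lt_trans (hA t).
  have m1 : measurable (D `&` T (kap1 t) @^-1` B) by apply: measurableI => //; exact: mpt_pre.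
  have m2 : measurable (D `&` l @^-1` A t) by exact: measurableI.
  have m3 := measurable_symdiff m1 m2.
  rewrite /dm -(Pr_pre (mT (- kap1 t)) m3); apply: Pr_le_ae.
  + exact: measurableI.
  + exact: mpt_pre.
  + apply: filterS3 l1D TT (act0 aT) => x h1 h2 h3 [].
    rewrite /symdiff /preimage /= /ll /= => h4 xt.
    have Dx : D (T (- kap1 t) x) by apply/h1.
    rewrite xt inordK// in h4.
    by rewrite -h2// subrr h3 /=; move: h4; tauto.
Qed.

(** [T] is first made free over the finite group [H1] of controlled elements. Its tower is then
    refined to levels indexed by a large finite [K], and [K] is made to translate these levels.
    Under [H1] both actions move the refined levels in the same way, and the controlled sets are
    almost unions of levels, so the new action stays close to [T]. *)
Lemma tower_dense T n0 m (e : R) : ~ finite_set H ->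
  (forall h, H h -> exists2 n, (0 < n)%N & h *+ n = 0) -> actions_on P H T -> 0 < e ->
  exists2 S, wclose n0 S T & near_in P E en (actions_on P H) (tower e m) S.
Proof.
move=> iH tH aT e0; pose N0 := maxn n0.*2.+1 m.
pose gs := [seq (if `[< H (en i) >] then en i else 0) | i <- iota 0 N0].
have gsH g : g \in gs -> H g.
  by move=> /mapP[i _ ->]; case: asboolP => // _; exact: subgroup0.
pose H1 := adjoins [set 0] gs; have s0 := @subgroup_triv G.
have sH1 : is_subgroup H1 by exact: adjoins_subgroup.
have H1H : H1 `<=` H by apply: adjoins_min => // x ->; exact: subgroup0.
have enH1 i : (i < N0)%N -> H (en i) -> H1 (en i).
  move=> iN Hi; apply: adjoins_gen => //; apply/mapP; exists i; first by rewrite mem_iota.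
  by rewrite asboolT.
have fH1 : finite_set H1 by apply: adjoins_finite => g /gsH/tH.
have [n1 [kap1 [k1H ik1 sk1]]] := finite_enum fH1 (subgroup0 sH1).
have rk1 : range kap1 = H1.
  by apply/seteqP; split=> [_ [t _ <-]//|h /sk1[t <-]]; exists t.
have [S1 [l1 [aS1 ml1 Pl1 hl1 cS1]]] :=
  free_skew HX HP sH1 k1H ik1 sk1 mE en n0.*2.+1 (restr_actions sH1 H1H aT).
pose Es := [seq E j | j <- iota 0 N0].
have mEs B : B \in Es -> measurable B by move=> /mapP[j _ ->].
have inEs j : (j < N0)%N -> E j \in Es by move=> jN; apply/mapP; exists j; rewrite ?mem_iota.
set v : R := n0.+1%:R^-1; have v0 : 0 < v by rewrite invr_gt0.
(* Passing from [T] to [S1] costs [v / 2]; approximating by levels before and after applying the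
   action costs [e1] twice. *)
pose e1 := Num.min e (v / 4%:R).
have e10 : 0 < e1 by rewrite lt_min e0 divr_gt0.
have e1e : e1 <= e by rewrite ge_min lexx.
have e1v : e1 <= v / 4%:R by rewrite ge_min lexx orbT.
have [M hM] := label_refinement e10 sH1 ik1 rk1 aS1 ml1 Pl1 hl1 mEs.
(* More than [n1.+1 * M.+1] elements force more than [M.+1] cosets of [H1], hence enough slices. *)
have [K [sK fK KH gK [u [uu us uK]]]] := finite_hull (n1.+1 * M.+1) sH iH tH gsH.
have H1K : H1 `<=` K by apply: adjoins_min => // x ->; exact: subgroup0.
have [m1 [s [sT cov uniq]]] := finite_transversal sH1 H1K sK fK.
pose kap (t : 'I_n1.+1 * 'I_m1.+1) := kap1 t.1 + s t.2.
have ik : injective kap.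
  move=> [t a] [t' a']; rewrite /kap /= => h.
  have aa : a = a'.
    apply: uniq; have -> : s a - s a' = kap1 t' - kap1 t.
      by apply/eqP; rewrite subr_eq addrAC eq_sym subr_eq addrC [s a + _]addrC h addrC.
    exact: subgroupB.
  by move: h; rewrite aa => /addIr/ik1 ->.
have rk : range kap = K.
  apply/seteqP; split=> [_ [t _ <-]|g Kg].
    by apply: subgroupD => //; exact: H1K.
  by have [a /sk1[t h]] := cov g Kg; exists (t, a); rewrite // /kap /= h subrK.
have cJ : #|{: 'I_n1.+1 * 'I_m1.+1}| = (n1.+1 * m1.+1)%N by rewrite card_prod !card_ord.
have Mm : (M <= m1)%N.
  have : (size u <= size (codom kap))%N.
    apply: uniq_leq_size => // g /uK; rewrite -rk => -[t _ <-]; exact: codom_f.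
  by rewrite size_codom cJ => h; have := leq_trans us h; rewrite ltn_pmul2l// ltnS => /ltnW.
have [l [ml Pl hl apx]] := hM m1 s Mm.
have sr : is_subgroup (range kap) by rewrite rk.
rewrite -cJ in Pl.
have [T2 aT2 hT2] := action_of_label ik sr ml Pl.
pose fibs := [seq l @^-1` [set t] | t : 'I_n1.+1 * 'I_m1.+1].
have mfib B : B \in fibs -> measurable B by move=> /mapP[t _ ->].
pose Bs := fibs ++ Es.
have mBs B : B \in Bs -> measurable B by rewrite mem_cat => /orP[/mfib|/mEs].
have rH : range kap `<=` H by rewrite rk.
have [S aS hS] := extension HX HP en_surj [seq kap t | t : 'I_n1.+1 * 'I_m1.+1] sH sr rH aT2 mBs.
have {}hS a B : range kap a -> B \in Bs -> dm (S a @^-1` B) (T2 a @^-1` B) = 0.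
  by move=> Ka BB; apply: hS => //; case: Ka => t _ <-; apply: map_f; rewrite mem_enum.
have hl2 a : H1 a -> \forall x \ae P, l (T2 a x) = l (S1 a x).
  move=> Ha; have Ka : range kap a by rewrite rk; exact: H1K.
  by apply: filterS2 (hT2 a Ka) (hl a Ha) => x h1 h2; apply: ik; rewrite h1 -h2.
have hlS a : range kap a -> \forall x \ae P, kap (l (S a x)) = kap (l x) + a.
  move=> Ka; have : \forall x \ae P, forall t, (l (S a x) = t) <-> (l (T2 a x) = t).
    apply: filter_forall => t; have mB := ml t.
    have : dm (S a @^-1` (l @^-1` [set t])) (T2 a @^-1` (l @^-1` [set t])) = 0.
      by apply: hS => //; rewrite mem_cat; apply/orP; left; apply: map_f; rewrite mem_enum.
    by move/dm0_ae; apply; [exact: act_pre aS mB|exact: act_pre aT2 mB].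
  by apply: filterS2 (hT2 a Ka) => x h1 /(_ (l (T2 a x)))[_ /(_ erefl) ->].
exists S.
  move=> i j ni nj; have [Hi|nH] := pselect (H (en i)); last first.
    by rewrite (act_off aS nH) (act_off aT nH) dmxx invr_gt0.
  have iN : (i < N0)%N by rewrite leq_max; apply/orP; left; lia.
  have jN : (j < N0)%N by rewrite leq_max; apply/orP; left; lia.
  have H1i := enH1 i iN Hi; have Ki : range kap (en i) by rewrite rk; exact: H1K.
  have := cS1 i j; rewrite inv_nat_half restrE// -/v => /(_ _ _).
  have i2 : (i < n0.*2.+1)%N by lia. have j2 : (j < n0.*2.+1)%N by lia.
  move=> /(_ i2 j2) h1.
  have [A hA] := apx _ (inEs j jN).
  have mA : measurable (l @^-1` A) by exact: (preimage_label id ml).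
  have m2 := act_mpt_all (en i) aT2; have m1' := act_mpt_all (en i) aS1.
  have p1 := act_pre (en i) aS (mE j); have p2 := mpt_pre m2 (mE j); have p3 := mpt_pre m1' (mE j).
  have p4 := mpt_pre m2 mA; have p5 := mpt_pre m1' mA; have p6 := act_pre (en i) aT (mE j).
  have z1 : dm (S (en i) @^-1` E j) (T2 (en i) @^-1` E j) = 0.
    by apply: hS => //; rewrite mem_cat inEs ?orbT.
  have z2 : dm (T2 (en i) @^-1` (l @^-1` A)) (S1 (en i) @^-1` (l @^-1` A)) = 0.
    by apply/(dm0_ae P p4 p5); apply: filterS (hl2 _ H1i) => x; rewrite /preimage /= => ->.
  have q1 := dm_pre m2 (mE j) mA; have q2 := dm_pre m1' (mE j) mA.
  have t1 := dm_tri P p1 p2 p6; have t2 := dm_tri P p2 p4 p6; have t3 := dm_tri P p4 p5 p6.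
  have t4 := dm_tri P p5 p3 p6; rewrite (dmC P _ (S1 (en i) @^-1` E j)) in t4; lra.
split=> //; set N := #|{: 'I_n1.+1 * 'I_m1.+1}|%:R in Pl *.
have N0' : 0 <= N ^+ 2 by rewrite exprn_ge0.
have N1 : 0 < N * N ^+ 2 + 1 by rewrite ltr_wpDl// mulr_ge0.
(* A point where the translation rule fails for [W] lies in one of [N] differences between levels,
   and the total must stay below [e / N ^+ 2]; the added 1 makes the inequality strict. *)
have eta0 : 0 < e / (N * N ^+ 2 + 1) by rewrite divr_gt0.
have [q hq] := close_control mE dE en_surj [seq kap t | t : 'I_n1.+1 * 'I_m1.+1] eta0 mfib.
exists q => W aW hW; exists ('I_n1.+1 * 'I_m1.+1)%type, kap, l; split=> //.
- split=> //.
    by move=> t; apply: rH; exists t.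
  move=> i im Hi; rewrite rk; apply/H1K/enH1 => //.
  by rewrite leq_max im orbT.
- move=> t; have Kt : range kap (kap t) by exists t.
  have mW B := act_pre (A := B) (kap t) aW; have mS B := act_pre (A := B) (kap t) aS.
  have mD a := measurable_symdiff (mW _ (ml a)) (mS _ (ml a)).
  have [mU hU] := Pr_setU_bound P mD.
  have mlW a : measurable ((fun x => l (W (kap t) x)) @^-1` [set a]) by exact: mW (ml a).
  have hP : Pr [set x | kap (l (W (kap t) x)) <> kap (l x) + kap t] <= N * (e / (N * N ^+ 2 + 1)).
    apply: le_trans (Pr_le_ae _ mU _) (le_trans hU _).
    + exact: (measurable_two_labels (fun a b => kap a <> kap b + kap t) mlW ml).
    + apply: filterS (hlS _ Kt) => x h /= no; exists (l (S (kap t) x)).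
      by right; split=> //; rewrite /preimage /= => E1; apply: no; rewrite -h -E1.
    + apply: (@le_trans _ _ (\sum_(t : 'I_n1.+1 * 'I_m1.+1) (e / (N * N ^+ 2 + 1)))).
        apply: ler_sum => a _; apply/ltW/(hq W S (act_mpts aW) (act_mpts aS) hW).
          by apply: map_f; rewrite mem_enum.
        by apply: map_f; rewrite mem_enum.
      by rewrite sumr_const -[leLHS]mulr_natl.
  apply: le_lt_trans (ler_wpM2l N0' hP) _.
  set D := N * N ^+ 2 + 1 in N1 *; have -> : N ^+ 2 * (N * (e / D)) = e * (N * N ^+ 2 / D) by ring.
  by rewrite gtr_pMr// ltr_pdivrMr// mul1r ltrDl.
- move=> j jm; have [|A hA] := apx (E j); first by apply: inEs; rewrite leq_max jm orbT.
  by exists A; exact: lt_le_trans hA e1e.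
Qed.
End towers.

(** * Transformations commuting with an action that has towers *)

Section weak_closure.
Context (R : realType) (d : measure_display) (X : measurableType d)
  (P : probability X R).
Context (G : zmodType) (H : set G) (sH : is_subgroup H).
Context (E : nat -> set X) (mE : forall n, measurable (E n))
  (dE : forall A, measurable A -> forall e : R, 0 < e -> exists n, dm P A (E n) < e).
Context (en : nat -> G).
Implicit Types (A B C D : set X) (S T : G -> X -> X).
Local Notation Pr := (Pr P).
Local Notation dm := (dm P).

Lemma weighted_pigeonhole (J : finType) (w f : J -> R) (c c' : R) : (forall k, 0 <= w k) ->
  \sum_k w k = 1 -> \sum_k w k * f k <= c -> c < c' -> exists k, f k < c'.
Proof.
move=> w0 w1 h cc; apply: contrapT => no.
have : \sum_k w k * c' <= \sum_k w k * f k.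
  apply: ler_sum => k _; apply: ler_wpM2l => //.
  by rewrite leNgt; apply/negP => fk; apply: no; exists k.
by rewrite -mulr_suml w1 mul1r; lra.
Qed.

Lemma dm_label (J : finType) (l : X -> J) (A A' : set J) :
  dm (l @^-1` A) (l @^-1` A') = Pr (l @^-1` (symdiff A A')).
Proof. by []. Qed.

(* [w x] is the translation by which [r] moves the level of [x]. As [r] commutes with the
   action, [w] is almost invariant, hence almost independent of the level. On [w x = k] the
   transformation [r] acts on levels as [T k]; sets whose preimages under [r] are again unions
   of levels can therefore be translated consistently only if [T k] is close to [r] on them,
   for most [k]. *)
Lemma centralizer_tower T (r : X -> X) (J : finType) (kap : J -> G) (l : X -> J) (b : R)
    (As : seq (set X)) (de : R) :
  actions_on P H T -> mpt P r -> (forall h, H h -> ae_eq P (r \o T h) (T h \o r)) ->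
  injective kap -> (forall t, H (kap t)) -> is_subgroup (range kap) ->
  (forall t, measurable (l @^-1` [set t])) -> (forall t, #|J|%:R * Pr (l @^-1` [set t]) = 1) ->
  (forall t, Pr [set x | kap (l (T (kap t) x)) <> kap (l x) + kap t] <= b) ->
  #|J|%:R ^+ 2 * b <= de -> b <= de -> 0 < de ->
  (forall A, A \in As -> measurable A) ->
  (forall A, A \in As -> exists S : set J, dm A (l @^-1` S) < 2 * de) ->
  (forall A, A \in As -> exists S : set J, dm (r @^-1` A) (l @^-1` S) < 2 * de) ->
  exists k, forall A, A \in As ->
    dm (T (kap k) @^-1` A) (r @^-1` A) < (6 * (size As).+1%:R) * de.
Proof.
move=> aT mr rT ik kH sK ml Pl hb hN bde de0 mAs hS hS'.
have mlQ (Q : set J) : measurable (l @^-1` Q) by exact: (preimage_label id ml).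
have mT k : mpt P (T k) by exact: act_mpt_all aT.
have N0 : 0 < #|J|%:R :> R.
  have [j0 _ _] := subgroup0 sK; rewrite lt_def ler0n andbT; apply/eqP => h.
  by have := Pl j0; rewrite h mul0r => /esym/eqP; rewrite oner_eq0.
have b0 : 0 <= b.
  have [j0 _ _] := subgroup0 sK; apply: le_trans (hb j0); exact: Pr_ge0.
have /choice[dif hdif] : forall st : J * J, exists k, kap k = kap st.1 - kap st.2.
  move=> [s t]; have [||k _ kE] := subgroupB (a := kap s) (b := kap t) sK; last by exists k.
    by exists s.
  by exists t.
have mlr t : measurable ((l \o r) @^-1` [set t]) by exact: (mpt_pre mr (ml t)).
pose w x := dif (l (r x), l x).
have mw k : measurable (w @^-1` [set k]).
  exact: (measurable_two_labels (fun s t => dif (s, t) = k) mlr ml).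
have wP x k : w x = k <-> kap (l (r x)) = kap (l x) + kap k.
  split=> [<-|h]; first by rewrite hdif /= addrC subrK.
  by apply: ik; rewrite hdif /= h addrAC subrr add0r.
have mWl k s : measurable (w @^-1` [set k] `&` l @^-1` [set s]) by exact: measurableI.
have mbad t : measurable [set x | kap (l (T (kap t) x)) <> kap (l x) + kap t].
  apply: (measurable_two_labels (l := l \o T (kap t)) (fun a b => kap a <> kap b + kap t) _ ml).
  by move=> a; exact: (mpt_pre (mT _) (ml a)).
(* The displacement [w] is unchanged by [T (kap t)] unless [x] or [r x] is a bad point of that
   translation, whence [2 * b]. *)
have inv k s s' : Pr (w @^-1` [set k] `&` l @^-1` [set s]) <=
    Pr (w @^-1` [set k] `&` l @^-1` [set s']) + 2 * b.
  pose t := dif (s', s); have tE : kap t = kap s' - kap s by rewrite hdif.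
  set bad := [set x | kap (l (T (kap t) x)) <> kap (l x) + kap t].
  have mb := mbad t; have mrb := mpt_pre mr mb; have mTW := mpt_pre (mT (kap t)) (mWl k s').
  have mU : measurable (bad `|` r @^-1` bad) by exact: measurableU.
  have : Pr (w @^-1` [set k] `&` l @^-1` [set s]) <=
      Pr (T (kap t) @^-1` (w @^-1` [set k] `&` l @^-1` [set s'])) + Pr (bad `|` r @^-1` bad).
    apply: Pr_leD_ae => //; apply: filterS (rT _ (kH t)) => x /= rTx [wx lx].
    have [|nb] := pselect (bad x); first by right; left.
    have [|nrb] := pselect (bad (r x)); first by right; right.
    left; have h1 : kap (l (T (kap t) x)) = kap (l x) + kap t by apply: contrapT.
    have h2 : kap (l (T (kap t) (r x))) = kap (l (r x)) + kap t by apply: contrapT.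
    rewrite /preimage /=; split; last by apply: ik; rewrite h1 lx tE addrC subrK.
    apply/wP; rewrite rTx h2 h1 addrAC; congr (_ + _); exact/wP.
  rewrite (Pr_pre (mT _) (mWl k s')); have := PrU_le P mb mrb; rewrite (Pr_pre mr mb).
  by have := hb t; rewrite -/bad; lra.
(* The set where [w = k] meets all levels in nearly equal measure, so it is nearly independent of
   every union of levels. *)
have indep k (Q : set J) : Pr (w @^-1` [set k]) * Pr (l @^-1` Q) <=
    Pr (w @^-1` [set k] `&` l @^-1` Q) + #|J|%:R * (2 * b).
  have low s : Pr (w @^-1` [set k]) * Pr (l @^-1` [set s]) <=
      Pr (w @^-1` [set k] `&` l @^-1` [set s]) + 2 * b.
    have : Pr (w @^-1` [set k]) <=
        \sum_(s' : J) (Pr (w @^-1` [set k] `&` l @^-1` [set s]) + 2 * b).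
      by rewrite (Pr_fibers P ml (mw k)); apply: ler_sum => s' _; exact: inv.
    rewrite sumr_const -[leRHS]mulr_natl => h; rewrite -(ler_pM2l N0).
    by rewrite mulrCA Pl mulr1.
  have mWQ : measurable (w @^-1` [set k] `&` l @^-1` Q) by exact: measurableI.
  rewrite (Pr_fibers P ml (mlQ Q)) (Pr_fibers P ml mWQ) mulr_sumr.
  have -> : #|J|%:R * (2 * b) = \sum_(s : J) (2 * b) by rewrite sumr_const mulr_natl.
  rewrite -big_split /=; apply: ler_sum => s _.
  have [Qs|nQs] := pselect (Q s).
    have -> : l @^-1` Q `&` l @^-1` [set s] = l @^-1` [set s].
      by apply/seteqP; split=> x; rewrite /preimage /=; [case|move=> ->].
    have -> : w @^-1` [set k] `&` l @^-1` Q `&` l @^-1` [set s] =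
        w @^-1` [set k] `&` l @^-1` [set s].
      by apply/seteqP; split=> x; rewrite /preimage /=; [move=> [[]]|move=> [-> ->]].
    exact: low.
  have -> : l @^-1` Q `&` l @^-1` [set s] = set0.
    by apply/seteqP; split=> x //; rewrite /preimage /= => -[Qx lx]; apply: nQs; rewrite -lx.
  by rewrite Pr0 mulr0 addr_ge0 ?Pr_ge0// mulr_ge0.
have /choice[SA hSA] : forall A, exists S : set J, A \in As -> dm A (l @^-1` S) < 2 * de.
  move=> A; have [AA|] := boolP (A \in As); last by exists set0.
  by have [S ?] := hS A AA; exists S.
have /choice[SA' hSA'] : forall A, exists S : set J, A \in As -> dm (r @^-1` A) (l @^-1` S) < 2 * de.
  move=> A; have [AA|] := boolP (A \in As); last by exists set0.
  by have [S ?] := hS' A AA; exists S.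
(* The levels that the translation by [kap k] moves into [SA A]; where [w = k], this is also how [r]
   moves them. *)
pose sh A k := [set s | exists2 s', kap s' = kap s + kap k & SA A s'].
pose Q A k := symdiff (sh A k) (SA' A).
have shP A k s s' : kap s' = kap s + kap k -> sh A k s <-> SA A s'.
  by move=> h; split=> [[s1 h1]|h1]; [rewrite -h in h1; rewrite -(ik _ _ h1)|exists s'].
(* The constant 6 consists of [4 * de] for the two approximations by levels and [2 * de] for the
   defect of independence summed over all [k]. *)
have sumk A : A \in As ->
    \sum_k Pr (w @^-1` [set k]) * Pr (l @^-1` Q A k) <= 6 * de.
  move=> AA; have mA := mAs _ AA; pose D := symdiff (r @^-1` (l @^-1` SA A)) (l @^-1` SA' A).
  have mD : measurable D by apply: measurable_symdiff => //; exact: (mpt_pre mr (mlQ _)).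
  have PD : Pr D <= 4 * de.
    have t1 := dm_tri P (mpt_pre mr (mlQ (SA A))) (mpt_pre mr mA) (mlQ (SA' A)).
    have t2 := hSA A AA; have t3 := hSA' A AA.
    rewrite (dm_pre mr (mlQ _) mA) [dm (l @^-1` SA A) A]dmC in t1.
    by apply: (le_trans t1); lra.
  apply: (@le_trans _ _ (\sum_k (Pr (D `&` w @^-1` [set k]) + #|J|%:R * (2 * b)))).
    apply: ler_sum => k _; apply: le_trans (indep k (Q A k)) _; rewrite lerD2r.
    rewrite (_ : w @^-1` [set k] `&` _ = D `&` w @^-1` [set k])// setIC.
    apply/seteqP; split=> x [Dx wx]; split=> //; move: Dx; rewrite /D /Q /symdiff /preimage /=;
      by have := shP A k _ _ ((wP x k).1 wx); tauto.
  rewrite big_split /= -(Pr_fibers P mw mD) sumr_const -[X in _ + X]mulr_natl.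
  by move: hN; rewrite expr2; lra.
have W1 : \sum_k Pr (w @^-1` [set k]) = 1.
  rewrite -(PrT P) (Pr_fibers P mw measurableT).
  by under [in RHS]eq_bigr do rewrite setTI.
pose f k := \sum_(A <- As) Pr (l @^-1` Q A k).
have fsum : \sum_k Pr (w @^-1` [set k]) * f k <= 6 * (size As)%:R * de.
  rewrite (eq_bigr (fun k => \sum_(A <- As) Pr (w @^-1` [set k]) * Pr (l @^-1` Q A k))); last first.
    by move=> k _; rewrite mulr_sumr.
  rewrite exchange_big /= big_seq_cond.
  apply: (@le_trans _ _ (\sum_(A <- As | (A \in As) && true) (6 * de))).
    by apply: ler_sum => A /andP[AA _]; exact: sumk.
  by rewrite -big_seq_cond big_const_seq count_predT iter_addr_0 -[leLHS]mulr_natl; lra.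
have [||k hk] := weighted_pigeonhole (c' := 6 * (size As)%:R * de + de) _ W1 fsum _.
- by move=> k; exact: Pr_ge0.
- by rewrite ltrDl.
(* Besides the pigeonhole bound, which includes one extra [de] for strictness, [2 * de] is spent on
   each approximation and at most [de] on bad points: 6 more in all. *)
exists k => A AA; have mA := mAs _ AA.
have fA : Pr (l @^-1` Q A k) <= f k.
  rewrite /f (big_rem A AA) /= lerDl; apply: sumr_ge0 => B _; exact: Pr_ge0.
have mTk := mT (kap k).
have p1 := mpt_pre mTk mA; have p2 := mpt_pre mTk (mlQ (SA A)).
have p3 := mlQ (sh A k); have p4 := mlQ (SA' A); have p5 := mpt_pre mr mA.
have t1 := dm_tri P p1 p2 p5; have t2 := dm_tri P p2 p3 p5; have t3 := dm_tri P p3 p4 p5.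
rewrite (dm_pre mTk mA (mlQ _)) in t1; rewrite [dm (l @^-1` SA' A) _]dmC in t3.
have h1 := hSA A AA; have h2 := hSA' A AA.
have h3 : dm (T (kap k) @^-1` (l @^-1` SA A)) (l @^-1` sh A k) <= b.
  apply: le_trans (hb k); apply: Pr_le => //; first exact: measurable_symdiff.
  move=> x Dx /= E1; have := shP A k _ _ E1; move: Dx; rewrite /symdiff /preimage /=; tauto.
rewrite dm_label -/(Q A k) in t3.
by rewrite -natr1; lra.
Qed.
End weak_closure.

Section residual_properties.
Context (R : realType) (d : measure_display) (X : measurableType d)
  (P : probability X R).
Context (G : zmodType) (H : set G) (sH : is_subgroup H).
Context (E : nat -> set X) (mE : forall n, measurable (E n))
  (dE : forall A, measurable A -> forall e : R, 0 < e -> exists n, dm P A (E n) < e).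
Context (en : nat -> G) (en_surj : forall g, exists i, en i = g).
Implicit Types (A B C D : set X) (S T : G -> X -> X).
Local Notation Pr := (Pr P).
Local Notation dm := (dm P).
Local Notation tower := (tower P H E en).

Lemma tower_closure T (r : X -> X) (As : seq (set X)) (e : R) : actions_on P H T ->
  (forall m, tower m.+1%:R^-1 m T) ->
  mpt P r -> (forall h, H h -> ae_eq P (r \o T h) (T h \o r)) ->
  (forall A, A \in As -> measurable A) -> 0 < e ->
  exists2 h, H h & forall A, A \in As -> dm (T h @^-1` A) (r @^-1` A) < e.
Proof.
move=> aT tT mr rT mAs e0.
pose s := 6 * (size As).+1%:R : R; have s0 : 0 < s by rewrite mulr_gt0.
pose de := e / s; have de0 : 0 < de by rewrite divr_gt0.
have /choice[ix hix] : forall A, exists j, measurable A -> dm A (E j) < de.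
  move=> A; have [mA|] := pselect (measurable A); last by exists 0%N.
  by have [j ?] := dE mA de0; exists j.
have [m0 hm0] := inv_nat_lt de0.
(* Both [A] and its preimage under [r] must be almost unions of levels, so the indices approximating
   either one have to be below [m]. *)
pose m := maxn m0 (\max_(A <- As) maxn (ix A).+1 (ix (r @^-1` A)).+1).
have em : m.+1%:R^-1 < de.
  by apply: le_lt_trans hm0; apply: inv_nat_le; exact: leq_maxl.
have ixm A : A \in As -> (ix A < m)%N /\ (ix (r @^-1` A) < m)%N.
  move=> AA; have h : (maxn (ix A).+1 (ix (r @^-1` A)).+1 <= m)%N.
    apply: leq_trans (leq_maxr _ _).
    exact: (leq_bigmax_seq (F := fun A => maxn (ix A).+1 (ix (r @^-1` A)).+1)).
  by split; apply: leq_trans h; rewrite leq_max leqnn ?orbT.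
have [J [kap [l [[ik kH sK _] ml Pl hb hA]]]] := tT m.
have approx A : measurable A -> (ix A < m)%N -> exists S : set J, dm A (l @^-1` S) < 2 * de.
  move=> mA ia; have [S hS] := hA _ ia; exists S.
  have mlS : measurable (l @^-1` S) by exact: (preimage_label id ml).
  have := dm_tri P mA (mE (ix A)) mlS; have := hix A mA; have := lt_trans hS em.
  by clear hS em hm0; lra.
have N1 : 1 <= #|J|%:R :> R.
  rewrite (ler_nat _ 1); have [j0 _ _] := subgroup0 sK.
  by apply/card_gt0P; exists j0.
have N2 : 0 < #|J|%:R ^+ 2 :> R by rewrite exprn_gt0//; lra.
have [|||||||k hk] := @centralizer_tower _ _ _ P G H T r J kap l (m.+1%:R^-1 / #|J|%:R ^+ 2) As de
  aT mr rT ik kH sK ml Pl.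
- by move=> t; rewrite ler_pdivlMr// mulrC ltW.
- by rewrite mulrC divfK ?gt_eqF// ltW.
- rewrite ler_pdivrMr//; apply: le_trans (ltW em) _.
  by apply: ler_peMr; [exact: ltW|exact: exprn_ege1].
- by [].
- exact: mAs.
- by move=> A AA; apply: approx; [exact: mAs|case: (ixm A AA)].
- by move=> A AA; apply: approx; [exact: mpt_pre mr (mAs _ AA)|case: (ixm A AA)].
exists (kap k) => // A AA; have := hk A AA; rewrite -/s /de mulrC divfK//.
by rewrite gt_eqF.
Qed.

(** If [T h] is trivial while [h] is not 0, almost every point violates the translation rule of a
    tower whose group contains [h]. *)
Lemma tower_faithful T h : actions_on P H T -> (forall m, tower m.+1%:R^-1 m T) ->
  H h -> ae_eq P (T h) id -> h = 0.
Proof.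
move=> aT tT Hh Th; have [i ih] := en_surj h.
have [J [kap [l [[ik kH sK hK] ml Pl hb _]]]] := tT i.+1.
have [t _ tE] : range kap h by rewrite -ih; apply: hK; rewrite ?ih.
apply: contrapT => /eqP h0; have := hb t; rewrite tE.
have mTl a : measurable ((l \o T h) @^-1` [set a]) by exact: (act_pre h aT (ml a)).
have mB : measurable [set x | kap (l (T h x)) <> kap (l x) + h].
  exact: (measurable_two_labels (l := l \o T h) (fun a b => kap a <> kap b + h) mTl ml).
have -> : Pr [set x | kap (l (T h x)) <> kap (l x) + h] = 1.
  rewrite -(PrT P); apply: Pr_eq_ae => //; apply: filterS Th => x Tx; split=> // _ /=.
  by rewrite (Tx : T h x = x) => /eqP; rewrite -subr_eq0 opprD addrA subrr sub0r oppr_eq0 (negbTE h0).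
have : 1 <= #|J|%:R :> R by rewrite (ler_nat _ 1); apply/card_gt0P; exists t.
have : (i.+1).+1%:R^-1 <= 1 :> R by rewrite invf_le1// ler1n.
set v := _^-1; set w := _%:R; rewrite mulr1 => h1 h2; nra.
Qed.

End residual_properties.

(** * Multiples of weak limits, and primary groups with finite socle *)

Section limits_of_powers.
Context (R : realType) (d : measure_display) (X : measurableType d)
  (P : probability X R).
Context (G : zmodType).
Implicit Types (A B C D : set X) (S T : G -> X -> X) (H : set G).
Local Notation dm := (dm P).

Definition in_closure H S g := forall (As : seq (set X)) (e : R),
  (forall A, A \in As -> measurable A) -> 0 < e ->
  exists2 h, H h & forall A, A \in As -> dm (S h @^-1` A) (S g @^-1` A) < e.

(** Telescoping: one factor [h] is exchanged for [g] at a time, and the exchange at step [i] is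
    tested on the preimage already taken under [S (g *+ i)]. *)
Lemma close_multiples S g h (As : seq (set X)) (e : R) n : Omega P G S ->
  (forall A, A \in As -> measurable A) ->
  (forall A i, A \in As -> (i < n)%N ->
     dm (S h @^-1` (S (g *+ i) @^-1` A)) (S g @^-1` (S (g *+ i) @^-1` A)) < e) ->
  forall A, A \in As -> dm (S (h *+ n) @^-1` A) (S (g *+ n) @^-1` A) <= n%:R * e.
Proof.
move=> aS mAs; have mS k : mpt P (S k) by exact: act_mpt_all aS.
have split k l A : measurable A -> dm (S (k + l) @^-1` A) (S l @^-1` (S k @^-1` A)) = 0.
  move=> mA; apply/(dm0_ae P (mpt_pre (mS _) mA) (mpt_pre (mS _) (mpt_pre (mS _) mA))).
  by apply: filterS (actD aS (I : [set: G] k) (I : [set: G] l)) => x; rewrite /preimage /= => ->.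
elim: n => [|n ih] hn A AA; have mA := mAs _ AA; first by rewrite !mulr0n dmxx mul0r.
have {}ih := ih (fun A i AA ni => hn A i AA (ltnW ni)) A AA.
have hnA := hn A n AA (ltnSn n).
rewrite !mulrSr.
have p1 := mpt_pre (mS (h *+ n)) mA; have p2 := mpt_pre (mS (g *+ n)) mA.
have q1 := mpt_pre (mS (h *+ n + h)) mA; have q2 := mpt_pre (mS h) p1.
have q3 := mpt_pre (mS h) p2; have q4 := mpt_pre (mS g) p2.
have q5 := mpt_pre (mS (g *+ n + g)) mA.
have t1 := dm_tri P q1 q2 q5; have t2 := dm_tri P q2 q3 q5; have t3 := dm_tri P q3 q4 q5.
have := split (g *+ n) g A mA; rewrite dmC => z1.
rewrite (split (h *+ n) h A mA) in t1; rewrite (dm_pre (mS h) p1 p2) in t2.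
by lra.
Qed.

Lemma closure_multiple H S g n : Omega P G S -> in_closure H S g ->
  in_closure [set h *+ n | h in H] S (g *+ n).
Proof.
move=> aS cl As e mAs e0; have mS k : mpt P (S k) by exact: act_mpt_all aS.
pose As' := [seq S (g *+ i) @^-1` A | i <- iota 0 n, A <- As].
have mAs' A : A \in As' -> measurable A.
  by move=> /allpairsP[[i B] /= [_ /mAs mB ->]]; exact: mpt_pre.
have e1 : 0 < e / n.+1%:R by rewrite divr_gt0.
have [h Hh hh] := cl As' _ mAs' e1; exists (h *+ n).
  by exists h.
move=> A AA; apply: le_lt_trans (close_multiples (e := e / n.+1%:R) aS mAs _ AA) _.
  move=> B i BB ni; apply: hh; apply/allpairsP; exists (i, B); split=> //.
  by rewrite mem_iota.
by rewrite mulrCA gtr_pMr// ltr_pdivrMr// mul1r ltr_nat.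
Qed.


(** Finite sets are closed because the weak topology is separated: each [S h] different from [S g]
    is kept at a positive distance by one set of the dense sequence. *)
Lemma closure_finite (HX : standard_borel R X) (E : nat -> set X) F S g :
  (forall n, measurable (E n)) ->
  (forall A, measurable A -> forall e : R, 0 < e -> exists n, dm A (E n) < e) ->
  Omega P G S -> finite_set F -> in_closure F S g -> exists2 h, F h & ae_eq P (S h) (S g).
Proof.
move=> mE dE aS /finite_seqP[s sE] cl; apply: contrapT => no.
have mS k : mpt P (S k) by exact: act_mpt_all aS.
have /choice[j hj] : forall h, exists j, F h -> dm (S h @^-1` E j) (S g @^-1` E j) != 0.
  move=> h; have [Fh|] := pselect (F h); last by exists 0%N.
  apply: contrapT => nex; apply: no; exists h => //.
  apply: (separation HX mE dE) => // i; apply/eqP; apply: contrapT => /negP ne.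
  by apply: nex; exists i.
have [e e0 he] : exists2 e : R, 0 < e & forall h, h \in s ->
    e <= dm (S h @^-1` E (j h)) (S g @^-1` E (j h)).
  have : forall h, h \in s -> 0 < dm (S h @^-1` E (j h)) (S g @^-1` E (j h)).
    by move=> h hs; rewrite lt_def dm_ge0 hj// sE.
  elim: s {sE cl} => [_|h s ih hs]; first by exists 1.
  have [|e e0 he] := ih; first by move=> h' h's; apply: hs; rewrite inE h's orbT.
  exists (Num.min e (dm (S h @^-1` E (j h)) (S g @^-1` E (j h)))).
    by rewrite lt_min e0 hs// mem_head.
  move=> h'; rewrite inE => /orP[/eqP ->|/he]; first by rewrite ge_min lexx orbT.
  by apply: le_trans; rewrite ge_min lexx.
have [|h Fh hh] := cl [seq E (j h) | h <- s] e _ e0.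
  by move=> A /mapP[h _ ->].
have hs : h \in s by rewrite sE in Fh.
have := hh (E (j h)) (map_f _ hs); rewrite ltNge => /negP; apply; exact: he.
Qed.
End limits_of_powers.

Section bounded_primary.
Context (G : zmodType).

(** Nonempty fibres of multiplication by [p] are cosets of the elements killed by [p], so finiteness
    climbs from exponent [p ^ n] to [p ^ n.+1]. *)
Lemma finite_primary (F : set G) p a : is_subgroup F ->
  finite_set [set x | F x /\ x *+ p = 0] -> (forall x, F x -> x *+ (p ^ a) = 0) -> finite_set F.
Proof.
move=> sF fp hF.
suff h n : finite_set [set x | F x /\ x *+ (p ^ n) = 0].
  by apply: sub_finite_set (h a) => x Fx; split=> //; exact: hF.
elim: n => [|n ih].
  by apply: sub_finite_set (finite_set1 0) => x [_]; rewrite expn0 mulr1n.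
pose S y := [set x | F x /\ x *+ p = y].
apply: (sub_finite_set (B := \bigcup_(y in [set x | F x /\ x *+ (p ^ n) = 0]) S y)).
  move=> x [Fx xn]; exists (x *+ p); split=> //; last by rewrite -mulrnA -expnS.
  by rewrite pmulrn; exact: subgroupMz.
apply: bigcup_finite => // y _.
have [[x0 [Fx0 x0y]]|no] := pselect (S y !=set0); last first.
  rewrite (_ : S y = set0); first exact: finite_set0.
  by apply/seteqP; split=> x // Sx; apply: no; exists x.
apply: (sub_finite_set (B := (fun z => z + x0) @` [set x | F x /\ x *+ p = 0])).
  move=> x [Fx xy]; exists (x - x0); last by rewrite subrK.
  by split; [exact: subgroupB|rewrite mulrnBl xy x0y subrr].
exact: finite_image.
Qed.

Lemma bounded_exponent (H : set G) : bounded_group H ->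
  exists2 N, (0 < N)%N & forall h, H h -> h *+ N = 0.
Proof.
move=> [N hN]; exists N`!; first exact: fact_gt0.
move=> h /hN[m [/andP[m0 mN] hm]]; have /dvdnP[q ->] : (m %| N`!)%N by rewrite dvdn_fact ?m0.
by rewrite mulnC mulrnA hm mul0rn.
Qed.
End bounded_primary.

(** * Necessity: the kernel of an extended generic action *)

Section necessity.
Context (R : realType) (d : measure_display) (X : measurableType d)
  (P : probability X R) (HX : standard_borel R X) (HP : atomless P).
Context (G : zmodType) (H : set G) (sH : is_subgroup H) (iH : ~ finite_set H)
  (bH : bounded_group H).
Context (en : nat -> G) (en_surj : forall g, exists i, en i = g).
Implicit Types (A B C D : set X) (S T : G -> X -> X).

(** A generic action of [H] both extends to [G] and has towers of every precision. As [G] is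
    abelian, each [S g] commutes with it and is therefore a limit of the [S h]. *)
Lemma centralized_extension :
  contains_dense_Gdelta P (actions_on P H) (restr H @` Omega P G) ->
  exists S, [/\ Omega P G S, forall g, in_closure P H S g
    & forall h, H h -> ae_eq P (S h) id -> h = 0].
Proof.
move=> [D [[U [oU DU]] [DY dD] Dim]].
have [f [mf inj fimg]] := HX; have [E [mE dE]] := dense_family P mf inj fimg.
have tH h : H h -> exists2 n, (0 < n)%N & h *+ n = 0.
  by have [N N0 hN] := bounded_exponent bH; exists N => //; exact: hN.
have mY y : actions_on P H y -> mpts P y by exact: act_mpts.
pose W m := near_in P E en (actions_on P H) (tower P H E en m.+1%:R^-1 m).
have oW m : wopen_in P (actions_on P H) (W m) by exact: near_in_wopen.
have dW m : dense_in P (actions_on P H) (W m).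
  apply: dense_near => // T n0 aT.
  by apply: (tower_dense HX HP sH mE dE en_surj) => //; rewrite invr_gt0.
have dU m : dense_in P (actions_on P H) (U m).
  split; first by case: (oU m).
  by move=> V oV V0; have [T [DT VT]] := dD V oV V0; exists T; split=> //; rewrite DU in DT; exact: DT.
pose O m := if odd m then U m./2 else W m./2.
have [_ dO] : dense_in P (actions_on P H) (\bigcap_m O m).
  apply: (baire mE dE) => //; first exact: complete_actions.
  - by move=> m; rewrite /O; case: ifP.
  - by move=> m; rewrite /O; case: ifP.
have oY : wopen_in P (actions_on P H) (actions_on P H).
  by apply: (@close_wopen _ _ _ P E mE _ en) => // T _; exists 0%N.
have aI : actions_on P H (restr H (fun=> id)).
  by apply: actions_onI => //; try (move=> *; exact: aeq_refl); move=> *; exact: mpt_id.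
have [T [OT aT]] := dO _ oY (ex_intro _ _ aI).
have tT m : tower P H E en m.+1%:R^-1 m T.
  by have := OT m.*2 I; rewrite /O odd_double doubleK => /near_in_sub.
have [S aS ST] : (restr H @` Omega P G) T.
  apply: Dim; rewrite DU => m _; have := OT m.*2.+1 I.
  by rewrite /O /= odd_double /= uphalf_double.
have TS h : H h -> T h = S h by move=> Hh; rewrite -ST restrE.
exists S; split=> // [g As e mAs e0|h Hh Sh].
  have [||h Hh hh] := tower_closure mE dE (r := S g) aT tT _ _ mAs e0.
  - exact: act_mpt_all aS.
  - move=> h Hh; rewrite (TS h Hh).
    have h1 := actD aS (I : [set: G] g) (I : [set: G] h).
    have h2 := actD aS (I : [set: G] h) (I : [set: G] g).
    by apply: aeq_trans (aeq_sym h1) _; rewrite addrC.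
  by exists h => // A AA; rewrite -(TS h Hh); exact: hh.
by apply: (tower_faithful en_surj aT tT Hh); rewrite (TS h Hh).
Qed.

(** [Gs] is the kernel of [S]. Each [S (g *+ n)] is a limit of the [S (h *+ n)], hence one of them
    when these are finite in number. Taking for [n] an exponent of [H] bounds the quotient; taking
    [p ^ k * c] treats the finite layers. *)
Lemma necessary_subgroup :
  contains_dense_Gdelta P (actions_on P H) (restr H @` Omega P G) ->
  exists Gs : set G, [/\ is_subgroup Gs, forall g, Gs g -> H g -> g = 0 &
    forall (Q : zmodType) (phi : G -> Q), is_quotient_map Gs phi ->
      (exists2 N, (0 < N)%N & forall q : Q, q *+ N = 0) /\
      forall p k, prime p -> finite_set (socle_layer p k (phi @` H)) ->
        socle_layer p k setT `<=` socle_layer p k (phi @` H)].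
Proof.
move=> /centralized_extension[S [aS clS fS]].
have [f [mf inj fimg]] := HX; have [E [mE dE]] := dense_family P mf inj fimg.
have mS k : mpt P (S k) by exact: act_mpt_all aS.
have SD g k := actD aS (I : [set: G] g) (I : [set: G] k).
pose Gs := [set g | ae_eq P (S g) id].
have sGs : is_subgroup Gs.
  split; first exact: act0 aS.
  move=> x y hx hy; have h := SD (x - y) y; rewrite subrK in h.
  have : ae_eq P (S (x - y)) (S x).
    by apply: filterS2 h hy => z /= -> ->.
  by move=> h'; exact: aeq_trans h' hx.
exists Gs; split=> // [g Gg Hg|Q phi [phiD phi_surj phiK]]; first exact: fS.
have phi0' : phi 0 = 0 by apply: (hom_on0 (subgroupT G)).
have phiMn g n : phi (g *+ n) = phi g *+ n.
  by elim: n => [|n ih]; rewrite ?mulr0n ?phi0'// !mulrS phiD ih.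
have phiB x y : phi (x - y) = phi x - phi y.
  by rewrite phiD (hom_onN (subgroupT G)).
have phi_inj h : H h -> phi h = 0 -> h = 0 by move=> Hh /phiK Gh; exact: fS.
have agree h g : ae_eq P (S h) (S g) -> phi h = phi g.
  move=> hg; apply/eqP; rewrite -subr_eq0 -phiB; apply/eqP/phiK.
  have h1 := SD (h - g) g; rewrite subrK in h1.
  have h2 := SD (g - g) g; rewrite subrK in h2.
  have e1 := SD g (- g); have e2 := SD h (- g).
  have e3 : ae_eq P (S h \o S (- g)) (S g \o S (- g)) by exact: mpt_ae (mS _) hg.
  apply: aeq_trans e2 _; apply: aeq_trans e3 _.
  by apply: aeq_trans (aeq_sym e1) _; rewrite subrr; exact: act0 aS.
have [N N0 hN] := bounded_exponent bH.
split.
  exists N => // q; have [g <-] := phi_surj q; rewrite -phiMn; apply/phiK.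
  have := closure_multiple N aS (clS g).
  have -> : [set h *+ N | h in H] = [set 0].
    apply/seteqP; split=> [_ [h /hN -> <-]//|_ ->].
    by exists 0; [exact: subgroup0|rewrite mul0rn].
  move/(closure_finite HX mE dE aS (finite_set1 _)) => [_ -> h].
  by apply: aeq_trans (aeq_sym h) _; exact: act0 aS.
move=> p k pp fin x [xp [y _ xE]].
have [N' pN' NE] := pfactor_coprime pp N0; set a := logn p N in NE.
(* Multiplication by [c] fixes the elements of order [p] and kills the part of [H] of order prime to
   [p]. So [F] is a [p]-group whose elements of order [p] embed in the finite layer, hence is
   finite. *)
pose c := chinese p N' 1 0.
have c1 : c = 1 %[mod p] by exact: (chinese_modl pN').
have c0 : c = 0 %[mod N'] by exact: (chinese_modr pN').
have [g gy] := phi_surj y.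
have xc : x *+ c = x.
  rewrite (divn_eq c p) mulrnDr mulnC mulrnA xp mul0rn add0r c1 modn_small ?mulr1n//.
  exact: prime_gt1.
have xg : phi (g *+ (p ^ k * c)) = x by rewrite phiMn gy mulrnA -xE xc.
pose F := [set h *+ (p ^ k * c) | h in H].
have FH h : F h -> H h by move=> [h' Hh <-]; rewrite pmulrn; exact: subgroupMz.
have sF : is_subgroup F.
  split; first by exists 0; [exact: subgroup0|rewrite mul0rn].
  move=> _ _ [h Hh <-] [h' Hh' <-]; exists (h - h'); first exact: subgroupB.
  by rewrite mulrnBl.
have layer h : F h -> h *+ p = 0 -> socle_layer p k (phi @` H) (phi h).
  move=> [h' Hh' <-] hp; split; first by rewrite -phiMn hp.
  exists (phi (h' *+ c)); last by rewrite mulnC mulrnA; exact: phiMn.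
  by exists (h' *+ c) => //; rewrite pmulrn; exact: subgroupMz.
have fF : finite_set F.
  apply: (finite_primary (p := p) (a := a)) => // [|_ [h Hh <-]].
    have /choice[psi hpsi] : forall q, exists h, (phi @` H) q -> H h /\ phi h = q.
      by move=> q; have [[h Hh <-]|] := pselect ((phi @` H) q); [exists h|exists 0].
    apply: sub_finite_set (finite_image psi fin) => h [Fh hp].
    exists (phi h); first exact: layer.
    have [|h1 h2] := hpsi (phi h); first by exists h => //; exact: FH.
    apply/eqP; rewrite -subr_eq0; apply/eqP/phi_inj; last by rewrite phiB h2 subrr.
    by apply: subgroupB => //; exact: FH.
  have /dvdnP[q cE] : (N' %| c)%N by rewrite /dvdn c0 mod0n.
  by rewrite -mulrnA cE mulnA -mulnA -NE mulnC mulrnA hN// mul0rn.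
have := closure_multiple (p ^ k * c) aS (clS g).
move/(closure_finite HX mE dE aS fF) => [h Fh /agree]; rewrite xg => hx.
rewrite -hx; apply: layer => //; apply: phi_inj; last by rewrite phiMn hx.
by rewrite pmulrn; apply: subgroupMz => //; exact: FH.
Qed.
End necessity.

(** * Embedding a bounded group into a subgroup *)
Section embedding.
Context (Q : zmodType) (V : set Q) (sV : is_subgroup V).
Implicit Types (F : set Q) (x y z g h : Q) (e : Q -> Q).

Lemma prime_order_mod F g p : prime p -> is_subgroup F -> ~ F g -> F (g *+ p) ->
  forall i : int, F (g *~ i) <-> (p%:Z %| i)%Z.
Proof.
move=> pp sF Fg Fgp i; split=> [Fi|/dvdzP[j ->]].
  have := @order_mod_pfactor _ F p 0 g pp sF; rewrite expn1 expn0 mulr1n; exact.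
by rewrite mulrC mulrzA; apply: subgroupMz.
Qed.

Definition emb (n : nat) := exists e, [/\
  forall x y, x *+ n = 0 -> y *+ n = 0 -> e (x + y) = e x + e y,
  forall x, x *+ n = 0 -> e x = 0 -> x = 0 & forall x, x *+ n = 0 -> V (e x)].

Lemma torsion_subgroup (n : nat) : is_subgroup [set x : Q | x *+ n = 0].
Proof. by split=> [|x y /= hx hy]; rewrite /= ?mul0rn// mulrnBl hx hy subrr. Qed.

Lemma hom_on_mulrn (A : zmodType) F (e : Q -> A) x n : is_subgroup F ->
  (forall x y, F x -> F y -> e (x + y) = e x + e y) -> F x -> e (x *+ n) = e x *+ n.
Proof. by move=> sF he Fx; rewrite pmulrn (hom_onMz _ sF he)// -pmulrn. Qed.

(** Multiplications by [u] and [v] are the projections onto the two coprime summands; applied to the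
    values they also separate the two images, which gives injectivity. *)
Lemma emb_coprime m n : coprime m n -> emb m -> emb n -> emb (m * n).
Proof.
move=> mn [e1 [D1 I1 V1]] [e2 [D2 I2 V2]].
pose u := chinese m n 1 0; pose v := chinese m n 0 1.
have um : u = 1 %[mod m] by exact: chinese_modl.
have un : u = 0 %[mod n] by exact: chinese_modr.
have vm : v = 0 %[mod m] by exact: chinese_modl.
have vn : v = 1 %[mod n] by exact: chinese_modr.
have red x k c d : c = d %[mod k] -> x *+ k = 0 -> x *+ c = x *+ d.
  move=> cd xk; rewrite (divn_eq c k) (divn_eq d k) cd !mulrnDr ![(_ * k)%N]mulnC.
  by rewrite !mulrnA xk !mul0rn.
have mu x : x *+ (m * n) = 0 -> (x *+ u) *+ m = 0.
  move=> h; have /dvdnP[q ->] : (n %| u)%N by rewrite /dvdn un mod0n.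
  by rewrite -mulrnA -mulnA [(n * m)%N]mulnC mulnC mulrnA h mul0rn.
have nv x : x *+ (m * n) = 0 -> (x *+ v) *+ n = 0.
  move=> h; have /dvdnP[q ->] : (m %| v)%N by rewrite /dvdn vm mod0n.
  by rewrite -mulrnA -mulnA mulnC mulrnA h mul0rn.
have sm := torsion_subgroup m; have sn := torsion_subgroup n.
exists (fun x => e1 (x *+ u) + e2 (x *+ v)); split=> [x y hx hy|x hx ex|x hx].
- by rewrite !mulrnDl D1 ?D2 1?addrACA//; [exact: nv|exact: nv|exact: mu|exact: mu].
- have h1 : e1 (x *+ u) *+ m = 0.
    by rewrite -(hom_on_mulrn m sm D1 (mu x hx)) mu// (hom_on0 sm D1).
  have h2 : e2 (x *+ v) *+ n = 0.
    by rewrite -(hom_on_mulrn n sn D2 (nv x hx)) nv// (hom_on0 sn D2).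
  have e10 : e1 (x *+ u) = 0.
    have := congr1 (fun z => z *+ u) ex; rewrite mul0rn mulrnDl.
    by rewrite (red _ m u 1%N um h1) (red _ n u 0%N un h2) mulr0n addr0.
  have e20 : e2 (x *+ v) = 0 by move: ex; rewrite e10 add0r.
  have xu : x *+ u = 0 by apply: I1 => //; exact: mu.
  have xv : x *+ v = 0 by apply: I2 => //; exact: nv.
  have uv : (u + v)%N = 1 %[mod m * n].
    apply/eqP; rewrite chinese_remainder//; apply/andP; split; apply/eqP.
      by rewrite -modnDm um vm mod0n addn0 modn_mod.
    by rewrite -modnDm un vn mod0n add0n modn_mod.
  by rewrite -[x]mulr1n -(red _ _ _ _ uv hx) mulrnDr xu xv addr0.
- by apply: subgroupD => //; [apply/V1/mu|apply/V2/nv].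
Qed.

Lemma emb_of_primary N : (0 < N)%N -> (forall p a, prime p -> emb (p ^ a)) -> emb N.
Proof.
move=> + hp; elim/ltn_ind: N => N ih N0; have [N1|N1] := leqP N 1%N.
  have -> : N = 1%N by lia.
  by exists id; split=> // x; rewrite mulr1n => ->; exact: subgroup0.
have pp := pdiv_prime N1; have [N' pN' NE] := pfactor_coprime pp N0.
rewrite NE; apply: emb_coprime; last exact: hp.
  by rewrite coprime_sym coprimeXl.
have a0 : (0 < logn (pdiv N) N)%N by rewrite logn_gt0 mem_primes pp N0 pdiv_dvd.
have N'0 : (0 < N')%N by move: N0; rewrite NE muln_gt0 => /andP[].
apply: ih => //; rewrite {1}NE ltn_Pmulr//.
by rewrite -(exp1n (logn (pdiv N) N)) ltn_exp2r// prime_gt1.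
Qed.


Section primary.
Context (N p a : nat) (N0 : (0 < N)%N) (QN : forall x, x *+ N = 0) (pp : prime p).
Context (layerV : forall k, finite_set (socle_layer p k V) ->
  socle_layer p k setT `<=` socle_layer p k V).
Local Notation U := [set x | x *+ (p ^ a) = 0].

Definition height_in (K : set Q) k x := exists2 y, K y & x = y *+ (p ^ k).

Lemma height_subgroup K k : is_subgroup K -> is_subgroup (height_in K k).
Proof.
move=> sK; split; first by exists 0; [exact: subgroup0|rewrite mul0rn].
by move=> _ _ [x Kx ->] [y Ky ->]; exists (x - y); [exact: subgroupB|rewrite mulrnBl].
Qed.

Lemma height_le K j k x : is_subgroup K -> (j <= k)%N -> height_in K k x -> height_in K j x.
Proof.
move=> sK jk [y Ky ->]; exists (y *+ (p ^ (k - j))); first by rewrite pmulrn; exact: subgroupMz.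
by rewrite -mulrnA -expnD subnK.
Qed.

(** At the exponent of [p] in [N] the layer is trivial: its elements are killed by [p] and by the
    part of [N] prime to [p]. *)
Lemma finite_layer_exists : exists k, `[< finite_set (socle_layer p k V) >].
Proof.
have [N' pN' NE] := pfactor_coprime pp N0; exists (logn p N); apply/asboolP.
apply: sub_finite_set (finite_set1 (0 : Q)) => x [xp [y _ xE]] /=.
have xN : x *+ N' = 0 by rewrite xE -mulrnA mulnC -NE.
have := egcdnP N' (prime_gt0 pp); case=> km kn E1 _.
have : x *+ (km * p)%N = x *+ (kn * N' + gcdn p N')%N by rewrite E1.
rewrite (eqP pN') mulrnDr mulr1n [(km * p)%N]mulnC [(kn * N')%N]mulnC !mulrnA xp xN.
by rewrite !mul0rn add0r.
Qed.

(** The threshold of the construction: below it the layers of [V] are infinite and leave a choice of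
    images, from it on they are finite and exhaust the layers of [Q]. *)
Definition kappa := ex_minn finite_layer_exists.

Lemma kappa_finite k : (kappa <= k)%N -> finite_set (socle_layer p k V).
Proof.
rewrite /kappa; case: ex_minnP => m /asboolP fm _ mk; apply: sub_finite_set fm => x [xp hx].
by split=> //; exact: height_le hx.
Qed.

Lemma kappa_infinite k : (k < kappa)%N -> ~ finite_set (socle_layer p k V).
Proof.
rewrite /kappa; case: ex_minnP => m _ min; apply: contraPnot => fk.
by rewrite ltnNge => /negP; apply; apply: min; apply/asboolP.
Qed.

(** Induction on the exponent: [x *+ (p ^ s)] lies in a finite layer, so it equals
    [h *+ (p ^ (s + j))] for some [h] in [V], and subtracting [h *+ (p ^ j)] from [x] lowers the
    exponent. *)
Lemma height_above_kappa s j x : (kappa <= j)%N -> height_in setT j x -> x *+ (p ^ s) = 0 ->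
  height_in V j x.
Proof.
move=> kj; elim: s x => [|s ih] x hx xs.
  by move: xs; rewrite expn0 mulr1n => ->; exact: subgroup0 (height_subgroup j sV).
have : socle_layer p (s + j) setT (x *+ (p ^ s)).
  split; first by rewrite -mulrnA -expnSr.
  by have [y _ ->] := hx; exists y => //; rewrite -mulrnA -expnD addnC.
move/(layerV (kappa_finite (leq_trans kj (leq_addl s j)))) => [_ [h Vh hE]].
have hj : height_in V j (h *+ (p ^ j)) by exists h.
have hj' : height_in setT j (h *+ (p ^ j)) by exists h.
have sT : is_subgroup [set: Q] by [].
have hd : height_in V j (x - h *+ (p ^ j)).
  apply: ih; first exact: (subgroupB (height_subgroup j sT)).
  by rewrite mulrnBl hE -mulrnA -expnD addnC subrr.
by have := subgroupD (height_subgroup j sV) hd hj; rewrite subrK.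
Qed.

(** A finite group already contained in [V]; the embedding starts as the identity on it. *)
Definition deep := [set x | x *+ (p ^ a) = 0 /\ height_in setT kappa x].

(** Preservation of heights up to [kappa] is the inductive invariant: it lets the image of [g *+ p]
    be divided by the power of [p] required for the image of [g]. *)
Definition partial_emb F e := [/\ [/\ is_subgroup F, finite_set F, F `<=` U & deep `<=` F],
  forall x y, F x -> F y -> e (x + y) = e x + e y, forall x, F x -> e x = 0 -> x = 0,
  forall x, F x -> V (e x)
  & forall j x, (j <= kappa)%N -> F x -> height_in setT j x -> height_in V j (e x)].

Lemma partial_emb_id : partial_emb deep id.
Proof.
have sT : is_subgroup [set: Q] by [].
have sh := @height_subgroup setT _ sT.
have sd : is_subgroup deep.
  split; first by split; [rewrite mul0rn|exact: subgroup0].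
  by move=> x y [x1 x2] [y1 y2]; split; [rewrite mulrnBl x1 y1 subrr|exact: subgroupB].
have dV x : deep x -> forall j, (j <= kappa)%N -> height_in V j x.
  move=> [xa hx] j jk; apply: height_le sV jk _.
  exact: (@height_above_kappa a kappa x).
split=> // [|x /dV/(_ 0%N (leq0n _))[y Vy ->]|j x jk /dV/(_ j jk)//].
  split=> //; last by move=> x [].
  apply: (@finite_primary _ _ p a) => //; last by move=> x [].
  apply: sub_finite_set (kappa_finite (leqnn _)) => x [[xa hx] xp].
  by apply: layerV; [exact: kappa_finite|split].
by rewrite expn0 mulr1n.
Qed.

(* The new generator [g] is first corrected by [F] so as to have the largest possible height
   [r] in its coset; as [F] contains [deep], [r < kappa], so [V] has infinitely many elements
   of order [p] and height at least [r], and one of them can be used to avoid [e F]. *)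
Lemma partial_emb_step F e g : partial_emb F e -> U g -> F (g *+ p) ->
  exists F' e', [/\ partial_emb F' e', F `<=` F', F' g & forall x, F x -> e' x = e x].
Proof.
move=> pe Ug Fgp; have [[sF fF FU dF] De Ie Ve He] := pe; have sT : is_subgroup [set: Q] by [].
have sh K j := @height_subgroup K j.
have [Fg|nFg] := pselect (F g); first by exists F, e; split=> //; exact: subset_refl.
have exr : exists r, `[< exists2 x, F x & height_in setT r (g + x) >].
  exists 0%N; apply/asboolP; exists 0; first exact: subgroup0.
  by exists (g + 0) => //; rewrite expn0 mulr1n.
have ltk r : `[< exists2 x, F x & height_in setT r (g + x) >] -> (r <= kappa)%N /\ (r != kappa).
  move=> /asboolP[x Fx hx].
  have nk : ~ (kappa <= r)%N.
    move=> kr; apply: nFg; rewrite -(addrK x g); apply: subgroupB => //; apply: dF.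
    split; last exact: height_le sT kr hx.
    by rewrite mulrnDl Ug add0r; exact: FU.
  by move/negP: nk; rewrite -ltnNge ltn_neqAle => /andP[].
case: (ex_maxnP exr (fun r lr => (ltk r lr).1)) => r /[dup] /ltk[rk1 rk2] /asboolP[x0 Fx0 hr] rmax.
have rk : (r < kappa)%N by rewrite ltn_neqAle rk2.
set g' := g + x0 in hr.
have Ug' : U g' by rewrite /= mulrnDl Ug add0r; exact: FU.
have nFg' : ~ F g' by move=> h; apply: nFg; rewrite -(addrK x0 g); exact: subgroupB.
have Fg'p : F (g' *+ p).
  by rewrite mulrnDl; apply: subgroupD => //; rewrite pmulrn; exact: subgroupMz.
have [h1 Vh1 h1E] : height_in V r.+1 (e (g' *+ p)).
  by apply: He => //; have [y _ ->] := hr; exists y => //; rewrite -mulrnA -expnSr.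
pose h0 := h1 *+ (p ^ r).
have [z Lz nz] : exists2 z, socle_layer p r V z & forall x, F x -> e x <> h0 + z.
  apply: contrapT => no; apply: (kappa_infinite rk).
  apply: (sub_finite_set (B := (fun x => e x - h0) @` F)); last exact: finite_image.
  move=> z Lz; apply: contrapT => nz; apply: no; exists z => // x Fx xz; apply: nz.
  by exists x => //; rewrite xz addrC addKr.
pose h := h0 + z; have hrh : height_in V r h.
  by apply: (subgroupD (sh V r sV)); [exists h1|case: Lz].
have hpE : h *+ p = e (g' *+ p).
  by have [zp _] := Lz; rewrite mulrnDl zp addr0 h1E -mulrnA -expnSr.
have Vh : V h by have [y Vy ->] := hrh; rewrite pmulrn; exact: subgroupMz.
have e0 := hom_on0 sF De.
pose eF := e @` F.
have seF : is_subgroup eF.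
  split; first by exists 0; [exact: subgroup0|].
  move=> _ _ [x Fx <-] [y Fy <-]; exists (x - y); first exact: subgroupB.
  by rewrite De ?(hom_onN sF De)//; exact: subgroupN.
have neh : ~ eF h by move=> [x Fx]; exact: nz.
have ehp : eF (h *+ p) by rewrite hpE; exists (g' *+ p).
have og := prime_order_mod pp sF nFg' Fg'p; have oh := prime_order_mod pp seF neh ehp.
have [//||e' [e'E e'D]] := @hom_adjoin Q Q F e g' h sF.
  move=> i /og/dvdzP[q ->]; rewrite mulrC !mulrzA -!pmulrn hpE.
  by rewrite -(hom_onMz q sF De).
have e'F x : F x -> e' x = e x by move=> Fx; have := e'E x 0 Fx; rewrite !mulr0z !addr0.
have sF' := adjoin_subgroup g' sF.
have FF' : F `<=` adjoin F g' by exact: sub_adjoin.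
exists (adjoin F g'), e'; split=> //; last first.
  by rewrite -(addrK x0 g); apply: subgroupB => //; [exact: adjoin_gen|exact: FF'].
split=> //.
- split=> //.
  + by apply: (adjoin_finite (n := (p ^ a)%N)) => //; rewrite expn_gt0 prime_gt0.
  + by apply: adjoin_min => //; exact: torsion_subgroup.
  + by move=> x /dF/FF'.
- move=> _ [k [i [Fk ->]]]; rewrite e'E// => E1.
  have [pi|npi] := boolP (p%:Z %| i)%Z.
    apply: Ie; first by apply: subgroupD => //; apply/og.
    by rewrite -e'F ?e'E//; apply: subgroupD => //; apply/og.
  case/negP: npi; apply/oh; exists (- k); first exact: subgroupN.
  by rewrite (hom_onN sF De)//; apply/eqP; rewrite -subr_eq0 -opprD oppr_eq0; apply/eqP.
- move=> _ [k [i [Fk ->]]]; rewrite e'E//; apply: subgroupD => //; first exact: Ve.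
  exact: subgroupMz.
- move=> j _ jk [k [i [Fk ->]]] hy.
  have [pi|npi] := boolP (p%:Z %| i)%Z.
    have Fi : F (g' *~ i) by apply/og.
    by rewrite e'F; [apply: He => //; exact: subgroupD|exact: subgroupD].
  have cop : coprimez p%:Z i by rewrite coprimezE /= prime_coprime.
  have [[u v] /= uv] := coprimezP _ _ cop.
  (* As [i] is prime to [p], a Bezout multiple of the element is congruent to [g] modulo [F]; its
     height is at least [j], so the maximality of [r] applies. *)
  have jr : (j <= r)%N.
    apply: rmax; apply/asboolP.
    exists (x0 + k *~ v - g' *~ (u * p%:Z)).
      apply: subgroupB => //; first by apply: subgroupD => //; exact: subgroupMz.
      by apply/og; rewrite dvdz_mull.
    have -> : g + (x0 + k *~ v - g' *~ (u * p%:Z)) = (k + g' *~ i) *~ v.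
      have vi : v * i = 1 - u * p%:Z by rewrite -uv addrC addKr.
      rewrite mulrzDl -mulrzA [i * v]mulrC vi mulrzBr mulr1z /g'.
      by rewrite !addrA; congr (_ - _); rewrite addrAC [g + _ + x0]addrAC [g + x0 + _]addrC addrA.
    by have := subgroupMz v (sh _ j sT) hy.
  have hk : height_in setT j k.
    rewrite -(addrK (g' *~ i) k); apply: (subgroupB (sh _ _ sT)) => //.
    by apply: (subgroupMz _ (sh _ _ sT)); exact: height_le sT jr hr.
  rewrite e'E//; apply: (subgroupD (sh _ _ sV)); first exact: He.
  by apply: (subgroupMz _ (sh _ _ sV)); exact: height_le sV jr hrh.
Qed.

(** Adjoining [g *+ p] before [g] reduces to the case of order [p] modulo the domain. *)
Lemma partial_emb_extend n F e g : partial_emb F e -> U g -> F (g *+ (p ^ n)) ->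
  exists F' e', [/\ partial_emb F' e', F `<=` F', F' g & forall x, F x -> e' x = e x].
Proof.
elim: n F e g => [|n ih] F e g pe Ug Fg.
  by rewrite expn0 mulr1n in Fg; exists F, e; split.
have Ugp : U (g *+ p) by rewrite /= mulrnAC Ug mul0rn.
have [|F1 [e1 [pe1 FF1 F1g e1e]]] := ih F e (g *+ p) pe Ugp; first by rewrite -mulrnA -expnS.
have [F2 [e2 [pe2 F12 F2g e21]]] := partial_emb_step pe1 Ug F1g.
exists F2, e2; split=> //; first exact: subset_trans F12.
by move=> x Fx; rewrite e21 ?e1e//; exact: FF1.
Qed.

(** Elements are adjoined in the order of the enumeration. The partial embeddings are compatible, so
    the value at [x] is read off right after the stage that handles [x]. *)
Lemma emb_primary (en : nat -> Q) : (forall q, exists i, en i = q) -> emb (p ^ a).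
Proof.
move=> surj.
have /choice[step hstep] : forall ist : nat * (set Q * (Q -> Q)), exists st : set Q * (Q -> Q),
    partial_emb ist.2.1 ist.2.2 -> [/\ partial_emb st.1 st.2, ist.2.1 `<=` st.1,
      U (en ist.1) -> st.1 (en ist.1) & forall x, ist.2.1 x -> st.2 x = ist.2.2 x].
  move=> [i [F e]] /=; have [pe|] := pselect (partial_emb F e); last by exists (F, e).
  have [Ug|nU] := pselect (U (en i)); last first.
    by exists (F, e) => _; split=> //; exact: subset_refl.
  have [|F' [e' [h1 h2 h3 h4]]] := @partial_emb_extend a F e (en i) pe Ug.
    by rewrite (Ug : _ = 0); have [[sF _ _ _] _ _ _ _] := pe; exact: subgroup0.
  by exists (F', e').
pose st := fix f n := if n is n'.+1 then step (n', f n') else (deep, id).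
have pst n : partial_emb (st n).1 (st n).2.
  by elim: n => [|n ih]; [exact: partial_emb_id|case: (hstep (n, st n) ih)].
have stS n := hstep (n, st n) (pst n).
have mono n m : (n <= m)%N -> (st n).1 `<=` (st m).1 /\
    forall x, (st n).1 x -> (st m).2 x = (st n).2 x.
  move=> /subnK <-; elim: (m - n)%N => [|k [h1 h2]]; first by split=> //; exact: subset_refl.
  have [_ h3 _ h4] := stS (k + n)%N; rewrite addSn; split; first exact: subset_trans h3.
  by move=> x Fx; rewrite h4 ?h2//; exact: h1.
have /choice[ix hix] := surj.
have inst x m : U x -> (ix x < m)%N -> (st m).1 x.
  move=> Ux xm; have [h _] := mono _ _ xm; apply: h.
  by have [_ _ h _] := stS (ix x); have := h; rewrite /= hix; apply.
pose e x := (st (ix x).+1).2 x.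
have eE x m : U x -> (ix x < m)%N -> e x = (st m).2 x.
  by move=> Ux xm; have [_ ->] := mono _ _ xm; rewrite //; exact: inst.
have sU := torsion_subgroup (p ^ a).
exists e; split=> [x y Ux Uy|x Ux|x Ux].
- have Uxy := subgroupD sU Ux Uy; pose m := (ix x + ix y + ix (x + y)).+1.
  have [_ h _ _ _] := pst m.
  rewrite (eE x m) ?(eE y m) ?(eE (x + y) m)//; try by rewrite /m; lia.
  by apply: h; apply: inst => //; rewrite /m; lia.
- by have [_ _ h _ _] := pst (ix x).+1; apply: h; exact: inst.
- by have [_ _ _ h _] := pst (ix x).+1; apply: h; exact: inst.
Qed.
End primary.
End embedding.

(** * Sufficiency in the bounded case: layers and primary parts *)

Section primary_decomposition.
Context (Q : zmodType).

(** [f] maps the whole layer of [Q] into the layer of [V]. If the latter is finite, its own elements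
    already take up all the places, and a further element would contradict injectivity. *)
Lemma finite_layer_eq (V : set Q) (f : Q -> Q) p k :
  (forall x y, f (x + y) = f x + f y) -> injective f -> (forall q, V (f q)) ->
  finite_set (socle_layer p k V) -> socle_layer p k setT `<=` socle_layer p k V.
Proof.
move=> fD fi fV /finite_seqP[s sE] x Lx; apply: contrapT => nx.
have sT : is_subgroup [set: Q] by [].
have fM y n : f (y *+ n) = f y *+ n by apply: (hom_on_mulrn n sT).
have f0 : f 0 = 0 by apply: (hom_on0 sT).
have fL y : socle_layer p k setT y -> f y \in s.
  move=> [yp [z _ yE]]; have : socle_layer p k V (f y).
    by split; [rewrite -fM yp|exists (f z); rewrite // yE fM].
  by rewrite sE.
have xs : x \notin undup s.
  by rewrite mem_undup; apply/negP => h; apply: nx; rewrite sE.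
have : (size (map f (x :: undup s)) <= size (undup s))%N.
  apply: uniq_leq_size; first by rewrite map_inj_uniq//= xs undup_uniq.
  move=> _ /mapP[y + ->]; rewrite inE mem_undup => /orP[/eqP ->|ys]; rewrite mem_undup; apply: fL => //.
  have : socle_layer p k V y by rewrite sE.
  by move=> [yp [z _ yE]]; split=> //; exists z.
by rewrite size_map /= ltnn.
Qed.

(** The primary decomposition is phrased through subgroups containing the parts, which is the form
    in which generators are adjoined. *)
Lemma primary_parts N q : (0 < N)%N -> q *+ N = 0 -> exists l : seq Q,
  (forall g, g \in l -> exists p k, prime p /\ g *+ (p ^ k) = 0) /\
  forall K : set Q, is_subgroup K -> (forall g, g \in l -> K g) -> K q.
Proof.
elim/ltn_ind: N q => N ih q N0 qN; have [N1|N1] := leqP N 1%N.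
  exists [::]; split=> // K sK _; have E1 : N = 1%N by lia.
  by move: qN; rewrite E1 mulr1n => ->; exact: subgroup0.
have pp := pdiv_prime N1; have [N' pN' NE] := pfactor_coprime pp N0.
set p := pdiv N in pp pN' NE; set a := logn p N in NE.
have a0 : (0 < a)%N by rewrite logn_gt0 mem_primes pp N0 pdiv_dvd.
have N'0 : (0 < N')%N by move: N0; rewrite NE muln_gt0 => /andP[].
have N'N : (N' < N)%N.
  rewrite {1}NE ltn_Pmulr//.
  by rewrite -(exp1n a) ltn_exp2r// prime_gt1.
have cop : coprime (p ^ a) N' by rewrite coprimeXl.
have [l [lp lK]] : exists l : seq Q,
  (forall g, g \in l -> exists p k, prime p /\ g *+ (p ^ k) = 0) /\
  forall K : set Q, is_subgroup K -> (forall g, g \in l -> K g) -> K (q *+ (p ^ a)).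
  by apply: (ih N') => //; rewrite -mulrnA mulnC -NE.
exists (q *+ N' :: l); split=> [g|K sK gK].
  rewrite inE => /orP[/eqP ->|/lp//]; exists p, a; split=> //.
  by rewrite -mulrnA -NE.
have K1 : K (q *+ N') by apply: gK; exact: mem_head.
have K2 : K (q *+ (p ^ a)) by apply: lK => // g gl; apply: gK; rewrite inE gl orbT.
have pa0 : (0 < p ^ a)%N by rewrite expn_gt0 prime_gt0.
case: (egcdnP N' pa0) => km kn E1 _.
have -> : q = q *+ (p ^ a) *~ km%:Z - q *+ N' *~ kn%:Z.
  rewrite -!pmulrn -!mulrnA [(p ^ a * km)%N]mulnC E1 (eqP cop) mulrnDr [(N' * kn)%N]mulnC.
  by rewrite addrAC subrr add0r mulr1n.
by apply: subgroupB => //; exact: subgroupMz.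
Qed.
End primary_decomposition.

Section bounded_density.
Context (R : realType) (d : measure_display) (X : measurableType d)
  (P : probability X R) (HX : standard_borel R X) (HP : atomless P).
Context (E : nat -> set X) (mE : forall n, measurable (E n))
  (dE : forall A, measurable A -> forall e : R, 0 < e -> exists n, dm P A (E n) < e).
Context (Q : zmodType) (en : nat -> Q) (surj : forall q, exists i, en i = q).

(** Generators are replaced by their primary parts so that [key_bounded] applies. Its condition on
    layers passes from [V] to any larger subgroup, whose finite layers contain finite layers of
    [V]. *)
Lemma locally_dense_bounded (V : set Q) N : is_subgroup V -> (0 < N)%N ->
  (forall q : Q, q *+ N = 0) ->
  (forall p k, finite_set (socle_layer p k V) ->
     socle_layer p k setT `<=` socle_layer p k V) ->
  locally_dense P E en (Omega P Q) V.
Proof.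
move=> sV N0 QN hV; have sT : is_subgroup [set: Q] by [].
apply: (locally_dense_union HX HP mE surj) => // n.
have /choice[ls hls] := fun q => primary_parts N0 (QN q).
exists (flatten [seq ls (en i) | i <- iota 0 n]); split=> // [i ni _|].
  apply: (hls (en i)).2; first exact: adjoins_subgroup.
  move=> g gl; apply: adjoins_gen => //; apply/flattenP; exists (ls (en i)) => //.
  by apply: map_f; rewrite mem_iota.
apply: (locally_dense_adjoins HX HP mE surj) => // g W /flattenP[_ /mapP[i _ ->] gl] sW VW _.
have [p [k [pp gk]]] := (hls (en i)).1 g gl.
apply: (@key_bounded _ _ _ P HX HP Q en surj W setT p k g) => //.
  by move=> x _; exists N.
move=> j fj x Lx.
have sub : socle_layer p j V `<=` socle_layer p j W.
  by move=> z [zp [y Vy zE]]; split=> //; exists y => //; exact: VW.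
by apply: (sub); apply: hV Lx; exact: sub_finite_set sub fj.
Qed.
End bounded_density.

(** * Quotients, weak isomorphism and the conclusion *)

Section quotients.
Context (G : zmodType) (Gs : set G) (sGs : is_subgroup Gs).

Lemma quotient_exists : exists (Q : zmodType) (phi : G -> Q), is_quotient_map Gs phi.
Proof.
pose pr : pred G := fun g => `[< Gs g >].
have zc : zmod_closed pr.
  split; first by apply/asboolP; exact: subgroup0.
  by move=> x y /asboolP hx /asboolP hy; apply/asboolP; exact: subgroupB.
pose I : zmodClosed G := HB.pack pr (GRing.isZmodClosed.Build G pr zc).
exists (Quotient.quot I), (\pi_(Quotient.quot I))%qT; split=> [x y|q|g].
- exact: raddfD.
- by exists (repr q); rewrite reprK.
- rewrite -(raddf0 (\pi_(Quotient.quot I))%qT); split.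
    by move/eqP; rewrite -Quotient.idealrBE subr0 => /asboolP.
  by move=> Gg; apply/eqP; rewrite -Quotient.idealrBE subr0; apply/asboolP.
Qed.
End quotients.

Section weak_isomorphism.
Context (G Q : zmodType) (Gs H : set G) (sH : is_subgroup H)
  (GH : forall g, Gs g -> H g -> g = 0) (phi : G -> Q) (hphi : is_quotient_map Gs phi).

Lemma quotient_injective g h : H g -> H h -> phi g = phi h -> g = h.
Proof.
have [phiD _ phiK] := hphi; have sT : is_subgroup [set: G] by [].
move=> Hg Hh gh; apply/eqP; rewrite -subr_eq0; apply/eqP/GH; last exact: subgroupB.
by apply/phiK; rewrite phiD (hom_onN sT)// gh subrr.
Qed.

Lemma quotient_image_subgroup : is_subgroup (phi @` H).
Proof.
have [phiD phi_surj phiK] := hphi.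
apply: (image_subgroup phiD sH).
Qed.

Lemma weakly_isomorphic_of_emb N : (forall q : Q, q *+ N = 0) -> emb (phi @` H) N ->
  weakly_isomorphic_sub Q H.
Proof.
have [phiD phi_surj phiK] := hphi; move=> QN [e [eD eI eV]]; split.
  have /choice[psi hpsi] : forall q, exists h, (phi @` H) q -> H h /\ phi h = q.
    by move=> q; have [[h Hh <-]|] := pselect ((phi @` H) q); [exists h|exists 0].
  have eH q : H (psi (e q)) /\ phi (psi (e q)) = e q by apply: hpsi; exact: eV.
  exists (psi \o e); split=> [x y|x y /= xy|q]; last by case: (eH q).
    have [h1 h2] := eH x; have [h3 h4] := eH y; have [h5 h6] := eH (x + y).
    by apply: quotient_injective => //; [exact: subgroupD|rewrite phiD h2 h4 h6 eD].
  have sT : is_subgroup [set: Q] by [].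
  have eD' a b : [set: Q] a -> [set: Q] b -> e (a + b) = e a + e b by move=> _ _; exact: eD.
  apply/eqP; rewrite -subr_eq0; apply/eqP/eI => //.
  by rewrite eD' ?(hom_onN sT eD')// -(eH x).2 xy (eH y).2 subrr.
exists phi; split=> [h1 h2 _ _|]; [exact: phiD|exact: quotient_injective].
Qed.

(** Following the embedding of [Q] in [H] by [phi] gives an injective endomorphism of [Q] with
    values in the image of [H], to which the counting argument on finite layers applies. *)
Lemma layers_of_weakly_isomorphic : bounded_group H -> weakly_isomorphic_sub Q H ->
  (exists2 N, (0 < N)%N & forall q : Q, q *+ N = 0) /\
  forall p k, finite_set (socle_layer p k (phi @` H)) ->
    socle_layer p k setT `<=` socle_layer p k (phi @` H).
Proof.
have [phiD phi_surj phiK] := hphi; move=> bH [[f [fD fI fH]] _].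
have sT : is_subgroup [set: Q] by [].
have [N N0 hN] := bounded_exponent bH; split.
  exists N => // q; apply: fI.
  have fD' a b : [set: Q] a -> [set: Q] b -> f (a + b) = f a + f b by move=> _ _; exact: fD.
  by rewrite (hom_on_mulrn N sT fD')// hN ?(hom_on0 sT fD').
move=> p k; apply: (@finite_layer_eq _ _ (phi \o f)) => [x y|x y /= xy|q] /=.
- by rewrite fD phiD.
- by apply: fI; exact: quotient_injective xy.
- by exists (f q).
Qed.
End weak_isomorphism.

Theorem theorem6p7 (R : realType) (d : measure_display) (X : measurableType d)
  (P : probability X R) (HX : standard_borel R X) (HP : atomless P)
  (G : countZmodType) (H : set G) (sH : is_subgroup H) :
  [/\ ~ (~ finite_set H /\ bounded_group H) ->
        contains_dense_Gdelta P (actions_on P H) (restr H @` Omega P G),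
      (~ finite_set H /\ bounded_group H) ->
        (contains_dense_Gdelta P (actions_on P H) (restr H @` Omega P G) <->
         exists Gs : set G, [/\ is_subgroup Gs,
           (forall g, Gs g -> H g -> g = 0) &
           exists (Q : zmodType) (phi : G -> Q),
             is_quotient_map Gs phi /\ weakly_isomorphic_sub Q H])
    & (~ finite_set H /\ bounded_group H) ->
        forall Gs : set G, is_subgroup Gs -> (forall g, Gs g -> H g -> g = 0) ->
        forall (Q : zmodType) (phi : G -> Q), is_quotient_map Gs phi ->
          weakly_isomorphic_sub Q H ->
          ess_cat_preserving P (restr H) (pullback (X:=X) phi @` Omega P Q)
            (actions_on P H)].
Proof.
pose en i : G := odflt 0 (unpickle i).
have surj g : exists i, en i = g by exists (pickle g); rewrite /en pickleK.
have [f [mf inj fimg]] := HX; have [E [mE dE]] := dense_family P mf inj fimg.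
(* Used twice: for the sufficiency of the condition and for the category statement. *)
have adm (Gs : set G) (Q : zmodType) (phi : G -> Q) : bounded_group H ->
    (forall g, Gs g -> H g -> g = 0) -> is_quotient_map Gs phi -> weakly_isomorphic_sub Q H ->
    admissible P E en (pullback (X:=X) phi @` Omega P Q) H.
  move=> bH GH hphi wi; have [phiD phi_surj phiK] := hphi.
  apply: (admissible_pullback HX HP mE dE surj phiD phi_surj sH).
    by move=> x Hx /phiK Gx; exact: GH.
  have [[N N0 QN] hV] := layers_of_weakly_isomorphic sH GH hphi bH wi.
  have surjQ : forall q, exists i, (phi \o en) i = q.
    by move=> q; have [g <-] := phi_surj q; have [i <-] := surj g; exists i.
  exact: (locally_dense_bounded HX HP mE surjQ (quotient_image_subgroup sH hphi) N0 QN hV).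
split=> [nH|[iH bH]|[iH bH] Gs sGs GH Q phi hphi wi].
(* Finite groups are treated through fundamental domains; otherwise [H] is unbounded, so is every
   subgroup containing it, and the perturbation principle holds for all [g]. *)
- have [fH|iH] := pselect (finite_set H); first exact: (finite_contains HX HP surj sH fH).
  have nb : ~ bounded_group H by move=> bH; apply: nH.
  apply: (admissible_contains HX mE dE surj sH (admissible_Omega HX HP mE dE surj sH _)).
  move=> g H' sH' HH'; apply: (key_unbounded HX HP surj sH').
  by move=> [N hN]; apply: nb; exists N => h /HH'; exact: hN.
- split=> [dG|[Gs [sGs GH [Q [phi [hphi wi]]]]]]; last first.
    exact: (admissible_contains HX mE dE surj sH (adm Gs Q phi bH GH hphi wi)).
  have [Gs [sGs GH hG]] := necessary_subgroup HX HP sH iH bH surj dG.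
  have [Q [phi hphi]] := quotient_exists sGs.
  exists Gs; split=> //; exists Q, phi; split=> //.
  have [phiD phi_surj phiK] := hphi.
  have [[N N0 QN] hV] := hG Q phi hphi.
  have sV := quotient_image_subgroup sH hphi.
  have surjQ : forall q, exists i, (phi \o en) i = q.
    by move=> q; have [g <-] := phi_surj q; have [i <-] := surj g; exists i.
  apply: (weakly_isomorphic_of_emb sH GH hphi QN).
  apply: (emb_of_primary sV N0) => p a pp.
  exact: (emb_primary sV a N0 QN pp (fun k => hV p k pp) surjQ).
- exact: (admissible_ess_cat HX mE dE surj sH (adm Gs Q phi bH GH hphi wi)).
Qed.
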